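(* In the setting of the context, for every $n\ge1$ let $z^{(n)}_1,\dots,z^{(n)}_{m}$, $m=2\lfloor\frac{n+1}2\rfloor$, be the zeros of the monic orthogonal section $\pi_n$ lying on $\gamma$. Then for every continuous function $\phi$ on $\gamma$, $$\lim_{n\to\infty}\frac1n\sum_{j=1}^{2\lfloor\frac{n+1}2\rfloor}\phi\big(z^{(n)}_j\big)=\int_\gamma\phi(p)\,\mathrm d\mu_0(p),\qquad \mathrm d\mu_0(p)=\frac1\pi\sqrt{\wp(\tfrac12)-\wp(p)}\,\mathrm dp,$$ where $\wp$ is the Weierstrass function of the lattice $\mathbb{Z}+\tau\mathbb{Z}$ (in the Weierstrass coordinate $X=\wp(p)$ this measure is $\frac{\mathrm dX}{2\pi\sqrt{(e_2-X)(X-e_3)}}$ on $[e_3,e_2]$ covered twice).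
   Context: Let $\tau\in i\mathbb{R}_{>0}$, $\Lambda_\tau=\mathbb{Z}+\tau\mathbb{Z}$, $\mathcal E_\tau=\mathbb{C}/\Lambda_\tau$ with coordinate $p$; $\wp(p)=p^{-2}+\sum_{\lambda\in\Lambda_\tau\setminus\{0\}}\big((p+\lambda)^{-2}-\lambda^{-2}\big)$, $e_1=\wp(\tfrac12)$, $e_2=\wp(\tfrac{1+\tau}2)$, $e_3=\wp(\tfrac\tau2)$ (real, $e_3<e_2<e_1$). Let $\gamma$ be the image of $\{\mathrm{Im}\,p=\tfrac12\mathrm{Im}\,\tau\}$, parametrized as $p=\tfrac\tau2+s$, $s\in[0,1]$, oriented by increasing $s$ (so $\mathrm dp=\mathrm ds>0$ along $\gamma$ and $\wp<e_1$ there); counting the zeros on $\gamma$ with multiplicity. Fix $\mathscr D\in(0,1)$. Let $w$ be analytic in a strip containing $\gamma$ and real on $\gamma$, giving the positive measure ${\rm e}^{w(p)}\mathrm dp$ on $\gamma$. For $n\ge0$, $\mathscr P_n$ is the space of meromorphic functions on $\mathcal E_\tau$ whose only possible poles are of order $\le n$ at $p\equiv0$ and $\le1$ at $p\equiv\mathscr D$. The monic orthogonal section $\pi_n$ ($n\ge1$) is the element of $\mathscr P_n$ with $\pi_n(p)=p^{-n}(1+\mathcal O(p))$ as $p\to0$ and $\int_\gamma\pi_nf{\rm e}^w\mathrm dp=0$ for all $f\in\mathscr P_{n-1}$; it exists and has $2\lfloor\frac{n+1}2\rfloor$ zeros on $\gamma$ counted with multiplicity. *)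

(* Defs.v *)
From Stdlib Require Import Reals ZArith List.
From Coquelicot Require Import Coquelicot.
Open Scope R_scope.

Definition cexp (z : C) : C :=
  (exp (Re z) * cos (Im z), exp (Re z) * sin (Im z)).

Definition tauC (t : R) : C := (0, t).

Definition latpt (t : R) (a b : Z) : C := Cplus (RtoC (IZR a)) (Cmult (IZR b) (tauC t)).

Definition in_lattice (t : R) (p : C) : Prop := exists a b : Z, p = latpt t a b.

(* sum over Z of a C-valued family (used only for absolutely summable ones) *)
Definition csum_nat (u : nat -> C) : C :=
  (Series (fun k => Re (u k)), Series (fun k => Im (u k))).
Definition csum_Z (g : Z -> C) : C :=
  Cplus (csum_nat (fun k => g (Z.of_nat k)))
        (csum_nat (fun k => g (- Z.of_nat k - 1)%Z)).

(* Weierstrass p-function of the lattice Z + tau Z :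
   wp(p) = p^-2 + sum_{lambda <> 0} ((p+lambda)^-2 - lambda^-2)
   (absolutely convergent; written as an iterated sum over (a,b) in Z^2) *)
Definition wp_term (t : R) (p : C) (a b : Z) : C :=
  if (Z.eqb a 0 && Z.eqb b 0)%bool then RtoC 0
  else Cminus (Cinv (Cmult (Cplus p (latpt t a b)) (Cplus p (latpt t a b))))
              (Cinv (Cmult (latpt t a b) (latpt t a b))).

Definition wp (t : R) (p : C) : C :=
  Cplus (Cinv (Cmult p p)) (csum_Z (fun a => csum_Z (fun b => wp_term t p a b))).

Definition gam (t : R) (s : R) : C := Cplus (RtoC s) (tauC (t / 2)).

Definition holo_at (f : C -> C) (z : C) : Prop :=
  @ex_derive C_AbsRing C_NormedModule f z.

(* The space P_n: meromorphic functions on E_tau (doubly periodic functions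
   C -> C, holomorphic off (Lambda) u (D + Lambda)), with pole of order <= n
   at 0 and <= 1 at D (values at the poles themselves are irrelevant). *)
Definition in_Pn (t D : R) (n : nat) (f : C -> C) : Prop :=
  (forall p, f (Cplus p (RtoC 1)) = f p) /\
  (forall p, f (Cplus p (tauC t)) = f p) /\
  (forall p, ~ in_lattice t p -> ~ in_lattice t (Cminus p (RtoC D)) -> holo_at f p) /\
  (exists M r, 0 < r /\ forall p, 0 < Cmod p < r -> Cmod (Cmult (Cpow p n) (f p)) <= M) /\
  (exists M r, 0 < r /\ forall p, 0 < Cmod (Cminus p (RtoC D)) < r ->
       Cmod (Cmult (Cminus p (RtoC D)) (f p)) <= M).

Definition monic_at0 (n : nat) (f : C -> C) : Prop :=
  exists M r, 0 < r /\ forall p, 0 < Cmod p < r ->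
    Cmod (Cminus (Cmult (Cpow p n) (f p)) (RtoC 1)) <= M * Cmod p.

Definition monic_orth_section (t D : R) (w : C -> C) (n : nat) (f : C -> C) : Prop :=
  in_Pn t D n f /\ monic_at0 n f /\
  forall g, in_Pn t D (n - 1) g ->
    RInt (V := C_R_CompleteNormedModule)
      (fun s => Cmult (Cmult (f (gam t s)) (g (gam t s))) (cexp (w (gam t s)))) 0 1
    = RtoC 0.

Definition zero_order (f : C -> C) (z : C) (k : nat) : Prop :=
  exists r (g : C -> C), 0 < r /\ g z <> RtoC 0 /\
    (forall p, Cmod (Cminus p z) < r -> holo_at g p) /\
    (forall p, Cmod (Cminus p z) < r -> f p = Cmult (Cpow (Cminus p z) k) (g p)).

(* zs lists the zeros of f on gamma, with multiplicity; a point of gamma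
   (in E_tau) is recorded by its parameter s in [0,1) *)
Definition zeros_on_gamma (t : R) (f : C -> C) (zs : list R) : Prop :=
  (forall s, In s zs -> 0 <= s < 1) /\
  (forall s, 0 <= s < 1 -> zero_order f (gam t s) (count_occ Req_EM_T zs s)).

Definition csum_list (phi : R -> C) (zs : list R) : C :=
  fold_right (fun s acc => Cplus (phi s) acc) (RtoC 0) zs.

(* integral of phi against d mu_0 = (1/pi) sqrt(wp(1/2) - wp(p)) dp on gamma;
   wp is real on the real axis and on gamma, so real parts are taken *)
Definition mu0_integral (t : R) (phi : R -> C) : C :=
  RInt (V := C_R_CompleteNormedModule)
    (fun s => Cmult (phi s)
       (RtoC (/ PI * sqrt (Re (wp t (RtoC (1/2))) - Re (wp t (gam t s)))))) 0 1.

(* Main.v *)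
(* On gamma every element of P_n is a constant times a product of theta functions, one for each of its zeros, and the
   constant is fixed by the behaviour at p = 0.  By orthogonality pi_n minimises the weighted L^2 norm among monic sections,
   so an explicit competitor built from theta functions gives ||pi_n||^2 <= K E^(2n), where E is the capacity.
   Conversely, by Jensen's inequality the integral of ln |pi_n / E^n| against a positive density is bounded above.  Taking for
   the density dens(s) = (1/t) sum_a sech (PI (s + a) / t), perturbed by a small multiple of cos (2 PI m s - theta), and
   computing with the Fourier coefficients of ln |theta|, the terms of order n cancel except for the defect of the m-th
   moment of the zeros.  Hence sum_j cos (2 PI m z_j - theta) = n cos theta / cosh (PI m t) + O(1): the zeros have
   asymptotically the moments of dens, and trigonometric polynomials are dense.  Finally (PI dens)^2 = wp(1/2) - wp on
   gamma, by squaring the sech series and summing wp along the columns of the lattice. *)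

(* A section may have n poles at 0 and one at [D]. Once n of its zeros are fixed on gamma, one theta
   factor is left, placed by Abel's condition: on the real axis for even n, on gamma for odd n. In
   the first case it is bounded above and below; in the second it is kept as one more factor, which
   is why a second list [L] accompanies the first n zeros. The same factor explains why [zs n] has n
   or n + 1 entries. The density is the equilibrium density because of one identity between Fourier
   coefficients, [lamk_ch]: averaging ln |theta(s - x)| against dens(s) gives ln theta at the point
   x of gamma. This cancels the potentials of the zeros against the normalisation at 0, and
   [kap0_rk] does the same for the capacity. The logarithmic singularities are smoothed by a
   parameter rho < 1, which tends to 1 for fixed n. The amplitude of the cosine is a lower bound of
   the density, so the weight stays nonnegative; the phases theta and theta + PI give the two halves
   of the estimate. Removable singularities are met by a Goursat theorem with finitely many
   exceptional points, near which the function is only bounded. *)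
Require Import Defs.
From Stdlib Require Import Reals ZArith List.
From Coquelicot Require Import Coquelicot.
From Stdlib Require Import Lra Lia Psatz Classical ClassicalDescription.
Open Scope R_scope.

Open Scope C_scope.

Bind Scope C_scope with C.
Arguments Cmod _%_C.
Arguments cexp _%_C.
Arguments Re _%_C.
Arguments Im _%_C.
Notation "x < y" := (Rlt x%R y%R) : C_scope.
Notation "x <= y" := (Rle x%R y%R) : C_scope.
Notation "x < y < z" := (x < y /\ y < z) : C_scope.
Notation "x <= y < z" := (x <= y /\ y < z) : C_scope.
Notation "x < y <= z" := (x < y /\ y <= z) : C_scope.
Notation "x <= y <= z" := (x <= y /\ y <= z) : C_scope.
Notation om k := (2 * PI * INR k)%R.
Notation VR := R_CompleteNormedModule.
Notation arith := ltac:(lra) (only parsing).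
Tactic Notation "have" ident(H) ":" lconstr(T) := assert (H : T).
Tactic Notation "have" ident(H) ":" lconstr(T) "by" tactic3(tac) := assert (H : T) by tac.
Tactic Notation "have" ident(H) ":=" lconstr(t) := assert (H := t).
Tactic Notation "etr" lconstr(t) := eapply Rle_trans; [apply t|].

Ltac rmin := repeat match goal with
 | |- context [Rmin ?a ?b] => pose proof (Rmin_l a b); pose proof (Rmin_r a b); generalize dependent (Rmin a b); intros
 | _ : context [Rmin ?a ?b] |- _ => pose proof (Rmin_l a b); pose proof (Rmin_r a b); generalize dependent (Rmin a b); intros
 end; lra.

Lemma exp_le_mono a b : a <= b -> exp a <= exp b.
Proof. intros [H | ->]; [left; apply exp_increasing; auto|right; auto]. Qed.

(** It starts with [auto] and [lra], so it also closes easy goals that are not about signs. *)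
Ltac pos := intros; auto; try lra; repeat first
 [ lra | assumption | apply exp_pos | apply PI_RGT_0 | apply Rmult_lt_0_compat | apply Rdiv_lt_0_compat | apply Rinv_0_lt_compat
 | apply pow_lt | apply Rmin_glb_lt | apply Rabs_pos | apply Cmod_ge_0 | apply pos_INR | apply pow_le | apply Rle_0_sqr
 | apply Rmult_le_pos | apply Rlt_le ].

Lemma Rlt_min {x a b} : (x < Rmin a b)%R -> (x < a /\ x < b)%R.
Proof. intros H. pose proof (Rmin_l a b). pose proof (Rmin_r a b). lra. Qed.

Lemma Rabs_tri a b c : (Rabs a + Rabs b <= c)%R -> (Rabs (a + b) <= c)%R.
Proof. intros H. eapply Rle_trans; [apply Rabs_triang|exact H]. Qed.

Lemma Cmod_tri a b c : (Cmod a + Cmod b <= c)%R -> (Cmod (a + b) <= c)%R.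
Proof. intros H. eapply Rle_trans; [apply Cmod_triangle|exact H]. Qed.

(** * Complex differentiability and the complex exponential *)

Definition cder (f : C -> C) (z l : C) : Prop :=
 forall eps : R, 0 < eps -> exists d : R, 0 < d /\
  forall h, Cmod h < d -> Cmod (f (z + h) - f z - l * h)%C <= eps * Cmod h.

Definition chol (f : C -> C) (z : C) : Prop := exists l, cder f z l.

Definition ccont (f : C -> C) (z : C) : Prop :=
 forall eps : R, 0 < eps -> exists d : R, 0 < d /\
  forall y, Cmod (y - z) < d -> Cmod (f y - f z) < eps.

Lemma Cmod_minus_sym a b : Cmod (a - b) = Cmod (b - a).
Proof. replace (a - b) with (- (b - a)) by ring. apply Cmod_opp. Qed.

Lemma Cmod_rev_triangle a b : Cmod a - Cmod b <= Cmod (a - b).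
Proof.
 have H := Cmod_triangle (a - b) b. replace (a - b + b) with a in H by ring. lra.
Qed.

Lemma chol_cont f z : chol f z -> ccont f z.
Proof.
 intros [l Hl] eps He. destruct (Hl 1%R Rlt_0_1) as [d [Hd H]].
 have HK : 0 < 1 + Cmod l by (pose proof (Cmod_ge_0 l); lra).
 exists (Rmin d (eps / (1 + Cmod l))). split.
 { pos. }
 intros y Hy.
 destruct (Rlt_min Hy) as [Hy1 Hy2].
 specialize (H _ Hy1). replace (z + (y - z)) with y in H by ring.
 replace (f y - f z) with ((f y - f z - l * (y - z)) + l * (y - z)) by ring.
 eapply Rle_lt_trans; [apply Cmod_triangle|]. rewrite Cmod_mult.
 apply Rle_lt_trans with ((1 + Cmod l) * Cmod (y - z))%R; [lra|].
 apply Rmult_lt_compat_l with (r := (1 + Cmod l)%R) in Hy2; auto.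
 replace ((1 + Cmod l) * (eps / (1 + Cmod l)))%R with eps in Hy2 by (field; lra). exact Hy2.
Qed.

Lemma cder_is_derive f z l : cder f z l <-> is_derive (K := C_AbsRing) (V := AbsRing_NormedModule C_AbsRing) f z l.
Proof.
 split.
 - intros Hl. split.
  + apply is_linear_scal_l.
  + intros x Hx. pose proof (@is_filter_lim_locally_unique C_AbsRing (AbsRing_NormedModule C_AbsRing) z x Hx) as Ex. subst x. intros eps.
   destruct (Hl eps (cond_pos eps)) as [d [Hd H]].
   exists (mkposreal d Hd). refine (fun (y : C) Hy => _). change (Cmod (y - z) < d)%R in Hy.
   change (Cmod ((f y - f z) - (y - z) * l) <= eps * Cmod (y - z))%R.
   specialize (H (y - z) Hy). replace (z + (y - z)) with y in H by ring.
   replace (f y - f z - (y - z) * l) with (f y - f z - l * (y - z)) by ring. exact H.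
 - intros [_ Hl] eps He.
  destruct (Hl z (fun P H => H) (mkposreal eps He)) as [d Hd].
  exists d; split; [apply cond_pos|]. intros h Hh.
  have B : ball (M := AbsRing_UniformSpace C_AbsRing) z d (z + h).
  { change (Cmod ((z + h) - z) < d)%R. replace (z + h - z) with h by ring. exact Hh. }
  specialize (Hd (z + h) B).
  change (Cmod ((f (z + h) - f z) - ((z + h) - z) * l)%C <= eps * Cmod (z + h - z))%R in Hd.
  replace (z + h - z) with h in Hd by ring.
  replace (f (z + h) - f z - l * h) with (f (z + h) - f z - h * l) by ring. exact Hd.
Qed.

(* [C_NormedModule] and [C_AbsRing] as a module over itself differ only by their (equivalent) balls. *)
Lemma holo_at_chol f z : holo_at f z <-> chol f z.
Proof.
 split; intros [l Hl]; exists l; [apply cder_is_derive|apply cder_is_derive in Hl]; destruct Hl as [_ H]; (split; [apply is_linear_scal_l|exact H]).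
Qed.

Lemma cder_const c z : cder (fun _ => c) z 0.
Proof. apply cder_is_derive, @is_derive_const. Qed.

Lemma cder_id z : cder (fun p => p) z 1.
Proof. apply cder_is_derive, @is_derive_id. Qed.

Lemma cder_plus f g z a b : cder f z a -> cder g z b -> cder (fun p => f p + g p) z (a + b).
Proof. rewrite !cder_is_derive. apply @is_derive_plus. Qed.

Lemma cder_comp f g z a b : cder f z a -> cder g (f z) b -> cder (fun p => g (f p)) z (b * a).
Proof. rewrite Cmult_comm, !cder_is_derive. intros Hf Hg. exact (is_derive_comp (K := C_AbsRing) (V := AbsRing_NormedModule C_AbsRing) g f z b a Hg Hf). Qed.

Lemma cder_eq f z a b : a = b -> cder f z a -> cder f z b.
Proof. intros ->; auto. Qed.

Lemma cder_ext_loc f g z l r : 0 < r ->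
 (forall p, Cmod (p - z) < r -> f p = g p) -> cder f z l -> cder g z l.
Proof. rewrite !cder_is_derive. intros Hr E. apply @is_derive_ext_loc. exists (mkposreal r Hr). exact E. Qed.

Lemma cder_ext f g z l : (forall p, f p = g p) -> cder f z l -> cder g z l.
Proof. intros E. apply (cder_ext_loc f g z l 1); [lra|pos]. Qed.

Lemma cder_mult f g z a b : cder f z a -> cder g z b ->
 cder (fun p => f p * g p) z (a * g z + f z * b).
Proof. rewrite !cder_is_derive. intros Hf Hg. exact (is_derive_mult (K := C_AbsRing) f g z a b Hf Hg Cmult_comm). Qed.

Lemma cder_scal c f z a : cder f z a -> cder (fun p => c * f p) z (c * a).
Proof. intros Hf. apply (cder_eq _ _ (0 * f z + c * a)); [ring|]. exact (cder_mult _ _ _ _ _ (cder_const c z) Hf). Qed.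

Lemma cder_Cinv (z : C) : z <> 0 -> cder Cinv z (- / (z * z)).
Proof.
 intros Hz eps He.
 have Hm : 0 < Cmod z by exact (proj1 (Cmod_gt_0 z) Hz).
 set (m := Cmod z) in *.
 exists (Rmin (m / 2) (eps * (m * m * m) / 2)). split.
 { pos. }
 intros h Hh.
 destruct (Rlt_min Hh) as [Hh1 Hh2].
 have Hzh : m / 2 <= Cmod (z + h).
 { have T := Cmod_rev_triangle z (- h). rewrite Cmod_opp in T.
  replace (z - - h) with (z + h) in T by ring. fold m in T. lra. }
 have Nzh : z + h <> 0 by (apply (proj2 (Cmod_gt_0 (z+h))); lra).
 replace (/ (z + h) - / z - - / (z * z) * h) with (h * h * / (z * z * (z + h))) by (field; auto).
 rewrite !Cmod_mult, Cmod_inv, !Cmod_mult by (repeat apply Cmult_neq_0; auto). fold m.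
 have Hm0 := Cmod_ge_0 h.
 have I : / (m * m * Cmod (z + h)) <= 2 / (m * m * m).
 { replace (2 / (m * m * m))%R with (/ (m * m * (m/2)))%R by (field; lra).
  apply Rinv_le_contravar; [|apply Rmult_le_compat_l; nra]. repeat apply Rmult_lt_0_compat; lra. }
 have Q : Cmod h * / (m * m * Cmod (z + h)) <= eps.
 { apply Rle_trans with ((eps * (m * m * m) / 2) * (2 / (m * m * m)))%R.
  - apply Rmult_le_compat; try lra. left. apply Rinv_0_lt_compat.
   repeat apply Rmult_lt_0_compat; lra.
  - right. field. lra. }
 nra.
Qed.

Lemma chol_const c z : chol (fun _ => c) z.
Proof. eexists; apply cder_const. Qed.
Lemma chol_id z : chol (fun p => p) z.
Proof. eexists; apply cder_id. Qed.
Lemma chol_plus f g z : chol f z -> chol g z -> chol (fun p => f p + g p) z.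
Proof. intros [a Ha] [b Hb]; eexists; apply cder_plus; eauto. Qed.
Lemma chol_mult f g z : chol f z -> chol g z -> chol (fun p => f p * g p) z.
Proof. intros [a Ha] [b Hb]; eexists; apply cder_mult; eauto. Qed.
Lemma chol_comp f g z : chol f z -> chol g (f z) -> chol (fun p => g (f p)) z.
Proof. intros [a Ha] [b Hb]; eexists; apply (cder_comp f g); eauto. Qed.
Lemma chol_inv f z : chol f z -> f z <> 0 -> chol (fun p => / f p) z.
Proof. intros Hf H. apply (chol_comp f Cinv); auto. eexists; apply cder_Cinv; auto. Qed.
Lemma chol_div f g z : chol f z -> chol g z -> g z <> 0 -> chol (fun p => f p / g p) z.
Proof. intros. apply chol_mult; auto. apply chol_inv; auto. Qed.
Lemma chol_ext f g z : (forall p, f p = g p) -> chol f z -> chol g z.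
Proof. intros E [l Hl]; exists l; eapply cder_ext; eauto. Qed.
Lemma chol_ext_loc f g z r : 0 < r ->
 (forall p, Cmod (p - z) < r -> f p = g p) -> chol f z -> chol g z.
Proof. intros Hr E [l Hl]; exists l; eapply cder_ext_loc; eauto. Qed.
Lemma chol_opp f z : chol f z -> chol (fun p => - f p) z.
Proof.
 intros H. apply chol_ext with (fun p => (-1) * f p); [intros; ring|].
 apply chol_mult; auto. apply chol_const.
Qed.
Lemma chol_minus f g z : chol f z -> chol g z -> chol (fun p => f p - g p) z.
Proof. intros. apply chol_plus; auto. apply chol_opp; auto. Qed.
Lemma chol_pow f z n : chol f z -> chol (fun p => (f p ^ n)) z.
Proof.
 intros H. induction n as [|n IH].
 - apply chol_ext with (fun _ => RtoC 1); [pos|apply chol_const].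
 - apply chol_ext with (fun p => f p * f p ^ n); [pos|]. apply chol_mult; auto.
Qed.
Lemma chol_shift f a z : chol f (z - a) -> chol (fun p => f (p - a)) z.
Proof.
 intros H. apply (chol_comp (fun p => p - a) f); auto.
 apply chol_minus; [apply chol_id|apply chol_const].
Qed.

(** Everything follows from 1 + a <= exp a, applied to a and to - a. *)
Lemma exp_rem a : Rabs (exp a - 1 - a) <= a * a * exp (Rabs a).
Proof.
 have H1 : 0 <= exp a - 1 - a.
 { destruct (Req_dec a 0) as [->|N]; [rewrite exp_0; lra|]. pose proof (exp_ineq1 a N). lra. }
 rewrite Rabs_pos_eq by auto.
 have H2 : 1 - a <= exp (- a).
 { destruct (Req_dec a 0) as [->|N]; [rewrite Ropp_0, exp_0; lra|]. pose proof (exp_ineq1 (-a)). lra. }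
 have Pe := exp_pos a.
 have H3 : exp a * (1 - a) <= 1.
 { apply Rmult_le_compat_l with (r := exp a) in H2; [|lra].
  rewrite <- exp_plus, Rplus_opp_r, exp_0 in H2. exact H2. }
  destruct (Rle_dec 0 a) as [Ha|Ha].
 - rewrite Rabs_pos_eq by auto.
  have H5 : exp a - 1 <= a * exp a by lra.
  apply Rmult_le_compat_l with (r := a) in H5; auto. lra.
 - rewrite Rabs_left by lra.
        nra.
Qed.

Lemma exp_m1 a : Rabs (exp a - 1) <= Rabs a * exp (Rabs a).
Proof.
 have H1 : 1 + a <= exp a.
 { destruct (Req_dec a 0) as [->|N]; [rewrite exp_0; lra|]. pose proof (exp_ineq1 a N). lra. }
 have H2 : 1 - a <= exp (- a).
 { destruct (Req_dec a 0) as [->|N]; [rewrite Ropp_0, exp_0; lra|]. pose proof (exp_ineq1 (-a)). lra. }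
 have Pe := exp_pos a.
 have H3 : exp a * (1 - a) <= 1.
 { apply Rmult_le_compat_l with (r := exp a) in H2; [|lra].
  rewrite <- exp_plus, Rplus_opp_r, exp_0 in H2. exact H2. }
 destruct (Rle_dec 0 a) as [Ha|Ha].
 - rewrite !Rabs_pos_eq by lra. lra.
 - rewrite !(Rabs_left a) by lra. rewrite Rabs_left1.
  + nra.
  + assert (exp a < exp 0)%R by (apply exp_increasing; lra). rewrite exp_0 in H. lra.
Qed.

Lemma sin_abs_le b : Rabs (sin b) <= Rabs b.
Proof.
 have P : forall x, (0 <= x -> Rabs (sin x) <= x)%R.
 { intros x Hx. destruct (Req_dec x 0) as [->|N]; [rewrite sin_0, Rabs_R0; lra|].
  assert (sin x < x)%R by (apply sin_lt_x; lra).
  unfold Rabs; destruct Rcase_abs as [L|L]; [|lra].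
  destruct (Rle_dec x PI) as [Hp|Hp].
  - assert (0 <= sin x)%R by (apply sin_ge_0; lra). lra.
  - pose proof (SIN_bound x). pose proof PI2_1. lra. }
 destruct (Rle_dec 0 b) as [H|H].
 - rewrite (Rabs_pos_eq b) by auto. auto.
 - have Q := P (-b)%R. rewrite sin_neg, Rabs_Ropp in Q. rewrite (Rabs_left b) by lra. apply Q; lra.
Qed.

Lemma cos_m1_le b : Rabs (cos b - 1) <= b * b.
Proof.
 replace b with (2 * (b/2))%R at 1 by field. rewrite cos_2a_sin.
 have H := sin_abs_le (b/2).
 replace (1 - 2 * sin (b/2) * sin (b/2) - 1)%R with (- (2 * (sin (b/2) * sin (b/2))))%R by ring.
 rewrite Rabs_Ropp, Rabs_mult, Rabs_mult, (Rabs_pos_eq 2) by lra.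
 assert (0 <= Rabs (sin (b/2)))%R by apply Rabs_pos.
 have E : (Rabs (b/2) * Rabs (b/2) = b * b / 4)%R.
 { rewrite <- Rabs_mult, Rabs_pos_eq by nra. field. }
 nra.
Qed.

Lemma cos_m1_le_abs b : Rabs (cos b - 1) <= Rabs b.
Proof.
 replace b with (2 * (b/2))%R at 1 by field. rewrite cos_2a_sin.
 have H := sin_abs_le (b/2). have HB := SIN_bound (b/2).
 replace (1 - 2 * sin (b/2) * sin (b/2) - 1)%R with (- (2 * (sin (b/2) * sin (b/2))))%R by ring.
 rewrite Rabs_Ropp, Rabs_mult, Rabs_mult, (Rabs_pos_eq 2) by lra.
 assert (0 <= Rabs (sin (b/2)))%R by apply Rabs_pos.
 assert (Rabs (sin (b/2)) <= 1)%R by (apply Rabs_le; lra).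
 assert (Rabs b = 2 * Rabs (b/2))%R.
 { replace b with (2 * (b/2))%R at 1 by field. rewrite Rabs_mult, (Rabs_pos_eq 2) by lra. ring. }
 nra.
Qed.

Lemma sin_rem b : Rabs (sin b - b) <= b * b.
Proof.
 have P : forall x, (0 <= x -> Rabs (sin x - x) <= x * x)%R.
 { intros x Hx. destruct (Req_dec x 0) as [->|N].
  { rewrite sin_0, Rminus_0_r, Rabs_R0; lra. }
  have L : sin x < x by (apply sin_lt_x; lra).
  rewrite Rabs_left by lra.
    destruct (MVT_cor2 (fun u => sin u - u)%R (fun u => cos u - 1)%R 0 x) as [c [E Hc]]; [lra| |].
  { intros c _. apply is_derive_Reals. auto_derive; auto; ring. }
  rewrite sin_0 in E. have Hc1 : Rabs (cos c - 1) <= x.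
  { have H5 := cos_m1_le_abs c. rewrite (Rabs_pos_eq c) in H5 by lra. lra. }
  unfold Rabs in Hc1; destruct Rcase_abs in Hc1; nra. }
 destruct (Rle_dec 0 b) as [H|H]; [pos|].
 replace (sin b - b)%R with (- (sin (-b) - (-b)))%R by (rewrite sin_neg; ring).
 rewrite Rabs_Ropp. replace (b * b)%R with ((-b) * (-b))%R by ring. apply P; lra.
Qed.

Lemma Cmod_le_sum (z : C) : Cmod z <= Rabs (fst z) + Rabs (snd z).
Proof.
 destruct z as [x y]. replace (x, y) with (RtoC x + Ci * RtoC y).
 2:{ unfold RtoC, Ci, Cplus, Cmult; simpl. f_equal; ring. }
 apply Cmod_tri. rewrite Cmod_mult, Cmod_Ci, !Cmod_R.
 unfold RtoC, Ci, Cplus, Cmult; simpl.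
 replace (x + (0 * y - 1 * 0))%R with x by ring. replace (0 + (0 * 0 + 1 * y))%R with y by ring. lra.
Qed.

Lemma Re_le_Cmod (z : C) : Rabs (Re z) <= Cmod z.
Proof. eapply Rle_trans; [|apply Rmax_Cmod]. apply Rmax_l. Qed.
Lemma Im_le_Cmod (z : C) : Rabs (Im z) <= Cmod z.
Proof. eapply Rle_trans; [|apply Rmax_Cmod]. apply Rmax_r. Qed.

Lemma Ceq_ReIm (x y : C) : Re x = Re y -> Im x = Im y -> x = y.
Proof. destruct x, y; unfold Re, Im; simpl; intros; subst; auto. Qed.

Lemma cexp_plus x y : cexp (x + y) = cexp x * cexp y.
Proof.
 unfold cexp. destruct x as [a b], y as [c d]. unfold Cplus, Cmult, Re, Im; simpl.
 rewrite exp_plus, cos_plus, sin_plus. f_equal; ring.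
Qed.

Lemma cexp_0 : cexp 0 = 1.
Proof. unfold cexp, RtoC, Re, Im; simpl. rewrite exp_0, cos_0, sin_0. f_equal; ring. Qed.

Lemma Cmod_cexp z : Cmod (cexp z) = exp (Re z).
Proof.
 unfold cexp, Cmod; simpl.
 replace (exp (Re z) * cos (Im z) * (exp (Re z) * cos (Im z) * 1) + exp (Re z) * sin (Im z) * (exp (Re z) * sin (Im z) * 1))%R
  with (exp (Re z) * exp (Re z) * (Rsqr (sin (Im z)) + Rsqr (cos (Im z))))%R by (unfold Rsqr; ring).
 rewrite sin2_cos2, Rmult_1_r. apply sqrt_square. left; apply exp_pos.
Qed.

Lemma cexp_neq0 (z : C) : cexp z <> 0.
Proof. apply (proj2 (Cmod_gt_0 _)). rewrite Cmod_cexp. apply exp_pos. Qed.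

Lemma cexp_opp z : cexp (- z) = / cexp z.
Proof.
 have H : cexp (- z) * cexp z = 1.
 { rewrite <- cexp_plus. replace (- z + z) with (RtoC 0) by ring. apply cexp_0. }
 rewrite <- (Cmult_1_l (/ cexp z)), <- H, <- Cmult_assoc, Cinv_r, Cmult_1_r; auto. apply cexp_neq0.
Qed.

Lemma cexp_pow z n : cexp z ^ n = cexp (RtoC (INR n) * z).
Proof.
 induction n as [|n IH].
 - rewrite Cmult_0_l, cexp_0. reflexivity.
 - rewrite Cpow_S, IH, <- cexp_plus. f_equal. rewrite S_INR, RtoC_plus. ring.
Qed.

Lemma cexp_rem h : Cmod (cexp h - 1 - h) <= 5 * (Cmod h * Cmod h) * exp (Cmod h).
Proof.
 destruct h as [a b] eqn:Eh. rewrite <- Eh.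
 have Ha : Rabs a <= Cmod h by (rewrite Eh; apply (Re_le_Cmod (a,b))).
 have Hb : Rabs b <= Cmod h by (rewrite Eh; apply (Im_le_Cmod (a,b))).
 set (m := Cmod h) in *.
 have Hm : 0 <= m by apply Cmod_ge_0.
 etr Cmod_le_sum. subst h. unfold cexp, Re, Im; simpl.
 have He1 : 1 <= exp m.
 { rewrite <- exp_0. apply exp_le_mono, Hm. }
 have Hea := exp_le_mono _ _ Ha.
 have Hea2 : exp a <= exp m.
 { apply exp_le_mono. pose proof (Rle_abs a). lra. }
 have Haa : a * a <= m * m.
 { replace (a * a)%R with (Rabs a * Rabs a)%R by (rewrite <- Rabs_mult, Rabs_pos_eq; nra).
  pose proof (Rabs_pos a). nra. }
 have Hbb : b * b <= m * m.
 { replace (b * b)%R with (Rabs b * Rabs b)%R by (rewrite <- Rabs_mult, Rabs_pos_eq; nra).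
  pose proof (Rabs_pos b). nra. }
 have Pe := exp_pos a. assert (0 <= a * a)%R by nra. have A : Rabs (exp a * cos b + - (1) + - a) <= 2 * (m * m) * exp m.
 { replace (exp a * cos b + - (1) + - a)%R with ((exp a - 1 - a) + exp a * (cos b - 1))%R by ring.
  apply Rabs_tri. rewrite Rabs_mult, (Rabs_pos_eq (exp a)) by lra.
  have H1 := exp_rem a. have H2 := cos_m1_le b.
  assert (a * a * exp (Rabs a) <= m * m * exp m)%R by (apply Rmult_le_compat; try lra; left; apply exp_pos).
  assert (exp a * Rabs (cos b - 1) <= exp m * (m * m))%R
   by (apply Rmult_le_compat; try lra; apply Rabs_pos).
  lra. }
 have B : Rabs (exp a * sin b + - 0 + - b) <= 2 * (m * m) * exp m.
 { replace (exp a * sin b + - 0 + - b)%R with ((exp a - 1) * sin b + (sin b - b))%R by ring.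
  apply Rabs_tri. rewrite Rabs_mult.
  have H1 := exp_m1 a. have H2 := sin_rem b. have H3 := sin_abs_le b.
  assert (Rabs (exp a - 1) * Rabs (sin b) <= (m * exp m) * m)%R.
  { apply Rmult_le_compat; try apply Rabs_pos; try lra.
   etr H1. apply Rmult_le_compat; try lra; try apply Rabs_pos. left; apply exp_pos. }
  assert (m * m <= m * m * exp m)%R by nra. lra. }
 assert (0 <= m * m * exp m)%R by pos. lra.
Qed.

Lemma cder_cexp z : cder cexp z (cexp z).
Proof.
 intros eps He.
 set (K := (Cmod (cexp z) * (5 * exp 1))%R).
 have HK : 0 < K.
 { unfold K. rewrite Cmod_cexp. pose proof (exp_pos (Re z)). pose proof (exp_pos 1). apply Rmult_lt_0_compat; lra. }
 exists (Rmin 1 (eps / K)); split; [pos|].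
 intros h Hh.
 destruct (Rlt_min Hh) as [Hh1 Hh2].
 rewrite cexp_plus. replace (cexp z * cexp h - cexp z - cexp z * h) with (cexp z * (cexp h - 1 - h)) by ring.
 rewrite Cmod_mult.
 have H := cexp_rem h. have Hm := Cmod_ge_0 h.
 have He2 : exp (Cmod h) <= exp 1 by (left; apply exp_increasing; auto).
 apply Rle_trans with (K * Cmod h * Cmod h)%R.
 - unfold K. replace (Cmod (cexp z) * (5 * exp 1) * Cmod h * Cmod h)%R
   with (Cmod (cexp z) * (5 * (Cmod h * Cmod h) * exp 1))%R by ring.
  apply Rmult_le_compat_l; [pos|]. etr H.
  apply Rmult_le_compat_l; auto. nra.
 - apply Rmult_le_compat_r; auto.
  apply Rmult_lt_compat_l with (r := K) in Hh2; auto.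
  replace (K * (eps / K))%R with eps in Hh2 by (field; lra). lra.
Qed.

Lemma chol_cexp f z : chol f z -> chol (fun p => cexp (f p)) z.
Proof. intros H. apply (chol_comp f cexp); auto. eexists; apply cder_cexp. Qed.

(** * Exponential series *)

Lemma ex_series_mul_l (c : R) (a : nat -> R) : ex_series a -> ex_series (fun n => (c * a n)%R).
Proof. apply (ex_series_scal (K := R_AbsRing) (V := R_NormedModule) c a). Qed.

Lemma Series_nonneg u : (forall k, 0 <= u k)%R -> ex_series u -> 0 <= Series u.
Proof.
 intros H E. have Q : Series (fun n => (0 * u n)%R) <= Series u.
 { apply Series_le; auto. intros n; specialize (H n); lra. }
 rewrite Series_scal_l in Q. lra.
Qed.

Lemma Rabs_Series_le (u : nat -> R) (M : nat -> R) :
 (forall k, Rabs (u k) <= M k)%R -> ex_series M -> ex_series u /\ Rabs (Series u) <= Series M.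
Proof.
 intros H E.
 have E1 : ex_series (fun k => Rabs (u k)).
 { apply (ex_series_le (V := VR) _ M); auto. intros k.
  change (Rabs (Rabs (u k)) <= M k)%R. rewrite Rabs_Rabsolu; auto. }
 split; [apply ex_series_Rabs; auto|].
 eapply Rle_trans; [apply Series_Rabs; auto|].
 apply Series_le; auto. intros n; split; [pos|auto].
Qed.

Definition csum_ex (u : nat -> C) : Prop := ex_series (fun k => Cmod (u k)).

Lemma csum_ex_le u M : (forall k, Cmod (u k) <= M k)%R -> ex_series M -> csum_ex u.
Proof.
 intros H E. apply (ex_series_le (V := VR) _ M); auto. intros k.
 change (Rabs (Cmod (u k)) <= M k)%R. rewrite Rabs_pos_eq; auto. apply Cmod_ge_0.
Qed.

Lemma csum_ex_Re u : csum_ex u -> ex_series (fun k => Re (u k)).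
Proof. intros E. apply (Rabs_Series_le _ (fun k => Cmod (u k))); auto. intros; apply Re_le_Cmod. Qed.
Lemma csum_ex_Im u : csum_ex u -> ex_series (fun k => Im (u k)).
Proof. intros E. apply (Rabs_Series_le _ (fun k => Cmod (u k))); auto. intros; apply Im_le_Cmod. Qed.

Lemma csum_nat_bound u M : (forall k, Cmod (u k) <= M k)%R -> ex_series M ->
 Cmod (csum_nat u) <= 2 * Series M.
Proof.
 intros H E. etr Cmod_le_sum. simpl.
 destruct (Rabs_Series_le (fun k => Re (u k)) M) as [_ H1]; auto.
 { intros k. eapply Rle_trans; [apply Re_le_Cmod|auto]. }
 destruct (Rabs_Series_le (fun k => Im (u k)) M) as [_ H2]; auto.
 { intros k. eapply Rle_trans; [apply Im_le_Cmod|auto]. }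
 lra.
Qed.

Lemma csum_nat_ext u v : (forall k, u k = v k) -> csum_nat u = csum_nat v.
Proof. intros H. unfold csum_nat. f_equal; apply Series_ext; intros; rewrite H; auto. Qed.

Lemma csum_nat_plus u v : csum_ex u -> csum_ex v ->
 csum_nat (fun k => u k + v k) = csum_nat u + csum_nat v.
Proof.
 intros Hu Hv. unfold csum_nat, Cplus; simpl. f_equal.
 - rewrite <- Series_plus by (apply csum_ex_Re; auto). apply Series_ext; intros; reflexivity.
 - rewrite <- Series_plus by (apply csum_ex_Im; auto). apply Series_ext; intros; reflexivity.
Qed.

Lemma csum_nat_scal c u : csum_ex u -> csum_nat (fun k => c * u k) = c * csum_nat u.
Proof.
 intros Hu. unfold csum_nat, Cmult; simpl. f_equal.
 - rewrite <- !Series_scal_l, <- Series_minus.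
  + pos.
  + apply (ex_series_mul_l (fst c)). apply csum_ex_Re; auto.
  + apply (ex_series_mul_l (snd c)). apply csum_ex_Im; auto.
 - rewrite <- !Series_scal_l, <- Series_plus.
  + pos.
  + apply (ex_series_mul_l (fst c)). apply csum_ex_Im; auto.
  + apply (ex_series_mul_l (snd c)). apply csum_ex_Re; auto.
Qed.

Lemma csum_ex_plus u v : csum_ex u -> csum_ex v -> csum_ex (fun k => u k + v k).
Proof.
 intros Hu Hv. apply csum_ex_le with (fun k => (Cmod (u k) + Cmod (v k))%R).
 - intros; apply Cmod_triangle.
 - apply (ex_series_plus (fun k => Cmod (u k)) (fun k => Cmod (v k))); auto.
Qed.

Lemma csum_ex_scal c u : csum_ex u -> csum_ex (fun k => c * u k).
Proof.
 intros Hu. apply csum_ex_le with (fun k => (Cmod c * Cmod (u k))%R).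
 - intros; rewrite Cmod_mult; lra.
 - apply (ex_series_mul_l (Cmod c)); auto.
Qed.

Lemma csum_nat_minus u v : csum_ex u -> csum_ex v ->
 csum_nat (fun k => u k - v k) = csum_nat u - csum_nat v.
Proof.
 intros Hu Hv. rewrite (csum_nat_ext _ (fun k => u k + (-1) * v k)) by (intros; ring).
 rewrite csum_nat_plus, csum_nat_scal; auto; [ring|]. apply csum_ex_scal; auto.
Qed.

(** Each of the terms 1, s, ..., s^k of the geometric sum is at least s^k. *)
Lemma k_pow_bound (s : R) k : 0 <= s < 1 -> INR k * s ^ k <= / (1 - s).
Proof.
 intros Hs.
 have H : INR k * s ^ k <= sum_f_R0 (fun j => s ^ j) k.
 { induction k as [|k IH]; [simpl; lra|].
  rewrite S_INR. simpl sum_f_R0. simpl pow in *.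
  assert (0 <= s ^ k)%R by pos.
  assert (0 <= INR k)%R by apply pos_INR.
  assert (INR k * (s * s ^ k) <= INR k * s^k)%R.
  { apply Rmult_le_compat_l; auto. nra. } lra. }
 rewrite tech3 in H by lra. etr H.
 unfold Rdiv. rewrite <- (Rmult_1_l (/ (1 - s))) at 2. apply Rmult_le_compat_r.
 - pos.
 - assert (0 <= s ^ S k)%R by pos. lra.
Qed.

(** With r = s^4 the term is (k s^k)^2 (s^2)^k, a bounded factor times a geometric one. *)
Lemma ex_series_k2 (r : R) : 0 <= r < 1 -> ex_series (fun k => (INR k * INR k * r ^ k)%R).
Proof.
 intros Hr.
 set (s := sqrt (sqrt r)).
 have Hs0 : 0 <= s by apply sqrt_pos.
 have E2 : (s * s = sqrt r)%R by (apply sqrt_sqrt, sqrt_pos).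
 have E4 : ((s * s) * (s * s) = r)%R by (rewrite E2; apply sqrt_sqrt; lra).
 have Hs1 : s < 1.
 { destruct (Rlt_dec s 1) as [|N]; auto. exfalso. assert (1 <= s * s)%R by nra. nra. }
 apply (ex_series_le (V := VR) _ (fun k => (/ (1-s) * / (1-s)) * (s * s) ^ k)%R).
 - intros k. change (Rabs (INR k * INR k * r ^ k) <= (/ (1-s) * / (1-s)) * (s * s) ^ k)%R.
  rewrite <- E4, !Rpow_mult_distr.
  have H := k_pow_bound s k (conj Hs0 Hs1).
  have P : 0 <= INR k * s ^ k by pos.
    replace (INR k * INR k * (s ^ k * s ^ k * (s ^ k * s ^ k)))%R
   with ((INR k * s ^ k) * (INR k * s ^ k) * (s ^ k * s ^ k))%R by ring.
  rewrite Rabs_pos_eq by pos.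
  apply Rmult_le_compat_r; [pos|]. apply Rmult_le_compat; auto.
 - apply (ex_series_mul_l (/ (1-s) * / (1-s))%R). apply ex_series_geom. rewrite E2.
  rewrite <- E2. rewrite Rabs_pos_eq; nra.
Qed.

Definition ce : C -> C := fun p => cexp (RtoC (2 * PI) * Ci * p).
Arguments ce _%_C.

Lemma ce_plus x y : ce (x + y) = ce x * ce y.
Proof. unfold ce. rewrite <- cexp_plus. f_equal. ring. Qed.
Lemma ce_opp x : ce (- x) = / ce x.
Proof. unfold ce. rewrite <- cexp_opp. f_equal. ring. Qed.
Lemma ce_minus x y : ce (x - y) = ce x / ce y.
Proof. unfold Cminus. rewrite ce_plus, ce_opp. reflexivity. Qed.
Lemma ce_neq0 x : ce x <> 0.
Proof. apply cexp_neq0. Qed.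
Lemma ce_0 : ce 0 = 1.
Proof. unfold ce. rewrite Cmult_0_r. apply cexp_0. Qed.
Lemma ce_Z (a : Z) : ce (RtoC (IZR a)) = 1.
Proof.
 unfold ce, cexp. replace (RtoC (2 * PI) * Ci * IZR a) with ((0, 2 * PI * IZR a)%R : C).
 2:{ unfold Ci, RtoC, Cmult; simpl. f_equal; ring. }
 unfold Re, Im; simpl. rewrite exp_0.
 assert (cos (2 * PI * IZR a) = 1 /\ sin (2 * PI * IZR a) = 0)%R as [-> ->].
 2:{ unfold RtoC. f_equal; ring. }
 have N : forall n : nat, (cos (om n) = 1 /\ sin (om n) = 0)%R.
 { intros n. replace (om n)%R with (0 + 2 * INR n * PI)%R by ring.
  rewrite cos_period, sin_period, cos_0, sin_0. auto. }
 destruct (Z_le_dec 0 a) as [H|H].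
 - rewrite <- (Z2Nat.id a H), <- INR_IZR_INZ. apply N.
 - have E : (IZR a = - INR (Z.to_nat (- a)))%R.
  { rewrite INR_IZR_INZ, Z2Nat.id, opp_IZR by lia. ring. }
  rewrite E. replace (2 * PI * - INR (Z.to_nat (- a)))%R with (- (2 * PI * INR (Z.to_nat (- a))))%R by ring.
  rewrite cos_neg, sin_neg. destruct (N (Z.to_nat (- a))) as [-> ->]. split; ring.
Qed.
Lemma ce_eq x y : ce (x, y) = (exp (- (2 * PI * y)) * cos (2 * PI * x), exp (- (2 * PI * y)) * sin (2 * PI * x))%R.
Proof.
 unfold ce, cexp. replace (RtoC (2 * PI) * Ci * (x, y)) with ((- (2 * PI * y), 2 * PI * x)%R : C).
 - pos.
 - unfold Ci, RtoC, Cmult; simpl. f_equal; ring.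
Qed.
Lemma Cmod_ce p : Cmod (ce p) = exp (- (2 * PI * Im p)).
Proof.
 unfold ce. rewrite Cmod_cexp. f_equal. destruct p as [x y].
 unfold Ci, RtoC, Cmult, Re, Im; simpl. ring.
Qed.
Lemma exp_pow x k : exp (INR k * x) = (exp x ^ k)%R.
Proof.
 induction k as [|k IH]; [simpl; rewrite Rmult_0_l, exp_0; auto|].
 rewrite S_INR. replace ((INR k + 1) * x)%R with (x + INR k * x)%R by ring.
 rewrite exp_plus, IH. reflexivity.
Qed.

Lemma ce_pow p k : ce (RtoC (INR k) * p) = ce p ^ k.
Proof. unfold ce. rewrite cexp_pow. f_equal. ring. Qed.
Lemma chol_ce f z : chol f z -> chol (fun p => ce (f p)) z.
Proof. intros. apply chol_cexp. apply chol_mult; auto. apply chol_const. Qed.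

(** A power series in e(p) = exp(2 pi i p): periodic with period 1, and convergent in an upper half
    plane whose height depends on the decay of [a]. *)
Definition ES (a : nat -> R) (p : C) : C := csum_nat (fun k => RtoC (a k) * ce (RtoC (INR k) * p)).

Lemma Cmod_ES_term a p k : Cmod (RtoC (a k) * ce (RtoC (INR k) * p)) = (Rabs (a k) * exp (- (2 * PI * Im p)) ^ k)%R.
Proof. rewrite Cmod_mult, Cmod_R, ce_pow, Cmod_pow, Cmod_ce. reflexivity. Qed.

Definition geo_bd (a : nat -> R) (A r : R) : Prop := (0 <= r)%R /\ forall k, Rabs (a k) <= A * r ^ k.

Lemma ES_ex a A r p : geo_bd a A r -> r * exp (- (2 * PI * Im p)) < 1 ->
 csum_ex (fun k => RtoC (a k) * ce (RtoC (INR k) * p)).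
Proof.
 intros [Hr Ha] Hp. set (E := exp _) in *.
 have HE : 0 < E by apply exp_pos.
 apply csum_ex_le with (fun k => (A * (r * E) ^ k)%R).
 - intros k. rewrite Cmod_ES_term. rewrite Rpow_mult_distr, <- Rmult_assoc.
  apply Rmult_le_compat_r; [pos|auto].
 - apply (ex_series_mul_l A). apply ex_series_geom. rewrite Rabs_pos_eq; auto. nra.
Qed.

(** Termwise differentiation: the quadratic remainder of the exponential in the k-th term is at most
    a multiple of k^2 rho^k |h|^2, and [ex_series_k2] sums it. *)
Lemma ES_cder a A r p : geo_bd a A r -> r * exp (- (2 * PI * Im p)) < 1 ->
 cder (ES a) p (RtoC (2 * PI) * Ci * ES (fun k => (INR k * a k)%R) p).
Proof.
 intros [Hr Ha] Hp eps He.
 set (E := exp (- (2 * PI * Im p))) in *.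
 have HE : 0 < E by apply exp_pos.
 have Hpi := PI_RGT_0.
 assert (exists d0, 0 < d0 /\ r * E * exp (2 * PI * d0) < 1) as [d0 [Hd0 Hroom]].
 { destruct (Req_dec r 0) as [->|Nr]; [exists 1%R; split; lra|].
  set (x := (r * E)%R) in *. have Hx : 0 < x by pos.
  (* With this radius the common ratio rho is the square root of x = r E. *)
  exists (- ln x / 2 / (2 * PI))%R.
  have L : ln x < 0 by (rewrite <- ln_1; apply ln_increasing; auto).
  split. { pos. }
  replace (2 * PI * (- ln x / 2 / (2 * PI)))%R with (- ln x / 2)%R by (field; lra).
  rewrite <- (exp_ln x Hx) at 1. rewrite <- exp_plus, <- exp_0. apply exp_increasing. lra. }
 set (rho := (r * E * exp (2 * PI * d0))%R) in *.
 have Hrho : 0 <= rho < 1.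
 { split; auto. unfold rho. pos. }
 have HA : 0 <= A.
 { specialize (Ha 0%nat). pose proof (Rabs_pos (a 0%nat)). lra. }
 set (T := Series (fun k => (INR k * INR k * rho ^ k)%R)).
 have HT : 0 <= T.
 { apply Series_nonneg; [|apply ex_series_k2; auto]. intros k.
  repeat apply Rmult_le_pos; try apply pos_INR. apply pow_le; lra. }
 set (K := (2 * (A * 5 * (2 * PI) * (2 * PI) * T) + 1)%R).
 have HK : 0 < K.
 { unfold K. have Q1 : 0 <= A * T by pos.
  have Q2 : 0 <= PI * PI by nra. have Q3 := Rmult_le_pos _ _ Q1 Q2. lra. }
 exists (Rmin d0 (eps / K)). split; [pos|].
 intros h Hh.
 destruct (Rlt_min Hh) as [Hh1 Hh2].
 have Hm := Cmod_ge_0 h.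
 have Gp : csum_ex (fun k => RtoC (a k) * ce (RtoC (INR k) * p)) by (eapply ES_ex; eauto; split; eauto).
 have Gph : csum_ex (fun k => RtoC (a k) * ce (RtoC (INR k) * (p + h))).
 { apply ES_ex with A r; [split; auto|].
  apply Rle_lt_trans with rho; [|lra]. unfold rho.
  rewrite (Rmult_assoc r E). apply Rmult_le_compat_l; auto. unfold E. rewrite <- exp_plus.
  change (Im (p + h)) with (Im p + Im h)%R.
  have I := Im_le_Cmod h. apply Rabs_le_between in I.
  apply exp_le_mono. assert (0 <= 2 * PI * (d0 + Im h))%R by pos. lra. }
 have Gd : csum_ex (fun k => RtoC (INR k * a k) * ce (RtoC (INR k) * p)).
 { apply csum_ex_le with (fun k => (A * (INR k * INR k * rho ^ k))%R).
  - intros k. rewrite (Cmod_ES_term (fun k => INR k * a k)%R). rewrite Rabs_mult, (Rabs_pos_eq (INR k)) by apply pos_INR.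
   fold E.
   assert (r * E <= rho)%R.
   { rewrite <- (Rmult_1_r (r * E)) at 1. apply Rmult_le_compat_l; [pos|].
    rewrite <- exp_0. left; apply exp_increasing. apply Rmult_lt_0_compat; lra. }
   destruct k as [|k]; [simpl; lra|].
   assert (1 <= INR (S k))%R by (rewrite S_INR; pose proof (pos_INR k); lra).
   assert ((r * E) ^ S k <= rho ^ S k)%R by (apply pow_incr; split; auto; apply Rmult_le_pos; lra).
   rewrite Rpow_mult_distr in H1.
   specialize (Ha (S k)). set (n := S k) in *.
   assert (0 <= E ^ n)%R by pos.
   assert (Rabs (a n) * E ^ n <= A * rho ^ n)%R.
   { apply Rle_trans with (A * r ^ n * E ^ n)%R; [apply Rmult_le_compat_r; auto|].
    rewrite Rmult_assoc. apply Rmult_le_compat_l; auto. }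
   assert (0 <= A * rho ^ n)%R by pos.
   rewrite Rmult_assoc. replace (A * (INR n * INR n * rho ^ n))%R with (INR n * (INR n * (A * rho ^ n)))%R by ring.
   apply Rmult_le_compat_l; [lra|]. nra.
  - apply (ex_series_mul_l A). apply ex_series_k2; auto. }
 unfold ES.
 match goal with |- context [RtoC (2 * PI) * Ci * ?X * h] =>
  replace (RtoC (2 * PI) * Ci * X * h) with ((RtoC (2 * PI) * Ci * h) * X) by ring end.
 rewrite <- csum_nat_scal, <- !csum_nat_minus; auto; [| |apply csum_ex_scal; auto].
 2: { apply csum_ex_le with (fun k => (Cmod (RtoC (a k) * ce (RtoC (INR k) * (p + h))) + Cmod (RtoC (a k) * ce (RtoC (INR k) * p)))%R).
    - intros k. rewrite <- (Cmod_opp (RtoC (a k) * ce (RtoC (INR k) * p))). apply Cmod_triangle.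
    - apply (ex_series_plus (fun k => Cmod (RtoC (a k) * ce (RtoC (INR k) * (p + h))))); auto. }
 eapply Rle_trans.
 { apply csum_nat_bound with (M := fun k => ((A * 5 * (2 * PI) * (2 * PI) * (Cmod h * Cmod h)) * (INR k * INR k * rho ^ k))%R).
  2: { apply ex_series_mul_l. apply ex_series_k2; auto. }
  intros k.
  replace (RtoC (a k) * ce (RtoC (INR k) * (p + h)) - RtoC (a k) * ce (RtoC (INR k) * p) -
   RtoC (2 * PI) * Ci * h * (RtoC (INR k * a k) * ce (RtoC (INR k) * p)))
   with (RtoC (a k) * ce (RtoC (INR k) * p) * (cexp (RtoC (2 * PI) * Ci * (RtoC (INR k) * h)) - 1 - RtoC (2 * PI) * Ci * (RtoC (INR k) * h))).
  2: { have Q : ce (RtoC (INR k) * (p + h)) = ce (RtoC (INR k) * p) * cexp (RtoC (2 * PI) * Ci * (RtoC (INR k) * h)).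
     { rewrite Cmult_plus_distr_l, ce_plus. reflexivity. }
     rewrite Q, (RtoC_mult (INR k) (a k)). ring. }
  rewrite Cmod_mult, Cmod_ES_term. set (u := RtoC (2 * PI) * Ci * (RtoC (INR k) * h)).
  have Eu : Cmod u = (om k * Cmod h)%R.
  { unfold u. rewrite !Cmod_mult, Cmod_Ci, !Cmod_R, !Rabs_pos_eq; [ring|pos|lra]. }
  have Hu := cexp_rem u. rewrite Eu in Hu.
  have HI := pos_INR k.
  have He2 : exp (om k * Cmod h) <= exp (2 * PI * d0) ^ k.
  { rewrite <- (exp_pow (2 * PI * d0)). apply exp_le_mono.
   replace (om k * Cmod h)%R with (INR k * (2 * PI * Cmod h))%R by ring.
   apply Rmult_le_compat_l; auto. apply Rmult_le_compat_l; lra. }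
  unfold rho. rewrite !Rpow_mult_distr.
  apply Rle_trans with ((A * r ^ k) * E ^ k * (5 * (om k * Cmod h * (om k * Cmod h)) * exp (2 * PI * d0) ^ k))%R.
  - apply Rmult_le_compat.
   1,2: pos.
   + apply Rmult_le_compat_r; pos.
   + etr Hu. apply Rmult_le_compat_l; pos.
  - right. ring. }
 rewrite Series_scal_l. fold T. apply Rlt_div_r in Hh2; auto.
 apply Rle_trans with ((K * Cmod h) * Cmod h)%R; [unfold K|]; nra.
Qed.

Lemma ES_chol a A r p : geo_bd a A r -> r * exp (- (2 * PI * Im p)) < 1 -> chol (ES a) p.
Proof. intros. eexists. eapply ES_cder; eauto. Qed.

Lemma csum_nat_incr u : csum_ex u -> csum_nat u = u 0%nat + csum_nat (fun k => u (S k)).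
Proof.
 intros H. unfold csum_nat. rewrite Series_incr_1 by (apply csum_ex_Re; auto).
 rewrite (Series_incr_1 (fun k => Im (u k))) by (apply csum_ex_Im; auto). apply Ceq_ReIm; reflexivity.
Qed.

Lemma csum_geom z : Cmod z < 1 -> csum_ex (fun k => z ^ k) /\ csum_nat (fun k => z ^ k) = / (1 - z).
Proof.
 intros Hz.
 have E : csum_ex (fun k => z ^ k).
 { apply csum_ex_le with (fun k => (Cmod z ^ k)%R); [intros; rewrite Cmod_pow; lra|].
  apply ex_series_geom. rewrite Rabs_pos_eq; auto. apply Cmod_ge_0. }
 split; auto.
 have N : 1 - z <> 0.
 { intro H. assert (z = 1) by (replace z with (1 - (1 - z)) by ring; rewrite H; ring).
  rewrite H0, Cmod_1 in Hz. lra. }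
 have Q := csum_nat_incr _ E. cbv beta in Q.
 rewrite (csum_nat_ext (fun k => z ^ S k) (fun k => z * z ^ k)) in Q by pos.
 rewrite csum_nat_scal in Q by auto. change (z ^ 0) with (RtoC 1) in Q.
 set (T := csum_nat _) in *.
 have Q2 : (1 - z) * T = 1.
 { replace ((1 - z) * T) with (T - z * T) by ring. rewrite Q at 1. ring. }
 replace T with ((1 - z) * T * / (1 - z)) by (field; auto). rewrite Q2. ring.
Qed.

(* z^k/k with the junk index 0 set to 0 *)
Definition invk (k : nat) : R := match k with O => 0%R | _ => (/ INR k)%R end.

Lemma invk_bd : geo_bd invk 1 1.
Proof.
 split; [lra|]. intros k. rewrite pow1, Rmult_1_r. destruct k; [simpl; rewrite Rabs_R0; lra|].
 assert (1 <= INR (S k))%R by (rewrite S_INR; pose proof (pos_INR k); lra).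
 rewrite Rabs_pos_eq by pos.
 rewrite <- Rinv_1. apply Rinv_le_contravar; lra.
Qed.

Lemma cder_vertical f x y l : cder f (x, y) l ->
 is_derive (fun v => Re (f (x, v))%C) y (Re (l * Ci)) /\ is_derive (fun v => Im (f (x, v))%C) y (Im (l * Ci)).
Proof.
 intros H.
 have G : forall eps, 0 < eps -> exists d, 0 < d /\ forall v, Rabs (v - y) < d ->
   Cmod (f (x, v) - f (x, y) - RtoC (v - y) * (l * Ci))%C <= eps * Rabs (v - y).
 { intros eps He. destruct (H eps He) as [d [Hd H1]]. exists d; split; auto. intros v Hv.
  have E : (x, v) = (x, y) + RtoC (v - y) * Ci.
  { unfold Cplus, Cmult, RtoC, Ci; simpl. f_equal; ring. }
  have M : Cmod (RtoC (v - y) * Ci) = Rabs (v - y).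
  { rewrite Cmod_mult, Cmod_Ci, Cmod_R; ring. }
  specialize (H1 (RtoC (v - y) * Ci)). rewrite M in H1. specialize (H1 Hv). rewrite <- E in H1.
  replace (RtoC (v - y) * (l * Ci)) with (l * (RtoC (v - y) * Ci)) by ring. exact H1. }
 split; (split; [apply is_linear_scal_l|]);
 intros x0 Hx0; pose proof (@is_filter_lim_locally_unique R_AbsRing R_NormedModule y x0 Hx0) as E; subst x0;
 intros eps; destruct (G eps (cond_pos eps)) as [d [Hd H1]];
 exists (mkposreal d Hd); intros v Hv; specialize (H1 v Hv).
 - change (Rabs (Re (f (x, v))%C - Re (f (x, y))%C - (v - y) * Re (l * Ci)) <= eps * Rabs (v - y))%R.
  eapply Rle_trans; [|apply H1]. eapply Rle_trans; [|apply Re_le_Cmod]. right. f_equal.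
  unfold Re, Cminus, Cplus, Copp, Cmult, RtoC; simpl. ring.
 - change (Rabs (Im (f (x, v))%C - Im (f (x, y))%C - (v - y) * Im (l * Ci)) <= eps * Rabs (v - y))%R.
  eapply Rle_trans; [|apply H1]. eapply Rle_trans; [|apply Im_le_Cmod]. right. f_equal.
  unfold Im, Cminus, Cplus, Copp, Cmult, RtoC; simpl. ring.
Qed.

Lemma is_derive_0_const (f : R -> R) a b : a < b -> (forall y, a <= y <= b -> is_derive f y 0) -> f a = f b.
Proof.
 intros Hab H.
 destruct (MVT_cor2 f (fun _ => 0%R) a b Hab) as [c [E _]].
 { intros c Hc. apply is_derive_Reals. apply H; auto. }
 lra.
Qed.

Lemma cder_0_vertical f x a b : a < b -> (forall y, a <= y <= b -> cder f (x, y) 0) -> f (x, a) = f (x, b).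
Proof.
 intros Hab H. apply Ceq_ReIm.
 - apply (is_derive_0_const (fun v => Re (f (x, v))%C)); auto. intros y Hy.
  destruct (cder_vertical f x y 0 (H y Hy)) as [D _]. rewrite Cmult_0_l in D. exact D.
 - apply (is_derive_0_const (fun v => Im (f (x, v))%C)); auto. intros y Hy.
  destruct (cder_vertical f x y 0 (H y Hy)) as [_ D]. rewrite Cmult_0_l in D. exact D.
Qed.

(* The function (1 - e p) exp (sum e(kp)/k) has zero derivative and tends to 1 as Im p goes to infinity. *)
Lemma log_series p : 0 < Im p -> (1 - ce p) * cexp (ES invk p) = 1.
Proof.
 destruct p as [x y]. unfold Im; simpl. intros Hy.
 have Hpi := PI_RGT_0.
 set (f := fun p => (1 - ce p) * cexp (ES invk p)).
 change (f (x, y) = 1).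
 have HX : forall v, 0 < v -> 1 * exp (- (2 * PI * v)) < 1.
 { intros v Hv. rewrite Rmult_1_l. apply Rlt_le_trans with (exp 0); [|rewrite exp_0; lra]. apply exp_increasing.
  assert (0 < 2 * PI * v)%R by pos. lra. }
 have D : forall v, 0 < v -> cder f (x, v) 0.
 { intros v Hv. set (p := (x, v) : C).
  have D1 : cder ce p (ce p * (RtoC (2 * PI) * Ci)).
  { apply (cder_comp (fun q => RtoC (2 * PI) * Ci * q) cexp).
   - apply cder_eq with (RtoC (2 * PI) * Ci * 1); [ring|]. apply cder_scal, cder_id.
   - apply cder_cexp. }
  have D2 := ES_cder invk 1 1 p invk_bd (HX v Hv).
  have HZ : Cmod (ce p) < 1.
  { rewrite Cmod_ce. rewrite <- (Rmult_1_l (exp _)). apply HX; auto. }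
  destruct (csum_geom _ HZ) as [GE GS].
  have E : ES (fun k => (INR k * invk k)%R) p = ce p * / (1 - ce p).
  { rewrite <- GS, <- csum_nat_scal by auto. unfold ES. rewrite csum_nat_incr.
   - change (INR 0) with 0%R. rewrite Rmult_0_l, Cmult_0_l, Cplus_0_l. apply csum_nat_ext.
    intros k. rewrite ce_pow. replace (INR (S k) * invk (S k))%R with 1%R.
    + rewrite Cmult_1_l. reflexivity.
    + unfold invk. field. apply not_0_INR. lia.
   - apply csum_ex_le with (fun k => (Cmod (ce p) ^ k)%R).
    + intros k. rewrite Cmod_mult, ce_pow, Cmod_pow, Cmod_R.
     rewrite <- (Rmult_1_l (Cmod (ce p) ^ k)) at 2.
     apply Rmult_le_compat_r; [pos|].
     destruct k; [simpl; rewrite Rmult_0_l, Rabs_R0; lra|].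
     rewrite Rinv_r, Rabs_R1; [lra|apply not_0_INR; lia].
    + apply ex_series_geom. rewrite Rabs_pos_eq; auto. apply Cmod_ge_0. }
  rewrite E in D2.
  have N : 1 - ce p <> 0.
  { intro H. have H0 : ce p = 1 by (replace (ce p) with (1 - (1 - ce p)) by ring; rewrite H; ring).
   rewrite H0, Cmod_1 in HZ. lra. }
  eapply cder_eq; cycle 1.
  { apply (cder_mult (fun p => 1 - ce p)).
   - apply cder_ext with (fun q => 1 + (-1) * ce q); [intros; ring|].
    apply cder_plus; [apply cder_const|]. apply cder_scal. exact D1.
   - apply (cder_comp (ES invk) cexp); [exact D2|apply cder_cexp]. }
  set (W := cexp (ES invk p)). set (U := ce p) in *. field. auto. }
 have L : forall eps, 0 < eps -> Cmod (f (x, y) - 1)%C < eps.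
 { intros eps He.
  destruct (chol_cont cexp 0 (ex_intro _ _ (cder_cexp 0)) (Rmin 1 (eps / 4))) as [d [Hd HC]].
  { pos. }
  (* If |e(p)| = Q <= X0, the series is at most 2 Q / (1 - Q) <= 4 Q < d, so its exponential is
     within eps / 4 of 1, and the factor 1 - e(p) costs at most 2 X0 <= eps / 4 more. *)
  set (X0 := Rmin (/2) (Rmin (d / 5) (eps / 8))).
  have HX0 : 0 < X0 by pos.
  assert (X0 <= /2 /\ X0 <= d / 5 /\ X0 <= eps / 8)%R as [X1 [X2 X3]] by (unfold X0; repeat split; rmin).
  set (v := Rmax (y + 1) (- ln X0 / (2 * PI))).
  have Hv : y < v by (apply Rlt_le_trans with (y + 1)%R; [lra|apply Rmax_l]).
  have Hexp : exp (- (2 * PI * v)) <= X0.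
  { rewrite <- (exp_ln X0 HX0). apply exp_le_mono.
   assert (- ln X0 / (2 * PI) <= v)%R by apply Rmax_r. apply Rle_div_l in H; lra. }
  rewrite (cder_0_vertical f x y v Hv) by (intros; apply D; lra).
  set (p := (x, v) : C). unfold f.
  have Hu : Cmod (ce p) <= X0 by (rewrite Cmod_ce; exact Hexp).
  set (Q := Cmod (ce p)) in *. have HQ := Cmod_ge_0 (ce p). fold Q in HQ.
  have Hw : Cmod (ES invk p) < d.
  { eapply Rle_lt_trans.
   - apply csum_nat_bound with (M := fun k => match k with O => 0%R | S j => (Q * Q ^ j)%R end).
    + intros k. rewrite Cmod_ES_term. rewrite <- Cmod_ce. fold Q. destruct k; [simpl; rewrite Rabs_R0; lra|].
     have H := proj2 invk_bd (S k). rewrite pow1, Rmult_1_l in H.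
     change (Q * Q ^ k)%R with (Q ^ S k)%R.
     assert (0 <= Q ^ S k)%R by pos. nra.
    + apply ex_series_incr_1. apply ex_series_mul_l. apply ex_series_geom. rewrite Rabs_pos_eq; lra.
   - rewrite Series_incr_1_aux by reflexivity. rewrite Series_scal_l, Series_geom by (rewrite Rabs_pos_eq; lra).
    assert (/ (1 - Q) <= 2)%R.
    { rewrite <- (Rinv_inv 2). apply Rinv_le_contravar; lra. }
    nra. }
  specialize (HC (ES invk p)). replace (ES invk p - 0) with (ES invk p) in HC by ring.
  specialize (HC Hw). rewrite cexp_0 in HC.
  set (W := cexp (ES invk p)) in *.
  destruct (Rlt_min HC) as [HC1 HC2].
  have HW : Cmod W <= 2.
  { replace W with ((W - 1) + 1) by ring. apply Cmod_tri. rewrite Cmod_1. lra. }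
  replace ((1 - ce p) * W - 1) with ((W - 1) + - (ce p * W)) by ring.
  eapply Rle_lt_trans; [apply Cmod_triangle|]. rewrite Cmod_opp, Cmod_mult. fold Q.
  assert (Q * Cmod W <= X0 * 2)%R by (apply Rmult_le_compat; auto; apply Cmod_ge_0). lra. }
 have Z : Cmod (f (x, y) - 1)%C = 0%R.
 { destruct (Cmod_ge_0 (f (x, y) - 1)) as [H|H]; auto. specialize (L _ H). lra. }
 apply Cmod_eq_0 in Z. replace (f (x, y)) with ((f (x, y) - 1) + 1) by ring. rewrite Z. ring.
Qed.

Lemma cexp_log_series p : 0 < Im p -> cexp (- ES invk p) = 1 - ce p.
Proof.
 intros H. rewrite cexp_opp.
 replace (1 - ce p) with ((1 - ce p) * cexp (ES invk p) * / cexp (ES invk p)) by (field; apply cexp_neq0).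
 rewrite (log_series p H). ring.
Qed.

(** * Contour integrals over rectangles *)

Ltac req := match goal with |- ?a = ?b => change (@eq R a b) end.

Lemma RInt_mulR (c : R) (g : R -> R) a b : ex_RInt g a b -> RInt (fun x => (c * g x)%R) a b = (c * RInt g a b)%R.
Proof. apply (RInt_scal (V := VR) g a b c). Qed.
Lemma RInt_plusR (f g : R -> R) a b : ex_RInt f a b -> ex_RInt g a b ->
 RInt (fun x => (f x + g x)%R) a b = (RInt f a b + RInt g a b)%R.
Proof. apply (RInt_plus (V := VR) f g a b). Qed.
Lemma RInt_minusR (f g : R -> R) a b : ex_RInt f a b -> ex_RInt g a b ->
 RInt (fun x => (f x - g x)%R) a b = (RInt f a b - RInt g a b)%R.
Proof. apply (RInt_minus (V := VR) f g a b). Qed.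
Lemma ex_RInt_mulR (c : R) (g : R -> R) a b : ex_RInt g a b -> ex_RInt (fun x => (c * g x)%R) a b.
Proof. apply (ex_RInt_scal (V := R_NormedModule) g a b c). Qed.

Lemma ex_RInt_plusR (f g : R -> R) a b : ex_RInt f a b -> ex_RInt g a b -> ex_RInt (fun x => (f x + g x)%R) a b.
Proof. apply (ex_RInt_plus (V := R_NormedModule) f g a b). Qed.

Definition CI (f : R -> C) (a b : R) : C :=
 (RInt (fun x => Re (f x)) a b, RInt (fun x => Im (f x)) a b).

Definition ccontR (f : R -> C) (x : R) : Prop :=
 continuous (fun u => Re (f u)) x /\ continuous (fun u => Im (f u)) x.

Definition cint (f : R -> C) (a b : R) : Prop :=
 ex_RInt (fun x => Re (f x)) a b /\ ex_RInt (fun x => Im (f x)) a b.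

Lemma cint_cont f a b : a <= b -> (forall x, a <= x <= b -> ccontR f x) -> cint f a b.
Proof.
 intros Hab H. split.
 - apply (ex_RInt_continuous (V := VR) (fun x => Re (f x))).
  intros z Hz. rewrite Rmin_left, Rmax_right in Hz by exact Hab. exact (proj1 (H z Hz)).
 - apply (ex_RInt_continuous (V := VR) (fun x => Im (f x))).
  intros z Hz. rewrite Rmin_left, Rmax_right in Hz by exact Hab. exact (proj2 (H z Hz)).
Qed.

Lemma CI_Chasles f a b c : cint f a b -> cint f b c -> CI f a b + CI f b c = CI f a c.
Proof.
 intros [H1 H2] [H3 H4]. apply Ceq_ReIm; unfold Cplus, Re, Im; simpl.
 - apply (RInt_Chasles (fun x => Re (f x))); auto.
 - apply (RInt_Chasles (fun x => Im (f x))); auto.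
Qed.

Lemma CI_plus f g a b : cint f a b -> cint g a b -> CI (fun x => f x + g x) a b = CI f a b + CI g a b.
Proof.
 intros [H1 H2] [H3 H4]. apply Ceq_ReIm; unfold Cplus, Re, Im; simpl.
 - apply (RInt_plus (fun x => Re (f x)) (fun x => Re (g x))); auto.
 - apply (RInt_plus (fun x => Im (f x)) (fun x => Im (g x))); auto.
Qed.

Lemma CI_ext f g a b : a <= b -> (forall x, a < x < b -> f x = g x) -> CI f a b = CI g a b.
Proof.
 intros Hab H. unfold CI. f_equal; apply RInt_ext; intros x Hx;
 rewrite Rmin_left, Rmax_right in Hx by lra; rewrite H; auto.
Qed.

Lemma CI_scal c f a b : cint f a b -> CI (fun x => c * f x) a b = c * CI f a b.
Proof.
 intros [H1 H2]. apply Ceq_ReIm; unfold Cmult, Re, Im; simpl.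
 - rewrite (RInt_minusR (fun x => (fst c * fst (f x))%R) (fun x => (snd c * snd (f x))%R)), !RInt_mulR;
   auto; apply ex_RInt_mulR; auto.
 - rewrite (RInt_plusR (fun x => (fst c * snd (f x))%R) (fun x => (snd c * fst (f x))%R)), !RInt_mulR;
   auto; apply ex_RInt_mulR; auto.
Qed.

Lemma cint_plus f g a b : cint f a b -> cint g a b -> cint (fun x => f x + g x) a b.
Proof.
 intros [H1 H2] [H3 H4]. split.
 - apply (ex_RInt_plus (V := R_NormedModule) (fun x => Re (f x)) (fun x => Re (g x))); auto.
 - apply (ex_RInt_plus (V := R_NormedModule) (fun x => Im (f x)) (fun x => Im (g x))); auto.
Qed.

Lemma cint_scal c f a b : cint f a b -> cint (fun x => c * f x) a b.
Proof.
 intros [H1 H2]. split; unfold Cmult, Re, Im; simpl.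
 - apply (ex_RInt_minus (V := R_NormedModule) (fun x => (fst c * fst (f x))%R) (fun x => (snd c * snd (f x))%R));
   apply (ex_RInt_scal (V := R_NormedModule)); auto.
 - apply (ex_RInt_plus (V := R_NormedModule) (fun x => (fst c * snd (f x))%R) (fun x => (snd c * fst (f x))%R));
   apply (ex_RInt_scal (V := R_NormedModule)); auto.
Qed.

(** The factor 2 comes from bounding the real and imaginary parts separately. *)
Lemma CI_bound f a b M : a <= b -> cint f a b -> (forall x, a <= x <= b -> Cmod (f x) <= M) ->
 Cmod (CI f a b) <= 2 * (M * (b - a)).
Proof.
 intros Hab [H1 H2] H.
 etr Cmod_le_sum. unfold CI; simpl.
 have A : forall g : R -> R, ex_RInt g a b -> (forall x, a <= x <= b -> Rabs (g x) <= M) -> Rabs (RInt g a b) <= M * (b - a).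
 { intros g Hg HM. rewrite (Rmult_comm M).
  apply (norm_RInt_le_const (V := R_NormedModule) g a b (RInt g a b) M); auto.
  apply (RInt_correct (V := VR)); auto. }
 assert (Rabs (RInt (fun x => Re (f x)) a b) <= M * (b - a))%R.
 { apply A; auto. intros x Hx. eapply Rle_trans; [apply Re_le_Cmod|auto]. }
 assert (Rabs (RInt (fun x => Im (f x)) a b) <= M * (b - a))%R.
 { apply A; auto. intros x Hx. eapply Rle_trans; [apply Im_le_Cmod|auto]. }
 lra.
Qed.

Lemma CI_affine k l a b : CI (fun x => k + RtoC x * l) a b = RtoC (b - a) * k + RtoC ((b * b - a * a) / 2) * l.
Proof.
 have A : forall u v : R, RInt (fun x => (u + x * v)%R) a b = ((b - a) * u + (b * b - a * a) / 2 * v)%R.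
 { intros u v.
  have D : is_RInt (fun x => (u + x * v)%R) a b (minus (b * u + b * b / 2 * v)%R (a * u + a * a / 2 * v)%R).
  { apply (is_RInt_derive (fun x => (x * u + x * x / 2 * v)%R) (fun x => (u + x * v)%R)).
   - intros x _. auto_derive; auto. field.
   - intros x _. apply (continuous_plus (fun _ : R => u) (fun x : R => (x * v)%R)).
    + apply continuous_const.
    + apply (continuous_mult (fun x : R => x) (fun _ => v)); [apply continuous_id|apply continuous_const]. }
  apply (is_RInt_unique (V := VR)) in D. etransitivity; [exact D|].
  change (@eq R ((b * u + b * b / 2 * v) - (a * u + a * a / 2 * v))%R ((b - a) * u + (b * b - a * a) / 2 * v)%R). field. }
 unfold CI. apply Ceq_ReIm; unfold Re, Im; simpl.
 - rewrite <- (RInt_ext (fun x => (fst k + x * fst l)%R)); [rewrite A; field|]. intros x _; req; ring.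
 - rewrite <- (RInt_ext (fun x => (snd k + x * snd l)%R)); [rewrite A; field|]. intros x _; req; ring.
Qed.

Global Opaque CI RInt.

Lemma ccont_ccontR (f : C -> C) (g : R -> C) x :
 ccont f (g x) -> (forall u v, Cmod (g u - g v) <= Rabs (u - v))%R -> ccontR (fun u => f (g u)) x.
Proof.
 intros H Hg.
 have K : forall eps, 0 < eps -> exists d, 0 < d /\ forall u, Rabs (u - x) < d -> Cmod (f (g u) - f (g x))%C < eps.
 { intros eps He. destruct (H eps He) as [d [Hd H1]]. exists d; split; auto. intros u Hu. apply H1.
  eapply Rle_lt_trans; [pos|auto]. }
 split; apply continuity_pt_filterlim; intros eps He; destruct (K eps He) as [d [Hd H1]];
 exists d; split; auto; intros u [_ Hu]; specialize (H1 u Hu); simpl; unfold R_dist.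
 - eapply Rle_lt_trans; [|apply H1]. apply (Re_le_Cmod (f (g u) - f (g x))).
 - eapply Rle_lt_trans; [|apply H1]. apply (Im_le_Cmod (f (g u) - f (g x))).
Qed.

Lemma hline_lip (c : R) u v : Cmod (((u, c) : C) - ((v, c) : C)) <= Rabs (u - v).
Proof.
 replace (((u, c) : C) - ((v, c) : C)) with (RtoC (u - v)); [rewrite Cmod_R; lra|].
 unfold RtoC, Cminus, Cplus, Copp; simpl. f_equal; ring.
Qed.
Lemma vline_lip (c : R) u v : Cmod (((c, u) : C) - ((c, v) : C)) <= Rabs (u - v).
Proof.
 replace (((c, u) : C) - ((c, v) : C)) with (Ci * RtoC (u - v)).
 - rewrite Cmod_mult, Cmod_Ci, Cmod_R; lra.
 - unfold RtoC, Cminus, Cplus, Copp, Cmult, Ci; simpl. f_equal; ring.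
Qed.

Lemma ccontR_h f c x : ccont f (x, c) -> ccontR (fun u => f (u, c)) x.
Proof. intros H. apply (ccont_ccontR f (fun u => (u, c) : C)); auto. apply hline_lip. Qed.
Lemma ccontR_v f c x : ccont f (c, x) -> ccontR (fun u => f (c, u)) x.
Proof. intros H. apply (ccont_ccontR f (fun u => (c, u) : C)); auto. apply vline_lip. Qed.

Lemma cint_h f c a b : a <= b -> (forall x, a <= x <= b -> ccont f (x, c)) -> cint (fun u => f (u, c)) a b.
Proof. intros Hab H. apply cint_cont; auto. intros. apply ccontR_h; auto. Qed.
Lemma cint_v f c a b : a <= b -> (forall x, a <= x <= b -> ccont f (c, x)) -> cint (fun u => f (c, u)) a b.
Proof. intros Hab H. apply cint_cont; auto. intros. apply ccontR_v; auto. Qed.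

(** The contour integral along the boundary of [a, b] x [c, d], counterclockwise. *)
Definition J (f : C -> C) (a b c d : R) : C :=
 CI (fun x => f (x, c)) a b + Ci * CI (fun y => f (b, y)) c d
 - CI (fun x => f (x, d)) a b - Ci * CI (fun y => f (a, y)) c d.

Definition bdry_cont (f : C -> C) (a b c d : R) : Prop :=
 (forall x, a <= x <= b -> ccont f (x, c) /\ ccont f (x, d)) /\
 (forall y, c <= y <= d -> ccont f (a, y) /\ ccont f (b, y)).

Lemma J_split_v f a m b c d : a <= m <= b ->
 bdry_cont f a b c d -> J f a b c d = J f a m c d + J f m b c d.
Proof.
 intros Hm [H1 H2]. unfold J.
 rewrite <- (CI_Chasles (fun x => f (x, c)) a m b), <- (CI_Chasles (fun x => f (x, d)) a m b).
 - ring.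
 - apply cint_h; [lra|intros; apply H1; lra].
 - apply cint_h; [lra|intros; apply H1; lra].
 - apply cint_h; [lra|intros; apply H1; lra].
 - apply cint_h; [lra|intros; apply H1; lra].
Qed.

Lemma J_split_h f a b c m d : c <= m <= d ->
 bdry_cont f a b c d -> J f a b c d = J f a b c m + J f a b m d.
Proof.
 intros Hm [H1 H2]. unfold J.
 rewrite <- (CI_Chasles (fun x => f (a, x)) c m d), <- (CI_Chasles (fun x => f (b, x)) c m d).
 - ring.
 - apply cint_v; [lra|intros; apply H2; lra].
 - apply cint_v; [lra|intros; apply H2; lra].
 - apply cint_v; [lra|intros; apply H2; lra].
 - apply cint_v; [lra|intros; apply H2; lra].
Qed.

Lemma J_plus f g a b c d : a <= b -> c <= d -> bdry_cont f a b c d -> bdry_cont g a b c d ->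
 J (fun p => f p + g p) a b c d = J f a b c d + J g a b c d.
Proof.
 intros Hab Hcd [H1 H2] [H3 H4]. unfold J.
 have E1 := CI_plus (fun x => f (x, c)) (fun x => g (x, c)) a b (cint_h f c a b Hab (fun x Hx => proj1 (H1 x Hx))) (cint_h g c a b Hab (fun x Hx => proj1 (H3 x Hx))).
 have E2 := CI_plus (fun x => f (x, d)) (fun x => g (x, d)) a b (cint_h f d a b Hab (fun x Hx => proj2 (H1 x Hx))) (cint_h g d a b Hab (fun x Hx => proj2 (H3 x Hx))).
 have E3 := CI_plus (fun x => f (a, x)) (fun x => g (a, x)) c d (cint_v f a c d Hcd (fun x Hx => proj1 (H2 x Hx))) (cint_v g a c d Hcd (fun x Hx => proj1 (H4 x Hx))).
 have E4 := CI_plus (fun x => f (b, x)) (fun x => g (b, x)) c d (cint_v f b c d Hcd (fun x Hx => proj2 (H2 x Hx))) (cint_v g b c d Hcd (fun x Hx => proj2 (H4 x Hx))).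
 rewrite E1, E2, E3, E4. ring.
Qed.

Lemma J_ext f g a b c d : a <= b -> c <= d -> (forall p, f p = g p) -> J f a b c d = J g a b c d.
Proof.
 intros Hab Hcd H. unfold J.
 rewrite (CI_ext (fun x => f (x, c)) (fun x => g (x, c)) a b Hab (fun x _ => H _)),
  (CI_ext (fun x => f (x, d)) (fun x => g (x, d)) a b Hab (fun x _ => H _)),
  (CI_ext (fun x => f (a, x)) (fun x => g (a, x)) c d Hcd (fun x _ => H _)),
  (CI_ext (fun x => f (b, x)) (fun x => g (b, x)) c d Hcd (fun x _ => H _)). reflexivity.
Qed.

Lemma J_bound f a b c d M : a <= b -> c <= d -> bdry_cont f a b c d ->
 (forall x, a <= x <= b -> (Cmod (f (x, c))%C <= M /\ Cmod (f (x, d))%C <= M)%R) ->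
 (forall y, c <= y <= d -> (Cmod (f (a, y))%C <= M /\ Cmod (f (b, y))%C <= M)%R) ->
 Cmod (J f a b c d) <= 4 * M * ((b - a) + (d - c)).
Proof.
 intros Hab Hcd [H1 H2] B1 B2. unfold J.
 have T1 := CI_bound (fun x => f (x, c)) a b M Hab (cint_h f c a b Hab (fun x Hx => proj1 (H1 x Hx))) (fun x Hx => proj1 (B1 x Hx)).
 have T2 := CI_bound (fun x => f (x, d)) a b M Hab (cint_h f d a b Hab (fun x Hx => proj2 (H1 x Hx))) (fun x Hx => proj2 (B1 x Hx)).
 have T3 := CI_bound (fun x => f (a, x)) c d M Hcd (cint_v f a c d Hcd (fun x Hx => proj1 (H2 x Hx))) (fun x Hx => proj1 (B2 x Hx)).
 have T4 := CI_bound (fun x => f (b, x)) c d M Hcd (cint_v f b c d Hcd (fun x Hx => proj2 (H2 x Hx))) (fun x Hx => proj2 (B2 x Hx)).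
 unfold Cminus.
 apply Cmod_tri. rewrite Cmod_opp, Cmod_mult, Cmod_Ci.
 assert (Cmod (CI (fun x => f (x, c)) a b + Ci * CI (fun y => f (b, y)) c d + - CI (fun x => f (x, d)) a b)%C
   <= Cmod (CI (fun x => f (x, c)) a b)%C + Cmod (CI (fun y => f (b, y)) c d)%C + Cmod (CI (fun x => f (x, d)) a b)%C)%R.
 { apply Cmod_tri. rewrite Cmod_opp. apply Rplus_le_compat_r.
  apply Cmod_tri. rewrite Cmod_mult, Cmod_Ci. lra. }
 lra.
Qed.

Lemma J_affine k l a b c d : a <= b -> c <= d -> J (fun p => k + l * p) a b c d = 0.
Proof.
 intros Hab Hcd. unfold J.
 have E1 : forall y, CI (fun x => k + l * ((x, y) : C)) a b = CI (fun x => (k + l * (Ci * RtoC y)) + RtoC x * l) a b.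
 { intros y. apply CI_ext; auto. intros x _.
  replace ((x, y) : C) with (RtoC x + Ci * RtoC y); [ring|]. apply Ceq_ReIm; unfold Re, Im; simpl; ring. }
 have E2 : forall x, CI (fun y => k + l * ((x, y) : C)) c d = CI (fun y => (k + l * RtoC x) + RtoC y * (l * Ci)) c d.
 { intros x. apply CI_ext; auto. intros y _.
  replace ((x, y) : C) with (RtoC x + Ci * RtoC y); [ring|]. apply Ceq_ReIm; unfold Re, Im; simpl; ring. }
 rewrite !E1, !E2, !CI_affine. rewrite !RtoC_minus.
 apply Ceq_ReIm; unfold Re, Im; simpl; field.
Qed.

Section Bisect.
Variable P : R -> R -> R -> R -> Prop.
Variables a c w h : R.
Hypothesis Hw : 0 < w.
Hypothesis Hh : 0 < h.
Hypothesis Hquarter : forall a c w h, P a c (w/2) (h/2) -> P (a + w/2) c (w/2) (h/2) ->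
 P a (c + h/2) (w/2) (h/2) -> P (a + w/2) (c + h/2) (w/2) (h/2) -> P a c w h.

(** Lower left corners of nested quarters on which [P] fails. Three quarters are tested; if [P]
    holds on all of them, the fourth is taken untested, since by [Hquarter] it must be a bad one. *)
Fixpoint bis (n : nat) : R * R :=
 match n with
 | O => (a, c)
 | S n => let s := bis n in
   let w' := (w / 2 ^ n / 2)%R in let h' := (h / 2 ^ n / 2)%R in
   if excluded_middle_informative (P (fst s) (snd s) w' h') then
   if excluded_middle_informative (P (fst s + w') (snd s) w' h')%R then
   if excluded_middle_informative (P (fst s) (snd s + h') w' h')%R then
   (fst s + w', snd s + h')%R else (fst s, snd s + h')%R else (fst s + w', snd s)%R else s
 end.

Lemma bis_bad n : ~ P a c w h -> ~ P (fst (bis n)) (snd (bis n)) (w / 2 ^ n) (h / 2 ^ n).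
Proof.
 intros H. induction n as [|n IH].
 - simpl. unfold Rdiv. rewrite Rinv_1, !Rmult_1_r. auto.
 - have E : forall u, (u / 2 ^ S n = u / 2 ^ n / 2)%R.
  { intros. simpl. field. apply pow_nonzero; lra. }
  rewrite !E. simpl.
  do 3 (destruct excluded_middle_informative; simpl; [|pos]).
  intro. apply IH. apply Hquarter; auto.
Qed.

Lemma bis_step n : ((fst (bis n) <= fst (bis (S n)) /\ fst (bis (S n)) + w / 2 ^ S n <= fst (bis n) + w / 2 ^ n) /\
 (snd (bis n) <= snd (bis (S n)) /\ snd (bis (S n)) + h / 2 ^ S n <= snd (bis n) + h / 2 ^ n))%R.
Proof.
 have E : forall u, (u / 2 ^ S n = u / 2 ^ n / 2)%R.
 { intros. simpl. field. apply pow_nonzero; lra. }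
  assert (0 < w / 2 ^ n)%R by pos.
 assert (0 < h / 2 ^ n)%R by pos.
 rewrite !E. simpl.
 repeat (destruct excluded_middle_informative; simpl); lra.
Qed.

Lemma nested_limit (u : nat -> R) (v : R) : 0 < v ->
 (forall n, u n <= u (S n) /\ u (S n) + v / 2 ^ S n <= u n + v / 2 ^ n)%R ->
 exists x, forall n, u n <= x <= u n + v / 2 ^ n.
Proof.
 intros Hv H.
 have M : forall n m, (n <= m)%nat -> (u n <= u m /\ u m + v / 2 ^ m <= u n + v / 2 ^ n)%R.
 { intros n m L. induction L; [lra|]. specialize (H m). lra. }
 have Q : forall n, 0 < v / 2 ^ n by pos.
 have B : forall m, u m <= u 0%nat + v.
 { intros m. destruct (M 0%nat m ltac:(lia)) as [_ K]. specialize (Q m). lra. }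
 destruct (ex_finite_lim_seq_incr u (u 0%nat + v)%R (fun n => proj1 (H n)) B) as [x Hx].
 exists x. intros n. split.
 - apply (is_lim_seq_incr_compare u x Hx (fun n => proj1 (H n))).
 - apply (is_lim_seq_le (fun k => u (k + n)%nat) (fun _ => u n + v / 2 ^ n)%R x (u n + v / 2 ^ n)%R).
  + intros k. destruct (M n (k + n)%nat ltac:(lia)) as [_ K]. specialize (Q (k + n)%nat). lra.
  + apply (is_lim_seq_incr_n u n); auto.
  + apply is_lim_seq_const.
Qed.

(** If [P] failed, the bad quarters [bis n] would shrink to a point, and near that point the local
    hypothesis gives [P]. *)
Lemma rect_bisect :
 (forall x y, a <= x <= a + w -> c <= y <= c + h -> exists delta, 0 < delta /\
   forall a' c' n, a' <= x <= a' + w / 2 ^ n -> c' <= y <= c' + h / 2 ^ n ->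
    w / 2 ^ n < delta -> h / 2 ^ n < delta -> P a' c' (w / 2 ^ n) (h / 2 ^ n)) ->
 P a c w h.
Proof.
 intros Hloc. apply NNPP. intro N.
 destruct (nested_limit (fun n => fst (bis n)) w Hw (fun n => proj1 (bis_step n))) as [x Hx].
 destruct (nested_limit (fun n => snd (bis n)) h Hh (fun n => proj2 (bis_step n))) as [y Hy].
 have Hx0 := Hx 0%nat. have Hy0 := Hy 0%nat. simpl in Hx0, Hy0.
 unfold Rdiv in Hx0, Hy0. rewrite Rinv_1, Rmult_1_r in Hx0, Hy0.
 destruct (Hloc x y Hx0 Hy0) as [delta [Hd H]].
 destruct (pow_lt_1_zero (/2) ltac:(rewrite Rabs_pos_eq; lra) (delta / (w + h))) as [n Hn].
 { pos. }
 specialize (Hn n (le_n n)). rewrite pow_inv in Hn.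
 have Q : 0 < / 2 ^ n by pos.
 rewrite Rabs_pos_eq in Hn by lra.
 apply Rmult_lt_compat_l with (r := (w + h)%R) in Hn; [|lra].
 replace ((w + h) * (delta / (w + h)))%R with delta in Hn by (field; lra).
 apply (bis_bad n N). apply H; auto.
 - nra.
 - nra.
Qed.
End Bisect.

Lemma bdry_of_all f a b c d : a <= b -> c <= d ->
 (forall x y, a <= x <= b -> c <= y <= d -> chol f (x, y)) -> bdry_cont f a b c d.
Proof.
 intros Hab Hcd H. split; intros; split; apply chol_cont, H; lra.
Qed.

Lemma goursat f a b c d : a < b -> c < d ->
 (forall x y, a <= x <= b -> c <= y <= d -> chol f (x, y)) -> J f a b c d = 0.
Proof.
 intros Hab Hcd Hf.
 have G : forall eps, 0 < eps -> Cmod (J f a b c d) <= eps * (((b - a) + (d - c)) * ((b - a) + (d - c))).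
 { intros eps He.
  (* The bound is quadratic in the size, so the bounds of four quarters add up exactly to the bound
     of the whole. *)
  set (P := fun a' c' w h => (0 < w)%R -> 0 < h -> a <= a' -> a' + w <= b -> c <= c' -> c' + h <= d ->
    Cmod (J f a' (a' + w) c' (c' + h))%C <= eps * ((w + h) * (w + h))).
  have HP : P a c (b - a)%R (d - c)%R.
  { apply rect_bisect; [lra|lra| |].
   - intros a' c' w h H1 H2 H3 H4 Hw Hh B1 B2 B3 B4.
    specialize (H1 arith arith arith arith arith arith).
    specialize (H2 arith arith arith arith arith arith).
    specialize (H3 arith arith arith arith arith arith).
    specialize (H4 arith arith arith arith arith arith).
    rewrite (J_split_v f a' (a' + w/2) (a' + w)), !(J_split_h f _ _ c' (c' + h/2) (c' + h));
     try lra; try (apply bdry_of_all; try lra; intros; apply Hf; lra).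
    replace (a' + w/2 + w/2)%R with (a' + w)%R in * by field.
    replace (c' + h/2 + h/2)%R with (c' + h)%R in * by field.
    match goal with |- (Cmod (?p + ?q + (?r + ?s)) <= _)%R =>
     assert (Cmod (p + q + (r + s)) <= (Cmod p + Cmod q) + (Cmod r + Cmod s))%R end.
    { apply Cmod_tri. apply Rplus_le_compat; apply Cmod_triangle. }
    nra.
   - pos.
    destruct (Hf x y arith arith) as [l Hl].
    destruct (Hl (eps / 4)%R arith) as [dl [Hdl HD]].
    exists (dl / 2)%R; split; [lra|]. intros a' c' n Bx By Bw Bh.
    set (w := ((b - a) / 2 ^ n)%R) in *. set (h := ((d - c) / 2 ^ n)%R) in *.
    intros Hw Hh C1 C2 C3 C4.
    set (p0 := (x, y) : C) in *.
    (* The tangent map has integral 0 by [J_affine]; only the remainder, of size eps / 4 times w +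
       h, contributes. *)
    set (g := fun p : C => (f p0 - l * p0) + l * p).
    set (r := fun p : C => f p - g p).
    have Hg : forall p, chol g p.
    { intros p. apply chol_plus; [apply chol_const|]. apply chol_mult; [apply chol_const|apply chol_id]. }
    have Hr : forall x y, a' <= x <= a' + w -> c' <= y <= c' + h -> chol r (x, y).
    { intros u v Hu Hv. apply chol_minus; auto. apply Hf; lra. }
    have E : J f a' (a' + w) c' (c' + h) = J g a' (a' + w) c' (c' + h) + J r a' (a' + w) c' (c' + h).
    { rewrite <- J_plus; try lra; try (apply bdry_of_all; try lra; auto).
     apply J_ext; try lra. intros p; unfold r; ring. }
    rewrite E. unfold g at 1. rewrite J_affine by lra. rewrite Cplus_0_l.
    have Br : forall u v, a' <= u <= a' + w -> c' <= v <= c' + h -> Cmod (r (u, v))%C <= eps / 4 * (w + h).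
    { intros u v Hu Hv.
     set (q := (u, v) : C). set (hh := q - p0).
     have Mh : Cmod hh <= w + h.
     { etr Cmod_le_sum. unfold hh, p0, q; simpl.
      apply Rplus_le_compat; apply Rabs_le; lra. }
     specialize (HD hh arith).
     have Eq : p0 + hh = q by (unfold hh; ring). rewrite Eq in HD.
     unfold r, g. have Eq2 : f q - (f p0 - l * p0 + l * q) = f q - f p0 - l * hh by (unfold hh; ring).
     rewrite Eq2.
     etr HD. apply Rmult_le_compat_l; lra. }
    eapply Rle_trans.
    { apply J_bound with (M := (eps / 4 * (w + h))%R); try lra.
     - apply bdry_of_all; try lra; auto.
     - intros; split; apply Br; lra.
     - intros; split; apply Br; lra. }
    right. field. }
  specialize (HP arith arith arith arith arith arith).
  replace (a + (b - a))%R with b in HP by ring. replace (c + (d - c))%R with d in HP by ring. exact HP. }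
 apply Cmod_eq_0. destruct (Cmod_ge_0 (J f a b c d)) as [H|H]; auto. exfalso.
 set (S := (((b - a) + (d - c)) * ((b - a) + (d - c)))%R) in *.
 have HS : 0 < S by pos.
 specialize (G (Cmod (J f a b c d) / (2 * S))%R).
 assert (0 < Cmod (J f a b c d) / (2 * S))%R by pos.
 specialize (G H0). replace (Cmod (J f a b c d) / (2 * S) * S)%R with (Cmod (J f a b c d) / 2)%R in G by (field; lra).
 lra.
Qed.

(** The centre is excluded: at a removable singularity a quotient takes the arbitrary value given by
    division by 0. Boundedness is all that the contour integrals require there. *)
Definition pbounded (f : C -> C) (z : C) : Prop :=
 exists M r : R, 0 < r /\ forall p, 0 < Cmod (p - z) < r -> Cmod (f p) <= M.

Lemma gap_list (g : C -> R) (l : list C) : exists r, 0 < r /\ forall z, In z l -> g z = 0%R \/ (r < Rabs (g z))%R.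
Proof.
 induction l as [|z l [r [Hr H]]].
 - exists 1%R; split; [lra|]. intros z [].
 - destruct (Req_dec (g z) 0) as [E|N].
  + exists r; split; auto. intros z' [<-|Hz]; auto.
  + exists (Rmin r (Rabs (g z) / 2)). assert (0 < Rabs (g z))%R by (apply Rabs_pos_lt; auto). split.
   * pos.
   * intros z' [<-|Hz].
    -- right. rmin.
    -- destruct (H z' Hz); auto. right. rmin.
Qed.

Definition off_bdry (a b c d : R) (z : C) : Prop :=
 (fst z <> a /\ fst z <> b /\ snd z <> c /\ snd z <> d)%R.

Lemma bdry_exc f a b c d l : a <= b -> c <= d ->
 (forall z, a <= fst z <= b -> c <= snd z <= d -> ~ In z l -> chol f z) ->
 (forall z, In z l -> off_bdry a b c d z) -> bdry_cont f a b c d.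
Proof.
 intros Hab Hcd Hf Hl. split; intros u Hu; split; apply chol_cont, Hf; simpl; try lra;
 intro HI; destruct (Hl _ HI) as [H1 [H2 [H3 H4]]]; simpl in *; lra.
Qed.

(** Induction on the list of exceptional points: a square around one of them is cut out, the outer
    rectangles have one exception less, and the square contributes O(e) because f is bounded near
    its centre. *)
Lemma goursat_exc l : forall f a b c d, a < b -> c < d ->
 (forall z, a <= fst z <= b -> c <= snd z <= d -> ~ In z l -> chol f z) ->
 (forall z, In z l -> off_bdry a b c d z) ->
 (forall z, In z l -> pbounded f z) -> J f a b c d = 0.
Proof.
 induction l as [|z0 l IH]; intros f a b c d Hab Hcd Hf Hl Hb.
 - apply (goursat f a b c d Hab Hcd). intros x y Hx Hy. apply Hf; simpl; auto.
 - destruct (classic (a < fst z0 < b /\ c < snd z0 < d)%R) as [[Hx Hy]|N].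
  2: { apply IH; auto; [|intros; apply Hl; right; auto|intros; apply Hb; right; auto].
     intros z Hz1 Hz2 Hn. apply Hf; auto. intros [E|E]; auto. subst z0.
     destruct (Hl z (or_introl eq_refl)) as [H1 [H2 [H3 H4]]]. apply N. lra. }
  destruct (Hb z0 (or_introl eq_refl)) as [M [r [Hr HM]]].
  (* For e below both gaps, the lines x - e, x + e, y - e and y + e miss all the other exceptional
     points, even those that share a coordinate with [z0]. *)
  destruct (gap_list (fun z => fst z - fst z0)%R l) as [r1 [Hr1 G1]].
  destruct (gap_list (fun z => snd z - snd z0)%R l) as [r2 [Hr2 G2]].
  set (x := fst z0) in *. set (y := snd z0) in *.
  set (r0 := Rmin (Rmin (r / 3) (Rmin r1 r2)) (Rmin (Rmin (x - a) (b - x)) (Rmin (y - c) (d - y)))).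
  have B : (r0 <= r / 3 /\ r0 <= r1 /\ r0 <= r2 /\ r0 <= x - a /\ r0 <= b - x /\ r0 <= y - c /\ r0 <= d - y)%R.
  { unfold r0. repeat split; rmin. }
  have Hr0 : 0 < r0 by pos.
  have G : forall e, 0 < e < r0 -> Cmod (J f a b c d) <= 16 * M * e.
  { intros e He.
   have Off : forall z, In z l -> off_bdry (x - e) (x + e) (y - e) (y + e) z.
   { intros z Hz. destruct (G1 z Hz) as [E1|E1]; destruct (G2 z Hz) as [E2|E2];
    repeat split; intro E3; rewrite E3 in *; try lra;
    try (replace (x - e - x)%R with (- e)%R in * by ring); try (replace (x + e - x)%R with e in * by ring);
    try (replace (y - e - y)%R with (- e)%R in * by ring); try (replace (y + e - y)%R with e in * by ring);
    try rewrite Rabs_Ropp in *; try rewrite (Rabs_pos_eq e) in * by lra; lra. }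
   have Sub : forall a' b' c' d', a <= a' -> b' <= b -> c <= c' -> d' <= d -> a' < b' -> c' < d' ->
     (b' < x \/ x < a' \/ d' < y \/ y < c')%R ->
     (forall z, In z l -> off_bdry a' b' c' d' z) -> J f a' b' c' d' = 0.
   { intros a' b' c' d' A1 A2 A3 A4 A5 A6 A7 A8. apply IH; auto; [|intros; apply Hb; right; auto].
    intros z Hz1 Hz2 Hn. apply Hf; try lra. intros [E|E]; auto. subst z. unfold x, y in *. lra. }
   have Offo : forall z, In z l -> off_bdry a b c d z by (intros; apply Hl; right; auto).
      have Bd : forall a' b' c' d', a <= a' -> b' <= b -> c <= c' -> d' <= d -> a' <= b' -> c' <= d' ->
     (forall z, In z (z0 :: l) -> off_bdry a' b' c' d' z) -> bdry_cont f a' b' c' d'.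
   { intros a' b' c' d' A1 A2 A3 A4 A5 A6 A8. apply bdry_exc with (z0 :: l); auto.
    intros z Hz1 Hz2 Hn. apply Hf; auto; lra. }
   have Off0 : forall a' b' c' d', (x <> a' -> x <> b' -> y <> c' -> y <> d' -> off_bdry a' b' c' d' z0)%R.
   { intros. repeat split; auto. }
   have Mix : forall a' b' c' d', (a' = a \/ a' = x - e \/ a' = x + e)%R -> (b' = b \/ b' = x - e \/ b' = x + e)%R ->
     (c' = c \/ c' = y - e \/ c' = y + e)%R -> (d' = d \/ d' = y - e \/ d' = y + e)%R ->
     forall z, In z (z0 :: l) -> off_bdry a' b' c' d' z.
   { intros a' b' c' d' Qa Qb Qc Qd z [<-|Hz].
    - apply Off0; lra.
    - destruct (Off z Hz) as [F1 [F2 [F3 F4]]]. destruct (Offo z Hz) as [F5 [F6 [F7 F8]]].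
     split; [|split; [|split]].
     + destruct Qa as [-> |[-> | ->]]; auto.
     + destruct Qb as [-> |[-> | ->]]; auto.
     + destruct Qc as [-> |[-> | ->]]; auto.
     + destruct Qd as [-> |[-> | ->]]; auto. }
   have Mixl : forall a' b' c' d', (a' = a \/ a' = x - e \/ a' = x + e)%R -> (b' = b \/ b' = x - e \/ b' = x + e)%R ->
     (c' = c \/ c' = y - e \/ c' = y + e)%R -> (d' = d \/ d' = y - e \/ d' = y + e)%R ->
     forall z, In z l -> off_bdry a' b' c' d' z.
   { intros a' b' c' d' Qa Qb Qc Qd z Hz. apply Mix; auto. right; auto. }
   (* Two horizontal and two vertical cuts leave the small square and four rectangles that avoid
      [z0]. *)
   rewrite (J_split_h f a b c (y - e) d), (J_split_h f a b (y - e) (y + e) d),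
    (J_split_v f a (x - e) b (y - e) (y + e)), (J_split_v f (x - e) (x + e) b (y - e) (y + e));
    try lra; try (apply Bd; try lra; apply Mix; auto).
   rewrite (Sub a b c (y - e)%R), (Sub a b (y + e)%R d), (Sub a (x - e)%R (y - e)%R (y + e)%R), (Sub (x + e)%R b (y - e)%R (y + e)%R);
    try lra; try (apply Mixl; auto).
   rewrite !Cplus_0_l, !Cplus_0_r.
   have Bs : forall u v, Rabs (u - x) <= e -> Rabs (v - y) <= e -> (u <> x \/ v <> y)%R -> Cmod (f (u, v))%C <= M.
   { intros u v Hu Hv Hn. apply HM.
    have E : (u, v) - z0 = ((u - x)%R, (v - y)%R) by reflexivity. rewrite E. split.
    - apply (proj1 (Cmod_gt_0 _)). intro K. injection K as K1 K2. destruct Hn as [Hn|Hn]; apply Hn; lra.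
    - eapply Rle_lt_trans; [apply Cmod_le_sum|]. simpl. lra. }
   eapply Rle_trans.
   { apply J_bound with (M := M); try lra.
    - apply Bd; try lra. apply Mix; auto.
    - intros u Hu. split; apply Bs; try lra; try (apply Rabs_le; lra); right; lra.
    - intros u Hu. split; apply Bs; try lra; try (apply Rabs_le; lra); left; lra. }
   right. ring. }
  apply Cmod_eq_0. destruct (Cmod_ge_0 (J f a b c d)) as [H|H]; auto. exfalso.
  destruct (Rle_dec M 0) as [HM0|HM0].
  + specialize (G (r0 / 2)%R arith). nra.
  + set (K := Cmod (J f a b c d)) in *.
      set (e := Rmin (r0 / 2) (K / (32 * M))).
   have He : 0 < e < r0.
   { split; [pos|]. unfold e; rmin. }
   specialize (G e He). assert (e <= K / (32 * M))%R by apply Rmin_r. apply Rle_div_r in H0; lra.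
Qed.

(* The vertical sides cancel by periodicity. *)
Lemma line_shift f l a y1 y2 : y1 < y2 -> (forall p, f (p + 1) = f p) ->
 (forall z, a <= fst z <= a + 1 -> y1 <= snd z <= y2 -> ~ In z l -> chol f z) ->
 (forall z, In z l -> off_bdry a (a + 1) y1 y2 z) ->
 (forall z, In z l -> pbounded f z) ->
 CI (fun x => f (x, y1)) a (a + 1) = CI (fun x => f (x, y2)) a (a + 1).
Proof.
 intros Hy Hper Hf Hl Hb.
 have G := goursat_exc l f a (a + 1) y1 y2 arith Hy Hf Hl Hb.
 unfold J in G.
 rewrite (CI_ext (fun y => f ((a + 1)%R, y)) (fun y => f (a, y)) y1 y2) in G.
 - match type of G with ?A + ?B - ?C - ?B = _ => replace A with ((A + B - C - B) + C) by ring; rewrite G; ring end.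
 - lra.
 - intros y _. rewrite <- (Hper (a, y)). f_equal. unfold Cplus, RtoC; simpl. f_equal; ring.
Qed.

Close Scope C_scope.

(** * Fourier coefficients of continuous periodic functions *)

Lemma contR_plus (f g : R -> R) x : continuous f x -> continuous g x -> continuous (fun u => f u + g u) x.
Proof. apply (continuous_plus (V := R_NormedModule) f g). Qed.
Lemma contR_mult (f g : R -> R) x : continuous f x -> continuous g x -> continuous (fun u => f u * g u) x.
Proof. apply (continuous_mult (K := R_AbsRing) f g). Qed.
Lemma contR_opp (f : R -> R) x : continuous f x -> continuous (fun u => - f u) x.
Proof. apply (continuous_opp (V := R_NormedModule) f). Qed.
Lemma contR_minus (f g : R -> R) x : continuous f x -> continuous g x -> continuous (fun u => f u - g u) x.
Proof. intros. apply contR_plus; auto. apply contR_opp; auto. Qed.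
Lemma contR_const (c x : R) : continuous (fun _ : R => c) x.
Proof. apply continuous_const. Qed.
Lemma contR_derive (f : R -> R) x l : is_derive f x l -> continuous f x.
Proof. intros H. apply (ex_derive_continuous f). eexists; eauto. Qed.

Lemma ex_RInt_contR (f : R -> R) a b : (forall x, continuous f x) -> ex_RInt f a b.
Proof. intros H. apply (ex_RInt_continuous (V := VR) f). intros; auto. Qed.

Lemma contR_cos k x : continuous (fun y => cos (2 * PI * k * y)) x.
Proof. eapply contR_derive. auto_derive; auto. Qed.
Lemma contR_sin k x : continuous (fun y => sin (2 * PI * k * y)) x.
Proof. eapply contR_derive. auto_derive; auto. Qed.

Ltac cts := intros; auto; repeat first
 [ assumption | apply contR_const | apply contR_cos | apply contR_sin | apply contR_plus | apply contR_minus | apply contR_mult | apply ex_RInt_contR; intros ]; auto.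

Lemma cos_per_nat (k : nat) x : cos (om k * (x + 1)) = cos (om k * x).
Proof. replace (om k * (x + 1)) with (om k * x + 2 * INR k * PI) by ring. apply cos_period. Qed.
Lemma sin_per_nat (k : nat) x : sin (om k * (x + 1)) = sin (om k * x).
Proof. replace (om k * (x + 1)) with (om k * x + 2 * INR k * PI) by ring. apply sin_period. Qed.

(** The de la Vallee Poussin kernel, not normalised; [wallis N] is its integral over a period. *)
Definition kerN (N : nat) (u : R) : R := (cos (PI * u) * cos (PI * u)) ^ N.

Fixpoint cosl (l : list (R * nat)) (u : R) : R :=
 match l with nil => 0 | (c, k) :: l => c * cos (om k * u) + cosl l u end.

Lemma kerN_cosl N : exists l, forall u, kerN N u = cosl l u.
Proof.
 induction N as [|N [l H]].
 - exists ((1, 0%nat) :: nil). intros u. unfold kerN. simpl. rewrite Rmult_0_r, Rmult_0_l, cos_0. ring.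
 - have Q : forall l, exists l', forall u, cosl l u * (cos (PI * u) * cos (PI * u)) = cosl l' u.
  { clear. intros l. induction l as [|[c k] l [l' IH]].
   (* Multiplication by cos^2 sends frequency k to k, k + 1 and k - 1; for k = 0 the frequency -1 is
      recorded as 1, since the cosine is even. *)
   - exists nil. intros; simpl; ring.
   - exists ((c / 2, k) :: (c / 4, S k) :: (c / 4, match k with O => 1%nat | S j => j end) :: l'). intros u.
    cbn [cosl]. rewrite <- IH.
    have E : cos (om (S k) * u) + cos (2 * PI * INR (match k with O => 1%nat | S j => j end) * u)
     = 2 * cos (om k * u) * cos (2 * (PI * u)).
    { replace (om (S k) * u) with (om k * u + 2 * (PI * u)) by (rewrite S_INR; ring).
     have E2 : cos (2 * PI * INR (match k with O => 1%nat | S j => j end) * u) = cos (om k * u - 2 * (PI * u)).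
     { destruct k as [|k].
      - rewrite <- cos_neg. f_equal. simpl. ring.
      - f_equal. rewrite S_INR. ring. }
     rewrite E2, cos_plus, cos_minus. ring. }
    rewrite cos_2a_cos in E.
    replace (c / 2 * cos (om k * u) + (c / 4 * cos (om (S k) * u) +
     (c / 4 * cos (2 * PI * INR (match k with O => 1%nat | S j => j end) * u) + cosl l u * (cos (PI * u) * cos (PI * u)))))
    with (c / 2 * cos (om k * u) + c / 4 * (cos (om (S k) * u) + cos (2 * PI * INR (match k with O => 1%nat | S j => j end) * u))
      + cosl l u * (cos (PI * u) * cos (PI * u))) by ring.
    rewrite E. field. }
  destruct (Q l) as [l' H']. exists l'. intros u. rewrite <- H', <- H. unfold kerN. simpl. ring.
Qed.

Lemma kerN_cont N x u : continuous (fun y => kerN N (x - y)) u.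
Proof. unfold kerN. eapply contR_derive. auto_derive; auto. Qed.

Lemma kerN_ex N x : ex_RInt (fun y => kerN N (x - y)) 0 1.
Proof. apply ex_RInt_contR. intros; apply kerN_cont. Qed.

Fixpoint wallis (N : nat) : R :=
 match N with O => 1 | S N => (2 * INR N + 1) / (2 * INR N + 2) * wallis N end.

Lemma wallis_pos N : 0 < wallis N.
Proof.
 induction N as [|N IH]; simpl; [lra|]. pose proof (pos_INR N).
 apply Rmult_lt_0_compat; auto. apply Rdiv_lt_0_compat; lra.
Qed.

(* integration by parts of cos^(2N+2) *)
Lemma kerN_int N x : RInt (fun y => kerN N (x - y)) 0 1 = wallis N.
Proof.
 induction N as [|N IH].
 - simpl. rewrite (RInt_ext _ (fun _ => 1)) by pos.
  rewrite RInt_const. change (scal (1 - 0) 1) with ((1 - 0) * 1). req. ring.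
 - set (F := fun y => - (cos (PI * (x - y)) ^ (2 * N + 1) * sin (PI * (x - y)) / PI)).
  have HP := PI_RGT_0. pose proof (pos_INR N) as HN.
  have D : is_RInt (fun y => (2 * INR N + 2) * kerN (S N) (x - y) - (2 * INR N + 1) * kerN N (x - y)) 0 1 (minus (F 1) (F 0)).
  { apply (is_RInt_derive F).
   - intros y _. unfold F.
    have E : (2 * INR N + 2) * kerN (S N) (x - y) - (2 * INR N + 1) * kerN N (x - y)
     = - ((INR (2 * N + 1) * (PI * sin (PI * (x - y))) * cos (PI * (x - y)) ^ (2 * N)) * sin (PI * (x - y))
       + cos (PI * (x - y)) ^ (2 * N + 1) * (- PI * cos (PI * (x - y)))) / PI.
    { unfold kerN. replace (INR (2 * N + 1)) with (2 * INR N + 1) by (rewrite plus_INR, mult_INR; simpl; ring).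
     set (s := sin _). set (c := cos _).
     have E2 : s * s = 1 - c * c by (pose proof (sin2_cos2 (PI * (x - y))) as Q; fold s c in Q; unfold Rsqr in Q; lra).
     rewrite pow_add, pow_mult, pow_1. replace (c ^ 2) with (c * c) by ring.
     change ((c * c) ^ S N) with (c * c * (c * c) ^ N). set (k := (c * c) ^ N).
     replace ((2 * INR N + 1) * (PI * s) * k * s) with ((2 * INR N + 1) * PI * k * (s * s)) by ring.
     rewrite E2. field. lra. }
    rewrite E. auto_derive; auto.
    change (N + (N + 0) + 1)%nat with (2 * N + 1)%nat.
    replace (Init.Nat.pred (2 * N + 1)) with (2 * N)%nat by lia. unfold Rminus. field. lra.
   - intros y _. apply contR_minus; apply contR_mult; try apply contR_const; apply kerN_cont. }
  have Z : minus (F 1) (F 0) = 0.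
  { change (F 1 - F 0 = 0). unfold F. rewrite Rminus_0_r.
   replace (PI * (x - 1)) with (PI * x - PI) by ring.
   have C : cos (PI * x - PI) = - cos (PI * x).
   { rewrite cos_minus, cos_PI, sin_PI. ring. }
   have S : sin (PI * x - PI) = - sin (PI * x).
   { rewrite sin_minus, cos_PI, sin_PI. ring. }
   rewrite C, S, !pow_add, !pow_mult, !pow_1. replace ((- cos (PI * x)) ^ 2) with (cos (PI * x) ^ 2) by ring.
   field. lra. }
  rewrite Z in D. apply (is_RInt_unique (V := VR)) in D.
  have X1 := kerN_ex (S N) x. have X2 := kerN_ex N x.
  rewrite (RInt_minusR (fun y => (2 * INR N + 2) * kerN (S N) (x - y)) (fun y => (2 * INR N + 1) * kerN N (x - y)) 0 1
   (ex_RInt_mulR _ _ _ _ X1) (ex_RInt_mulR _ _ _ _ X2)), (RInt_mulR _ _ _ _ X1), (RInt_mulR _ _ _ _ X2), IH in D.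
  simpl wallis. apply Rmult_eq_reg_l with (2 * INR N + 2); [|lra].
  replace ((2 * INR N + 2) * ((2 * INR N + 1) / (2 * INR N + 2) * wallis N)) with ((2 * INR N + 1) * wallis N) by (field; lra).
  lra.
Qed.

Definition fcos (phi : R -> R) (k : nat) : R := RInt (fun y => phi y * cos (om k * y)) 0 1.
Definition fsin (phi : R -> R) (k : nat) : R := RInt (fun y => phi y * sin (om k * y)) 0 1.

Fixpoint fsum (phi : R -> R) (l : list (R * nat)) (x : R) : R :=
 match l with nil => 0
 | (c, k) :: l => c * (fcos phi k * cos (om k * x) + fsin phi k * sin (om k * x)) + fsum phi l x end.

Lemma conv_fsum phi l x : (forall y, continuous phi y) ->
 RInt (fun y => cosl l (x - y) * phi y) 0 1 = fsum phi l x.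
Proof.
 intros Hc.
 have Cl : forall l y, continuous (fun y => cosl l (x - y)) y.
 { clear. intros l y. induction l as [|[c k] l IH]; simpl; [cts|].
  apply contR_plus; auto. eapply contR_derive. auto_derive; auto. }
 induction l as [|[c k] l IH]; simpl.
 - rewrite (RInt_ext _ (fun _ => 0)) by pos. rewrite RInt_const.
  change (scal (1 - 0) 0) with ((1 - 0) * 0). req. ring.
 - rewrite (RInt_ext _ (fun y => (c * cos (om k * x)) * (phi y * cos (om k * y))
    + (c * sin (om k * x)) * (phi y * sin (om k * y)) + cosl l (x - y) * phi y)).
  2: { intros y _. req. replace (om k * (x - y)) with (om k * x - om k * y) by ring.
     rewrite cos_minus. ring. }
  have E1 : ex_RInt (fun y => phi y * cos (om k * y)) 0 1.
  { apply ex_RInt_contR. intros; apply contR_mult; auto. apply contR_cos. }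
  have E2 : ex_RInt (fun y => phi y * sin (om k * y)) 0 1.
  { apply ex_RInt_contR. intros; apply contR_mult; auto. apply contR_sin. }
  have E3 : ex_RInt (fun y => cosl l (x - y) * phi y) 0 1 by (apply ex_RInt_contR; intros; apply contR_mult; auto).
  have F1 := ex_RInt_mulR (c * cos (om k * x)) _ _ _ E1.
  have F2 := ex_RInt_mulR (c * sin (om k * x)) _ _ _ E2.
  rewrite (RInt_plusR _ _ _ _ (ex_RInt_plusR _ _ _ _ F1 F2) E3), (RInt_plusR _ _ _ _ F1 F2),
   (RInt_mulR _ _ _ _ E1), (RInt_mulR _ _ _ _ E2), IH.
  unfold fcos, fsin. ring.
Qed.

Lemma periodic_bounded (phi : R -> R) a b : a <= b -> (forall y, continuous phi y) ->
 exists M, 0 < M /\ forall x, a <= x <= b -> Rabs (phi x) <= M.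
Proof.
 intros Hab Hc.
 destruct (continuity_ab_maj (fun x => Rabs (phi x)) a b Hab) as [m [H _]].
 { intros c _. apply continuity_pt_filterlim.
  apply (continuous_comp phi Rabs); [pos|apply continuous_Rabs]. }
 exists (Rabs (phi m) + 1). pose proof (Rabs_pos (phi m)). split; [lra|]. intros x Hx. specialize (H x Hx). lra.
Qed.

Lemma frac_shift x : exists n : Z, 0 <= x - IZR n < 1.
Proof.
 exists (Int_part x). destruct (base_Int_part x). lra.
Qed.

Lemma periodic_Z (phi : R -> R) : (forall x, phi (x + 1) = phi x) -> forall (n : Z) x, phi (x + IZR n) = phi x.
Proof.
 intros H.
 have N : forall (n : nat) x, phi (x + INR n) = phi x.
 { induction n as [|n IH]; intros x; [simpl; f_equal; ring|].
  rewrite S_INR, <- Rplus_assoc, H. apply IH. }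
 intros n x. destruct (Z_le_dec 0 n) as [P|P].
 - rewrite <- (Z2Nat.id n P), <- INR_IZR_INZ. apply N.
 - rewrite <- (N (Z.to_nat (- n)) (x + IZR n)). f_equal.
  rewrite INR_IZR_INZ, Z2Nat.id, opp_IZR by lia. ring.
Qed.

(** Uniform continuity on the circle, with sin^2(PI (x - y)) as the measure of distance. Integrated
    against the kernel this quantity is the difference of two successive Wallis numbers, which makes
    the convergence in [trig_dense] explicit. *)
Lemma trig_modulus (phi : R -> R) eps : (forall y, continuous phi y) -> (forall x, phi (x + 1) = phi x) -> 0 < eps ->
 exists K, 0 < K /\ forall x y, 0 <= x <= 1 -> 0 <= y <= 1 ->
  Rabs (phi x - phi y) <= eps + K * (1 - cos (PI * (x - y)) * cos (PI * (x - y))).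
Proof.
 intros Hc Hper He.
 destruct (unifcont_1d phi (-1) 2 ltac:(intros; apply Hc) (mkposreal eps He)) as [d Hd].
 destruct (periodic_bounded phi 0 1 arith Hc) as [M [HM HB]].
 set (dl := Rmin d (1/2)).
 have Hdl : 0 < dl by (apply Rmin_glb_lt; [apply cond_pos|lra]).
 have Hd1 : dl <= d by apply Rmin_l. have Hd2 : dl <= 1/2 by apply Rmin_r.
 have HP := PI_RGT_0.
 have Hs0 : 0 < sin (PI * dl).
 { apply sin_gt_0; [pos|nra]. }
 set (sg := sin (PI * dl) * sin (PI * dl)).
 have Hsg : 0 < sg by pos.
 exists (2 * M / sg). split; [pos|]. intros x y Hx Hy.
 have U : forall u v, -1 <= u <= 2 -> -1 <= v <= 2 -> Rabs (u - v) < dl -> Rabs (phi u - phi v) <= eps.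
 { intros u v Hu Hv Huv.
  have B : ball u d v by (change (Rabs (v - u) < d); rewrite Rabs_minus_sym; lra).
  specialize (Hd u v Hu Hv B). apply NNPP in Hd. change (Rabs (phi v - phi u) < eps) in Hd. rewrite Rabs_minus_sym. lra. }
 set (c := cos (PI * (x - y))).
 have Hcc : 0 <= 1 - c * c.
 { pose proof (COS_bound (PI * (x - y))) as B. fold c in B. nra. }
 have HK : 0 <= 2 * M / sg * (1 - c * c).
 { pos. }
 destruct (Rlt_dec (Rabs (x - y)) dl) as [H1|H1].
 { have Q := U x y arith arith H1. lra. }
 (* Here x and y are close on the circle but not on the line: one of them is moved by a period. *)
 destruct (Rlt_dec (1 - dl) (Rabs (x - y))) as [H2|H2].
 { assert (Q : Rabs (phi x - phi y) <= eps); [|lra].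
  destruct (Rle_dec x y) as [H3|H3].
  - rewrite Rabs_left1 in H2 by lra. rewrite <- (Hper x). apply U; try lra. rewrite Rabs_pos_eq; lra.
  - rewrite Rabs_pos_eq in H2 by lra. rewrite <- (Hper y). apply U; try lra. rewrite Rabs_left1; lra. }
 have Q : sg <= 1 - c * c.
 { replace (1 - c * c) with (sin (PI * Rabs (x - y)) * sin (PI * Rabs (x - y))).
  2: { pose proof (sin2_cos2 (PI * Rabs (x - y))) as Q. unfold Rsqr in Q.
     have E : cos (PI * Rabs (x - y)) = c.
     { unfold c, Rabs. destruct Rcase_abs; auto. rewrite <- cos_neg. f_equal. ring. }
     rewrite E in Q. lra. }
  set (v := Rabs (x - y)) in *.
  assert (sin (PI * dl) <= sin (PI * v)); [|unfold sg; nra].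
  destruct (Rle_dec v (1/2)) as [H3|H3].
  - apply sin_incr_1; nra.
  - rewrite <- (sin_PI_x (PI * v)). apply sin_incr_1; nra. }
 apply Rle_trans with (2 * M).
 - apply Rabs_tri. rewrite Rabs_Ropp. have Q1 := HB x Hx. have Q2 := HB y Hy. lra.
 - assert (2 * M <= 2 * M / sg * (1 - c * c)); [|lra].
  replace (2 * M) with (2 * M / sg * sg) at 1 by (field; lra). apply Rmult_le_compat_l; auto.
  left; apply Rdiv_lt_0_compat; lra.
Qed.

Lemma fsum_per phi l x : fsum phi l (x + 1) = fsum phi l x.
Proof.
 induction l as [|[c k] l IH]; simpl; auto. rewrite IH, cos_per_nat, sin_per_nat. reflexivity.
Qed.

Theorem trig_dense (phi : R -> R) eps : (forall y, continuous phi y) -> (forall x, phi (x + 1) = phi x) -> 0 < eps ->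
 exists l, forall x, Rabs (phi x - fsum phi l x) <= eps.
Proof.
 intros Hc Hper He.
 destruct (trig_modulus phi (eps / 2) Hc Hper arith) as [K [HK HM]].
 (* The error of the kernel of order N will be eps / 2 + K / (2 N + 2). *)
 destruct (INR_archimed (eps / 2) K arith) as [N HN].
 pose proof (pos_INR N) as PN.
 destruct (kerN_cosl N) as [l Hl].
 set (W := wallis N). have HW : 0 < W by apply wallis_pos.
 exists (map (fun p => (fst p / W, snd p)) l).
 have E : forall x, fsum phi (map (fun p => (fst p / W, snd p)) l) x = fsum phi l x / W.
 { intros x. clear -HW. induction l as [|[c k] l IH]; simpl; [pos|]. rewrite IH. field. lra. }
 have G : forall x, 0 <= x <= 1 -> Rabs (phi x - fsum phi (map (fun p => (fst p / W, snd p)) l) x) <= eps.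
 { intros x Hx. rewrite E, <- conv_fsum by auto.
  rewrite (RInt_ext _ (fun y => kerN N (x - y) * phi y)) by (intros; rewrite Hl; reflexivity).
  have C1 : forall y, continuous (fun y => kerN N (x - y) * phi y) y by (intros; apply contR_mult; auto; apply kerN_cont).
  have I1 : phi x = RInt (fun y => phi x * kerN N (x - y)) 0 1 / W.
  { rewrite RInt_mulR by (apply ex_RInt_contR; intros; apply kerN_cont). rewrite kerN_int. fold W. field. lra. }
  rewrite I1 at 1. unfold Rdiv. rewrite <- Rmult_minus_distr_r.
  rewrite <- RInt_minusR.
  2: { apply ex_RInt_mulR. apply ex_RInt_contR; intros; apply kerN_cont. }
  2: { apply ex_RInt_contR; auto. }
  rewrite Rabs_mult, (Rabs_pos_eq (/ W)) by pos.
  apply Rmult_le_reg_r with W; auto. rewrite Rmult_assoc, Rinv_l, Rmult_1_r by lra.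
  have Kp : forall y, 0 <= kerN N (x - y).
  { pos. }
  have C2 : forall y, continuous (fun y => phi x * kerN N (x - y) - kerN N (x - y) * phi y) y.
  { intros. apply contR_minus; auto. apply contR_mult; [cts|apply kerN_cont]. }
  eapply Rle_trans; [apply abs_RInt_le; [lra|apply ex_RInt_contR; auto]|].
  apply Rle_trans with (RInt (fun y => (eps / 2 + K) * kerN N (x - y) - K * kerN (S N) (x - y)) 0 1).
  - apply RInt_le; [lra| | |].
   + apply ex_RInt_contR. intros y. apply (continuous_comp _ Rabs); [pos|apply continuous_Rabs].
   + apply ex_RInt_contR. intros y. apply contR_minus; (apply contR_mult; [cts|apply kerN_cont]).
   + intros y Hy. replace (phi x * kerN N (x - y) - kerN N (x - y) * phi y) with (kerN N (x - y) * (phi x - phi y)) by ring.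
    rewrite Rabs_mult, (Rabs_pos_eq (kerN N (x - y))) by apply Kp.
    specialize (HM x y Hx arith).
    apply Rmult_le_compat_l with (r := kerN N (x - y)) in HM; [|pos].
    etr HM. right. unfold kerN. simpl. ring.
  - have X1 := kerN_ex (S N) x. have X2 := kerN_ex N x.
   rewrite (RInt_minusR (fun y => (eps / 2 + K) * kerN N (x - y)) (fun y => K * kerN (S N) (x - y)) 0 1
    (ex_RInt_mulR _ _ _ _ X2) (ex_RInt_mulR _ _ _ _ X1)), (RInt_mulR _ _ _ _ X1), (RInt_mulR _ _ _ _ X2), !kerN_int.
   simpl wallis. fold W.
   replace ((eps / 2 + K) * W - K * ((2 * INR N + 1) / (2 * INR N + 2) * W)) with ((eps / 2 + K / (2 * INR N + 2)) * W) by (field; lra).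
   apply Rmult_le_compat_r; [lra|].
   assert (K / (2 * INR N + 2) <= eps / 2); [|lra].
   apply Rmult_le_reg_r with (2 * INR N + 2); [lra|]. unfold Rdiv at 1. rewrite Rmult_assoc, Rinv_l, Rmult_1_r by lra. nra. }
 intros x. destruct (frac_shift x) as [n Hn].
 have Ex : x = (x - IZR n) + IZR n by ring.
 rewrite Ex, (periodic_Z phi Hper), (periodic_Z _ (fsum_per phi _)). apply G. lra.
Qed.

Lemma fourier_unique (phi : R -> R) : (forall y, continuous phi y) -> (forall x, phi (x + 1) = phi x) ->
 (forall k, fcos phi k = 0) -> (forall k, fsin phi k = 0) -> forall x, phi x = 0.
Proof.
 intros Hc Hper H1 H2 x.
 have Z : forall l, fsum phi l x = 0.
 { induction l as [|[c k] l IH]; simpl; auto. rewrite H1, H2, IH. ring. }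
 destruct (Req_dec (phi x) 0) as [|N]; auto. exfalso.
 have P : 0 < Rabs (phi x) by (apply Rabs_pos_lt; auto).
 destruct (trig_dense phi (Rabs (phi x) / 2) Hc Hper arith) as [l Hl].
 specialize (Hl x). rewrite Z, Rminus_0_r in Hl. lra.
Qed.

Lemma RInt_period (h : R -> R) a : (forall x, continuous h x) -> (forall x, h (x + 1) = h x) ->
 RInt h a (a + 1) = RInt h 0 1.
Proof.
 intros Hc Hp.
 have E : forall u v, ex_RInt h u v by (intros; apply ex_RInt_contR; auto).
 have S : RInt h (0 + 1) (a + 1) = RInt h 0 a.
 { rewrite <- (RInt_ext (fun x => h (x + 1)) h 0 a) by pos.
  have Q := RInt_comp_lin (V := VR) h 1 1 0 a.
  replace (1 * 0 + 1) with (0 + 1) in Q by ring. replace (1 * a + 1) with (a + 1) in Q by ring.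
  rewrite <- Q by auto. apply RInt_ext. intros x _. change (1 * h (1 * x + 1) = h (x + 1)).
  rewrite !Rmult_1_l. reflexivity. }
 rewrite Rplus_0_l in S.
 have C1 := RInt_Chasles (V := VR) h a 0 (a + 1) (E _ _) (E _ _).
 have C2 := RInt_Chasles (V := VR) h 0 1 (a + 1) (E _ _) (E _ _).
 have C3 := opp_RInt_swap (V := VR) h 0 a (E _ _).
 change (RInt h a 0 + RInt h 0 (a + 1) = RInt h a (a + 1)) in C1.
 change (RInt h 0 1 + RInt h 1 (a + 1) = RInt h 0 (a + 1)) in C2.
 change (- RInt h 0 a = RInt h a 0) in C3. lra.
Qed.

Lemma ce_R x : ce (RtoC x) = (cos (2 * PI * x), sin (2 * PI * x)).
Proof. unfold RtoC. rewrite ce_eq. rewrite Rmult_0_r, Ropp_0, exp_0. f_equal; ring. Qed.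

Transparent CI.
(** The coefficients at k and - k give four real equations, which separate the cosine and sine
    coefficients of the real and imaginary parts. *)
Lemma cfourier_unique (g : R -> C) a : (forall x, ccontR g x) -> (forall x, g (x + 1) = g x) ->
 (forall k : Z, CI (fun x => Cmult (g x) (ce (RtoC (IZR k * x)))) a (a + 1) = RtoC 0) -> forall x, g x = RtoC 0.
Proof.
 intros Hc Hp H.
 set (u := fun x => Re (g x)). set (v := fun x => Im (g x)).
 have Cu : forall x, continuous u x by (intros; apply Hc).
 have Cv : forall x, continuous v x by (intros; apply Hc).
 have Pu : forall x, u (x + 1) = u x by (intros; unfold u; rewrite Hp; auto).
 have Pv : forall x, v (x + 1) = v x by (intros; unfold v; rewrite Hp; auto).
 have K : forall k, fcos u k = 0 /\ fsin u k = 0 /\ fcos v k = 0 /\ fsin v k = 0.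
 { intros k.
  have E : forall f, (forall x, continuous f x) -> ex_RInt (fun x => f x * cos (om k * x)) a (a + 1)
     /\ ex_RInt (fun x => f x * sin (om k * x)) a (a + 1).
  { intros f Hf. split; apply ex_RInt_contR; intros; apply contR_mult; auto; [cts|apply contR_sin]. }
  have F : forall f, (forall x, continuous f x) -> (forall x, f (x + 1) = f x) ->
    RInt (fun x => f x * cos (om k * x)) a (a + 1) = fcos f k /\
    RInt (fun x => f x * sin (om k * x)) a (a + 1) = fsin f k.
  { intros f Hf Hpf. split; apply RInt_period; intros.
   - apply contR_mult; auto; apply contR_cos.
   - rewrite Hpf, cos_per_nat; auto.
   - apply contR_mult; auto; apply contR_sin.
   - rewrite Hpf, sin_per_nat; auto. }
  destruct (E u Cu) as [E1 E2]. destruct (E v Cv) as [E3 E4].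
  destruct (F u Cu Pu) as [F1 F2]. destruct (F v Cv Pv) as [F3 F4].
  have H1 := H (Z.of_nat k). have H2 := H (- Z.of_nat k)%Z.
  have H1a := f_equal Re H1. have H1b := f_equal Im H1. have H2a := f_equal Re H2. have H2b := f_equal Im H2.
  change (RInt (fun x => Re (Cmult (g x) (ce (RtoC (IZR (Z.of_nat k) * x))))%C) a (a + 1) = 0) in H1a.
  change (RInt (fun x => Im (Cmult (g x) (ce (RtoC (IZR (Z.of_nat k) * x))))%C) a (a + 1) = 0) in H1b.
  change (RInt (fun x => Re (Cmult (g x) (ce (RtoC (IZR (- Z.of_nat k) * x))))%C) a (a + 1) = 0) in H2a.
  change (RInt (fun x => Im (Cmult (g x) (ce (RtoC (IZR (- Z.of_nat k) * x))))%C) a (a + 1) = 0) in H2b.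
  have G1 : RInt (fun x => u x * cos (om k * x)) a (a + 1) - RInt (fun x => v x * sin (om k * x)) a (a + 1) = 0.
  { rewrite <- (RInt_minusR _ _ _ _ E1 E4). etransitivity; [|exact H1a]. apply RInt_ext. intros x _. req.
   rewrite ce_R, <- INR_IZR_INZ. rewrite !Rmult_assoc. reflexivity. }
  have G2 : RInt (fun x => u x * sin (om k * x)) a (a + 1) + RInt (fun x => v x * cos (om k * x)) a (a + 1) = 0.
  { rewrite <- (RInt_plusR _ _ _ _ E2 E3). etransitivity; [|exact H1b]. apply RInt_ext. intros x _. req.
   rewrite ce_R, <- INR_IZR_INZ. rewrite !Rmult_assoc. reflexivity. }
  have G3 : RInt (fun x => u x * cos (om k * x)) a (a + 1) + RInt (fun x => v x * sin (om k * x)) a (a + 1) = 0.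
  { rewrite <- (RInt_plusR _ _ _ _ E1 E4). etransitivity; [|exact H2a]. apply RInt_ext. intros x _. req.
   rewrite ce_R, opp_IZR, <- INR_IZR_INZ. unfold u, v, Re, Im, Cmult; simpl.
   replace (2 * PI * (- INR k * x)) with (- (om k * x)) by ring. rewrite cos_neg, sin_neg. ring. }
  have G4 : RInt (fun x => v x * cos (om k * x)) a (a + 1) - RInt (fun x => u x * sin (om k * x)) a (a + 1) = 0.
  { rewrite <- (RInt_minusR _ _ _ _ E3 E2). etransitivity; [|exact H2b]. apply RInt_ext. intros x _. req.
   rewrite ce_R, opp_IZR, <- INR_IZR_INZ. unfold u, v, Re, Im, Cmult; simpl.
   replace (2 * PI * (- INR k * x)) with (- (om k * x)) by ring. rewrite cos_neg, sin_neg. ring. }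
  lra. }
 intros x. apply Ceq_ReIm.
 - apply (fourier_unique u); auto; intros; apply K.
 - apply (fourier_unique v); auto; intros; apply K.
Qed.
Opaque CI.

Open Scope C_scope.

(** * Theta functions *)

(** This is q = e(tau); its square root [hnome] is the modulus of e(p) on gamma. *)
Definition nome (t : R) : R := exp (- (2 * PI * t)).
Definition hnome (t : R) : R := exp (- (PI * t)).

Lemma nome_bd t : 0 < t -> 0 < nome t < 1.
Proof.
 intros H. split; [pos|].
 rewrite <- exp_0. apply exp_increasing. assert (0 < 2 * PI * t)%R by pos. lra.
Qed.

Lemma hnome_bd t : 0 < t -> 0 < hnome t < 1.
Proof.
 intros H. split; [pos|].
 rewrite <- exp_0. apply exp_increasing. assert (0 < PI * t)%R by pos. lra.
Qed.

Lemma nome_hnome t k : (nome t ^ k = hnome t ^ k * hnome t ^ k)%R.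
Proof.
 rewrite <- Rpow_mult_distr. f_equal. unfold nome, hnome. rewrite <- exp_plus. f_equal. ring.
Qed.

(** The coefficient of z^k in the sum of ln (1 - q^n z) over n >= 1. So [Bf (cth t)] is the Jacobi
    product of 1 - e(p) and of all (1 - q^n e(p)) (1 - q^n e(-p)), in the strip |Im p| < t where the
    series converge. In [cph] the logarithms carry the signs (-1)^n, so the factors of odd n go to
    the denominator. *)
Definition cth (t : R) (k : nat) : R := (- (invk k * (nome t ^ k / (1 - nome t ^ k))))%R.
Definition cph (t : R) (k : nat) : R := (invk k * (nome t ^ k / (1 + nome t ^ k)))%R.

Lemma invk_le1 k : 0 <= invk k <= 1.
Proof.
 pose proof (proj2 invk_bd k) as H. rewrite pow1, Rmult_1_r in H.
 assert (0 <= invk k)%R.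
 { destruct k; [simpl; lra|]. left. apply Rinv_0_lt_compat. apply lt_0_INR; lia. }
 rewrite Rabs_pos_eq in H; lra.
Qed.

Lemma pow_lt1 (q : R) k : 0 < q < 1 -> (1 <= k)%nat -> 0 < q ^ k <= q.
Proof.
 intros Hq Hk. split; [pos|]. destruct k; [lia|]. simpl.
 assert (q ^ k <= 1)%R.
 { rewrite <- (pow1 k). apply pow_incr. lra. }
 nra.
Qed.

Lemma cth_bd t : 0 < t -> geo_bd (cth t) (/ (1 - nome t)) (nome t).
Proof.
 intros Ht. have Hq := nome_bd t Ht. split; [lra|]. intros k. unfold cth.
 destruct k as [|k].
 { rewrite Rmult_0_l, Ropp_0, Rabs_R0, Rmult_1_r. left. apply Rinv_0_lt_compat; lra. }
 have Hk := pow_lt1 (nome t) (S k) Hq ltac:(lia). set (n := S k) in *. have Hi := invk_le1 n.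
 have P : 0 < / (1 - nome t ^ n) by pos.
 have Q : / (1 - nome t ^ n) <= / (1 - nome t) by (apply Rinv_le_contravar; lra).
 rewrite Rabs_Ropp, Rabs_pos_eq.
 - set (u := (nome t ^ n)%R) in *.
  apply Rle_trans with (1 * (u * / (1 - u)))%R.
  + apply Rmult_le_compat_r; [|lra]. apply Rmult_le_pos; lra.
  + rewrite Rmult_1_l, Rmult_comm. apply Rmult_le_compat_r; lra.
 - pos.
Qed.

Lemma cph_bd t : 0 < t -> geo_bd (cph t) 1 (nome t).
Proof.
 intros Ht. have Hq := nome_bd t Ht. split; [lra|]. intros k. unfold cph.
 have Hi := invk_le1 k.
 have P : 0 < nome t ^ k by pos.
 set (u := (nome t ^ k)%R) in *.
 have Q : 0 < / (1 + u) by pos.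
 have Q1 : / (1 + u) <= 1 by (rewrite <- Rinv_1; apply Rinv_le_contravar; lra).
 rewrite Rabs_pos_eq.
 - apply Rle_trans with (1 * (u * 1))%R; [|lra].
  apply Rmult_le_compat; try lra. + apply Rmult_le_pos; lra. + apply Rmult_le_compat_l; lra.
 - pos.
Qed.

Lemma nome_room t y : - t < y -> nome t * exp (- (2 * PI * y)) < 1.
Proof.
 intros H. unfold nome. rewrite <- exp_plus, <- exp_0. apply exp_increasing.
 assert (0 < 2 * PI * (t + y))%R by pos. lra.
Qed.

Lemma one_room y : 0 < y -> 1 * exp (- (2 * PI * y)) < 1.
Proof.
 intros H. rewrite Rmult_1_l. rewrite <- exp_0. apply exp_increasing.
 assert (0 < 2 * PI * y)%R by pos. lra.
Qed.

Definition Bex (c : nat -> R) (p : C) : C := cexp (ES c p + ES c (- p))%C.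
Definition Bf (c : nat -> R) (p : C) : C := (1 - ce p) * Bex c p.

Lemma Bex_neq0 c p : Bex c p <> 0.
Proof. apply cexp_neq0. Qed.

Lemma Bex_chol c A t p : geo_bd c A (nome t) -> Rabs (Im p) < t -> chol (Bex c) p.
Proof.
 intros Hc Hp. apply Rabs_def2 in Hp. apply chol_cexp. apply chol_plus.
 - eapply ES_chol; eauto. apply nome_room; lra.
 - apply (chol_comp (fun p => - p) (ES c)).
  + apply chol_opp, chol_id.
  + eapply ES_chol; eauto. apply nome_room. unfold Im, Copp in *; simpl. lra.
Qed.

Lemma Bf_chol c A t p : geo_bd c A (nome t) -> Rabs (Im p) < t -> chol (Bf c) p.
Proof.
 intros Hc Hp. apply chol_mult; [|eapply Bex_chol; eauto].
 apply chol_minus; [apply chol_const|]. apply chol_ce, chol_id.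
Qed.

Lemma ES_Z c p (n : Z) : ES c (p + RtoC (IZR n)) = ES c p.
Proof.
 apply csum_nat_ext. intros k. rewrite Cmult_plus_distr_l, ce_plus.
 have E : RtoC (INR k) * RtoC (IZR n) = RtoC (IZR (Z.of_nat k * n)).
 { rewrite mult_IZR, <- INR_IZR_INZ, RtoC_mult. reflexivity. }
 rewrite E, ce_Z, Cmult_1_r. reflexivity.
Qed.

Lemma Bf_Z c p (n : Z) : Bf c (p + RtoC (IZR n)) = Bf c p.
Proof.
 unfold Bf, Bex. rewrite ce_plus, ce_Z, Cmult_1_r, ES_Z.
 replace (- (p + RtoC (IZR n))) with (- p + RtoC (IZR (- n))) by (rewrite opp_IZR, RtoC_opp; ring).
 rewrite ES_Z. reflexivity.
Qed.

Lemma Bex_opp c p : Bex c (- p) = Bex c p.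
Proof. unfold Bex. f_equal. replace (- - p) with p by ring. ring. Qed.

Lemma Bf_opp c p : Bf c (- p) = - ce (- p) * Bf c p.
Proof.
 unfold Bf. rewrite Bex_opp, ce_opp. field. apply ce_neq0.
Qed.

Lemma ce_eq1 p : ce p = 1 -> exists n : Z, p = RtoC (IZR n).
Proof.
 intros H. have HP := PI_RGT_0.
 have M : Cmod (ce p) = 1%R by (rewrite H; apply Cmod_1).
 rewrite Cmod_ce in M. destruct p as [x y]. unfold Im in M; simpl in M.
 have Hy : y = 0%R.
 { rewrite <- exp_0 in M. apply exp_inv in M. assert (y * (2 * PI) = 0)%R by lra.
  apply Rmult_integral in H0. lra. }
 subst y. destruct (frac_shift x) as [n Hn]. exists n.
 set (u := (x - IZR n)%R) in *.
 have E : ce (RtoC u) = 1.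
 { unfold u. rewrite RtoC_minus, ce_minus, ce_Z. change (RtoC x) with ((x, 0%R) : C). rewrite H. field. }
 rewrite ce_R in E. injection E as E1 E2.
 replace (2 * PI * u)%R with (2 * (PI * u))%R in E1 by ring. rewrite cos_2a_sin in E1.
 have S0 : sin (PI * u) = 0%R by nra.
 destruct (Req_dec u 0) as [U|U].
 - unfold RtoC. f_equal. unfold u in U. lra.
 - exfalso. assert (0 < sin (PI * u))%R; [|lra]. apply sin_gt_0; [pos|nra].
Qed.

Lemma Bf_0 c p : Bf c p = 0 -> exists n : Z, p = RtoC (IZR n).
Proof.
 intros H. apply ce_eq1.
 destruct (Ceq_dec (1 - ce p) 0) as [E|N].
 - replace (ce p) with (1 - (1 - ce p)) by ring. rewrite E. ring.
 - exfalso. apply (Cmult_neq_0 _ _ N (Bex_neq0 c p)). exact H.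
Qed.

Definition th (t : R) : C -> C := Bf (cth t).
(** In the strip |Im p| < t / 2 its modulus is exp (- 2 G), with G the Green function of the torus
    cut along gamma with pole at 0. The square is taken because e(-p/2) changes sign under p -> p +
    1. *)
Definition Ph2 (t : R) : C -> C := fun p => RtoC (exp (- (PI * t))) * ce (- p) * (Bf (cph t) p * Bf (cph t) p).

Lemma ce_tau t : ce (tauC t) = RtoC (nome t).
Proof.
 unfold tauC. rewrite ce_eq. unfold nome, RtoC. rewrite Rmult_0_r, cos_0, sin_0. f_equal; ring.
Qed.
Lemma ce_ktau t k : ce (RtoC (INR k) * tauC t) = RtoC (nome t ^ k).
Proof. rewrite ce_pow, ce_tau, <- RtoC_pow. reflexivity. Qed.

Lemma RtoC_neq0 x : x <> 0%R -> RtoC x <> 0.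
Proof. intros H E. apply H. injection E; auto. Qed.

Lemma cth_id1 t k : 0 < t -> (cth t k * nome t ^ k = cth t k + invk k * nome t ^ k)%R.
Proof.
 intros Ht. unfold cth. destruct k; [simpl; ring|].
 pose proof (pow_lt1 _ (S k) (nome_bd t Ht) ltac:(lia)). pose proof (nome_bd t Ht). field. lra.
Qed.
Lemma cth_id2 t k : 0 < t -> (cth t k * / nome t ^ k = cth t k - invk k)%R.
Proof.
 intros Ht. unfold cth. destruct k; [simpl; ring|].
 pose proof (pow_lt1 _ (S k) (nome_bd t Ht) ltac:(lia)). pose proof (nome_bd t Ht). field. lra.
Qed.
Lemma cph_id1 t k : 0 < t -> (cph t k * nome t ^ k = - cph t k + invk k * nome t ^ k)%R.
Proof.
 intros Ht. unfold cph. pose proof (pow_lt (nome t) k (proj1 (nome_bd t Ht))). field. lra.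
Qed.
Lemma cph_id2 t k : 0 < t -> (cph t k * / nome t ^ k = - cph t k + invk k)%R.
Proof.
 intros Ht. unfold cph. pose proof (pow_lt (nome t) k (proj1 (nome_bd t Ht))). field. lra.
Qed.

(** The shift multiplies the k-th term by q^k, and the recurrence of the coefficients turns this
    into the old series plus a logarithmic one. The sign [e] is 1 for [cth] and -1 for [cph]; the
    Boolean of [ES_shift_dn] has the same role. *)
Lemma ES_shift_up (a : nat -> R) t e A p : geo_bd a A (nome t) -> - t < Im p -> - t < 0 ->
 (forall k, a k * nome t ^ k = e * a k + invk k * nome t ^ k)%R -> 0 < Im (p + tauC t) ->
 ES a (p + tauC t) = RtoC e * ES a p + ES invk (p + tauC t).
Proof.
 intros Ha Hp Ht Hid Hp2.
 have X1 := ES_ex a A (nome t) p Ha (nome_room t _ Hp).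
 have X2 := ES_ex invk 1 1 (p + tauC t) invk_bd (one_room _ Hp2).
 unfold ES. rewrite <- csum_nat_scal, <- csum_nat_plus by (auto; apply csum_ex_scal; auto).
 apply csum_nat_ext. intros k.
 rewrite Cmult_plus_distr_l, ce_plus, ce_ktau.
 replace (RtoC (a k) * (ce (RtoC (INR k) * p) * RtoC (nome t ^ k)))
  with (RtoC (a k * nome t ^ k) * ce (RtoC (INR k) * p)) by (rewrite RtoC_mult; ring).
 rewrite Hid, RtoC_plus, !RtoC_mult. ring.
Qed.

Lemma Im_opp p : Im (- p) = (- Im p)%R.
Proof. reflexivity. Qed.

Lemma ES_shift_dn (a : nat -> R) t (e : bool) A p : 0 < t -> geo_bd a A (nome t) -> Im p < t -> Im p < 0 ->
 (forall k, a k * / nome t ^ k = (if e then a k - invk k else - a k + invk k))%R ->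
 ES a (- (p + tauC t)) = if e then ES a (- p) - ES invk (- p) else - ES a (- p) + ES invk (- p).
Proof.
 intros Ht Ha Hp Hp2 Hid.
 have X1 := ES_ex a A (nome t) (- p) Ha (nome_room t (Im (- p)) ltac:(unfold Im in *; simpl; lra)).
 have X2 := ES_ex invk 1 1 (- p) invk_bd (one_room (Im (- p)) ltac:(unfold Im in *; simpl; lra)).
 have E : ES a (- (p + tauC t)) = csum_nat (fun k => RtoC (a k * / nome t ^ k) * ce (RtoC (INR k) * - p)).
 { apply csum_nat_ext. intros k.
  replace (RtoC (INR k) * - (p + tauC t)) with (RtoC (INR k) * - p - RtoC (INR k) * tauC t) by ring.
  rewrite ce_minus, ce_ktau, RtoC_mult, RtoC_inv; [unfold Cdiv; ring|].
  apply pow_nonzero. pose proof (nome_bd t Ht). lra. }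
 rewrite E. unfold ES. destruct e.
 - rewrite <- csum_nat_minus by auto. apply csum_nat_ext. intros k. rewrite Hid, RtoC_minus. ring.
 - replace (- csum_nat (fun k => RtoC (a k) * ce (RtoC (INR k) * - p))) with ((-1) * csum_nat (fun k => RtoC (a k) * ce (RtoC (INR k) * - p))) by ring.
  rewrite <- csum_nat_scal, <- csum_nat_plus by (auto; apply csum_ex_scal; auto).
  apply csum_nat_ext. intros k. rewrite Hid, RtoC_plus, RtoC_opp. ring.
Qed.

Lemma Im_plus_tau p t : Im (p + tauC t) = (Im p + t)%R.
Proof. reflexivity. Qed.

(** For these p both p and p + tau lie in the strip of convergence. The logarithmic series left by
    the shifts sum to 1 - e(-p) and 1 - e(p + tau), of which the second cancels. *)
Lemma th_tau t p : - t < Im p < 0 -> th t (p + tauC t) = - ce (- p) * th t p.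
Proof.
 intros Hp. have Ht : 0 < t by lra.
 have L1 : cexp (- ES invk (- p))%C = 1 - ce (- p) by (apply cexp_log_series; rewrite Im_opp; lra).
 have L2 : cexp (- ES invk (p + tauC t))%C = 1 - ce (p + tauC t) by (apply cexp_log_series; rewrite Im_plus_tau; lra).
 unfold th, Bf, Bex.
 rewrite (ES_shift_up (cth t) t 1 _ p (cth_bd t Ht)) by (rewrite ?Im_plus_tau; try lra; intros; rewrite cth_id1 by auto; ring).
 rewrite (ES_shift_dn (cth t) t true _ p Ht (cth_bd t Ht)) by (try lra; intros; apply cth_id2; auto).
  replace (1 * ES (cth t) p + ES invk (p + tauC t) + (ES (cth t) (- p) - ES invk (- p)))
  with ((ES (cth t) p + ES (cth t) (- p)) + (- ES invk (- p)) + - (- ES invk (p + tauC t))) by ring.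
 rewrite !cexp_plus, (cexp_opp (- ES invk (p + tauC t))), L1, L2.
 have N : 1 - ce (p + tauC t) <> 0.
 { rewrite <- L2. apply cexp_neq0. }
 have N2 := ce_neq0 p.
 rewrite ce_opp. field. split; auto.
Qed.

Lemma Bph_tau t p : - t < Im p < 0 -> Bf (cph t) (p + tauC t) * Bf (cph t) p = - ce p.
Proof.
 intros Hp. have Ht : 0 < t by lra.
 have L1 : cexp (- ES invk (- p))%C = 1 - ce (- p) by (apply cexp_log_series; rewrite Im_opp; lra).
 have L2 : cexp (- ES invk (p + tauC t))%C = 1 - ce (p + tauC t) by (apply cexp_log_series; rewrite Im_plus_tau; lra).
 unfold Bf, Bex.
 rewrite (ES_shift_up (cph t) t (-1) _ p (cph_bd t Ht)) by (rewrite ?Im_plus_tau; try lra; intros; rewrite cph_id1 by auto; ring).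
 rewrite (ES_shift_dn (cph t) t false _ p Ht (cph_bd t Ht)) by (try lra; intros; apply cph_id2; auto).
  match goal with |- _ * cexp ?X * (_ * cexp ?Y) = _ =>
  replace (((1 - ce (p + tauC t)) * cexp X * ((1 - ce p) * cexp Y))) with ((1 - ce (p + tauC t)) * (1 - ce p) * cexp (X + Y)) by (rewrite cexp_plus; ring);
  replace (X + Y) with (- (- ES invk (p + tauC t)) + - (- ES invk (- p))) by ring end.
 rewrite cexp_plus, (cexp_opp (- ES invk (p + tauC t))), (cexp_opp (- ES invk (- p))), L1, L2.
 have N : 1 - ce (p + tauC t) <> 0.
 { rewrite <- L2. apply cexp_neq0. }
 have N1 : 1 - ce (- p) <> 0.
 { rewrite <- L1. apply cexp_neq0. }
 have N2 := ce_neq0 p.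
 rewrite ce_opp in *. field. repeat split; auto.
 intro E. apply N1. replace (1 - / ce p) with ((ce p - 1) / ce p) by (field; auto). rewrite E. field. auto.
Qed.

Lemma Ph2_tau t p : - t < Im p < 0 -> Ph2 t (p + tauC t) * Ph2 t p = 1.
Proof.
 intros Hp. unfold Ph2. have Q := Bph_tau t p Hp.
 set (X := Bf (cph t) (p + tauC t)) in *. set (Y := Bf (cph t) p) in *.
 replace (RtoC (exp (- (PI * t))) * ce (- (p + tauC t)) * (X * X) * (RtoC (exp (- (PI * t))) * ce (- p) * (Y * Y)))
  with (RtoC (exp (- (PI * t))) * RtoC (exp (- (PI * t))) * (ce (- (p + tauC t)) * ce (- p) * ((X * Y) * (X * Y)))) by ring.
 rewrite Q, !ce_opp, ce_plus, ce_tau, <- RtoC_mult, <- exp_plus.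
 replace (exp (- (PI * t) + - (PI * t))) with (nome t) by (unfold nome; f_equal; ring).
 field. split; [apply ce_neq0|]. apply RtoC_neq0. unfold nome. pose proof (exp_pos (- (2 * PI * t))). lra.
Qed.

Lemma csum_nat_real (u : nat -> R) : csum_nat (fun k => RtoC (u k)) = RtoC (Series u).
Proof.
 unfold csum_nat, RtoC, Re, Im; simpl. f_equal. rewrite (Series_ext (fun _ => 0%R) (fun k => (0 * 0)%R)) by pos.
 rewrite Series_scal_l. ring.
Qed.

(** [LR] is ln theta on gamma. [LT] is ln |theta(x) / (1 - e(x))| on the real axis, where the
    differences of two points of gamma lie. *)
Definition LR (t s : R) : R := Series (fun k => (- (2 * invk k * (hnome t ^ k / (1 - nome t ^ k))) * cos (om k * s))%R).
Definition LT (t x : R) : R := Series (fun k => (2 * cth t k * cos (om k * x))%R).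

Lemma gam_eq t s : gam t s = (s, (t / 2)%R).
Proof. unfold gam, tauC, RtoC, Cplus; simpl. f_equal; ring. Qed.

Lemma Im_gam t s : Im (gam t s) = (t / 2)%R.
Proof. rewrite gam_eq; reflexivity. Qed.

Lemma gam_room1 t s : 0 < t -> 1 * exp (- (2 * PI * Im (gam t s))) < 1.
Proof. intros. apply one_room. rewrite Im_gam. lra. Qed.
Lemma gam_room2 t s : 0 < t -> nome t * exp (- (2 * PI * Im (gam t s))) < 1.
Proof. intros. apply nome_room. rewrite Im_gam. lra. Qed.

Lemma ce_kgam t s k : ce (RtoC (INR k) * gam t s) = RtoC (hnome t ^ k) * ce (RtoC (INR k * s)).
Proof.
 rewrite ce_pow. rewrite RtoC_mult, ce_pow, RtoC_pow, <- Cpow_mult_l. f_equal.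
 unfold gam. rewrite ce_plus, Cmult_comm. f_equal. rewrite ce_tau. unfold nome, hnome. do 2 f_equal. field.
Qed.

Lemma ce_opp_kgam t s k : ce (RtoC (INR k) * - gam t s) = RtoC (/ hnome t ^ k) * ce (RtoC (- (INR k * s))).
Proof.
 replace (RtoC (INR k) * - gam t s) with (- (RtoC (INR k) * gam t s)) by ring.
 rewrite ce_opp, ce_kgam, RtoC_opp, ce_opp.
 have H : (hnome t ^ k <> 0)%R.
 { apply pow_nonzero. unfold hnome. pose proof (exp_pos (- (PI * t))). lra. }
 rewrite RtoC_inv by auto. field. split; [apply ce_neq0|apply RtoC_neq0; auto].
Qed.

Lemma ce_cos x : ce (RtoC x) + ce (RtoC (- x)) = RtoC (2 * cos (2 * PI * x)).
Proof.
 rewrite !ce_R. replace (2 * PI * - x)%R with (- (2 * PI * x))%R by ring. rewrite cos_neg, sin_neg.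
 unfold RtoC, Cplus; simpl. f_equal; ring.
Qed.

(** On gamma the three exponents combine so that e(ks) and e(-ks) receive the same real coefficient
    ([E1], [E2]); hence theta is positive there. *)
Lemma th_gam t s : 0 < t -> th t (gam t s) = RtoC (exp (LR t s)).
Proof.
 intros Ht. unfold th, Bf, Bex. rewrite <- (cexp_log_series (gam t s)) by (rewrite Im_gam; lra).
 rewrite <- cexp_plus.
 have X1 := ES_ex invk 1 1 (gam t s) invk_bd (gam_room1 t s Ht).
 have X2 := ES_ex (cth t) _ (nome t) (gam t s) (cth_bd t Ht) (gam_room2 t s Ht).
 have X3 : csum_ex (fun k => RtoC (cth t k) * ce (RtoC (INR k) * - gam t s)).
 { apply (ES_ex (cth t) (/ (1 - nome t)) (nome t)); [apply (cth_bd t Ht)|]. apply nome_room. rewrite Im_opp, Im_gam. lra. }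
 have E : - ES invk (gam t s) + (ES (cth t) (gam t s) + ES (cth t) (- gam t s)) = RtoC (LR t s).
 { unfold LR. rewrite <- csum_nat_real.
  replace (- ES invk (gam t s) + (ES (cth t) (gam t s) + ES (cth t) (- gam t s)))
   with ((ES (cth t) (gam t s) + ES (cth t) (- gam t s)) - ES invk (gam t s)) by ring.
  unfold ES. rewrite <- csum_nat_plus, <- csum_nat_minus; auto.
  2: { apply (csum_ex_plus _ _ X2 X3). }
  apply csum_nat_ext. intros k. rewrite ce_kgam, ce_opp_kgam.
  set (x := (INR k * s)%R).
  replace (om k * s)%R with (2 * PI * x)%R by (unfold x; ring).
  replace (RtoC (- (2 * invk k * (hnome t ^ k / (1 - nome t ^ k))) * cos (2 * PI * x)))
   with (RtoC (- (invk k * (hnome t ^ k / (1 - nome t ^ k)))) * RtoC (2 * cos (2 * PI * x))) by (rewrite <- RtoC_mult; f_equal; ring).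
  rewrite <- ce_cos.
  have H : (hnome t ^ k <> 0)%R.
  { apply pow_nonzero. pose proof (hnome_bd t Ht). lra. }
  destruct k as [|k].
  { unfold cth. change (invk 0) with 0%R. rewrite !Rmult_0_l, !Ropp_0. ring. }
  set (n := S k) in *.
  have Hk := pow_lt1 (nome t) n (nome_bd t Ht) ltac:(unfold n; lia).
  have Hn := nome_bd t Ht.
  have E1 : (cth t n * hnome t ^ n - invk n * hnome t ^ n = - (invk n * (hnome t ^ n / (1 - nome t ^ n))))%R.
  { unfold cth. field. lra. }
  have E2 : (cth t n * / hnome t ^ n = - (invk n * (hnome t ^ n / (1 - nome t ^ n))))%R.
  { unfold cth. rewrite nome_hnome in *. field. split; auto. lra. }
  rewrite <- E1 at 1. replace (RtoC (cth t n) * (RtoC (/ hnome t ^ n) * ce (RtoC (- x)))) with (RtoC (cth t n * / hnome t ^ n) * ce (RtoC (- x))) by (rewrite RtoC_mult; ring).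
  rewrite E2, <- E1, RtoC_minus, !RtoC_mult. ring. }
 rewrite E. unfold cexp, RtoC, Re, Im; simpl. rewrite cos_0, sin_0. f_equal; ring.
Qed.

(** The exponent is imaginary on gamma: the coefficients of each cosine cancel by the identity [E2].
    The prefactor exp(- PI t) is compensated by |e(-p)|. *)
Lemma Ph2_gam t s : 0 < t -> Cmod (Ph2 t (gam t s)) = 1%R.
Proof.
 intros Ht. unfold Ph2. rewrite !Cmod_mult, Cmod_R, Cmod_ce, Im_opp, Im_gam.
 have B1 : Cmod (Bf (cph t) (gam t s)) = 1%R.
 { unfold Bf, Bex. rewrite <- (cexp_log_series (gam t s)) by (rewrite Im_gam; lra).
  rewrite <- cexp_plus, Cmod_cexp.
  have X1 := ES_ex invk 1 1 (gam t s) invk_bd (gam_room1 t s Ht).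
  have X2 := ES_ex (cph t) _ (nome t) (gam t s) (cph_bd t Ht) (gam_room2 t s Ht).
  have X3 : csum_ex (fun k => RtoC (cph t k) * ce (RtoC (INR k) * - gam t s)).
  { apply (ES_ex (cph t) 1 (nome t)); [apply (cph_bd t Ht)|]. apply nome_room. rewrite Im_opp, Im_gam. lra. }
  replace (- ES invk (gam t s) + (ES (cph t) (gam t s) + ES (cph t) (- gam t s)))
   with ((ES (cph t) (gam t s) + ES (cph t) (- gam t s)) - ES invk (gam t s)) by ring.
  have E : Re ((ES (cph t) (gam t s) + ES (cph t) (- gam t s)) - ES invk (gam t s))%C = 0%R.
  { unfold ES. rewrite <- csum_nat_plus, <- csum_nat_minus; auto.
   2: { apply (csum_ex_plus _ _ X2 X3). }
   unfold csum_nat. unfold Re at 1; cbn [fst].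
   rewrite (Series_ext _ (fun k => (0 * 0)%R)); [rewrite Series_scal_l; ring|].
   intros k. rewrite ce_kgam, ce_opp_kgam, !ce_R.
   replace (2 * PI * - (INR k * s))%R with (- (2 * PI * (INR k * s)))%R by ring. rewrite cos_neg, sin_neg.
   have H : (hnome t ^ k <> 0)%R.
   { apply pow_nonzero. pose proof (hnome_bd t Ht). lra. }
   have E2 : (cph t k * hnome t ^ k + cph t k * / hnome t ^ k - invk k * hnome t ^ k = 0)%R.
   { have Hk := pow_lt (nome t) k (proj1 (nome_bd t Ht)). unfold cph. rewrite nome_hnome in *. field. split; auto. lra. }
   unfold Re, RtoC, Cminus, Cplus, Copp, Cmult; simpl.
   match goal with |- ?L = _ => replace L with ((cph t k * hnome t ^ k + cph t k * / hnome t ^ k - invk k * hnome t ^ k) * cos (2 * PI * (INR k * s)))%R by ring end.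
   rewrite E2. ring. }
  rewrite E. apply exp_0. }
 rewrite B1, Rabs_pos_eq by pos. rewrite !Rmult_1_r, <- exp_plus, <- exp_0. f_equal. field.
Qed.

Lemma Bex_R (c : nat -> R) x A r : geo_bd c A r -> r < 1 ->
 Bex c (RtoC x) = RtoC (exp (Series (fun k => (2 * c k * cos (om k * x))%R))).
Proof.
 intros Hc Hr. unfold Bex.
 have X : forall y, csum_ex (fun k => RtoC (c k) * ce (RtoC (INR k) * RtoC y)).
 { intros y. apply (ES_ex c A r); auto. rewrite Rmult_0_r, Ropp_0, exp_0. lra. }
 have E : ES c (RtoC x) + ES c (- RtoC x) = RtoC (Series (fun k => (2 * c k * cos (om k * x))%R)).
 { rewrite <- csum_nat_real, <- RtoC_opp. unfold ES. rewrite <- csum_nat_plus; auto. apply csum_nat_ext. intros k.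
  rewrite <- !RtoC_mult. rewrite <- Cmult_plus_distr_l. replace (INR k * - x)%R with (- (INR k * x))%R by ring.
  rewrite ce_cos, <- RtoC_mult. f_equal. replace (2 * PI * (INR k * x))%R with (om k * x)%R by ring. ring. }
 rewrite E. unfold cexp, RtoC, Re, Im; simpl. rewrite cos_0, sin_0. f_equal; ring.
Qed.

Lemma th_R t x : 0 < t -> th t (RtoC x) = (1 - ce (RtoC x)) * RtoC (exp (LT t x)).
Proof.
 intros Ht. unfold th, Bf. rewrite (Bex_R (cth t) x _ _ (cth_bd t Ht)) by apply (nome_bd t Ht). reflexivity.
Qed.

Lemma one_minus_ce x : 1 - ce (RtoC x) = RtoC (sin (PI * x)) * (RtoC (-2) * Ci * ce (RtoC (x / 2))).
Proof.
 rewrite !ce_R. replace (2 * PI * (x / 2))%R with (PI * x)%R by field.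
 replace (2 * PI * x)%R with (2 * (PI * x))%R by ring. rewrite cos_2a_sin, sin_2a.
 unfold RtoC, Ci, Cminus, Cplus, Copp, Cmult; simpl. f_equal; ring.
Qed.

(** The shape of [monic_at0], f = c + O(p) on a punctured disc. It is stable under products, powers
    and inverses, and ignores the value at 0, where quotients such as theta(p) / p are arbitrary. *)
Definition lip0 (f : C -> C) (c : C) : Prop :=
 exists M r, 0 < r /\ forall p, 0 < Cmod p < r -> Cmod (f p - c) <= M * Cmod p.

Lemma lip0_bounded f c : lip0 f c -> exists K r, 0 < K /\ 0 < r /\ forall p, 0 < Cmod p < r -> Cmod (f p) <= K.
Proof.
 intros [M [r [Hr H]]]. exists (Rabs M * r + Cmod c + 1)%R, r.
 have H1 := Cmod_ge_0 c. have H2 := Rabs_pos M. split; [nra|]. split; auto.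
 intros p Hp. replace (f p) with ((f p - c) + c) by ring.
 apply Cmod_tri. specialize (H p Hp).
 assert (M * Cmod p <= Rabs M * r)%R.
 { apply Rle_trans with (Rabs M * Cmod p)%R; [apply Rmult_le_compat_r; [lra|apply Rle_abs]|]. apply Rmult_le_compat_l; lra. }
 lra.
Qed.

Lemma lip0_chol f : chol f 0 -> lip0 f (f 0).
Proof.
 intros [l Hl]. destruct (Hl 1%R Rlt_0_1) as [d [Hd H]]. exists (1 + Cmod l)%R, d. split; auto.
 intros p Hp. specialize (H p (proj2 Hp)). rewrite Cplus_0_l in H.
 replace (f p - f 0) with ((f p - f 0 - l * p) + l * p) by ring.
 apply Cmod_tri. rewrite Cmod_mult. lra.
Qed.

Lemma lip0_mult f g a b : lip0 f a -> lip0 g b -> lip0 (fun p => f p * g p) (a * b).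
Proof.
 intros Hf Hg. destruct (lip0_bounded f a Hf) as [K [r0 [HK [Hr0 HB]]]].
 destruct Hf as [M1 [r1 [Hr1 H1]]]. destruct Hg as [M2 [r2 [Hr2 H2]]].
 exists (K * M2 + Cmod b * M1)%R, (Rmin r0 (Rmin r1 r2)). split; [pos|].
 intros p [Hp1 Hp2].
 destruct (Rlt_min Hp2) as [Q0 Q].
 destruct (Rlt_min Q) as [Q1 Q2].
 specialize (HB p (conj Hp1 Q0)). specialize (H1 p (conj Hp1 Q1)). specialize (H2 p (conj Hp1 Q2)).
 replace (f p * g p - a * b) with (f p * (g p - b) + b * (f p - a)) by ring.
 apply Cmod_tri. rewrite !Cmod_mult.
 assert (Cmod (f p) * Cmod (g p - b) <= K * (M2 * Cmod p))%R.
 { apply Rmult_le_compat; auto; apply Cmod_ge_0. }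
 assert (Cmod b * Cmod (f p - a) <= Cmod b * (M1 * Cmod p))%R by (apply Rmult_le_compat_l; auto; apply Cmod_ge_0).
 lra.
Qed.

Lemma lip0_nz f c : lip0 f c -> c <> 0 -> exists r, 0 < r /\ forall p, 0 < Cmod p < r -> Cmod c / 2 <= Cmod (f p).
Proof.
 intros [M [r [Hr H]]] Hc. have Hm := proj1 (Cmod_gt_0 c) Hc.
 have HM := Rabs_pos M.
 exists (Rmin r (Cmod c / 2 / (Rabs M + 1))). split.
 { pos. }
 intros p [Hp1 Hp2].
 destruct (Rlt_min Hp2) as [Q0 Q1].
 specialize (H p (conj Hp1 Q0)).
 have T := Cmod_rev_triangle c (c - f p). replace (c - (c - f p)) with (f p) in T by ring.
 rewrite (Cmod_minus_sym c) in T.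
 apply Rmult_lt_compat_l with (r := (Rabs M + 1)%R) in Q1; [|lra].
 replace ((Rabs M + 1) * (Cmod c / 2 / (Rabs M + 1)))%R with (Cmod c / 2)%R in Q1 by (field; lra).
 assert (M * Cmod p <= Rabs M * Cmod p)%R by (apply Rmult_le_compat_r; [lra|apply Rle_abs]).
 nra.
Qed.

Lemma lip0_inv f c : lip0 f c -> c <> 0 -> lip0 (fun p => / f p) (/ c).
Proof.
 intros Hf Hc. destruct (lip0_nz f c Hf Hc) as [r0 [Hr0 HB]].
 destruct Hf as [M [r [Hr H]]]. have Hm := proj1 (Cmod_gt_0 c) Hc.
 exists (Rabs M * (2 / (Cmod c * Cmod c)))%R, (Rmin r0 r). split; [apply Rmin_glb_lt; auto|].
 intros p [Hp1 Hp2].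
 destruct (Rlt_min Hp2) as [Q0 Q1].
 specialize (HB p (conj Hp1 Q0)). specialize (H p (conj Hp1 Q1)).
 have N : f p <> 0 by (apply (proj2 (Cmod_gt_0 (f p))); lra).
 replace (/ f p - / c) with ((c - f p) * / (c * f p)) by (field; auto).
 rewrite Cmod_mult, Cmod_inv, Cmod_mult, Cmod_minus_sym by (apply Cmult_neq_0; auto).
 assert (/ (Cmod c * Cmod (f p)) <= 2 / (Cmod c * Cmod c))%R.
 { replace (2 / (Cmod c * Cmod c))%R with (/ (Cmod c * (Cmod c / 2)))%R by (field; lra).
  apply Rinv_le_contravar; [pos|]. apply Rmult_le_compat_l; lra. }
 assert (0 < / (Cmod c * Cmod (f p)))%R by pos.
 replace (Rabs M * (2 / (Cmod c * Cmod c)) * Cmod p)%R with ((Rabs M * Cmod p) * (2 / (Cmod c * Cmod c)))%R by ring.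
 apply Rmult_le_compat; auto; [pos|lra|].
 etr H. apply Rmult_le_compat_r; [lra|apply Rle_abs].
Qed.

Lemma lip0_ext f g c : (exists r, 0 < r /\ forall p, 0 < Cmod p < r -> f p = g p) -> lip0 f c -> lip0 g c.
Proof.
 intros [r0 [Hr0 E]] [M [r [Hr H]]]. exists M, (Rmin r0 r). split; [pos|].
 intros p [Hp1 Hp2].
 destruct (Rlt_min Hp2) as [Q0 Q1].
 rewrite <- E by auto. auto.
Qed.

Lemma lip0_ext' f g c : (forall p : C, p <> 0 -> f p = g p) -> lip0 f c -> lip0 g c.
Proof.
 intros E. apply lip0_ext. exists 1%R; split; [lra|]. intros p Hp. apply E. apply (proj2 (Cmod_gt_0 p)). lra.
Qed.

Lemma lip0_const c : lip0 (fun _ => c) c.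
Proof. exists 0%R, 1%R. split; [lra|]. intros p _. replace (c - c) with (RtoC 0) by ring. rewrite Cmod_0. lra. Qed.

Lemma lip0_pow f c n : lip0 f c -> lip0 (fun p => f p ^ n) (c ^ n).
Proof.
 intros H. induction n as [|n IH].
 - apply (lip0_const 1).
 - apply (lip0_mult f (fun p => f p ^ n)); auto.
Qed.

Lemma lip0_plus f g a b : lip0 f a -> lip0 g b -> lip0 (fun p => f p + g p) (a + b).
Proof.
 intros [M1 [r1 [Hr1 H1]]] [M2 [r2 [Hr2 H2]]]. exists (M1 + M2)%R, (Rmin r1 r2). split; [pos|].
 intros p [Hp1 Hp2].
 destruct (Rlt_min Hp2) as [Q0 Q1].
 specialize (H1 p (conj Hp1 Q0)). specialize (H2 p (conj Hp1 Q1)).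
 replace (f p + g p - (a + b)) with ((f p - a) + (g p - b)) by ring.
 apply Cmod_tri. lra.
Qed.

(** The derivative of [Bf c] at its zero 0. *)
Definition B1 (c : nat -> R) : C := RtoC (-2 * PI) * Ci * Bex c 0.

Lemma B1_neq0 c : B1 c <> 0.
Proof.
 apply Cmult_neq_0; [apply Cmult_neq_0|apply Bex_neq0].
 - apply RtoC_neq0. pose proof PI_RGT_0. lra.
 - apply Ci_nz.
Qed.

Lemma Bf_lip0 c A t : 0 < t -> geo_bd c A (nome t) -> lip0 (fun p => Bf c p / p) (B1 c).
Proof.
 intros Ht Hc. apply lip0_ext' with (fun p => ((1 - ce p) / p) * Bex c p).
 { intros p Hp. unfold Bf. field. auto. }
 apply lip0_mult.
 2: { apply lip0_chol. eapply Bex_chol; eauto. unfold RtoC, Im; simpl. rewrite Rabs_R0. auto. }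
 have HP := PI_RGT_0.
 exists (5 * (2 * PI * (2 * PI)) * exp (2 * PI))%R, 1%R. split; [lra|]. intros p Hp.
 have N : p <> 0 by (apply (proj2 (Cmod_gt_0 p)); lra).
 replace ((1 - ce p) / p - RtoC (-2 * PI) * Ci) with (- (ce p - 1 - RtoC (2 * PI) * Ci * p) / p).
 2: { replace (-2 * PI)%R with (- (2 * PI))%R by ring. rewrite RtoC_opp. field. auto. }
 rewrite Cmod_div, Cmod_opp by auto.
 have H := cexp_rem (RtoC (2 * PI) * Ci * p). rewrite !Cmod_mult, Cmod_Ci, Cmod_R, (Rabs_pos_eq (2 * PI)) in H by lra.
 apply Rmult_le_reg_r with (Cmod p); [lra|]. unfold Rdiv. rewrite Rmult_assoc, Rinv_l, Rmult_1_r by lra.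
 etr H.
 have E : exp (2 * PI * 1 * Cmod p) <= exp (2 * PI).
 { left. apply exp_increasing. nra. }
 replace (5 * (2 * PI * (2 * PI)) * exp (2 * PI) * Cmod p * Cmod p)%R with (5 * (2 * PI * 1 * Cmod p * (2 * PI * 1 * Cmod p)) * exp (2 * PI))%R by ring.
 apply Rmult_le_compat_l; auto. apply Rmult_le_pos; [lra|pos].
Qed.

(** * A competitor for the extremal problem *)

(** With this convention [Cinv_mult] and [Cinv_pow] hold without side conditions, so quotients can
    be rearranged at their poles too. *)
Lemma Cinv_0 : / (RtoC 0) = 0.
Proof. unfold Cinv, RtoC; simpl. f_equal; unfold Rdiv; ring. Qed.

Lemma Cinv_mult (a b : C) : / (a * b) = / a * / b.
Proof.
 destruct (Ceq_dec a 0) as [->|Na]; [rewrite Cmult_0_l, Cinv_0; ring|].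
 destruct (Ceq_dec b 0) as [->|Nb]; [rewrite Cmult_0_r, Cinv_0; ring|].
 field. auto.
Qed.

Lemma Cinv_pow (a : C) n : / (a ^ n) = (/ a) ^ n.
Proof.
 induction n as [|n IH]; [|rewrite !Cpow_S, Cinv_mult, IH; reflexivity].
 simpl. field.
Qed.

Lemma Int_part_unique x (n : Z) : IZR n <= x < IZR n + 1 -> Int_part x = n.
Proof.
 intros H. destruct (base_Int_part x) as [H1 H2].
 assert (IZR (Int_part x) < IZR (n + 1))%R by (rewrite plus_IZR; lra).
 assert (IZR n < IZR (Int_part x + 1))%R by (rewrite plus_IZR; lra).
 apply lt_IZR in H0, H3. lia.
Qed.

(** The theta series live in a strip only, so a section is built there and copied to every
    horizontal row by [ext]. The offset 1/4 puts the cuts at Im p = - t / 4 modulo t, away from the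
    real axis and from gamma. *)
Definition row (t : R) (p : C) : Z := Int_part (Im p / t + / 4).
Definition ext (t : R) (g : C -> C) (p : C) : C := g (p - RtoC (IZR (row t p)) * tauC t).

Lemma row_bd t p : 0 < t -> - t / 4 <= Im p - IZR (row t p) * t < 3 * t / 4.
Proof.
 intros Ht. unfold row. destruct (base_Int_part (Im p / t + / 4)) as [H1 H2].
 set (n := IZR (Int_part (Im p / t + / 4))) in *.
 have E : (Im p = (Im p / t) * t)%R by (field; lra). set (u := (Im p / t)%R) in *. rewrite E. nra.
Qed.

Lemma row_unique t p n : 0 < t -> - t / 4 <= Im p - IZR n * t < 3 * t / 4 -> row t p = n.
Proof.
 intros Ht H. apply Int_part_unique.
 have E : (Im p = (Im p / t) * t)%R by (field; lra). set (u := (Im p / t)%R) in *. rewrite E in H.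
 split.
 - apply Rmult_le_reg_r with t; auto. lra.
 - apply Rmult_lt_reg_r with t; auto. lra.
Qed.

Lemma Im_minus_ktau t p x : Im (p - RtoC x * tauC t) = (Im p - x * t)%R.
Proof. unfold Im, Cminus, Cplus, Copp, Cmult, tauC, RtoC; simpl. ring. Qed.

Definition quasi (t : R) (g : C -> C) : Prop := forall p, - t / 2 < Im p < 0 -> g (p + tauC t) = g p.

Lemma ext_eq t g p : 0 < t -> quasi t g -> - t / 2 < Im p < t -> ext t g p = g p.
Proof.
 intros Ht Hq Hp. unfold ext.
 destruct (Rlt_dec (Im p) (- t / 4)) as [H1|H1].
 - rewrite (row_unique t p (-1)) by pos.
  replace (p - RtoC (IZR (-1)) * tauC t) with (p + tauC t) by ring. apply Hq. lra.
 - destruct (Rlt_dec (Im p) (3 * t / 4)) as [H2|H2].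
  + rewrite (row_unique t p 0) by pos. f_equal. ring.
  + rewrite (row_unique t p 1) by pos.
   replace (p - RtoC (IZR 1) * tauC t) with (p - tauC t) by ring.
   rewrite <- (Hq (p - tauC t)).
   * f_equal. ring.
   * replace (p - tauC t) with (p - RtoC 1 * tauC t) by ring. rewrite Im_minus_ktau. lra.
Qed.

Lemma ext_tau t g p : 0 < t -> ext t g (p + tauC t) = ext t g p.
Proof.
 intros Ht. unfold ext. have H := row_bd t p Ht.
 rewrite (row_unique t (p + tauC t) (row t p + 1)).
 - f_equal. rewrite plus_IZR, RtoC_plus. ring.
 - auto.
 - rewrite Im_plus_tau, plus_IZR. lra.
Qed.

Lemma ext_1 t g p : (forall p, g (p + 1) = g p) -> ext t g (p + 1) = ext t g p.
Proof.
 intros H. unfold ext. have E : row t (p + 1) = row t p.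
 { unfold row. do 3 f_equal. unfold Im, Cplus, RtoC; simpl. ring. }
 rewrite E, <- (H (p - _)). f_equal. ring.
Qed.

(** Near p the extension is [g] after one fixed translation, even on a cut, because [quasi] makes
    the formulas of adjacent rows agree on an overlap. *)
Lemma ext_chol t g p : 0 < t -> quasi t g -> chol g (p - RtoC (IZR (row t p)) * tauC t) -> chol (ext t g) p.
Proof.
 intros Ht Hq H. have Hb := row_bd t p Ht. set (n := IZR (row t p)) in *.
 apply chol_ext_loc with (f := fun q => g (q - RtoC n * tauC t)) (r := (t / 4)%R); [lra| |].
 - intros q Hqp.
  have I := Im_le_Cmod (q - p). have E : Im (q - p) = (Im q - Im p)%R by reflexivity.
  have B : - (t / 4) < Im q - Im p < t / 4.
  { apply Rabs_lt_between. rewrite <- E. lra. }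
  rewrite <- (ext_eq t g (q - RtoC n * tauC t)) by (auto; rewrite Im_minus_ktau; lra).
  have G : forall (m : nat) u, ext t g (u + RtoC (INR m) * tauC t) = ext t g u.
  { induction m as [|m IH]; intros u.
   - simpl. f_equal. ring.
   - rewrite S_INR, RtoC_plus. replace (u + (RtoC (INR m) + 1) * tauC t) with (u + RtoC (INR m) * tauC t + tauC t) by ring.
    rewrite ext_tau; auto. }
  unfold n. destruct (Z_le_dec 0 (row t p)) as [P|P].
  + rewrite <- (G (Z.to_nat (row t p))). f_equal. rewrite INR_IZR_INZ, Z2Nat.id by lia. ring.
  + rewrite <- (G (Z.to_nat (- row t p)) q). f_equal. rewrite INR_IZR_INZ, Z2Nat.id, opp_IZR, RtoC_opp by lia. ring.
 - apply (chol_comp (fun q => q - RtoC n * tauC t) g); auto. apply chol_minus; [apply chol_id|apply chol_const].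
Qed.

Lemma pbounded_ext_fun f g z : pbounded f z -> (exists r, 0 < r /\ forall p, 0 < Cmod (p - z) < r -> f p = g p) -> pbounded g z.
Proof.
 intros [M [r [Hr H]]] [r0 [Hr0 E]]. exists M, (Rmin r r0). split; [pos|].
 intros p [Hp1 Hp2].
 destruct (Rlt_min Hp2) as [Q0 Q1].
 rewrite <- E by auto. auto.
Qed.

Lemma pbounded_mult f g z : pbounded f z -> pbounded g z -> pbounded (fun p => f p * g p) z.
Proof.
 intros [M [r [Hr H]]] [M0 [r0 [Hr0 H0]]]. exists (Rabs M * Rabs M0)%R, (Rmin r r0). split; [pos|].
 intros p [Hp1 Hp2].
 destruct (Rlt_min Hp2) as [Q0 Q1].
 specialize (H p (conj Hp1 Q0)). specialize (H0 p (conj Hp1 Q1)). rewrite Cmod_mult.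
 apply Rmult_le_compat; try apply Cmod_ge_0; eapply Rle_trans; eauto; apply Rle_abs.
Qed.

Lemma pbounded_cont f z : ccont f z -> pbounded f z.
Proof.
 intros H. destruct (H 1%R Rlt_0_1) as [d [Hd K]]. exists (Cmod (f z) + 1)%R, d. split; auto.
 intros p [_ Hp]. specialize (K p Hp). replace (f p) with ((f p - f z) + f z) by ring.
 apply Cmod_tri. lra.
Qed.

Lemma pbounded_chol f z : chol f z -> pbounded f z.
Proof. intros. apply pbounded_cont, chol_cont; auto. Qed.

Lemma pbounded_lip0 f c : lip0 f c -> pbounded f 0.
Proof.
 intros H. destruct (lip0_bounded f c H) as [K [r [_ [Hr HB]]]]. exists K, r. split; auto.
 intros p Hp. replace (p - 0) with p in Hp by ring. auto.
Qed.

Lemma pbounded_shift f a : pbounded f 0 -> pbounded (fun p => f (p - a)) a.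
Proof.
 intros [M [r [Hr H]]]. exists M, r. split; auto. intros p Hp. apply H.
 replace (p - a - 0) with (p - a) by ring. auto.
Qed.

Lemma pbounded_pow f z n : pbounded f z -> pbounded (fun p => f p ^ n) z.
Proof.
 intros H. induction n as [|n IH].
 - apply (pbounded_chol (fun _ => 1)), chol_const.
 - apply (pbounded_mult f (fun p => f p ^ n)); auto.
Qed.

Definition isZ (p : C) : Prop := exists n : Z, p = RtoC (IZR n).

Lemma in_lattice_shift t p (k : Z) : isZ (p - RtoC (IZR k) * tauC t) -> in_lattice t p.
Proof.
 intros [n H]. exists n, k. replace p with ((p - RtoC (IZR k) * tauC t) + RtoC (IZR k) * tauC t) by ring. rewrite H. reflexivity.
Qed.

Lemma in_Pn_ext t D n g : 0 < t -> (forall p, g (p + 1) = g p) -> quasi t g ->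
 (forall p, - t / 2 < Im p < t -> ~ isZ p -> ~ isZ (p - RtoC D) -> chol g p) ->
 pbounded (fun p => p ^ n * g p) 0 -> pbounded (fun p => (p - RtoC D) * g p) (RtoC D) ->
 in_Pn t D n (ext t g).
Proof.
 intros Ht H1 Hq Hh B0 BD. repeat split.
 - intros p. apply ext_1; auto.
 - intros p. apply ext_tau; auto.
 - intros p N1 N2. apply holo_at_chol. apply ext_chol; auto. have Hb := row_bd t p Ht. apply Hh.
  + rewrite Im_minus_ktau. lra.
  + intro K. apply N1. apply in_lattice_shift in K; auto.
  + intro K. apply N2. apply (in_lattice_shift t _ (row t p)).
   replace (p - RtoC D - RtoC (IZR (row t p)) * tauC t) with (p - RtoC (IZR (row t p)) * tauC t - RtoC D) by ring. auto.
 - destruct (pbounded_ext_fun _ (fun p => p ^ n * ext t g p) 0 B0) as [M [r [Hr H]]].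
  + exists (t / 2)%R. split; [lra|]. intros p Hp. rewrite ext_eq; auto.
   replace (p - 0) with p in Hp by ring. have I := Im_le_Cmod p. apply Rabs_le_between in I. lra.
  + exists M, r. split; auto. intros p Hp. apply H. replace (p - 0) with p by ring. auto.
 - destruct (pbounded_ext_fun _ (fun p => (p - RtoC D) * ext t g p) (RtoC D) BD) as [M [r [Hr H]]].
  + exists (t / 2)%R. split; [lra|]. intros p Hp. rewrite ext_eq; auto.
   have I := Im_le_Cmod (p - RtoC D).
   have E : Im (p - RtoC D) = Im p by (unfold Im, Cminus, Cplus, Copp, RtoC; simpl; ring).
   rewrite E in I. apply Rabs_le_between in I. lra.
  + exists M, r. auto.
Qed.

Lemma th_Z1 t p : th t (p + 1) = th t p.
Proof. apply (Bf_Z (cth t) p 1). Qed.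
Lemma th_chol t p : 0 < t -> Rabs (Im p) < t -> chol (th t) p.
Proof. intros Ht. eapply Bf_chol. apply (cth_bd t Ht). Qed.
Lemma th_nz t p : ~ isZ p -> th t p <> 0.
Proof. intros H E. apply H. apply (Bf_0 _ _ E). Qed.

Lemma Im_minus p q : Im (p - q) = (Im p - Im q)%R.
Proof. reflexivity. Qed.

Lemma isZ_Im p : isZ p -> Im p = 0%R.
Proof. intros [n ->]. reflexivity. Qed.

Lemma D_not_Z D : 0 < D < 1 -> ~ isZ (RtoC D).
Proof.
 intros H [n E]. injection E as E. subst D.
 destruct H as [H1 H2]. apply lt_IZR in H1. apply lt_IZR in H2. lia.
Qed.

Lemma th_inv_pb t : 0 < t -> pbounded (fun p => p / th t p) 0.
Proof.
 intros Ht. apply pbounded_lip0 with (/ B1 (cth t)).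
 apply lip0_ext with (fun p => / (th t p / p)).
 - exists 1%R. split; [lra|]. intros p Hp.
  have N : p <> 0 by (apply (proj2 (Cmod_gt_0 p)); lra).
  have N2 : th t p <> 0.
  { apply th_nz. intros [n E]. subst p. rewrite Cmod_R, <- abs_IZR in Hp. destruct Hp as [P1 P2].
   apply lt_IZR in P1. apply lt_IZR in P2. lia. }
  field. auto.
 - apply lip0_inv; [|apply B1_neq0]. eapply Bf_lip0; eauto. apply (cth_bd t Ht).
Qed.

Fixpoint thp (t : R) (l : list C) (p : C) : C :=
 match l with nil => 1 | z :: l => th t (p - z) * thp t l p end.

Lemma thp_Z1 t l p : thp t l (p + 1) = thp t l p.
Proof.
 induction l as [|z l IH]; simpl; auto. rewrite IH. f_equal.
 replace (p + 1 - z) with (p - z + 1) by ring. apply th_Z1.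
Qed.

Lemma thp_chol t l p : 0 < t -> (forall z, In z l -> Rabs (Im p - Im z) < t) -> chol (thp t l) p.
Proof.
 intros Ht. induction l as [|z l IH]; intros H.
 - apply (chol_const 1).
 - apply (chol_mult (fun p => th t (p - z)) (thp t l)).
  + apply chol_shift. apply th_chol; auto. apply (H z). left; auto.
  + apply IH. intros; apply H; right; auto.
Qed.

Fixpoint Csum (l : list C) : C := match l with nil => 0 | z :: l => z + Csum l end.

Lemma thp_tau t l p : (forall z, In z l -> - t < Im p - Im z < 0) ->
 thp t l (p + tauC t) = (-1) ^ length l * ce (Csum l - RtoC (INR (length l)) * p) * thp t l p.
Proof.
 induction l as [|z l IH]; intros H.
 - simpl. replace (0 - 0 * p) with (RtoC 0) by ring. rewrite ce_0. ring.
 - cbn [thp Csum length]. rewrite IH by (intros; apply H; right; auto).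
  replace (p + tauC t - z) with (p - z + tauC t) by ring.
  rewrite th_tau by (apply (H z); left; auto).
  rewrite S_INR, RtoC_plus.
  replace (z + Csum l - (RtoC (INR (length l)) + 1) * p) with ((Csum l - RtoC (INR (length l)) * p) + - (p - z)) by ring.
  rewrite ce_plus, Cpow_S. ring.
Qed.

Definition sgam (t : R) (ss : list R) : list C := map (gam t) ss.
Fixpoint Rsum (l : list R) : R := match l with nil => 0%R | x :: l => (x + Rsum l)%R end.
Fixpoint sinp (ss : list R) (s : R) : R := match ss with nil => 1%R | x :: l => (sin (PI * (s - x)) * sinp l s)%R end.

Lemma Csum_sgam t ss : Csum (sgam t ss) = RtoC (Rsum ss) + RtoC (INR (length ss)) * (RtoC (/ 2) * tauC t).
Proof.
 induction ss as [|x l IH]; [simpl; ring|].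
 unfold sgam in *. cbn [map Csum Rsum length]. rewrite IH, S_INR, !RtoC_plus. unfold gam.
 replace (tauC (t / 2)) with (RtoC (/2) * tauC t); [ring|].
 unfold tauC, RtoC, Cmult; simpl. f_equal; field.
Qed.

Lemma gam_minus t s x : gam t s - gam t x = RtoC (s - x).
Proof. unfold gam. rewrite RtoC_minus. ring. Qed.

Lemma th_gam_gam t s x : 0 < t ->
 th t (gam t s - gam t x) = RtoC (sin (PI * (s - x)) * exp (LT t (s - x))) * (RtoC (-2) * Ci * ce (RtoC ((s - x) / 2))).
Proof.
 intros Ht. rewrite gam_minus, th_R, one_minus_ce by auto. rewrite RtoC_mult. ring.
Qed.

(** Theta at the real point s - x is sin(PI (s - x)) times a positive number and the phase -2 i e((s
    - x) / 2). The product therefore has the sign pattern of [sinp], with a phase linear in s. *)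
Lemma thp_gam t ss s : 0 < t -> exists rho, 0 < rho /\
 thp t (sgam t ss) (gam t s) = RtoC (rho * sinp ss s) * ((RtoC (-2) * Ci) ^ length ss * ce (RtoC ((INR (length ss) * s - Rsum ss) / 2))).
Proof.
 intros Ht. induction ss as [|x l [rho [Hr IH]]].
 - exists 1%R. split; [lra|]. simpl. replace ((0 * s - 0) / 2)%R with 0%R by field. rewrite ce_0.
  replace (1 * 1)%R with 1%R by ring. ring.
 - exists (exp (LT t (s - x)) * rho)%R. split; [pos|].
  unfold sgam in *. cbn [map thp sinp length Rsum]. rewrite IH, th_gam_gam by auto. rewrite S_INR.
  replace (((INR (length l) + 1) * s - (x + Rsum l)) / 2)%R with ((s - x) / 2 + (INR (length l) * s - Rsum l) / 2)%R by field.
  rewrite (RtoC_plus ((s - x) / 2)), ce_plus, !RtoC_mult, Cpow_S. ring.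
Qed.

Section GTest.
Variables t D : R.
Hypothesis Ht : 0 < t.
Hypothesis HD : 0 < D < 1.
Variable ss : list R.
Variable j : nat.
Hypothesis Hj : length ss = (2 * j)%nat.

(** Abel's condition: the 2j zeros on gamma and [b] have the sum of the poles, up to j tau, which
    the factor e(-jp) of [Gnum] absorbs. As [b] is real, its theta factor is positive on gamma and
    changes no sign there. *)
Let b : R := (D - Rsum ss)%R.

Definition Gnum (p : C) : C := ce (- (RtoC (INR j) * p)) * (thp t (sgam t ss) p * th t (p - RtoC b)).
Definition Gfun (p : C) : C := Gnum p / (th t p ^ (2 * j) * th t (p - RtoC D)).

Lemma Gnum_chol p : - t / 2 < Im p < t -> chol Gnum p.
Proof.
 intros Hp. apply chol_mult.
 - apply (chol_ce (fun p => - (RtoC (INR j) * p))). apply chol_opp. apply chol_mult; [apply chol_const|apply chol_id].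
 - apply chol_mult.
  + apply thp_chol; auto. intros z Hz. apply in_map_iff in Hz. destruct Hz as [x [<- _]]. rewrite Im_gam. apply Rabs_def1; lra.
  + apply chol_shift. apply th_chol; auto. rewrite Im_minus. unfold RtoC, Im; simpl. apply Rabs_def1; unfold Im in Hp; lra.
Qed.

Lemma Gfun_Z1 p : Gfun (p + 1) = Gfun p.
Proof.
 unfold Gfun, Gnum. rewrite thp_Z1, th_Z1.
 replace (p + 1 - RtoC b) with (p - RtoC b + 1) by ring. replace (p + 1 - RtoC D) with (p - RtoC D + 1) by ring.
 rewrite !th_Z1.
 replace (- (RtoC (INR j) * (p + 1))) with (- (RtoC (INR j) * p) + RtoC (IZR (- Z.of_nat j))).
 - rewrite ce_plus, ce_Z. unfold Cdiv. ring.
 - rewrite opp_IZR, <- INR_IZR_INZ, RtoC_opp. ring.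
Qed.

Lemma Gfun_quasi : quasi t Gfun.
Proof.
 intros p Hp. unfold Gfun, Gnum.
 rewrite thp_tau.
 2: { intros z Hz. apply in_map_iff in Hz. destruct Hz as [x [<- _]]. rewrite Im_gam. lra. }
 replace (p + tauC t - RtoC b) with (p - RtoC b + tauC t) by ring. replace (p + tauC t - RtoC D) with (p - RtoC D + tauC t) by ring.
 rewrite !th_tau by (rewrite ?Im_minus; unfold RtoC, Im in *; simpl; lra).
 unfold sgam. rewrite length_map. fold (sgam t ss). rewrite Hj.
 rewrite Csum_sgam, Hj.
 replace ((-1) ^ (2 * j)) with (RtoC 1) by (rewrite Cpow_mult_r; replace ((-1) ^ 2) with (RtoC 1) by (simpl; ring); rewrite Cpow_1_l; auto).
 replace ((- ce (- p) * th t p) ^ (2 * j)) with (ce (- (RtoC (INR (2 * j)) * p)) * th t p ^ (2 * j)).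
 2: { rewrite Cpow_mult_l. f_equal. rewrite (Cpow_mult_r (- ce (- p))).
    replace ((- ce (- p)) ^ 2) with (ce (- p) ^ 2) by (simpl; ring). rewrite <- Cpow_mult_r, <- ce_pow. f_equal. ring. }
 have E : ce (- (RtoC (INR j) * (p + tauC t))) * ce (RtoC (Rsum ss) + RtoC (INR (2 * j)) * (RtoC (/ 2) * tauC t) - RtoC (INR (2 * j)) * p) * ce (- (p - RtoC b))
  = ce (- (RtoC (INR j) * p)) * ce (- (RtoC (INR (2 * j)) * p)) * ce (- (p - RtoC D)).
 { rewrite <- !ce_plus. f_equal. unfold b. rewrite mult_INR, RtoC_mult, RtoC_minus. change (INR 2) with 2%R.
  rewrite RtoC_inv by lra. field. }
 set (T1 := ce (- (RtoC (INR j) * (p + tauC t)))) in *.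
 set (T2 := ce (RtoC (Rsum ss) + RtoC (INR (2 * j)) * (RtoC (/ 2) * tauC t) - RtoC (INR (2 * j)) * p)) in *.
 set (T3 := ce (- (p - RtoC b))) in *.
 have N1 := ce_neq0 (- (RtoC (INR (2 * j)) * p)). have N2 := ce_neq0 (- (p - RtoC D)).
 set (T5 := ce (- (RtoC (INR (2 * j)) * p))) in *. set (T6 := ce (- (p - RtoC D))) in *.
 have M1 : th t p ^ (2 * j) <> 0.
 { apply Cpow_nz. apply th_nz. intro K. apply isZ_Im in K. lra. }
 have M2 : th t (p - RtoC D) <> 0.
 { apply th_nz. intro K. apply isZ_Im in K. rewrite Im_minus in K. unfold RtoC, Im in *; simpl in *. lra. }
 replace (T1 * (1 * T2 * thp t (sgam t ss) p * (- T3 * th t (p - RtoC b))) / (T5 * th t p ^ (2 * j) * (- T6 * th t (p - RtoC D))))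
  with ((T1 * T2 * T3) * (thp t (sgam t ss) p * th t (p - RtoC b)) / (T5 * T6 * (th t p ^ (2 * j) * th t (p - RtoC D)))) by (field; auto).
 rewrite E. field. auto.
Qed.

Lemma Gfun_in_Pn : in_Pn t D (2 * j) (ext t Gfun).
Proof.
 apply in_Pn_ext; auto.
 - apply Gfun_Z1.
 - apply Gfun_quasi.
 - intros p Hp N1 N2. apply chol_div.
  + apply Gnum_chol; auto.
  + apply chol_mult; [apply chol_pow|apply chol_shift]; apply th_chol; auto; rewrite ?Im_minus; unfold RtoC, Im in *; simpl; apply Rabs_def1; lra.
  + apply Cmult_neq_0; [apply Cpow_nz|]; apply th_nz; auto.
 - apply pbounded_ext_fun with (fun p => (Gnum p / th t (p - RtoC D)) * (p / th t p) ^ (2 * j)).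
  + apply pbounded_mult.
   * apply pbounded_chol. apply chol_div.
    -- apply Gnum_chol. unfold RtoC, Im; simpl. lra.
    -- apply chol_shift. apply th_chol; auto. rewrite Im_minus. unfold RtoC, Im; simpl. rewrite Rminus_0_r, Rabs_R0. auto.
    -- apply th_nz. intros [n K]. apply (D_not_Z D HD). exists (- n)%Z.
      rewrite opp_IZR, RtoC_opp, <- K. ring.
   * apply pbounded_pow, th_inv_pb; auto.
  + exists 1%R. split; [lra|]. intros p _. unfold Gfun, Cdiv.
   rewrite Cpow_mult_l, Cinv_mult, Cinv_pow. ring.
 - apply pbounded_ext_fun with (fun p => (Gnum p / th t p ^ (2 * j)) * ((p - RtoC D) / th t (p - RtoC D))).
  + apply pbounded_mult.
   * apply pbounded_chol. apply chol_div.
    -- apply Gnum_chol. unfold RtoC, Im; simpl. lra.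
    -- apply chol_pow. apply th_chol; auto. unfold RtoC, Im; simpl. rewrite Rabs_R0. auto.
    -- apply Cpow_nz, th_nz, D_not_Z; auto.
   * apply (pbounded_shift (fun p => p / th t p)). apply th_inv_pb; auto.
  + exists 1%R. split; [lra|]. intros p _. unfold Gfun, Cdiv. rewrite Cinv_mult. ring.
Qed.

(** The factor e(-jp) cancels the phase e(js) of the theta product, so up to a constant the section
    is real on gamma, with prescribed changes of sign. *)
Lemma Gfun_gam : exists c : C, c <> 0 /\ forall s, exists rho, 0 < rho /\ ext t Gfun (gam t s) = c * RtoC (rho * sinp ss s).
Proof.
 exists ((RtoC (-2) * Ci) ^ (2 * j) * ce (RtoC (- (Rsum ss / 2)))). split.
 { apply Cmult_neq_0; [|apply ce_neq0]. apply Cpow_nz. apply Cmult_neq_0; [apply RtoC_neq0; lra|apply Ci_nz]. }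
 intros s. rewrite ext_eq; [|auto|apply Gfun_quasi|rewrite Im_gam; lra].
 destruct (thp_gam t ss s Ht) as [rho [Hr E]]. unfold Gfun, Gnum. rewrite E, Hj.
 replace (gam t s - RtoC b) with (gam t (s - b)) by (unfold gam; rewrite RtoC_minus; ring).
 replace (gam t s - RtoC D) with (gam t (s - D)) by (unfold gam; rewrite RtoC_minus; ring).
 rewrite !th_gam by auto.
 have E2 : ce (- (RtoC (INR j) * gam t s)) = RtoC (/ hnome t ^ j) * ce (RtoC (- (INR j * s))).
 { rewrite <- ce_opp_kgam. f_equal. ring. }
 rewrite E2.
  exists (/ hnome t ^ j * rho * exp (LR t (s - b)) / (exp (LR t s) ^ (2 * j) * exp (LR t (s - D))))%R. split.
 { pos. }
 have E3 : ce (RtoC (- (INR j * s))) * ce (RtoC ((INR (2 * j) * s - Rsum ss) / 2)) = ce (RtoC (- (Rsum ss / 2))).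
 { rewrite <- ce_plus, <- RtoC_plus. do 2 f_equal. rewrite mult_INR. simpl (INR 2). field. }
 rewrite <- E3.
 have P3 := exp_pos (LR t s). have P4 := exp_pos (LR t (s - D)).
 generalize dependent (exp (LR t s)). generalize dependent (exp (LR t (s - D))). intros r4 P4 r3 P3.
 generalize (exp (LR t (s - b))). intros r2. generalize (/ hnome t ^ j)%R. intros r1.
 generalize (sinp ss s). intros S.
 have N3 : (r3 ^ (2 * j) <> 0)%R by (apply pow_nonzero; lra).
 have E4 : RtoC (r1 * rho * r2 / (r3 ^ (2 * j) * r4) * S) = RtoC r1 * RtoC rho * RtoC r2 / (RtoC r3 ^ (2 * j) * RtoC r4) * RtoC S.
 { rewrite <- RtoC_pow, <- !RtoC_mult, <- RtoC_div, <- RtoC_mult; auto. apply Rmult_integral_contrapositive; split; auto. lra. }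
 rewrite E4, RtoC_mult. field. split; [|apply Cpow_nz]; apply RtoC_neq0; lra.
Qed.
End GTest.

(** The cosine coefficients of - [LR]. *)
Definition rk (t : R) (k : nat) : R := (2 * invk k * (hnome t ^ k / (1 - nome t ^ k)))%R.

Lemma Cinv_neq0 (z : C) : z <> 0 -> / z <> 0.
Proof.
 intros H E. apply C1_nz. rewrite <- (Cinv_r z H), E. ring.
Qed.

Lemma rk_bd t : 0 < t -> forall k, 0 <= rk t k <= 2 / (1 - nome t) * hnome t ^ k.
Proof.
 intros Ht k. have Hq := nome_bd t Ht. have Hh := hnome_bd t Ht. unfold rk.
 have P0 : 0 < hnome t ^ k by (apply pow_lt; lra).
 destruct k as [|k].
 { simpl. rewrite Rmult_0_r, Rmult_0_l, Rmult_1_r. split; [lra|]. left. apply Rdiv_lt_0_compat; lra. }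
 have Hk := pow_lt1 (nome t) (S k) Hq ltac:(lia). set (n := S k) in *. have Hi := invk_le1 n.
 have P : 0 < / (1 - nome t ^ n) by (apply Rinv_0_lt_compat; lra).
 have Q : / (1 - nome t ^ n) <= / (1 - nome t) by (apply Rinv_le_contravar; lra).
 set (u := (hnome t ^ n)%R) in *. unfold Rdiv.
 have W : 0 <= u * / (1 - nome t ^ n) by pos.
 split; [apply Rmult_le_pos; [lra|auto]|].
 replace (2 * / (1 - nome t) * u)%R with (2 * 1 * (u * / (1 - nome t)))%R by ring.
 apply Rmult_le_compat; try lra.
 - apply Rmult_le_compat_l; lra.
Qed.

Lemma rk_ex t : 0 < t -> ex_series (rk t).
Proof.
 intros Ht. apply (ex_series_le (V := VR) _ (fun k => (2 / (1 - nome t) * hnome t ^ k)%R)).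
 - intros k. change (Rabs (rk t k) <= 2 / (1 - nome t) * hnome t ^ k)%R. rewrite Rabs_pos_eq; apply (rk_bd t Ht).
 - apply ex_series_mul_l, ex_series_geom. pose proof (hnome_bd t Ht). rewrite Rabs_pos_eq; lra.
Qed.

Lemma LR_bound t s : 0 < t -> Rabs (LR t s) <= Series (rk t).
Proof.
 intros Ht. apply Rabs_Series_le; [|apply rk_ex; auto].
 intros k. fold (rk t k). rewrite Rabs_mult, Rabs_Ropp, (Rabs_pos_eq (rk t k)) by apply (rk_bd t Ht).
 assert (Rabs (cos (om k * s)) <= 1)%R by (apply Rabs_le; pose proof (COS_bound (om k * s)); lra).
 pose proof (proj1 (rk_bd t Ht k)). pose proof (Rabs_pos (cos (om k * s))). nra.
Qed.

(** The square root of |kap|, where [Ph2] behaves like kap p^2 at 0. Thus kap^k Ph2^(-k) is p^(-2k)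
    to leading order and has modulus Ecap^(2k) on gamma. *)
Definition Ecap (t : R) : R := (2 * PI * exp (- (PI * t / 2)) * Cmod (Bex (cph t) 0)%C)%R.

Lemma Ecap_pos t : 0 < Ecap t.
Proof.
 unfold Ecap. pose proof PI_RGT_0. pose proof (proj1 (Cmod_gt_0 _) (Bex_neq0 (cph t) 0)).
 apply Rmult_lt_0_compat; [pos|auto].
Qed.

Definition kap (t : R) : C := RtoC (exp (- (PI * t))) * (B1 (cph t) * B1 (cph t)).

Lemma kap_neq0 t : kap t <> 0.
Proof.
 unfold kap. apply Cmult_neq_0; [|apply Cmult_neq_0; apply B1_neq0].
 apply RtoC_neq0. pose proof (exp_pos (- (PI * t))). lra.
Qed.

Lemma Cmod_kap t : Cmod (kap t) = (Ecap t * Ecap t)%R.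
Proof.
 unfold kap, Ecap, B1. rewrite !Cmod_mult, Cmod_Ci, !Cmod_R.
 rewrite (Rabs_pos_eq (exp _)) by (left; apply exp_pos).
 replace (-2 * PI)%R with (- (2 * PI))%R by ring. rewrite Rabs_Ropp, (Rabs_pos_eq (2 * PI)) by (pose proof PI_RGT_0; lra).
 replace (exp (- (PI * t))) with (exp (- (PI * t / 2)) * exp (- (PI * t / 2)))%R by (rewrite <- exp_plus; f_equal; field).
 ring.
Qed.

Lemma Ph2_chol t p : 0 < t -> Rabs (Im p) < t -> chol (Ph2 t) p.
Proof.
 intros Ht Hp. unfold Ph2.
 have H : chol (Bf (cph t)) p by (eapply Bf_chol; [apply (cph_bd t Ht)|auto]).
 apply chol_mult; [|apply chol_mult; auto].
 apply chol_mult; [apply chol_const|]. apply (chol_ce (fun p => - p)), chol_opp, chol_id.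
Qed.

Lemma Ph2_Z1 t p : Ph2 t (p + 1) = Ph2 t p.
Proof.
 unfold Ph2. rewrite (Bf_Z (cph t) p 1). do 2 f_equal.
 replace (- (p + 1)) with (- p + RtoC (IZR (-1))) by ring. rewrite ce_plus, ce_Z. ring.
Qed.

Lemma Ph2_nz t p : ~ isZ p -> Ph2 t p <> 0.
Proof.
 intros H. have N : Bf (cph t) p <> 0 by (intro E; apply H; apply (Bf_0 _ _ E)).
 unfold Ph2. apply Cmult_neq_0; [apply Cmult_neq_0|apply Cmult_neq_0; auto]; [|apply ce_neq0].
 apply RtoC_neq0. pose proof (exp_pos (- (PI * t))). lra.
Qed.

Lemma Ph2_lip0 t : 0 < t -> lip0 (fun p => Ph2 t p / (p * p)) (kap t).
Proof.
 intros Ht. have HB := Bf_lip0 (cph t) _ t Ht (cph_bd t Ht).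
 apply lip0_ext' with (fun p => RtoC (exp (- (PI * t))) * ce (- p) * ((Bf (cph t) p / p) * (Bf (cph t) p / p))).
 { intros p Hp. unfold Ph2. field. auto. }
 unfold kap. replace (RtoC (exp (- (PI * t)))) with (RtoC (exp (- (PI * t))) * ce (- 0)) at 1.
 2: { replace (- 0) with (RtoC 0) by ring. rewrite ce_0. ring. }
 apply lip0_mult; [|apply lip0_mult; auto].
 apply lip0_mult; [apply lip0_const|]. apply (lip0_chol (fun p => ce (- p))).
 apply (chol_ce (fun p => - p)), chol_opp, chol_id.
Qed.

Section Comparison.
Variables t D : R.
Hypothesis Ht : 0 < t.
Hypothesis HD : 0 < D < 1.

(** A section with simple poles at 0 and [D], used for odd n. The double zero at D / 2 satisfies
    Abel's condition and stays away from gamma. *)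
Definition h1 (p : C) : C := (th t (p - RtoC (D / 2)) * th t (p - RtoC (D / 2))) / (th t p * th t (p - RtoC D)).
Definition l1 : C := (th t (- RtoC (D / 2)) * th t (- RtoC (D / 2))) / (B1 (cth t) * th t (- RtoC D)).

Lemma isZ_opp p : isZ (- p) -> isZ p.
Proof. intros [n E]. exists (- n)%Z. rewrite opp_IZR, RtoC_opp, <- E. ring. Qed.

Lemma th_D_nz : th t (- RtoC D) <> 0.
Proof. apply th_nz. intro K. apply (D_not_Z D HD), isZ_opp; auto. Qed.

Lemma l1_neq0 : l1 <> 0.
Proof.
 have N : th t (- RtoC (D / 2)) <> 0.
 { apply th_nz. intro K. apply (D_not_Z (D / 2)); [lra|]. apply isZ_opp; auto. }
 apply Cmult_neq_0; [apply Cmult_neq_0; auto|].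
 apply Cinv_neq0, Cmult_neq_0; [apply B1_neq0|apply th_D_nz].
Qed.

Lemma th_sh_chol a p : Rabs (Im p) < t -> chol (fun p => th t (p - RtoC a)) p.
Proof.
 intros Hp. apply chol_shift, th_chol; auto. rewrite Im_minus.
 replace (Im (RtoC a)) with 0%R by reflexivity. rewrite Rminus_0_r. auto.
Qed.

Lemma h1_lip0 : lip0 (fun p => p * h1 p) l1.
Proof.
 have HB := Bf_lip0 (cth t) _ t Ht (cth_bd t Ht). have Z0 : Rabs (Im (RtoC 0)) < t by (unfold RtoC, Im; simpl; rewrite Rabs_R0; auto).
 have S : forall a, lip0 (fun p => th t (p - RtoC a)) (th t (- RtoC a)).
 { intros a. replace (- RtoC a) with (0 - RtoC a) by ring. apply (lip0_chol (fun p => th t (p - RtoC a))). apply th_sh_chol; auto. }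
  apply lip0_ext with (fun p => (th t (p - RtoC (D / 2)) * th t (p - RtoC (D / 2))) * / ((th t p / p) * th t (p - RtoC D))).
 - exists (Rmin 1 (1 - D)). split; [pos|]. intros p [Hp1 Hp2]. unfold h1.
  have N : p <> 0 by (apply (proj2 (Cmod_gt_0 p)); lra).
  rewrite !Cinv_mult. unfold Cdiv. rewrite !Cinv_mult. replace (/ / p) with p by (field; auto). ring.
 - apply lip0_mult; [apply lip0_mult; auto|]. apply lip0_inv; [|apply Cmult_neq_0; [apply B1_neq0|apply th_D_nz]].
  apply lip0_mult; auto.
Qed.

Lemma h1_quasi : quasi t h1.
Proof.
 intros p Hp. unfold h1.
 replace (p + tauC t - RtoC (D/2)) with (p - RtoC (D/2) + tauC t) by ring. replace (p + tauC t - RtoC D) with (p - RtoC D + tauC t) by ring.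
 rewrite !th_tau by (rewrite ?Im_minus; unfold RtoC, Im in *; simpl; lra).
 have N1 := ce_neq0 (- p). have N2 := ce_neq0 (- (p - RtoC D)).
 have M1 : th t p <> 0.
 { apply th_nz. intro K. apply isZ_Im in K. lra. }
 have M2 : th t (p - RtoC D) <> 0.
 { apply th_nz. intro K. apply isZ_Im in K. rewrite Im_minus in K. unfold RtoC, Im in *; simpl in *. lra. }
 have E : ce (- (p - RtoC (D / 2))) * ce (- (p - RtoC (D / 2))) = ce (- p) * ce (- (p - RtoC D)).
 { rewrite <- !ce_plus. f_equal. replace (RtoC D) with (RtoC (D / 2) + RtoC (D / 2)) by (rewrite <- RtoC_plus; f_equal; field). ring. }
 set (A := ce (- (p - RtoC (D / 2)))) in *. set (B := th t (p - RtoC (D / 2))).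
 replace (- A * B * (- A * B)) with (A * A * (B * B)) by ring. rewrite E. field. auto.
Qed.

Lemma h1_Z1 p : h1 (p + 1) = h1 p.
Proof.
 unfold h1. replace (p + 1 - RtoC (D/2)) with (p - RtoC (D/2) + 1) by ring. replace (p + 1 - RtoC D) with (p - RtoC D + 1) by ring.
 rewrite !th_Z1. reflexivity.
Qed.

(** The shift by tau inverts [Ph2], so this Chebyshev-like sum is elliptic. Its modulus is at most 2
    on gamma. *)
Definition Hk (k : nat) (p : C) : C := Ph2 t p ^ k + (/ Ph2 t p) ^ k.

Lemma Hk_quasi k : quasi t (Hk k).
Proof.
 intros p Hp. unfold Hk. have E := Ph2_tau t p arith.
 have N : Ph2 t p <> 0 by (apply Ph2_nz; intro K; apply isZ_Im in K; lra).
 have E2 : Ph2 t (p + tauC t) = / Ph2 t p.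
 { replace (/ Ph2 t p) with (1 * / Ph2 t p) by ring. rewrite <- E. field. auto. }
 rewrite E2. replace (/ / Ph2 t p) with (Ph2 t p) by (field; auto). ring.
Qed.

(** The leading coefficient of [Hk] at 0. The power of 0 matters for k = 0 only, where [Hk] is the
    constant 2. *)
Definition Lk (k : nat) : C := 0 ^ k + (/ kap t) ^ k.

Lemma Lk_mod k : Cmod (/ kap t) ^ k <= Cmod (Lk k).
Proof.
 unfold Lk. destruct k as [|k].
 - simpl. replace (1 + 1) with (RtoC 2) by ring. rewrite Cmod_R, Rabs_pos_eq; lra.
 - rewrite Cpow_S, Cmult_0_l, Cplus_0_l, Cmod_pow. lra.
Qed.

Lemma Lk_pos k : 0 < Cmod (Lk k).
Proof.
 eapply Rlt_le_trans; [|apply Lk_mod]. apply pow_lt. rewrite Cmod_inv by apply kap_neq0.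
 apply Rinv_0_lt_compat. apply (proj1 (Cmod_gt_0 _)), kap_neq0.
Qed.

Lemma Hk_lip0 k : lip0 (fun p => p ^ (2 * k) * Hk k p) (Lk k).
Proof.
  apply lip0_ext' with (fun p => (p * p * Ph2 t p) ^ k + (/ (Ph2 t p / (p * p))) ^ k).
 { intros p Hp. unfold Hk. rewrite Cpow_mult_r. replace (p ^ 2) with (p * p) by (simpl; ring).
  unfold Cdiv. rewrite Cinv_mult. replace (/ / (p * p)) with (p * p) by (field; auto).
  rewrite !Cpow_mult_l. ring. }
 apply lip0_plus; apply lip0_pow.
 - replace (RtoC 0) with ((fun p => p * p * Ph2 t p) 0) by (cbv beta; ring). apply lip0_chol.
  apply chol_mult; [apply chol_mult; apply chol_id|]. apply Ph2_chol; auto. unfold RtoC, Im; simpl; rewrite Rabs_R0; auto.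
 - apply lip0_inv; [apply Ph2_lip0; auto|apply kap_neq0].
Qed.

(** The monic competitor of degree 2k + e, with e the parity. *)
Definition hfun (k e : nat) (p : C) : C := / (Lk k * l1 ^ e) * (Hk k p * h1 p ^ e).

Lemma Hk_chol k p : - t / 2 < Im p < t -> ~ isZ p -> chol (Hk k) p.
Proof.
 intros Hp N. have C : chol (Ph2 t) p by (apply Ph2_chol; auto; apply Rabs_def1; lra).
 apply chol_plus; apply (chol_pow (fun p => _)); auto. apply chol_inv; auto. apply Ph2_nz; auto.
Qed.

Lemma hfun_in_Pn k e : (e <= 1)%nat -> in_Pn t D (2 * k + e) (ext t (hfun k e)) /\ monic_at0 (2 * k + e) (ext t (hfun k e)).
Proof.
 intros He.
 have Hq : quasi t (hfun k e).
 { intros p Hp. unfold hfun. rewrite (Hk_quasi k p Hp), (h1_quasi p Hp). reflexivity. }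
 have N0 : Lk k * l1 ^ e <> 0.
 { apply Cmult_neq_0; [apply (proj2 (Cmod_gt_0 _)), Lk_pos|apply Cpow_nz, l1_neq0]. }
 have HL : lip0 (fun p => p ^ (2 * k + e) * hfun k e p) 1.
 { replace (RtoC 1) with (/ (Lk k * l1 ^ e) * (Lk k * l1 ^ e)) by (field; split; [apply Cpow_nz, l1_neq0|apply (proj2 (Cmod_gt_0 _)), Lk_pos]).
  apply lip0_ext' with (fun p => / (Lk k * l1 ^ e) * ((p ^ (2 * k) * Hk k p) * (p * h1 p) ^ e)).
  - intros p _. unfold hfun. rewrite Cpow_add_r, Cpow_mult_l. ring.
  - apply lip0_mult; [apply lip0_const|]. apply lip0_mult; [apply Hk_lip0|]. apply lip0_pow, h1_lip0. }
 split.
 - apply in_Pn_ext; auto.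
  + intros p. unfold hfun, Hk. rewrite h1_Z1, Ph2_Z1. reflexivity.
  + intros p Hp N1 N2. apply chol_mult; [apply chol_const|]. apply chol_mult; [apply Hk_chol; auto|].
   apply chol_pow. assert (Rabs (Im p) < t)%R by (apply Rabs_def1; lra). apply chol_div.
   * apply chol_mult; apply th_sh_chol; auto.
   * apply chol_mult; [apply th_chol; auto|apply th_sh_chol; auto].
   * apply Cmult_neq_0; apply th_nz; auto.
  + apply pbounded_lip0 with (RtoC 1). exact HL.
  + have ZD : Rabs (Im (RtoC D)) < t by (unfold RtoC, Im; simpl; rewrite Rabs_R0; auto).
   have BH : pbounded (fun p => / (Lk k * l1 ^ e) * Hk k p) (RtoC D).
   { apply pbounded_chol. apply chol_mult; [apply chol_const|]. apply Hk_chol; [|apply D_not_Z; auto].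
    unfold RtoC, Im; simpl. lra. }
   have Bh : pbounded (fun p => (p - RtoC D) * h1 p ^ e) (RtoC D).
   { destruct e as [|[|e]]; [| |lia].
    - apply (pbounded_chol (fun p => (p - RtoC D) * 1)). apply chol_mult; [|apply chol_const].
     apply chol_minus; [apply chol_id|apply chol_const].
    - apply pbounded_ext_fun with (fun p => (th t (p - RtoC (D / 2)) * th t (p - RtoC (D / 2)) / th t p) * ((p - RtoC D) / th t (p - RtoC D))).
     + apply pbounded_mult.
      * apply pbounded_chol. apply chol_div; [apply chol_mult; apply th_sh_chol; auto|apply th_chol; auto|].
       apply th_nz, D_not_Z; auto.
      * apply (pbounded_shift (fun p => p / th t p)). apply th_inv_pb; auto.
     + exists 1%R. split; [lra|]. intros p _. unfold h1, Cdiv. rewrite Cinv_mult. ring. }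
   destruct (pbounded_mult _ _ _ BH Bh) as [M [r [Hr H]]]. exists M, r. split; auto.
   intros p Hp. specialize (H p Hp). unfold hfun.
   replace ((p - RtoC D) * (/ (Lk k * l1 ^ e) * (Hk k p * h1 p ^ e))) with (/ (Lk k * l1 ^ e) * Hk k p * ((p - RtoC D) * h1 p ^ e)) by ring.
   exact H.
 - apply lip0_ext with (fun p => p ^ (2 * k + e) * hfun k e p); auto.
  exists (t / 2)%R. split; [lra|]. intros p Hp. rewrite ext_eq; auto.
  have I := Im_le_Cmod p. apply Rabs_le_between in I. lra.
Qed.

Lemma h1_gam s : Cmod (h1 (gam t s)) <= exp (4 * Series (rk t)).
Proof.
 unfold h1.
 replace (gam t s - RtoC (D / 2)) with (gam t (s - D / 2)) by (unfold gam; rewrite RtoC_minus; ring).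
 replace (gam t s - RtoC D) with (gam t (s - D)) by (unfold gam; rewrite RtoC_minus; ring).
 rewrite !th_gam by auto. rewrite <- !RtoC_mult, <- RtoC_div by (apply Rgt_not_eq, Rmult_lt_0_compat; apply exp_pos).
 rewrite Cmod_R, <- !exp_plus. unfold Rdiv. rewrite <- exp_Ropp, <- exp_plus, Rabs_pos_eq by pos.
 have B1 := LR_bound t (s - D / 2) Ht. have B2 := LR_bound t s Ht. have B3 := LR_bound t (s - D) Ht.
 apply Rabs_le_between in B1, B2, B3.
 apply exp_le_mono. pos.
Qed.

Lemma hfun_gam e : (e <= 1)%nat -> exists K, 0 < K /\ forall k s, Cmod (ext t (hfun k e) (gam t s)) <= K * Ecap t ^ (2 * k + e).
Proof.
 intros He.
 have P1 := proj1 (Cmod_gt_0 _) l1_neq0. have P2 := Ecap_pos t.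
 set (X := exp (4 * Series (rk t))). exists (2 * (X / (Cmod l1 * Ecap t)) ^ e)%R. split.
 { pos. }
 intros k s.
 have Hq : quasi t (hfun k e).
 { intros p Hp. unfold hfun. rewrite (Hk_quasi k p Hp), (h1_quasi p Hp). reflexivity. }
 rewrite ext_eq by (auto; rewrite Im_gam; lra).
 unfold hfun, Hk. rewrite !Cmod_mult, Cmod_inv, Cmod_mult, !Cmod_pow.
 2: { apply Cmult_neq_0; [apply (proj2 (Cmod_gt_0 _)), Lk_pos|apply Cpow_nz, l1_neq0]. }
 have N : Ph2 t (gam t s) <> 0.
 { apply Ph2_nz. intro K. apply isZ_Im in K. rewrite Im_gam in K. lra. }
 have B : Cmod (Ph2 t (gam t s) ^ k + (/ Ph2 t (gam t s)) ^ k)%C <= 2.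
 { apply Cmod_tri. rewrite !Cmod_pow, Cmod_inv, Ph2_gam, Rinv_1, pow1 by auto. lra. }
 have Bh := h1_gam s. have Bhe : Cmod (h1 (gam t s)) ^ e <= X ^ e by (apply pow_incr; split; auto; apply Cmod_ge_0).
 have LP := Lk_pos k. have LM := Lk_mod k.
 rewrite Cmod_inv, Cmod_kap in LM by apply kap_neq0.
 have PE2 : 0 < Ecap t * Ecap t by pos.
 have IL : / Cmod (Lk k) <= (Ecap t * Ecap t) ^ k.
 { rewrite <- (Rinv_inv ((Ecap t * Ecap t) ^ k)), <- pow_inv. apply Rinv_le_contravar; auto.
  apply pow_lt. apply Rinv_0_lt_compat; auto. }
 have Pl : 0 < Cmod l1 ^ e by (apply pow_lt; auto).
 rewrite Rinv_mult.
 apply Rle_trans with ((Ecap t * Ecap t) ^ k * / Cmod l1 ^ e * (2 * X ^ e))%R.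
 - apply Rmult_le_compat.
  + pos.
  + pos.
  + apply Rmult_le_compat_r; auto. left; apply Rinv_0_lt_compat; auto.
  + apply Rmult_le_compat; auto; [pos|pos].
 - right. rewrite pow_add, pow_mult. replace (Ecap t ^ 2)%R with (Ecap t * Ecap t)%R by ring.
  unfold Rdiv. rewrite !Rpow_mult_distr, pow_inv, Rpow_mult_distr. field.
  split; [|lra]. apply pow_nonzero. lra.
Qed.

Lemma comparison : exists K, 0 < K /\ forall n, exists h, in_Pn t D n h /\ monic_at0 n h /\
 forall s, Cmod (h (gam t s)) <= K * Ecap t ^ n.
Proof.
 destruct (hfun_gam 0 ltac:(lia)) as [K0 [P0 H0]]. destruct (hfun_gam 1 ltac:(lia)) as [K1 [P1 H1]].
 exists (K0 + K1)%R. split; [lra|]. intros n.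
 have PE : forall n, 0 < Ecap t ^ n by (intros; apply pow_lt, Ecap_pos).
 destruct (Nat.Even_or_Odd n) as [[k ->]|[k ->]].
 - exists (ext t (hfun k 0)). destruct (hfun_in_Pn k 0 ltac:(lia)) as [A B].
  rewrite Nat.add_0_r in *. split; auto. split; auto. intros s. specialize (H0 k s). rewrite Nat.add_0_r in H0.
  specialize (PE (2 * k)%nat). nra.
 - exists (ext t (hfun k 1)). destruct (hfun_in_Pn k 1 ltac:(lia)) as [A B].
  split; auto. split; auto. intros s. specialize (H1 k s). specialize (PE (2 * k + 1)%nat). nra.
Qed.
End Comparison.

(** * Real sections and the extremal property *)

Lemma RInt_pos_cont (phi : R -> R) a b x0 : a < b -> (forall x, continuous phi x) ->
 (forall x, a <= x <= b -> 0 <= phi x) -> a <= x0 <= b -> 0 < phi x0 -> 0 < RInt phi a b.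
Proof.
 intros Hab Hc Hp Hx Hpos.
 have E : forall u v, ex_RInt phi u v by (intros; apply ex_RInt_contR; auto).
 have Q := Hc x0. apply continuity_pt_filterlim in Q.
 destruct (Q (phi x0 / 2)%R arith) as [d [Hd HQ]].
 assert (exists c e, (a <= c /\ c < e /\ e <= b /\ forall x, c <= x <= e -> phi x0 / 2 <= phi x)%R) as [c [e [H1 [H2 [H3 H4]]]]].
 { set (r := (Rmin d (b - a) / 2)%R). have Hr : 0 < r by pos.
  have Hr1 : r < d by (unfold r; rmin).
  have Hr2 : r <= (b - a) / 2 by (unfold r; rmin).
  have K : forall x, Rabs (x - x0) <= r -> phi x0 / 2 <= phi x.
  { intros x Hxx. destruct (Req_dec x x0) as [->|N]; [lra|].
   have D : D_x no_cond x0 x /\ R_dist x x0 < d.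
   { split; [split; [exact I|auto]|unfold R_dist; lra]. }
   specialize (HQ x D). apply Rabs_lt_between in HQ. lra. }
  destruct (Rle_dec x0 ((a + b) / 2)).
  - exists x0, (x0 + r)%R. repeat split; try lra. intros x Hxx. apply K. apply Rabs_le. lra.
  - exists (x0 - r)%R, x0. repeat split; try lra. intros x Hxx. apply K. apply Rabs_le. lra. }
 have C1 := RInt_Chasles (V := VR) phi a c b (E _ _) (E _ _).
 have C2 := RInt_Chasles (V := VR) phi c e b (E _ _) (E _ _).
 change (RInt phi a c + RInt phi c b = RInt phi a b)%R in C1.
 change (RInt phi c e + RInt phi e b = RInt phi c b)%R in C2.
 have I1 : 0 <= RInt phi a c by (apply RInt_ge_0; auto; intros; apply Hp; lra).
 have I2 : 0 <= RInt phi e b by (apply RInt_ge_0; auto; intros; apply Hp; lra).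
 have I3 : phi x0 / 2 * (e - c) <= RInt phi c e.
 { rewrite <- (Rmult_comm (e - c)). replace ((e - c) * (phi x0 / 2))%R with (RInt (fun _ => phi x0 / 2)%R c e).
  - apply RInt_le; auto; [lra|apply ex_RInt_const|intros; apply H4; lra].
  - rewrite RInt_const. reflexivity. }
 assert (0 < phi x0 / 2 * (e - c))%R by pos. lra.
Qed.

Lemma RInt_zero_cont (phi : R -> R) a b : a < b -> (forall x, continuous phi x) ->
 (forall x, a <= x <= b -> 0 <= phi x) -> RInt phi a b = 0%R -> forall x, a <= x <= b -> phi x = 0%R.
Proof.
 intros Hab Hc Hp H x Hx. destruct (Hp x Hx) as [P|P]; auto.
 have Q := RInt_pos_cont phi a b x Hab Hc Hp Hx P. lra.
Qed.

Transparent CI.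
Lemma RInt_C f a b : cint f a b -> RInt (V := C_R_CompleteNormedModule) f a b = CI f a b.
Proof.
 intros [H1 H2]. apply (is_RInt_unique (V := C_R_CompleteNormedModule)).
 apply (is_RInt_fct_extend_pair (U := R_NormedModule) (V := R_NormedModule) f).
 - apply (RInt_correct (V := VR) (fun x => Re (f x))); auto.
 - apply (RInt_correct (V := VR) (fun x => Im (f x))); auto.
Qed.

Lemma Re_CI f a b : Re (CI f a b) = RInt (fun x => Re (f x)) a b.
Proof. reflexivity. Qed.
Lemma Im_CI f a b : Im (CI f a b) = RInt (fun x => Im (f x)) a b.
Proof. reflexivity. Qed.
Opaque CI.

(** Complex conjugation of sections: the lattice and [D] are invariant, and on gamma, where the
    conjugate of p is p - tau, it conjugates the values. *)
Definition star (f : C -> C) (p : C) : C := Cconj (f (Cconj p)).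

Lemma Cconj_minus a b : Cconj (a - b) = Cconj a - Cconj b.
Proof. unfold Cconj, Cminus, Cplus, Copp; simpl. f_equal; ring. Qed.
Lemma Cconj_mult a b : Cconj (a * b) = Cconj a * Cconj b.
Proof. unfold Cconj, Cmult; simpl. f_equal; ring. Qed.
Lemma Cconj_plus a b : Cconj (a + b) = Cconj a + Cconj b.
Proof. unfold Cconj, Cplus; simpl. f_equal; ring. Qed.
Lemma Cconj_inv2 a : Cconj (Cconj a) = a.
Proof. destruct a; unfold Cconj; simpl. f_equal; ring. Qed.
Lemma Cmod_conj2 a : Cmod (Cconj a) = Cmod a.
Proof. unfold Cmod, Cconj; simpl. f_equal. ring. Qed.
Lemma Cconj_R x : Cconj (RtoC x) = RtoC x.
Proof. unfold Cconj, RtoC; simpl. f_equal; ring. Qed.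
Lemma Cconj_pow a n : Cconj (a ^ n) = Cconj a ^ n.
Proof. induction n as [|n IH]; [apply Cconj_R|]. rewrite !Cpow_S, Cconj_mult, IH. reflexivity. Qed.

Lemma star_chol f p : chol f (Cconj p) -> chol (star f) p.
Proof.
 intros [l Hl]. exists (Cconj l). intros eps He. destruct (Hl eps He) as [d [Hd H]]. exists d; split; auto.
 intros h Hh. specialize (H (Cconj h)). rewrite Cmod_conj2 in H. specialize (H Hh).
 unfold star. rewrite Cconj_plus. rewrite <- (Cconj_inv2 h) at 2. rewrite <- Cconj_mult, <- !Cconj_minus, Cmod_conj2. exact H.
Qed.

Lemma in_lattice_conj t p : in_lattice t (Cconj p) -> in_lattice t p.
Proof.
 intros [a [b E]]. exists a, (- b)%Z. rewrite <- (Cconj_inv2 p), E. unfold latpt, tauC. rewrite opp_IZR.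
 unfold Cconj, Cplus, Cmult, RtoC; simpl. f_equal; ring.
Qed.

Lemma in_Pn_star t D n f : in_Pn t D n f -> in_Pn t D n (star f).
Proof.
 intros [H1 [H2 [H3 [H4 H5]]]]. repeat split.
 - intros p. unfold star. rewrite Cconj_plus, Cconj_R, H1. reflexivity.
 - intros p. unfold star. f_equal. rewrite <- (H2 (Cconj (p + tauC t))). f_equal.
  unfold Cconj, tauC, Cplus; simpl. destruct p; f_equal; ring.
 - intros p N1 N2. apply holo_at_chol, star_chol, holo_at_chol. apply H3.
  + intro K. apply N1, in_lattice_conj; auto.
  + intro K. apply N2, in_lattice_conj. rewrite Cconj_minus, Cconj_R. auto.
 - destruct H4 as [M [r [Hr H]]]. exists M, r. split; auto. intros p Hp. rewrite <- (Cmod_conj2 p) in Hp.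
  specialize (H _ Hp). unfold star. rewrite <- (Cmod_conj2 (Cmult _ _)), Cconj_mult, Cconj_pow, Cconj_inv2. exact H.
 - destruct H5 as [M [r [Hr H]]]. exists M, r. split; auto. intros p Hp.
  rewrite <- (Cmod_conj2 (Cminus p _)), Cconj_minus, Cconj_R in Hp.
  specialize (H _ Hp). unfold star. rewrite <- (Cmod_conj2 (Cmult _ _)), Cconj_mult, Cconj_minus, Cconj_R, Cconj_inv2. exact H.
Qed.

Lemma monic_star n f : monic_at0 n f -> monic_at0 n (star f).
Proof.
 intros [M [r [Hr H]]]. exists M, r. split; auto. intros p Hp. rewrite <- (Cmod_conj2 p) in Hp.
 specialize (H _ Hp). rewrite Cmod_conj2 in H. unfold star.
 rewrite <- (Cmod_conj2 (Cminus _ _)), Cconj_minus, Cconj_mult, Cconj_pow, Cconj_inv2, Cconj_R. exact H.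
Qed.

(** The leading terms cancel up to O(p), which lowers the order of the pole by one. *)
Lemma monic_diff t D n f g : (1 <= n)%nat -> in_Pn t D n f -> in_Pn t D n g -> monic_at0 n f -> monic_at0 n g ->
 in_Pn t D (n - 1) (fun p => f p - g p).
Proof.
 intros Hn [H1 [H2 [H3 [H4 H5]]]] [G1 [G2 [G3 [G4 G5]]]] [M [r [Hr H]]] [M' [r' [Hr' H']]]. repeat split.
 - intros p. rewrite H1, G1. reflexivity.
 - intros p. rewrite H2, G2. reflexivity.
 - intros p N1 N2. apply holo_at_chol, chol_minus; apply holo_at_chol; auto.
 - exists (M + M')%R, (Rmin r r'). split; [pos|]. intros p [Hp1 Hp2].
  destruct (Rlt_min Hp2) as [Q0 Q1].
  specialize (H p (conj Hp1 Q0)). specialize (H' p (conj Hp1 Q1)).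
  apply Rmult_le_reg_l with (Cmod p); auto. rewrite <- Cmod_mult.
  replace (p * (p ^ (n - 1) * (f p - g p))) with ((p ^ n * f p - 1) + - (p ^ n * g p - 1)).
  + apply Cmod_tri. rewrite Cmod_opp. lra.
  + replace n with (S (n - 1))%nat at 1 2 by lia. rewrite Cpow_S. ring.
 - destruct H5 as [M1 [r1 [Hr1 K1]]]. destruct G5 as [M2 [r2 [Hr2 K2]]].
  exists (M1 + M2)%R, (Rmin r1 r2). split; [pos|]. intros p [Hp1 Hp2].
  destruct (Rlt_min Hp2) as [Q0 Q1].
  specialize (K1 p (conj Hp1 Q0)). specialize (K2 p (conj Hp1 Q1)).
  replace ((p - RtoC D) * (f p - g p)) with ((p - RtoC D) * f p + - ((p - RtoC D) * g p)) by ring.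
  apply Cmod_tri. rewrite Cmod_opp. lra.
Qed.

Lemma star_gam t D n f s : in_Pn t D n f -> star f (gam t s) = Cconj (f (gam t s)).
Proof.
 intros [_ [H2 _]]. unfold star. f_equal. rewrite <- H2. f_equal.
 unfold gam, tauC, Cconj, Cplus, RtoC; simpl. f_equal; field.
Qed.

Lemma gam_not_lattice t s : 0 < t -> ~ in_lattice t (gam t s).
Proof.
 intros Ht [a [b E]]. have K := f_equal Im E. rewrite Im_gam in K.
 have K2 : (Im (latpt t a b) = IZR b * t)%R by (unfold latpt, tauC, Im, Cplus, Cmult, RtoC; simpl; ring).
 rewrite K2 in K. assert (2 * IZR b = 1)%R by (apply Rmult_eq_reg_r with t; lra).
 rewrite <- mult_IZR in H. apply eq_IZR in H. lia.
Qed.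

Lemma gam_chol t D n f s : 0 < t -> in_Pn t D n f -> chol f (gam t s).
Proof.
 intros Ht [_ [_ [H3 _]]]. apply holo_at_chol, H3; [apply gam_not_lattice; auto|].
 replace (gam t s - RtoC D) with (gam t (s - D)) by (unfold gam; rewrite RtoC_minus; ring).
 apply gam_not_lattice; auto.
Qed.

Lemma gam_1 t s : gam t (s + 1) = gam t s + 1.
Proof. unfold gam. rewrite RtoC_plus. ring. Qed.

Lemma gam_ccontR f t s : chol f (gam t s) -> ccontR (fun s => f (gam t s)) s.
Proof.
 intros H. apply (ccont_ccontR f (gam t)).
 - apply chol_cont; auto.
 - intros u v. rewrite gam_minus, Cmod_R. lra.
Qed.

Lemma ccontR_Re f x : ccontR f x -> continuous (fun s => Re (f s)) x.
Proof. intros H; apply H. Qed.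

Section Weight.
Variables t D : R.
Hypothesis Ht : 0 < t.
Variable w : C -> C.
Hypothesis Hw_hol : exists delta : R, 0 < delta /\ forall p, Rabs (Im p - t / 2) < delta -> holo_at w p.
Hypothesis Hw_per : forall p, w (Cplus p (RtoC 1)) = w p.
Hypothesis Hw_real : forall s, Im (w (gam t s)) = 0%R.

Definition wt (s : R) : R := exp (Re (w (gam t s))).

Lemma cexp_wt s : cexp (w (gam t s)) = RtoC (wt s).
Proof. unfold cexp, wt. rewrite Hw_real, cos_0, sin_0. unfold RtoC. f_equal; ring. Qed.

Lemma wt_cont s : continuous wt s.
Proof.
 apply (continuous_comp (fun s => Re (w (gam t s))) exp).
 - apply (ccontR_Re (fun s => w (gam t s))), (gam_ccontR w). apply holo_at_chol. destruct Hw_hol as [d [Hd H]]. apply H. rewrite Im_gam.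
  rewrite Rminus_diag, Rabs_R0. auto.
 - apply continuity_pt_filterlim. apply derivable_continuous_pt, derivable_pt_exp.
Qed.

Lemma wt_pos s : 0 < wt s.
Proof. apply exp_pos. Qed.

Lemma wt_bounds : exists a b, 0 < a /\ 0 < b /\ forall s, 0 <= s <= 1 -> a <= wt s <= b.
Proof.
 destruct (periodic_bounded wt 0 1 arith wt_cont) as [M [HM H]].
 destruct (continuity_ab_min wt 0 1 arith) as [m [Hm _]].
 { intros c _. apply continuity_pt_filterlim, wt_cont. }
 exists (wt m), M. split; [pos|]. split; auto. intros s Hs. split; [auto|].
 eapply Rle_trans; [apply Rle_abs|auto].
Qed.

Lemma ccontR_mult f g x : ccontR f x -> ccontR g x -> ccontR (fun s => f s * g s) x.
Proof.
 intros [H1 H2] [H3 H4]. split; unfold Cmult, Re, Im; simpl.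
 - apply contR_minus; apply contR_mult; auto.
 - apply contR_plus; apply contR_mult; auto.
Qed.

Lemma ccontR_real (u : R -> R) x : continuous u x -> ccontR (fun s => RtoC (u s)) x.
Proof. intros H. split; unfold Re, Im, RtoC; simpl; auto. apply contR_const. Qed.

Variable n : nat.
Variable f : C -> C.
Hypothesis Hn : (1 <= n)%nat.
Hypothesis Hf : monic_orth_section t D w n f.

Lemma orth_CI g : in_Pn t D (n - 1) g -> CI (fun s => f (gam t s) * g (gam t s) * RtoC (wt s)) 0 1 = 0.
Proof.
 intros Hg. destruct Hf as [H1 [H2 H3]]. rewrite <- (H3 g Hg). rewrite RInt_C.
 - apply CI_ext; [lra|]. intros; rewrite cexp_wt; reflexivity.
 - apply cint_cont; [lra|]. intros x _.
  have E : forall s, f (gam t s) * g (gam t s) * cexp (w (gam t s)) = f (gam t s) * g (gam t s) * RtoC (wt s) by (intros; rewrite cexp_wt; auto).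
  have Q : ccontR (fun s => f (gam t s) * g (gam t s) * RtoC (wt s)) x.
  { apply ccontR_mult; [apply ccontR_mult; apply gam_ccontR; eapply gam_chol; eauto|]. apply ccontR_real, wt_cont. }
  destruct Q as [Q1 Q2]. split.
  + apply (continuous_ext (fun u => Re (f (gam t u) * g (gam t u) * RtoC (wt u))%C)); auto. intros; rewrite E; auto.
  + apply (continuous_ext (fun u => Im (f (gam t u) * g (gam t u) * RtoC (wt u))%C)); auto. intros; rewrite E; auto.
Qed.

(** Orthogonality is stated for the bilinear form, without conjugation. Testing it on d = f - star f
    and on star d gives that the weighted norm of d on gamma vanishes; after this the form
    restricted to f behaves as an inner product. *)
Lemma section_real s : f (gam t s) = RtoC (Re (f (gam t s))).
Proof.
 destruct Hf as [H1 [H2 _]].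
 set (d := fun p => f p - star f p).
 have Hd : in_Pn t D (n - 1) d by (apply monic_diff; auto; [apply in_Pn_star; auto|apply monic_star; auto]).
 have Cd : forall s, ccontR (fun s => d (gam t s)) s by (intros; apply gam_ccontR; eapply gam_chol; eauto).
 have O1 := orth_CI (star d) (in_Pn_star _ _ _ _ Hd). have O2 := orth_CI d Hd.
 have R1 := f_equal Re O1. have R2 := f_equal Re O2. rewrite Re_CI in R1, R2.
 (* |d|^2 = f conj d - conj f conj d, and Re of the second is Re (f d) *)
 have Z : RInt (fun s => (Cmod (d (gam t s)) * Cmod (d (gam t s)) * wt s)%R) 0 1 = 0%R.
 { have C1 : forall g, in_Pn t D (n - 1) g -> forall s, continuous (fun s => Re (f (gam t s) * g (gam t s) * RtoC (wt s))%C) s.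
  { intros g Hg x. apply (ccontR_Re (fun s => f (gam t s) * g (gam t s) * RtoC (wt s))).
   apply (ccontR_mult (fun s => f (gam t s) * g (gam t s)) (fun s => RtoC (wt s))).
   - apply ccontR_mult; apply gam_ccontR; eapply gam_chol; eauto.
   - apply ccontR_real, wt_cont. }
  change (Re 0) with 0%R in R1, R2.
  transitivity (RInt (fun s => Re (f (gam t s) * star d (gam t s) * RtoC (wt s))%C) 0 1 -
   RInt (fun s => Re (f (gam t s) * d (gam t s) * RtoC (wt s))%C) 0 1)%R; [|pos].
  rewrite <- RInt_minusR.
  - apply RInt_ext. intros x _. req.
   rewrite (star_gam t D (n - 1) d x Hd). rewrite <- Cmod_mult.
   unfold d. rewrite (star_gam t D n f x H1).
   destruct (f (gam t x)) as [a b]. unfold Cmod, Cconj, Cmult, Cminus, Cplus, Copp, Re, RtoC; simpl.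
   match goal with |- (sqrt ?A * _)%R = _ => replace A with ((4 * (b * b)) * (4 * (b * b)))%R by ring end.
   rewrite sqrt_square by nra. ring.
  - apply ex_RInt_contR. apply C1. apply in_Pn_star; auto.
  - apply ex_RInt_contR. apply C1. auto. }
 have Hz : forall x, 0 <= x <= 1 -> d (gam t x) = 0.
 { intros x Hx.
  have Q := RInt_zero_cont (fun s => (Cmod (d (gam t s)) * Cmod (d (gam t s)) * wt s)%R) 0 1 arith.
  have Q1 : (Cmod (d (gam t x)) * Cmod (d (gam t x)) * wt x = 0)%R.
  { apply Q; auto.
   - intros y.
    apply (continuous_ext (fun s => ((Re (d (gam t s)) * Re (d (gam t s)) + Im (d (gam t s)) * Im (d (gam t s))) * wt s)%R)).
    + intros u. unfold Cmod. rewrite sqrt_sqrt by nra. simpl. ring.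
    + destruct (Cd y). apply contR_mult; [|apply wt_cont]. apply contR_plus; apply contR_mult; auto.
   - intros y _. repeat apply Rmult_le_pos; try apply Cmod_ge_0. left; apply wt_pos. }
  have G := Cmod_ge_0 (d (gam t x)).
  apply Cmod_eq_0. destruct G as [G|G]; auto. exfalso.
  assert (0 < Cmod (d (gam t x)) * Cmod (d (gam t x)) * wt x)%R by pos. lra. }
 have Hall : d (gam t s) = 0.
 { destruct (frac_shift s) as [k Hk].
  have P : forall x, d (gam t (x + 1)) = d (gam t x).
  { intros x. rewrite gam_1. apply Hd. }
  have PR : forall x (k : BinNums.Z), d (gam t (x + IZR k)) = d (gam t x).
  { intros x k'. apply Ceq_ReIm.
   - apply (periodic_Z (fun x => Re (d (gam t x)))). intros; rewrite P; auto.
   - apply (periodic_Z (fun x => Im (d (gam t x)))). intros; rewrite P; auto. }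
  replace s with ((s - IZR k) + IZR k)%R by ring. rewrite PR. apply Hz. lra. }
 unfold d in Hall. rewrite (star_gam t D n f s H1) in Hall.
 destruct (f (gam t s)) as [a b]. injection Hall as E1 E2.
 unfold RtoC, Re; simpl. f_equal. lra.
Qed.

Lemma orth_real g : in_Pn t D (n - 1) g ->
 RInt (fun s => (Re (f (gam t s)) * Re (g (gam t s)) * wt s)%R) 0 1 = 0%R.
Proof.
 intros Hg. have O := f_equal Re (orth_CI g Hg). rewrite Re_CI in O. change (Re 0) with 0%R in O.
 etransitivity; [|exact O]. apply RInt_ext. intros x _. req. rewrite section_real. unfold Re, RtoC, Cmult; simpl. ring.
Qed.

Lemma section_cont s : continuous (fun s => Re (f (gam t s))) s.
Proof. apply (ccontR_Re (fun s => f (gam t s))), (gam_ccontR f). destruct Hf. eapply gam_chol; eauto. Qed.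

(** With g = h - f in the space of order n - 1, |h|^2 >= f^2 + 2 f Re g pointwise because f is real,
    and the cross term integrates to 0. *)
Lemma section_minimal h : in_Pn t D n h -> monic_at0 n h ->
 RInt (fun s => (Re (f (gam t s)) * Re (f (gam t s)) * wt s)%R) 0 1 <= RInt (fun s => (Cmod (h (gam t s)) ^ 2 * wt s)%R) 0 1.
Proof.
 intros Hh Mh. destruct Hf as [H1 [H2 _]].
 set (g := fun p => h p - f p).
 have Hg : in_Pn t D (n - 1) g by (apply monic_diff; auto).
 have O := orth_real g Hg.
 have Cf := section_cont.
 have Cg : forall s, ccontR (fun s => g (gam t s)) s by (intros; apply gam_ccontR; eapply gam_chol; eauto).
 have Chh : forall s, ccontR (fun s => h (gam t s)) s by (intros; apply gam_ccontR; eapply gam_chol; eauto).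
 have C1 : forall s, continuous (fun s => (Re (f (gam t s)) * Re (f (gam t s)) * wt s)%R) s.
 { intros. apply contR_mult; [|apply wt_cont]. apply contR_mult; auto. }
 have C2 : forall s, continuous (fun s => (Re (f (gam t s)) * Re (g (gam t s)) * wt s)%R) s.
 { intros. apply contR_mult; [|apply wt_cont]. apply contR_mult; auto. exact (ccontR_Re (fun s => g (gam t s)) _ (Cg _)). }
 apply Rle_trans with (RInt (fun s => (Re (f (gam t s)) * Re (f (gam t s)) * wt s + 2 * (Re (f (gam t s)) * Re (g (gam t s)) * wt s))%R) 0 1).
 - have E1 : ex_RInt (fun s => (Re (f (gam t s)) * Re (f (gam t s)) * wt s)%R) 0 1 by exact (ex_RInt_contR _ 0 1 C1).
  have E2 : ex_RInt (fun s => (Re (f (gam t s)) * Re (g (gam t s)) * wt s)%R) 0 1 by exact (ex_RInt_contR _ 0 1 C2).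
  rewrite (RInt_plusR _ _ _ _ E1 (ex_RInt_mulR 2 _ _ _ E2)), (RInt_mulR _ _ _ _ E2), O. lra.
 - apply RInt_le; [lra| | |].
  + apply ex_RInt_plusR; [|apply ex_RInt_mulR]; apply ex_RInt_contR; auto.
  + apply ex_RInt_contR. intros s.
   apply (continuous_ext (fun s => ((Re (h (gam t s)) * Re (h (gam t s)) + Im (h (gam t s)) * Im (h (gam t s))) * wt s)%R)).
   * intros u. unfold Cmod. rewrite <- Rsqr_pow2, Rsqr_sqrt by nra. unfold Re, Im. simpl. ring.
   * destruct (Chh s). apply contR_mult; [|apply wt_cont]. apply contR_plus; apply contR_mult; auto.
  + intros x _. have P := wt_pos x.
   have E : h (gam t x) = RtoC (Re (f (gam t x))) + g (gam t x) by (rewrite <- section_real; unfold g; ring).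
   rewrite E. set (u := Re (f (gam t x))). destruct (g (gam t x)) as [a b].
   unfold Cmod. rewrite <- Rsqr_pow2, Rsqr_sqrt by (apply Rplus_le_le_0_compat; apply pow2_ge_0). unfold Re, RtoC, Cplus; simpl.
   assert (u * u + 2 * (u * a) <= (u + a) * ((u + a) * 1) + (0 + b) * ((0 + b) * 1))%R by nra.
   match goal with |- (?A * ?P1 + 2 * (?B * ?P1) <= ?Z * ?P1)%R => replace (A * P1 + 2 * (B * P1))%R with ((A + 2 * B) * P1)%R by ring end.
   apply Rmult_le_compat_r; lra.
Qed.
End Weight.

(** The weight enters through a lower bound a and an upper bound b on gamma, whence the ratio b / a
    in the constant; it does not depend on n. *)
Theorem section_norm t D w : 0 < t -> 0 < D < 1 ->
 (exists delta : R, 0 < delta /\ forall p, Rabs (Im p - t / 2) < delta -> holo_at w p) ->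
 (forall s, Im (w (gam t s)) = 0%R) ->
 exists K, 0 < K /\ forall n f, (1 <= n)%nat -> monic_orth_section t D w n f ->
  RInt (fun s => (Re (f (gam t s)) * Re (f (gam t s)))%R) 0 1 <= K * (Ecap t ^ n) ^ 2.
Proof.
 intros Ht HD Hw Hr.
 destruct (comparison t D Ht HD) as [K [HK HC]].
 destruct (wt_bounds t w Hw) as [a [b [Ha [Hb Hwt]]]].
 exists (K ^ 2 * b / a)%R. split.
 { pos. }
 intros n f Hn Hf. destruct (HC n) as [h [H1 [H2 H3]]].
 have M := section_minimal t D Ht w Hw Hr n f Hn Hf h H1 H2.
 have Cf := section_cont t D Ht w n f Hf. have Cw := wt_cont t w Hw.
 apply Rmult_le_reg_l with a; auto.
 replace (a * (K ^ 2 * b / a * (Ecap t ^ n) ^ 2))%R with (K ^ 2 * b * (Ecap t ^ n) ^ 2)%R by (field; lra).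
 eapply Rle_trans; [|eapply Rle_trans; [apply M|]].
 - rewrite <- RInt_mulR by (apply ex_RInt_contR; intros; apply contR_mult; auto).
  apply RInt_le; [lra| | |].
  + apply ex_RInt_mulR, ex_RInt_contR; intros; apply contR_mult; auto.
  + apply ex_RInt_contR; intros; apply contR_mult; auto. apply contR_mult; auto.
  + intros x Hx. have B := Hwt x arith. nra.
 - apply Rle_trans with (RInt (fun _ => (K ^ 2 * b * (Ecap t ^ n) ^ 2)%R) 0 1).
  + apply RInt_le; [lra| |apply ex_RInt_const|].
   * apply ex_RInt_contR. intros s.
    have Chh : ccontR (fun s => h (gam t s)) s by (apply gam_ccontR; eapply gam_chol; eauto).
    apply (continuous_ext (fun s => ((Re (h (gam t s)) * Re (h (gam t s)) + Im (h (gam t s)) * Im (h (gam t s))) * wt t w s)%R)).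
    -- intros u. unfold Cmod. rewrite <- Rsqr_pow2, Rsqr_sqrt by nra. unfold Re, Im. simpl. ring.
    -- destruct Chh. apply contR_mult; auto. apply contR_plus; apply contR_mult; auto.
   * intros x Hx. have B := Hwt x arith. specialize (H3 x).
    assert (Cmod (h (gam t x)) ^ 2 <= (K * Ecap t ^ n) ^ 2)%R by (apply pow_incr; split; auto; apply Cmod_ge_0).
    replace (K ^ 2 * b * (Ecap t ^ n) ^ 2)%R with ((K * Ecap t ^ n) ^ 2 * b)%R by ring.
    apply Rmult_le_compat; try lra. apply pow_le, Cmod_ge_0.
  + rewrite RInt_const. change (scal (1 - 0)%R (K ^ 2 * b * (Ecap t ^ n) ^ 2)%R) with ((1 - 0) * (K ^ 2 * b * (Ecap t ^ n) ^ 2))%R. lra.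
Qed.

(** * Zeros on the cycle *)

(** For tau = 1 or -1: on a punctured neighbourhood of x, h has the sign of tau (s - x)^k. Under
    products the exponents add and the signs multiply. *)
Definition sgnloc (h : R -> R) (x : R) (k : nat) (tau : R) : Prop :=
 exists d, 0 < d /\ forall s, 0 < Rabs (s - x) < d -> 0 < tau * (h s * (s - x) ^ k).

Lemma sgnloc_mult h1 h2 x k1 k2 t1 t2 : sgnloc h1 x k1 t1 -> sgnloc h2 x k2 t2 ->
 sgnloc (fun s => (h1 s * h2 s)%R) x (k1 + k2) (t1 * t2).
Proof.
 intros [d1 [P1 H1]] [d2 [P2 H2]]. exists (Rmin d1 d2). split; [pos|].
 intros s [Q1 Q2]. specialize (H1 s (conj Q1 (proj1 (Rlt_min Q2)))).
 specialize (H2 s (conj Q1 (proj2 (Rlt_min Q2)))).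
 rewrite pow_add. replace (t1 * t2 * (h1 s * h2 s * ((s - x) ^ k1 * (s - x) ^ k2)))%R
  with ((t1 * (h1 s * (s - x) ^ k1)) * (t2 * (h2 s * (s - x) ^ k2)))%R by ring.
 apply Rmult_lt_0_compat; auto.
Qed.

Lemma sgnloc_cont h x : continuous h x -> h x <> 0%R -> exists tau, (tau = 1 \/ tau = -1)%R /\ sgnloc h x 0 tau.
Proof.
 intros Hc Hx. apply continuity_pt_filterlim in Hc.
 destruct (Hc (Rabs (h x)) (Rabs_pos_lt _ Hx)) as [d [Hd H]].
 have K : forall s, 0 < Rabs (s - x) < d -> Rabs (h s - h x) < Rabs (h x).
 { intros s [Q1 Q2]. apply H. split; [split; [exact I|]|auto]. intro E. rewrite E, Rminus_diag, Rabs_R0 in Q1. lra. }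
 destruct (Rlt_dec 0 (h x)) as [P|P].
 - exists 1%R. split; auto. exists d. split; auto. intros s Hs. specialize (K s Hs).
  rewrite (Rabs_pos_eq (h x)) in K by lra. apply Rabs_lt_between in K. lra.
 - exists (-1)%R. split; auto. exists d. split; auto. intros s Hs. specialize (K s Hs).
  rewrite (Rabs_left (h x)) in K by lra. apply Rabs_lt_between in K. lra.
Qed.

Lemma sin_nz u : 0 < Rabs u < 1 -> sin (PI * u) <> 0%R.
Proof.
 intros H. pose proof PI_RGT_0. destruct (Rle_dec 0 u) as [P|P].
 - rewrite Rabs_pos_eq in H by auto. assert (0 < sin (PI * u))%R; [|lra]. apply sin_gt_0; [pos|nra].
 - rewrite Rabs_left in H by lra. assert (0 < sin (PI * - u))%R.
  { apply sin_gt_0; [pos|nra]. }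
  replace (PI * - u)%R with (- (PI * u))%R in H1 by ring. rewrite sin_neg in H1. lra.
Qed.

Lemma sgnloc_sin x a : 0 <= x < 1 -> 0 <= a < 1 ->
 exists tau, (tau = 1 \/ tau = -1)%R /\ sgnloc (fun s => sin (PI * (s - a))) x (if Req_EM_T a x then 1 else 0) tau.
Proof.
 intros Hx Ha. destruct Req_EM_T as [->|N].
 - exists 1%R. split; auto. exists 1%R. split; [lra|]. intros s Hs. pose proof PI_RGT_0.
  rewrite Rmult_1_l, pow_1. destruct (Rle_dec 0 (s - x)) as [P|P].
  + rewrite Rabs_pos_eq in Hs by auto. apply Rmult_lt_0_compat; [|lra]. apply sin_gt_0; [pos|nra].
  + rewrite Rabs_left in Hs by lra. replace (PI * (s - x))%R with (- (PI * - (s - x)))%R by ring. rewrite sin_neg.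
   assert (0 < sin (PI * - (s - x)))%R by (apply sin_gt_0; [apply Rmult_lt_0_compat; lra|nra]). nra.
 - apply sgnloc_cont.
  + eapply contR_derive. auto_derive; auto.
  + apply sin_nz. split; [apply Rabs_pos_lt; lra|]. apply Rabs_def1; lra.
Qed.

Lemma sgnloc_sinp x l : 0 <= x < 1 -> (forall a, In a l -> 0 <= a < 1) ->
 exists tau, (tau = 1 \/ tau = -1)%R /\ sgnloc (sinp l) x (count_occ Req_EM_T l x) tau.
Proof.
 intros Hx. induction l as [|a l IH]; intros Hl.
 - exists 1%R. split; auto. exists 1%R. split; [lra|]. intros; simpl; lra.
 - destruct IH as [t2 [H2 S2]]; [intros; apply Hl; right; auto|].
  destruct (sgnloc_sin x a Hx (Hl a (or_introl eq_refl))) as [t1 [H1 S1]].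
  exists (t1 * t2)%R. split; [destruct H1, H2; subst; lra|].
  have Q := sgnloc_mult _ _ _ _ _ _ _ S1 S2. cbn [count_occ sinp].
  destruct Req_EM_T; exact Q.
Qed.

Lemma sinp_cont l s : continuous (sinp l) s.
Proof.
 induction l as [|a l IH]; simpl; [cts|]. apply contR_mult; auto. eapply contR_derive. auto_derive; auto.
Qed.

Lemma sinp_shift l s : sinp l (s + 1) = ((-1) ^ length l * sinp l s)%R.
Proof.
 induction l as [|a l IH]; simpl; [ring|]. rewrite IH.
 replace (PI * (s + 1 - a))%R with (PI * (s - a) + PI)%R by ring. rewrite neg_sin. ring.
Qed.

(* Connectedness of R. *)
Lemma sign_connected (h : R -> R) : (forall x, continuous h x) ->
 (forall x, exists tau, (tau = 1 \/ tau = -1)%R /\ sgnloc h x 0 tau) ->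
 exists sg, (sg = 1 \/ sg = -1)%R /\ (forall x, sgnloc h x 0 sg) /\ forall s, 0 <= sg * h s.
Proof.
 intros Hc H.
 (* The local sign as a function of x. It is locally constant, hence continuous, and being never 0
    it is constant by the intermediate value theorem. *)
 set (f := fun x => if excluded_middle_informative (sgnloc h x 0 1) then 1%R else (-1)%R).
 have Hf : forall x, (f x = 1 \/ f x = -1)%R /\ sgnloc h x 0 (f x).
 { intros x. unfold f. destruct excluded_middle_informative as [Y|N]; [pos|].
  split; auto. destruct (H x) as [tau [[-> | ->] S]]; auto. contradiction. }
 have Lc : forall x, exists d, 0 < d /\ forall s, Rabs (s - x) < d -> f s = f x.
 { intros x. destruct (Hf x) as [V [d [Hd S]]]. exists d. split; auto. intros s Hs.
  destruct (Req_dec s x) as [->|N]; auto.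
  destruct (Hf s) as [V2 [d2 [Hd2 S2]]].
  set (r := (Rmin (Rmin d2 (d - Rabs (s - x))) (Rabs (s - x)) / 2)%R).
  have Ps : 0 < Rabs (s - x) by (apply Rabs_pos_lt; lra).
  have Hr : 0 < r by pos.
  have Hr1 : r < d2 by (unfold r; rmin).
  have Hr2 : r < d - Rabs (s - x) by (unfold r; rmin).
  have Hr3 : r < Rabs (s - x) by (unfold r; rmin).
  have A1 := S2 (s + r)%R. replace (s + r - s)%R with r in A1 by ring. rewrite Rabs_pos_eq in A1 by lra. specialize (A1 (conj Hr Hr1)).
  have A2 := S (s + r)%R.
  have B : 0 < Rabs (s + r - x) < d.
  { replace (s + r - x)%R with ((s - x) + r)%R by ring. unfold Rabs in *; repeat destruct Rcase_abs; lra. }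
  specialize (A2 B). destruct V as [V|V], V2 as [V2|V2]; rewrite V, V2 in *; auto; nra. }
 have Cf : continuity f.
 { intros x eps He. destruct (Lc x) as [d [Hd HL]]. exists d. split; auto. intros s [_ Hs]. simpl in *. unfold R_dist in *.
  rewrite HL by auto. rewrite Rminus_diag, Rabs_R0. auto. }
 have K : forall a b, f a = f b.
 { intros a b. destruct (Req_dec (f a) (f b)) as [|N]; auto. exfalso.
  destruct (IVT_gen f a b 0 Cf) as [x [_ Hx]].
  - destruct (Hf a) as [[A|A] _], (Hf b) as [[B|B] _]; rewrite A, B in *; try lra;
   unfold Rmin, Rmax; destruct Rle_dec; lra.
  - destruct (Hf x) as [[A|A] _]; lra. }
 exists (f 0%R). split; [apply Hf|]. split.
 - intros x. rewrite (K 0%R x). apply Hf.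
 - intros s. destruct (Rle_dec 0 (f 0%R * h s)) as [|N]; auto. exfalso.
  have N2 : h s <> 0%R by (intro E; apply N; rewrite E; lra).
  destruct (sgnloc_cont h s (Hc s) N2) as [tau [Ht [d [Hd S]]]].
  destruct (Hf s) as [V [d2 [Hd2 S2]]]. rewrite (K 0%R s) in N.
  have Q := Hc s. apply continuity_pt_filterlim in Q.
  destruct (Q (Rabs (h s)) (Rabs_pos_lt _ N2)) as [d3 [Hd3 H3]].
  set (r := (Rmin d2 d3 / 2)%R).
  have Hr : 0 < r by pos.
  have Hr1 : r < d2 by (unfold r; rmin).
  have Hr2 : r < d3 by (unfold r; rmin).
  specialize (S2 (s + r)%R). replace (s + r - s)%R with r in S2 by ring. rewrite Rabs_pos_eq in S2 by lra. specialize (S2 (conj Hr Hr1)).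
  have D : D_x no_cond s (s + r) /\ R_dist (s + r) s < d3.
  { split; [split; [exact I|lra]|]. unfold R_dist. replace (s + r - s)%R with r by ring. rewrite Rabs_pos_eq; lra. }
  specialize (H3 _ D). destruct V as [V|V]; rewrite V in *.
  + rewrite (Rabs_left (h s)) in H3 by lra. apply Rabs_lt_between in H3. lra.
  + rewrite (Rabs_pos_eq (h s)) in H3 by lra. apply Rabs_lt_between in H3. lra.
Qed.

Lemma in_Pn_le t D m n f : (m <= n)%nat -> in_Pn t D m f -> in_Pn t D n f.
Proof.
 intros L [H1 [H2 [H3 [[M [r [Hr H4]]] H5]]]]. repeat split; auto.
 exists M, (Rmin r 1). split; [pos|]. intros p [Hp1 Hp2].
 destruct (Rlt_min Hp2) as [Q0 Q1].
 specialize (H4 p (conj Hp1 Q0)). replace n with ((n - m) + m)%nat by lia.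
 rewrite Cpow_add_r, <- Cmult_assoc, Cmod_mult, Cmod_pow.
 assert (Cmod p ^ (n - m) <= 1)%R by (rewrite <- (pow1 (n - m)); apply pow_incr; split; [pos|lra]).
 assert (0 <= Cmod (p ^ m * f p))%R by apply Cmod_ge_0.
 nra.
Qed.

(** In f = (p - z)^k g the factor g is real on gamma near z, and at z itself by continuity; its
    nonzero value there gives the sign. *)
Lemma zero_order_sgnloc t f x k : (forall s, f (gam t s) = RtoC (Re (f (gam t s)))) ->
 zero_order f (gam t x) k -> exists tau, (tau = 1 \/ tau = -1)%R /\ sgnloc (fun s => Re (f (gam t s))) x k tau.
Proof.
 intros Hr [r [g [Hr0 [Hg0 [Hgh Hfg]]]]].
 have Cg : ccont g (gam t x).
 { apply chol_cont, holo_at_chol, Hgh. replace (gam t x - gam t x) with (RtoC 0) by ring. rewrite Cmod_0. auto. }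
 have R1 : forall s, Rabs (s - x) < r -> f (gam t s) = RtoC (s - x) ^ k * g (gam t s).
 { intros s Hs. rewrite Hfg; rewrite gam_minus; auto. rewrite Cmod_R. auto. }
 have Rg : forall s, 0 < Rabs (s - x) < r -> (Re (f (gam t s)) = (s - x) ^ k * Re (g (gam t s)))%R /\ Im (g (gam t s)) = 0%R.
 { intros s Hs. specialize (R1 s (proj2 Hs)). rewrite Hr in R1.
  have N : ((s - x) ^ k <> 0)%R.
  { apply pow_nonzero. intro E. rewrite E, Rabs_R0 in Hs. lra. }
  rewrite <- RtoC_pow in R1.
  have A1 := f_equal Re R1. have A2 := f_equal Im R1.
  unfold Re, Im, RtoC, Cmult in A1, A2; simpl in A1, A2. unfold Re, Im. split.
  - pos.
  - apply Rmult_eq_reg_l with ((s - x) ^ k)%R; auto. lra. }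
 have Cr : forall eps, 0 < eps -> exists d, 0 < d /\ forall s, Rabs (s - x) < d -> Cmod (g (gam t s) - g (gam t x))%C < eps.
 { intros eps He. destruct (Cg eps He) as [d [Hd H]]. exists d. split; auto. intros s Hs. apply H. rewrite gam_minus, Cmod_R. auto. }
 have I0 : Im (g (gam t x)) = 0%R.
 { destruct (Req_dec (Im (g (gam t x))) 0) as [|N]; auto. exfalso.
  destruct (Cr _ (Rabs_pos_lt _ N)) as [d [Hd H]].
  set (e := (Rmin d r / 2)%R).
  have He : 0 < e by pos.
  have He1 : e < d by (unfold e; rmin).
  have He2 : e < r by (unfold e; rmin).
  specialize (H (x + e)%R). destruct (Rg (x + e)%R) as [_ E].
  { replace (x + e - x)%R with e by ring. rewrite Rabs_pos_eq; lra. }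
  replace (x + e - x)%R with e in H by ring. rewrite Rabs_pos_eq in H by lra. specialize (H He1).
  have Q := Im_le_Cmod (g (gam t (x + e)) - g (gam t x)). rewrite Im_minus, E in Q.
  replace (0 - Im (g (gam t x)))%R with (- Im (g (gam t x)))%R in Q by ring. rewrite Rabs_Ropp in Q. lra. }
 have R0 : Re (g (gam t x)) <> 0%R.
 { intro E. apply Hg0. apply Ceq_ReIm; auto. }
 destruct (Cr _ (Rabs_pos_lt _ R0)) as [d [Hd H]].
 have Sg : forall s, 0 < Rabs (s - x) < Rmin d r -> 0 < Re (g (gam t x)) * Re (g (gam t s)).
 { intros s [Q1 Q2]. specialize (H s (proj1 (Rlt_min Q2))).
  have Q := Re_le_Cmod (g (gam t s) - g (gam t x)).
  change (Re (g (gam t s) - g (gam t x))%C) with (Re (g (gam t s)) - Re (g (gam t x)))%R in Q.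
  have Q3 := Rle_lt_trans _ _ _ Q H. unfold Rabs in Q3; repeat destruct Rcase_abs in Q3; nra. }
 have F : forall tau, 0 < tau * Re (g (gam t x)) -> sgnloc (fun s => Re (f (gam t s))) x k tau.
 { intros tau Ht. exists (Rmin d r). split; [pos|]. intros s Hs.
  destruct (Rg s) as [E _]; [split; [pos|eapply Rlt_le_trans; [apply Hs|apply Rmin_r]]|].
  rewrite E. specialize (Sg s Hs).
  have N : (s - x <> 0)%R by (intro E2; rewrite E2, Rabs_R0 in Hs; lra).
  have P : 0 < ((s - x) ^ k) * ((s - x) ^ k).
  { assert ((s - x) ^ k <> 0)%R by (apply pow_nonzero; auto). nra. }
  replace (tau * ((s - x) ^ k * Re (g (gam t s)) * (s - x) ^ k))%R with ((tau * Re (g (gam t s))) * ((s - x) ^ k * (s - x) ^ k))%R by ring.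
  apply Rmult_lt_0_compat; auto. set (a := Re (g (gam t x))) in *. set (b := Re (g (gam t s))) in *.
  assert (0 < a * a)%R by nra. apply Rmult_lt_reg_l with (a * a)%R; auto. rewrite Rmult_0_r.
  replace (a * a * (tau * b))%R with ((tau * a) * (a * b))%R by ring. apply Rmult_lt_0_compat; auto. }
 destruct (Rlt_dec 0 (Re (g (gam t x)))) as [P|P].
 - exists 1%R. split; auto. apply F. lra.
 - exists (-1)%R. split; auto. apply F. lra.
Qed.

Section Count.
Variables t D : R.
Hypothesis Ht : 0 < t.
Hypothesis HD : 0 < D < 1.
Variable w : C -> C.
Hypothesis Hw_hol : exists delta : R, 0 < delta /\ forall p, Rabs (Im p - t / 2) < delta -> holo_at w p.
Hypothesis Hw_real : forall s, Im (w (gam t s)) = 0%R.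
Variable n : nat.
Variable f : C -> C.
Hypothesis Hn : (1 <= n)%nat.
Hypothesis Hf : monic_orth_section t D w n f.
Variable zs : list R.
Hypothesis Hzs : zeros_on_gamma t f zs.

(** Every zero of f is doubled by a sine factor of the same order, so h keeps one sign on the whole
    line. *)
Let h (s : R) : R := (Re (f (gam t s)) * sinp zs s)%R.

Lemma uP_sign : exists sg, (sg = 1 \/ sg = -1)%R /\ (forall x, sgnloc h x 0 sg) /\ forall s, 0 <= sg * h s.
Proof.
 have Sh : forall s, h (s + 1) = ((-1) ^ length zs * h s)%R.
 { intros s. unfold h. rewrite sinp_shift, gam_1. destruct Hf as [[H1 _] _]. rewrite H1. ring. }
 apply sign_connected.
 - intros x. apply contR_mult; [|apply sinp_cont]. eapply section_cont; eauto.
 - have B : forall x, 0 <= x < 1 -> exists tau, (tau = 1 \/ tau = -1)%R /\ sgnloc h x 0 tau.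
  { intros x Hx. destruct Hzs as [Z1 Z2].
   destruct (zero_order_sgnloc t f x _ (section_real t D Ht w Hw_hol Hw_real n f Hn Hf) (Z2 x Hx)) as [t1 [T1 S1]].
   destruct (sgnloc_sinp x zs Hx Z1) as [t2 [T2 S2]].
   exists (t1 * t2)%R. split; [destruct T1, T2; subst; lra|].
   destruct (sgnloc_mult _ _ _ _ _ _ _ S1 S2) as [d [Hd S]]. exists d. split; auto. intros s Hs.
   specialize (S s Hs). rewrite pow_add in S. set (a := ((s - x) ^ _)%R) in S.
   (* Both orders are the multiplicity of x in [zs], so the two powers of s - x form a square. *)
   fold (h s) in S. rewrite Rmult_1_r.
      destruct (Rle_dec (t1 * t2 * h s) 0) as [L|L]; [|lra]. exfalso. nra. }
  have Eq : forall x tau (e : R), (e = 1 \/ e = -1)%R -> sgnloc h x 0 tau -> (forall s, h (s + 1) = e * h s)%R -> sgnloc h (x + 1) 0 (e * tau).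
  { intros x tau e He [d [Hd S]] E. exists d. split; auto. intros s Hs.
   specialize (S (s - 1)%R). replace (s - 1 - x)%R with (s - (x + 1))%R in S by ring. specialize (S Hs).
   have E2 := E (s - 1)%R. replace (s - 1 + 1)%R with s in E2 by ring. rewrite E2.
   destruct He; subst e; lra. }
  have Eq2 : forall x tau (e : R), (e = 1 \/ e = -1)%R -> sgnloc h x 0 tau -> (forall s, h (s + 1) = e * h s)%R -> sgnloc h (x - 1) 0 (e * tau).
  { intros x tau e He [d [Hd S]] E. exists d. split; auto. intros s Hs.
   specialize (S (s + 1)%R). replace (s + 1 - x)%R with (s - (x - 1))%R in S by ring. specialize (S Hs).
   rewrite E in S. destruct He; subst e; lra. }
  have He : ((-1) ^ length zs = 1 \/ (-1) ^ length zs = -1)%R.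
  { destruct (Nat.Even_or_Odd (length zs)) as [[j ->]|[j ->]]; [left|right]; [apply pow_1_even|].
   rewrite Nat.add_1_r. apply pow_1_odd. }
  have Up : forall (m : nat) x, (exists tau, (tau = 1 \/ tau = -1)%R /\ sgnloc h x 0 tau) ->
    (exists tau, (tau = 1 \/ tau = -1)%R /\ sgnloc h (x + INR m) 0 tau) /\ (exists tau, (tau = 1 \/ tau = -1)%R /\ sgnloc h (x - INR m) 0 tau).
  { induction m as [|m IH]; intros x Hx.
   - rewrite Rplus_0_r, Rminus_0_r. auto.
   - rewrite S_INR. destruct (IH x Hx) as [[t1 [T1 S1]] [t2 [T2 S2]]]. split.
    + exists ((-1) ^ length zs * t1)%R. split; [destruct He as [-> | ->], T1; subst; lra|].
     rewrite <- Rplus_assoc. apply Eq; auto.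
    + exists ((-1) ^ length zs * t2)%R. split; [destruct He as [-> | ->], T2; subst; lra|].
     replace (x - (INR m + 1))%R with (x - INR m - 1)%R by ring. apply Eq2; auto. }
  intros x. destruct (frac_shift x) as [k Hk]. destruct (Up (Z.to_nat (Z.abs k)) (x - IZR k)%R (B _ Hk)) as [U1 U2].
  rewrite INR_IZR_INZ, Z2Nat.id in U1, U2 by lia.
  destruct (Z_le_dec 0 k) as [P|P].
  + rewrite Z.abs_eq in U1 by auto. replace (x - IZR k + IZR k)%R with x in U1 by ring. auto.
  + rewrite Z.abs_neq, opp_IZR in U2 by lia. replace (x - IZR k - - IZR k)%R with x in U2 by ring. auto.
Qed.

(** For an odd number of sine factors h(s + 1) = - h(s), which is incompatible with a constant
    sign. *)
Lemma zeros_even : exists j, length zs = (2 * j)%nat.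
Proof.
 destruct (Nat.Even_or_Odd (length zs)) as [[j E]|[j E]]; [exists j; auto|]. exfalso.
 destruct uP_sign as [sg [Vsg [_ H]]].
 have Sh : forall s, h (s + 1) = (- h s)%R.
 { intros s. unfold h. rewrite sinp_shift, gam_1, E, Nat.add_1_r, pow_1_odd. destruct Hf as [[H1 _] _]. rewrite H1. ring. }
 destruct uP_sign as [sg' [Vsg' [S' _]]].
 destruct (S' 0%R) as [d [Hd S]].
 set (e := (Rmin d 1 / 2)%R).
 have He : 0 < e by pos.
 have He1 : e < d by (unfold e; rmin).
 specialize (S e). rewrite Rminus_0_r, Rabs_pos_eq in S by lra. specialize (S (conj He He1)). have A1 := H e. have A2 := H (e + 1)%R. rewrite Sh in A2.
 assert (h e = 0)%R by (destruct Vsg; subst sg; lra). rewrite H0 in S. lra.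
Qed.

(** With fewer than n zeros, the section [Gfun] vanishing at them has order at most n - 1, and its
    product with f has one sign on gamma, against orthogonality. *)
Lemma zeros_ge : (n <= length zs)%nat.
Proof.
 destruct (le_lt_dec n (length zs)) as [|L]; auto. exfalso.
 destruct zeros_even as [j Hj].
 have HG := Gfun_in_Pn t D Ht HD zs j Hj.
 destruct (Gfun_gam t D Ht zs j Hj) as [c [Hc HG2]].
 set (G := ext t (Gfun t D zs j)) in *.
 have HG3 : in_Pn t D (n - 1) G by (apply in_Pn_le with (2 * j)%nat; auto; lia).
 have O := orth_CI t D Ht w Hw_hol Hw_real n f Hf G HG3.
 have Re_f := section_real t D Ht w Hw_hol Hw_real n f Hn Hf.
 set (v := fun s => Re (/ c * G (gam t s))%C).
 have Ev : forall s, G (gam t s) = c * RtoC (v s).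
 { intros s. unfold v. destruct (HG2 s) as [rho [_ E]]. rewrite E.
  replace (/ c * (c * RtoC (rho * sinp zs s))) with (RtoC (rho * sinp zs s)) by (field; auto). reflexivity. }
 have Cv : forall s, continuous v s.
 { intros s. apply (ccontR_Re (fun s => / c * G (gam t s))). apply (ccontR_mult (fun _ => / c)).
  - split; apply contR_const.
  - apply gam_ccontR. eapply gam_chol; eauto. }
 have Cu : forall s, continuous (fun s => Re (f (gam t s))) s by (intros; eapply section_cont; eauto).
 have Cw := wt_cont t w Hw_hol.
 have O2 : RInt (fun s => (Re (f (gam t s)) * v s * wt t w s)%R) 0 1 = 0%R.
 { have O3 : c * CI (fun s => RtoC (Re (f (gam t s)) * v s * wt t w s)) 0 1 = 0.
  { rewrite <- O, <- CI_scal.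
   - apply CI_ext; [lra|]. intros x _. rewrite Ev, !RtoC_mult, <- Re_f. ring.
   - apply cint_cont; [lra|]. intros x _. apply ccontR_real. apply contR_mult; auto. apply contR_mult; auto. }
  have O4 : CI (fun s => RtoC (Re (f (gam t s)) * v s * wt t w s)) 0 1 = 0.
  { replace (CI (fun s => RtoC (Re (f (gam t s)) * v s * wt t w s)) 0 1) with (/ c * (c * CI (fun s => RtoC (Re (f (gam t s)) * v s * wt t w s)) 0 1)) by (field; auto).
   rewrite O3. ring. }
  have O5 := f_equal Re O4. rewrite Re_CI in O5. exact O5. }
 destruct uP_sign as [sg [Vsg [Sl H]]].
 have V : forall s, exists rho, 0 < rho /\ v s = (rho * sinp zs s)%R.
 { intros s. destruct (HG2 s) as [rho [Hr E]]. exists rho. split; auto. unfold v. rewrite E.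
  replace (/ c * (c * RtoC (rho * sinp zs s))) with (RtoC (rho * sinp zs s)) by (field; auto). reflexivity. }
 destruct (Sl (1/2)%R) as [d [Hd S]].
 set (e := (Rmin d (1/2) / 2)%R).
 have He : 0 < e by pos.
 have He1 : e < d by (unfold e; rmin).
 have He2 : e < 1/2 by (unfold e; rmin).
 have Q := RInt_pos_cont (fun s => (sg * (Re (f (gam t s)) * v s * wt t w s))%R) 0 1 (1/2 + e)%R arith.
 have Q1 : 0 < RInt (fun s => sg * (Re (f (gam t s)) * v s * wt t w s)) 0 1.
 { apply Q.
  - intros x. apply contR_mult; [cts|]. apply contR_mult; auto. apply contR_mult; auto.
  - intros x _. destruct (V x) as [rho [Hr E]]. rewrite E.
   replace (sg * (Re (f (gam t x)) * (rho * sinp zs x) * wt t w x))%R with ((sg * h x) * (rho * wt t w x))%R by (unfold h; ring).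
   apply Rmult_le_pos; auto. apply Rmult_le_pos; [lra|pos].
  - lra.
  - destruct (V (1/2 + e)%R) as [rho [Hr E]]. rewrite E.
   replace (sg * (Re (f (gam t (1/2 + e)))%C * (rho * sinp zs (1/2 + e)) * wt t w (1/2 + e)))%R with ((sg * h (1/2 + e)) * (rho * wt t w (1/2 + e)))%R by (unfold h; ring).
   apply Rmult_lt_0_compat; [|pos].
   specialize (S (1/2 + e)%R). replace (1/2 + e - 1/2)%R with e in S by ring. rewrite Rabs_pos_eq in S by lra.
   specialize (S (conj He He1)). lra. }
 rewrite (RInt_mulR sg (fun s => (Re (f (gam t s)) * v s * wt t w s)%R)), O2 in Q1; [lra|].
 apply ex_RInt_contR. intros x. apply contR_mult; auto. apply contR_mult; auto.
Qed.
End Count.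

(** * Factorisation of sections along the cycle *)

Section MultiplierOne.
Variable t : R.
Hypothesis Ht : 0 < t.
Variable F : C -> C.
Variable b : C.
Variable a : R.
Variable l : list C.
Hypothesis F1 : forall p, F (p + 1) = F p.
Hypothesis Fh : forall z, a <= fst z <= a + 1 -> - (t / 4) <= snd z <= 3 * t / 4 -> ~ In z l -> chol F z.
Hypothesis Hl : forall z, In z l -> a < fst z < a + 1 /\ (snd z = 0 \/ snd z = t / 2)%R.
Hypothesis Hb : forall z, In z l -> pbounded F z.
Hypothesis Fq : forall x, F ((x, (- (t / 4))%R) + tauC t) = - ce (b - (x, (- (t / 4))%R)) * F (x, (- (t / 4))%R).

(** The Laurent coefficient of F in the variable e(p), computed at height y. The exponential is
    taken at the full point (x, y), so the value does not depend on the height. *)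
Definition fcoef (k : Z) (y : R) : C := CI (fun x => F (x, y) * ce (- (RtoC (IZR k) * ((x, y) : C)))) a (a + 1).

Lemma ce_kZ1 (k : Z) p : ce (- (RtoC (IZR k) * (p + 1))) = ce (- (RtoC (IZR k) * p)).
Proof.
 replace (- (RtoC (IZR k) * (p + 1))) with (- (RtoC (IZR k) * p) + RtoC (IZR (- k))) by (rewrite opp_IZR, RtoC_opp; ring).
 rewrite ce_plus, ce_Z. ring.
Qed.

(** The heights of one period that avoid the exceptional points, all of which lie on the real axis
    or on gamma. *)
Definition okline (y : R) : Prop := (- (t / 4) <= y <= 3 * t / 4 /\ y <> 0 /\ y <> t / 2)%R.

Lemma okline_chol y x : okline y -> chol F (x, y).
Proof.
 intros [Hy [N1 N2]]. destruct (frac_shift (x - a)) as [k Hk].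
 have B : chol F ((x - IZR k)%R, y).
 { apply Fh; simpl; try lra. intro K. destruct (Hl _ K) as [_ [E|E]]; simpl in E; lra. }
 have N : forall (m : nat) p, F (p + RtoC (INR m)) = F p.
 { induction m as [|m IH]; intros p; [simpl; f_equal; ring|].
  rewrite S_INR, RtoC_plus. replace (p + (RtoC (INR m) + 1)) with (p + RtoC (INR m) + 1) by ring. rewrite F1. auto. }
 have NZ : forall p, F (p - RtoC (IZR k)) = F p.
 { intros p. destruct (Z_le_dec 0 k) as [P|P].
  - rewrite <- (N (Z.to_nat k)). f_equal. rewrite INR_IZR_INZ, Z2Nat.id by lia. ring.
  - rewrite <- (N (Z.to_nat (- k)) p). f_equal. rewrite INR_IZR_INZ, Z2Nat.id, opp_IZR, RtoC_opp by lia. ring. }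
 apply chol_ext with (fun p => F (p - RtoC (IZR k))); auto. apply chol_shift.
 replace ((x, y) - RtoC (IZR k)) with (((x - IZR k)%R, y) : C); auto.
 unfold Cminus, Cplus, Copp, RtoC; simpl. f_equal; ring.
Qed.

Lemma ce_lin_chol (k : Z) p : chol (fun p => ce (- (RtoC (IZR k) * p))) p.
Proof. apply (chol_ce (fun p => - (RtoC (IZR k) * p))). apply chol_opp, chol_mult; [apply chol_const|apply chol_id]. Qed.

Lemma fcoef_const k y1 y2 : okline y1 -> okline y2 -> y1 < y2 -> fcoef k y1 = fcoef k y2.
Proof.
 intros O1 O2 L. apply (line_shift (fun p => F p * ce (- (RtoC (IZR k) * p))) l a y1 y2 L).
 - intros p. rewrite F1, ce_kZ1. reflexivity.
 - intros z Hx Hy Hn. apply chol_mult; [|apply ce_lin_chol]. apply Fh; auto. destruct O1, O2. lra.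
 - intros z Hz. destruct (Hl z Hz) as [H1 [H2|H2]]; destruct O1 as [_ [? ?]], O2 as [_ [? ?]]; repeat split; try lra; rewrite H2; auto.
 - intros z Hz. apply pbounded_mult; auto. apply pbounded_chol, ce_lin_chol.
Qed.

Lemma okline_bot : okline (- (t / 4)). Proof. repeat split; lra. Qed.
Lemma okline_top : okline (3 * t / 4). Proof. repeat split; lra. Qed.

Lemma fcoef_cint k y : okline y -> cint (fun x => F (x, y) * ce (- (RtoC (IZR k) * ((x, y) : C)))) a (a + 1).
Proof.
 intros O. apply (cint_h (fun p => F p * ce (- (RtoC (IZR k) * p)))); [lra|]. intros x _. apply chol_cont, chol_mult; [|apply ce_lin_chol].
 apply okline_chol; auto.
Qed.

(** Moving the line up by tau changes nothing by Goursat, while the multiplier of F shifts the index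
    by one. *)
Lemma fcoef_rec k : fcoef k (- (t / 4)) = - ce b * ce (- (RtoC (IZR k) * tauC t)) * fcoef (k + 1) (- (t / 4)).
Proof.
 rewrite (fcoef_const k _ _ okline_bot okline_top) by lra.
 unfold fcoef. rewrite <- CI_scal by (apply fcoef_cint, okline_bot).
 apply CI_ext; [lra|]. intros x _.
 have E : ((x, (3 * t / 4)%R) : C) = (x, (- (t / 4))%R) + tauC t.
 { unfold tauC, Cplus; simpl. f_equal; field. }
 rewrite E, Fq. set (p := ((x, (- (t / 4))%R) : C)).
 rewrite plus_IZR, RtoC_plus.
 replace (- (RtoC (IZR k) * (p + tauC t))) with (- (RtoC (IZR k) * p) + - (RtoC (IZR k) * tauC t)) by ring.
 replace (- ((RtoC (IZR k) + RtoC 1) * p)) with (- (RtoC (IZR k) * p) + - p) by ring.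
 unfold Cminus at 1. rewrite !ce_plus. ring.
Qed.

Lemma fcoef_zero : fcoef 0 (- (t / 4)) = 0 -> forall k, fcoef k (- (t / 4)) = 0.
Proof.
 intros H0.
 have Up : forall k, fcoef k (- (t / 4)) = 0 -> fcoef (k + 1) (- (t / 4)) = 0.
 { intros k H. rewrite fcoef_rec in H. destruct (Ceq_dec (fcoef (k + 1) (- (t / 4))) 0) as [|N]; auto. exfalso.
  apply (Cmult_neq_0 (- ce b * ce (- (RtoC (IZR k) * tauC t))) (fcoef (k + 1) (- (t / 4)))); auto.
  apply Cmult_neq_0; [|apply ce_neq0]. intro E. apply (ce_neq0 b). replace (ce b) with (- - ce b) by ring. rewrite E. ring. }
 have Dn : forall k, fcoef (k + 1) (- (t / 4)) = 0 -> fcoef k (- (t / 4)) = 0.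
 { intros k H. rewrite fcoef_rec, H. ring. }
 have N : forall j : nat, fcoef (Z.of_nat j) (- (t / 4)) = 0 /\ fcoef (- Z.of_nat j) (- (t / 4)) = 0.
 { induction j as [|j [I1 I2]]; [pos|]. rewrite Nat2Z.inj_succ. split.
  - apply Up. exact I1.
  - apply Dn. replace (- Z.succ (Z.of_nat j) + 1)%Z with (- Z.of_nat j)%Z by lia. exact I2. }
 intros k. destruct (Z_le_dec 0 k) as [P|P].
 - rewrite <- (Z2Nat.id k P). exact (proj1 (N _)).
 - replace k with (- Z.of_nat (Z.to_nat (- k)))%Z by lia. exact (proj2 (N _)).
Qed.

(** A multiplier of degree one leaves a space of dimension one, detected by the coefficient of index
    0. This replaces a count of zeros by residues. *)
Lemma mult_one_zero : fcoef 0 (- (t / 4)) = 0 -> forall x y, okline y -> F (x, y) = 0.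
Proof.
 intros H0 x y O. have H := fcoef_zero H0.
 have Hy : forall k, fcoef k y = 0.
 { intros k. destruct (Req_dec y (- (t / 4))) as [->|N]; auto.
  rewrite <- (fcoef_const k (- (t / 4)) y okline_bot O); auto. destruct O. lra. }
 apply (cfourier_unique (fun x => F (x, y)) a).
 - intros u. apply ccontR_h, chol_cont, okline_chol; auto.
 - intros u. rewrite <- (F1 (u, y)). f_equal. unfold Cplus, RtoC; simpl. f_equal; ring.
 - intros k. have E := Hy (- k)%Z. unfold fcoef in E.
  set (c := / ce (RtoC (IZR k) * ((0%R, y) : C))).
  transitivity (c * CI (fun x => F (x, y) * ce (- (RtoC (IZR (- k)) * ((x, y) : C)))) a (a + 1)); [|rewrite E; ring].
  rewrite <- CI_scal by (apply fcoef_cint; auto).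
  apply CI_ext; [lra|]. intros u _.
  replace (- (RtoC (IZR (- k)) * ((u, y) : C))) with (RtoC (IZR k) * ((0%R, y) : C) + RtoC (IZR k * u)).
  + rewrite ce_plus. unfold c. field. apply ce_neq0.
  + rewrite opp_IZR. unfold Cplus, Cmult, Copp, RtoC; simpl. f_equal; ring.
Qed.
End MultiplierOne.

Lemma pbounded_inv_th t z a : 0 < t -> z = a \/ (~ isZ (z - a) /\ Rabs (Im (z - a)) < t) ->
 pbounded (fun p => (p - z) ^ (if Ceq_dec z a then 1 else 0) / th t (p - a)) z.
Proof.
 intros Ht H. destruct Ceq_dec as [->|N].
 - apply pbounded_ext_fun with (fun p => (p - a) / th t (p - a)).
  + apply (pbounded_shift (fun p => p / th t p)). apply th_inv_pb; auto.
  + exists 1%R. split; [lra|]. intros p _. rewrite Cpow_1_r. reflexivity.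
 - destruct H as [H|[H1 H2]]; [contradiction|].
  apply pbounded_ext_fun with (fun p => / th t (p - a)).
  + apply pbounded_chol. apply (chol_inv (fun p => th t (p - a))); [|apply th_nz; auto]. apply chol_shift, th_chol; auto.
  + exists 1%R. split; [lra|]. intros p _. unfold Cdiv. ring.
Qed.

Lemma gam_inj t a b : gam t a = gam t b -> a = b.
Proof. intros H. have E := f_equal Re H. rewrite !gam_eq in E. exact E. Qed.

Lemma unit_Z a b : 0 <= a < 1 -> 0 <= b < 1 -> isZ (RtoC (a - b)) -> a = b.
Proof.
 intros Ha Hb [n E]. injection E as E.
 assert (-1 < n < 1)%Z by (split; apply lt_IZR; lra). assert (n = 0%Z) by lia. subst n. lra.
Qed.

Lemma pbounded_inv_thp t l s0 : 0 < t -> 0 <= s0 < 1 -> (forall s, In s l -> 0 <= s < 1) ->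
 pbounded (fun p => (p - gam t s0) ^ (count_occ Req_EM_T l s0) / thp t (sgam t l) p) (gam t s0).
Proof.
 intros Ht H0. induction l as [|s l IH]; intros Hl.
 - apply (pbounded_ext_fun (fun _ => 1)); [apply pbounded_chol, chol_const|].
  exists 1%R. split; [lra|]. intros p _. simpl. field.
 - have IH' := IH (fun s Hs => Hl s (or_intror Hs)).
  have Hs := Hl s (or_introl eq_refl).
  have P : pbounded (fun p => (p - gam t s0) ^ (if Ceq_dec (gam t s0) (gam t s) then 1 else 0) / th t (p - gam t s)) (gam t s0).
  { apply pbounded_inv_th; auto. destruct (Ceq_dec (gam t s0) (gam t s)) as [|N]; auto. right. rewrite gam_minus. split.
   - intro K. apply unit_Z in K; auto. apply N. rewrite K. reflexivity.
   - unfold Im, RtoC; simpl. rewrite Rabs_R0. auto. }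
  apply (pbounded_ext_fun _ _ _ (pbounded_mult _ _ _ P IH')). exists 1%R. split; [lra|]. intros p _.
  unfold sgam. cbn [map thp count_occ]. unfold Cdiv. rewrite Cinv_mult.
  destruct Ceq_dec as [E|N]; destruct Req_EM_T as [E2|N2].
  + rewrite (Cpow_S _ (count_occ _ _ _)). change ((p - gam t s0) ^ 1) with ((p - gam t s0) * 1). ring.
  + exfalso. apply N2. apply gam_inj in E. auto.
  + exfalso. apply N. rewrite E2. reflexivity.
  + change ((p - gam t s0) ^ 0) with (RtoC 1). ring.
Qed.

(** The period [- e, 1 - e] then contains 0 and all the listed points in its interior, so no
    exceptional point falls on a vertical side. *)
Lemma Rlist_max_lt1 (l : list R) : (forall s, In s l -> 0 <= s < 1) -> exists e, 0 < e < 1 /\ forall s, In s l -> s < 1 - e.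
Proof.
 induction l as [|s l IH]; intros H.
 - exists (1/2)%R. split; [lra|]. intros s [].
 - destruct IH as [e [He H2]]; [intros; apply H; right; auto|]. have Hs := H s (or_introl eq_refl).
  exists (Rmin e ((1 - s) / 2)). split.
  + split; [apply Rmin_glb_lt; lra|]. eapply Rle_lt_trans; [apply Rmin_l|lra].
  + intros u [<-|Hu].
   * pose proof (Rmin_r e ((1 - s) / 2)). lra.
   * specialize (H2 u Hu). pose proof (Rmin_l e ((1 - s) / 2)). lra.
Qed.

Lemma thp_nz t l p : (forall z, In z l -> ~ isZ (p - z)) -> thp t l p <> 0.
Proof.
 induction l as [|z l IH]; intros H; [apply C1_nz|].
 cbn [thp]. apply Cmult_neq_0; [apply th_nz, H; left; auto|apply IH; intros; apply H; right; auto].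
Qed.

Lemma lattice_low t p : 0 < t -> - t < Im p < t -> in_lattice t p -> isZ p.
Proof.
 intros Ht Hp [a [b E]]. have K := f_equal Im E.
 have K2 : (Im (latpt t a b) = IZR b * t)%R by (unfold latpt, tauC, Im, Cplus, Cmult, RtoC; simpl; ring).
 rewrite K2 in K. have Hb : (-1 < b < 1)%Z.
 { rewrite K in Hp. split; apply lt_IZR; apply Rmult_lt_reg_r with t; auto; lra. }
 assert (b = 0%Z) by lia. subst b. exists a. rewrite E. unfold latpt. ring.
Qed.

Section Factor.
Variables t D : R.
Hypothesis Ht : 0 < t.
Hypothesis HD : 0 < D < 1.
Variable n : nat.
Variable f : C -> C.
Hypothesis Hf : in_Pn t D n f.
Variable ls : list R.
Hypothesis Hls : forall s, In s ls -> 0 <= s < 1.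
Hypothesis Hlen : length ls = n.
Hypothesis Hord : forall s, In s ls -> exists k, (count_occ Req_EM_T ls s <= k)%nat /\ zero_order f (gam t s) k.

(** The multiple of tau in Abel's condition: with n / 2 rounded up, the remaining zero [bpt] is real
    for even n and on gamma for odd n. *)
Definition mup : nat := Nat.div2 (S n).
Definition bpt : C := RtoC (D - Rsum ls) + (if Nat.even n then RtoC 0 else RtoC (/ 2) * tauC t).

Lemma mup_bpt : bpt = RtoC (D - Rsum ls) + (RtoC (INR mup) * tauC t - RtoC (INR n) * (RtoC (/ 2) * tauC t)).
Proof.
 unfold bpt, mup. f_equal. destruct (Nat.Even_or_Odd n) as [[j E]|[j E]].
 - rewrite E. rewrite Nat.even_mul. simpl orb. replace (S (2 * j)) with (S (2 * j))%nat by lia.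
  rewrite Nat.div2_succ_double. rewrite mult_INR, RtoC_mult. change (INR 2) with 2%R. rewrite RtoC_inv by lra. field.
 - rewrite E. assert (Nat.even (2 * j + 1) = false) as ->.
  { rewrite Nat.even_add, Nat.even_mul. reflexivity. }
  replace (S (2 * j + 1)) with (2 * (S j))%nat by lia. rewrite Nat.div2_double, S_INR, plus_INR, mult_INR, !RtoC_plus, RtoC_mult.
  change (INR 2) with 2%R. change (INR 1) with 1%R. rewrite RtoC_inv by lra. field.
Qed.

Lemma Im_bpt : (Im bpt = 0 \/ Im bpt = t / 2)%R.
Proof.
 unfold bpt. destruct Nat.even; [left|right]; unfold tauC, RtoC, Im, Cplus, Cmult; simpl; field.
Qed.

(** The poles of f are cleared and n of its zeros divided out. What remains has the multiplier of a
    single theta function centred at [bpt]. *)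
Definition Fq (p : C) : C := f p * th t p ^ n * th t (p - RtoC D) * ce (RtoC (INR mup) * p) / thp t (sgam t ls) p.

Lemma Fq_1 p : Fq (p + 1) = Fq p.
Proof.
 unfold Fq. destruct Hf as [H1 _]. rewrite H1, th_Z1, thp_Z1.
 replace (p + 1 - RtoC D) with (p - RtoC D + 1) by ring. rewrite th_Z1.
 replace (RtoC (INR mup) * (p + 1)) with (RtoC (INR mup) * p + RtoC (IZR (Z.of_nat mup))).
 - rewrite ce_plus, ce_Z. unfold Cdiv. ring.
 - rewrite <- INR_IZR_INZ. ring.
Qed.

Lemma in_sgam z l : In z (sgam t l) -> exists s, In s l /\ z = gam t s.
Proof. intros H. apply in_map_iff in H. destruct H as [s [<- H]]. exists s; auto. Qed.

Lemma Fq_tau p : - t / 2 < Im p < 0 -> Fq (p + tauC t) = - ce (bpt - p) * Fq p.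
Proof.
 intros Hp. unfold Fq. destruct Hf as [_ [H2 _]]. rewrite H2.
 rewrite thp_tau.
 2: { intros z Hz. apply in_sgam in Hz. destruct Hz as [s [_ ->]]. rewrite Im_gam. lra. }
 replace (p + tauC t - RtoC D) with (p - RtoC D + tauC t) by ring.
 rewrite !th_tau by (rewrite ?Im_minus; unfold RtoC, Im in *; simpl; lra).
 rewrite Csum_sgam. unfold sgam at 1 2. rewrite length_map, Hlen.
 rewrite Cpow_mult_l. replace ((- ce (- p)) ^ n) with ((-1) ^ n * ce (- (RtoC (INR n) * p))).
 2: { replace (- ce (- p)) with ((-1) * ce (- p)) by ring. rewrite Cpow_mult_l, <- ce_pow. do 2 f_equal. ring. }
 have E : ce (- (RtoC (INR n) * p)) * ce (- (p - RtoC D)) * ce (RtoC (INR mup) * (p + tauC t)) =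
  ce (bpt - p) * ce (RtoC (INR mup) * p) * ce (RtoC (Rsum ls) + RtoC (INR n) * (RtoC (/ 2) * tauC t) - RtoC (INR n) * p).
 { rewrite <- !ce_plus. f_equal. rewrite mup_bpt, RtoC_minus. ring. }
 set (T1 := ce (- (RtoC (INR n) * p))) in *. set (T2 := ce (- (p - RtoC D))) in *.
 set (T3 := ce (RtoC (INR mup) * (p + tauC t))) in *. set (T4 := ce (bpt - p)) in *. set (T5 := ce (RtoC (INR mup) * p)) in *.
 have N := ce_neq0 (RtoC (Rsum ls) + RtoC (INR n) * (RtoC (/ 2) * tauC t) - RtoC (INR n) * p).
 set (T6 := ce (RtoC (Rsum ls) + RtoC (INR n) * (RtoC (/ 2) * tauC t) - RtoC (INR n) * p)) in *.
 have M : thp t (sgam t ls) p <> 0.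
 { apply thp_nz. intros z Hz K. apply in_sgam in Hz. destruct Hz as [s [_ ->]]. apply isZ_Im in K. rewrite Im_minus, Im_gam in K. lra. }
 have M1 : (-1) ^ n <> 0 by (apply Cpow_nz; intro K; injection K; lra).
 set (U := thp t (sgam t ls) p) in *. set (e1 := (-1) ^ n) in *.
 replace (f p * (e1 * T1 * th t p ^ n) * (- T2 * th t (p - RtoC D)) * T3 / (e1 * T6 * U))
  with (- (T1 * T2 * T3) * (f p * th t p ^ n * th t (p - RtoC D)) / (T6 * U)) by (field; auto).
 rewrite E. field. auto.
Qed.

Definition exl : list C := RtoC 0 :: RtoC D :: sgam t ls.

Lemma num_chol p : Rabs (Im p) < t -> chol (fun p => th t p ^ n * th t (p - RtoC D) * ce (RtoC (INR mup) * p)) p.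
Proof.
 intros Hp. apply chol_mult; [apply chol_mult|].
 - apply chol_pow, th_chol; auto.
 - apply th_sh_chol; auto.
 - apply (chol_ce (fun p => RtoC (INR mup) * p)). apply chol_mult; [apply chol_const|apply chol_id].
Qed.

Lemma thps_chol p : - t / 2 < Im p < t -> chol (thp t (sgam t ls)) p.
Proof.
 intros Hp. apply thp_chol; auto. intros z Hz. apply in_sgam in Hz. destruct Hz as [s [_ ->]]. rewrite Im_gam. apply Rabs_def1; lra.
Qed.

Lemma thps_nz p : Im p = 0%R -> thp t (sgam t ls) p <> 0.
Proof.
 intros Hp. apply thp_nz. intros z Hz K. apply in_sgam in Hz. destruct Hz as [s [_ ->]]. apply isZ_Im in K.
 rewrite Im_minus, Im_gam in K. lra.
Qed.

Lemma Fq_chol e z : 0 < e < 1 -> (forall s, In s (D :: ls) -> s < 1 - e) -> - e <= fst z <= - e + 1 ->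
 - (t / 4) <= snd z <= 3 * t / 4 -> ~ In z exl -> chol Fq z.
Proof.
 intros He He2 Hx Hy Hn. destruct Hf as [_ [_ [H3 _]]].
 have Iz : Im z = snd z by reflexivity.
 have NI : forall s, In s (0%R :: D :: ls) -> 0 <= s < 1 /\ s < 1 - e.
 { intros s [<-|[<-|Hs]]; split; try lra; try apply He2; simpl; auto. }
 have Key : forall s y, In s (0%R :: D :: ls) -> isZ (z - ((s, y) : C)) -> z = (s, y).
 { intros s y Hs [k E]. destruct (NI s Hs) as [B1 B2]. destruct z as [zx zy]. simpl in *.
  injection E as E1 E2.
  assert (-1 < k < 1)%Z by (split; apply lt_IZR; lra). assert (k = 0%Z) by lia. subst k. f_equal; lra. }
 have N0 : ~ isZ z.
 { intro K. apply Hn. left. symmetry. apply (Key 0%R 0%R); [left; auto|]. replace (z - ((0%R, 0%R) : C)) with z; auto.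
  destruct z; unfold Cminus, Cplus, Copp; simpl. f_equal; ring. }
 have N1 : ~ isZ (z - RtoC D).
 { intro K. apply Hn. right; left. symmetry. apply (Key D 0%R); [right; left; auto|]. exact K. }
 apply chol_div.
 - apply chol_ext with (fun p => f p * (th t p ^ n * th t (p - RtoC D) * ce (RtoC (INR mup) * p))); [intros; ring|].
  apply chol_mult.
  + apply holo_at_chol, H3.
   * intro K. apply N0. apply (lattice_low t); auto. rewrite Iz. lra.
   * intro K. apply N1. apply (lattice_low t); auto. rewrite Im_minus, Iz. unfold Im, RtoC; simpl. lra.
  + apply num_chol. rewrite Iz. apply Rabs_def1; lra.
 - apply thps_chol. rewrite Iz. lra.
 - apply thp_nz. intros u Hu K. pose proof Hu as Hu'. apply in_sgam in Hu. destruct Hu as [s [Hs Eu]].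
  apply Hn. right; right. rewrite Eu, gam_eq in K. apply Key in K; [|right; right; auto].
  rewrite K, <- gam_eq, <- Eu. exact Hu'.
Qed.

Lemma lip_pb_th : pbounded (fun p => th t p / p) 0.
Proof. apply pbounded_lip0 with (B1 (cth t)). apply (Bf_lip0 (cth t) _ t Ht (cth_bd t Ht)). Qed.

Lemma pbounded_ratio f1 g1 z (k : nat) : pbounded (fun p => (p - z) ^ k * f1 p) z -> pbounded (fun p => g1 p / (p - z) ^ k) z ->
 pbounded (fun p => f1 p * g1 p) z.
Proof.
 intros A B. apply (pbounded_ext_fun _ _ _ (pbounded_mult _ _ _ A B)). exists 1%R. split; [lra|].
 intros p Hp. have N : p - z <> 0 by (apply (proj2 (Cmod_gt_0 (p - z))); lra).
 field. apply Cpow_nz; auto.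
Qed.

(** At 0 and at [D] the zeros of theta meet the order of the poles; at a listed zero, f vanishes at
    least to the multiplicity of the zero in [ls]. *)
Lemma Fq_pb z : In z exl -> pbounded Fq z.
Proof.
 have H := Hf. destruct H as [_ [_ [_ [H4 H5]]]].
 intros [<-|[<-|Hz]].
 - apply pbounded_ext_fun with (fun p => (f p * th t p ^ n) * (th t (p - RtoC D) * ce (RtoC (INR mup) * p) / thp t (sgam t ls) p)).
  2: { exists 1%R. split; [lra|]. intros p _. unfold Fq, Cdiv. ring. }
  apply pbounded_mult.
  + apply pbounded_ratio with n.
   * destruct H4 as [M [r [Hr H]]]. exists M, r. split; auto. intros p Hp. replace (p - 0) with p in * by ring. auto.
   * apply pbounded_ext_fun with (fun p => (th t p / p) ^ n).
    -- apply pbounded_pow, lip_pb_th.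
    -- exists 1%R. split; [lra|]. intros p _. replace (p - 0) with p by ring. unfold Cdiv. rewrite Cpow_mult_l, Cinv_pow. reflexivity.
  + apply pbounded_chol, chol_div; [apply chol_mult; [apply th_sh_chol; auto|]|apply thps_chol|apply thps_nz; reflexivity].
   * unfold Im, RtoC; simpl. rewrite Rabs_R0. auto.
   * apply (chol_ce (fun p => RtoC (INR mup) * p)). apply chol_mult; [apply chol_const|apply chol_id].
   * unfold Im, RtoC; simpl. lra.
 - apply pbounded_ext_fun with (fun p => (f p * th t (p - RtoC D)) * (th t p ^ n * ce (RtoC (INR mup) * p) / thp t (sgam t ls) p)).
  2: { exists 1%R. split; [lra|]. intros p _. unfold Fq, Cdiv. ring. }
  apply pbounded_mult.
  + apply pbounded_ratio with 1%nat.
   * destruct H5 as [M [r [Hr H]]]. exists M, r. split; auto. intros p Hp. rewrite Cpow_1_r. auto.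
   * apply pbounded_ext_fun with (fun p => th t (p - RtoC D) / (p - RtoC D)).
    -- apply (pbounded_shift (fun p => th t p / p)), lip_pb_th.
    -- exists 1%R. split; [lra|]. intros p _. rewrite Cpow_1_r. reflexivity.
  + apply pbounded_chol, chol_div; [apply chol_mult; [apply chol_pow, th_chol; auto|]|apply thps_chol|apply thps_nz; reflexivity].
   * unfold Im, RtoC; simpl. rewrite Rabs_R0. auto.
   * apply (chol_ce (fun p => RtoC (INR mup) * p)). apply chol_mult; [apply chol_const|apply chol_id].
   * unfold Im, RtoC; simpl. lra.
 - apply in_sgam in Hz. destruct Hz as [s [Hs ->]].
  destruct (Hord s Hs) as [k [Hk [r [g [Hr [Hg [Hgh Hfg]]]]]]].
  set (k' := count_occ Req_EM_T ls s) in *.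
  have Gz : chol g (gam t s).
  { apply holo_at_chol, Hgh. replace (gam t s - gam t s) with (RtoC 0) by ring. rewrite Cmod_0. auto. }
  apply pbounded_ext_fun with (fun p => ((p - gam t s) ^ k' / thp t (sgam t ls) p) *
    ((p - gam t s) ^ (k - k') * g p * (th t p ^ n * th t (p - RtoC D) * ce (RtoC (INR mup) * p)))).
  2: { exists r. split; auto. intros p Hp. unfold Fq. rewrite (Hfg p (proj2 Hp)).
     replace k with (k' + (k - k'))%nat at 2 by lia. rewrite Cpow_add_r. unfold Cdiv. ring. }
  apply pbounded_mult; [apply pbounded_inv_thp; auto|].
  apply pbounded_chol, chol_mult; [apply chol_mult; auto|].
  + apply chol_pow, chol_minus; [apply chol_id|apply chol_const].
  + apply num_chol. rewrite Im_gam. apply Rabs_def1; lra.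
Qed.

Lemma th_bpt_chol p : - t / 2 < Im p < t -> chol (fun p => th t (p - bpt)) p.
Proof.
 intros Hp. apply chol_shift, th_chol; auto. rewrite Im_minus. destruct Im_bpt as [-> | ->]; apply Rabs_def1; lra.
Qed.

(** The constant is the quotient of the coefficients of index 0; [mult_one_zero] then kills the
    difference. *)
Lemma factor_lines : exists c : C, forall x y, okline t y -> Fq (x, y) = c * th t ((x, y) - bpt).
Proof.
 destruct (Rlist_max_lt1 (D :: ls)) as [e [He He2]].
 { intros s [<-|Hs]; [lra|auto]. }
 have HlE : forall z, In z exl -> - e < fst z < - e + 1 /\ (snd z = 0 \/ snd z = t / 2)%R.
 { intros z [<-|[<-|Hz]].
  - simpl. split; [lra|auto].
  - simpl. specialize (He2 D (or_introl eq_refl)). split; [lra|auto].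
  - apply in_sgam in Hz. destruct Hz as [s [Hs ->]]. rewrite gam_eq. simpl.
   specialize (He2 s (or_intror Hs)). specialize (Hls s Hs). split; [lra|auto]. }
 set (T := fun p => th t (p - bpt)).
 have Tz : forall p, T (p + 1) = T p.
 { intros p. unfold T. replace (p + 1 - bpt) with (p - bpt + 1) by ring. apply th_Z1. }
 have Tc : forall z, - e <= fst z <= - e + 1 -> - (t / 4) <= snd z <= 3 * t / 4 -> chol T z.
 { intros z _ Hy. apply th_bpt_chol. unfold Im. lra. }
 have Tq : forall x, T ((x, (- (t / 4))%R) + tauC t) = - ce (bpt - (x, (- (t / 4))%R)) * T (x, (- (t / 4))%R).
 { intros x. unfold T. replace ((x, (- (t / 4))%R) + tauC t - bpt) with ((x, (- (t / 4))%R) - bpt + tauC t) by ring.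
  rewrite th_tau.
  - f_equal. f_equal. f_equal. ring.
  - rewrite Im_minus. replace (Im (x, (- (t / 4))%R)) with (- (t / 4))%R by reflexivity. destruct Im_bpt as [-> | ->]; lra. }
 set (y0 := (- (t / 4))%R) in *. have Ey0 : y0 = (- (t / 4))%R by reflexivity.
 have FqT : forall x, Fq ((x, y0) + tauC t) = - ce (bpt - (x, y0)) * Fq (x, y0).
 { intros x. apply Fq_tau. unfold Im, y0; simpl. lra. }
 set (T0 := fcoef T (- e) 0 y0). set (F0 := fcoef Fq (- e) 0 y0).
 (* Otherwise theta itself would vanish on a line that carries none of its zeros. *)
 have NT : T0 <> 0.
 { intro E. have Z := mult_one_zero t Ht T bpt (- e) nil Tz (fun z H1 H2 _ => Tc z H1 H2)
   (fun z K => match K with end) (fun z K => match K with end) Tq E 0%R y0.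
  have Z2 : T (0%R, y0) = 0 by (apply Z; apply okline_bot; auto).
  apply Bf_0 in Z2. apply isZ_Im in Z2. rewrite Im_minus in Z2.
  replace (Im (0%R, y0)) with y0 in Z2 by reflexivity. destruct Im_bpt as [E2 | E2]; rewrite E2 in Z2; lra. }
 exists (F0 / T0). intros x y O.
 set (cc := - (F0 / T0)). set (G := fun p => Fq p + cc * T p).
 have Q : G (x, y) = 0.
 { apply (mult_one_zero t Ht G bpt (- e) exl); auto.
  - intros p. unfold G. rewrite Fq_1, Tz. reflexivity.
  - intros z H1 H2 H3. apply chol_plus; [apply (Fq_chol e); auto|]. apply chol_mult; [apply chol_const|apply Tc; auto].
  - intros z Hz. destruct (Fq_pb z Hz) as [M1 [r1 [Hr1 K1]]].
   have C : chol (fun p => cc * T p) z.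
   { apply chol_mult; [apply chol_const|]. destruct (HlE z Hz) as [? [?|?]]; apply Tc; lra. }
   destruct (pbounded_chol _ _ C) as [M2 [r2 [Hr2 K2]]].
   exists (M1 + M2)%R, (Rmin r1 r2). split; [apply Rmin_glb_lt; auto|]. intros p [Hp1 Hp2].
   specialize (K1 p (conj Hp1 (proj1 (Rlt_min Hp2)))).
   specialize (K2 p (conj Hp1 (proj2 (Rlt_min Hp2)))).
   unfold G. apply Cmod_tri. lra.
  - intros u. unfold G. fold y0. rewrite FqT, Tq. ring.
  - fold y0.
   have I1 : cint (fun x => Fq (x, y0) * ce (- (RtoC (IZR 0) * ((x, y0) : C)))) (- e) (- e + 1).
   { apply (fcoef_cint t Ht Fq (- e) exl Fq_1); auto; [intros; apply (Fq_chol e); auto|apply okline_bot; auto]. }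
   have I2 : cint (fun x => T (x, y0) * ce (- (RtoC (IZR 0) * ((x, y0) : C)))) (- e) (- e + 1).
   { apply (fcoef_cint t Ht T (- e) nil Tz); auto; [intros z []|apply okline_bot; auto]. }
   transitivity (F0 + cc * T0); [|unfold cc; field; auto].
   unfold F0, T0, fcoef. rewrite <- CI_scal, <- CI_plus; auto; [|apply cint_scal; auto].
   apply CI_ext; [lra|]. intros u _. unfold G. ring. }
 unfold G in Q. replace (Fq (x, y)) with ((Fq (x, y) + cc * T (x, y)) + (F0 / T0) * T (x, y)) by (unfold cc; ring).
 rewrite Q. unfold T. ring.
Qed.
End Factor.

Lemma Cmod_vert x y z : Cmod ((x, y) - (x, z)) = Rabs (y - z).
Proof.
 replace ((x, y) - (x, z)) with (0%R, (y - z)%R) by (unfold Cminus, Cplus, Copp; simpl; f_equal; ring).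
 unfold Cmod; simpl. rewrite <- sqrt_Rsqr_abs. f_equal. unfold Rsqr. ring.
Qed.

Lemma ccont_vert_zero g x y0 d : 0 < d -> ccont g (x, y0) -> (forall y, 0 < y - y0 < d -> g (x, y) = 0) -> g (x, y0) = 0.
Proof.
 intros Hd Hc Hz. apply Cmod_eq_0. apply Rle_antisym; [|pos]. apply Rnot_lt_le. intro K.
 destruct (Hc (Cmod (g (x, y0))%C) K) as [e [He H]].
 set (y := (y0 + Rmin (d / 2) (e / 2))%R).
 have B : 0 < y - y0 /\ y - y0 <= d / 2 /\ y - y0 <= e / 2.
 { unfold y. replace (y0 + Rmin (d / 2) (e / 2) - y0)%R with (Rmin (d / 2) (e / 2)) by ring. split; [apply Rmin_glb_lt; lra|split; [apply Rmin_l|apply Rmin_r]]. }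
 specialize (H (x, y)). rewrite Cmod_vert, (Rabs_pos_eq (y - y0)) in H by lra. rewrite Hz in H by lra.
 replace (0 - g (x, y0)) with (- g (x, y0)) in H by ring. rewrite Cmod_opp in H. lra.
Qed.

Lemma lip0_vert_zero f c d : 0 < d -> lip0 f c -> (forall y, 0 < y < d -> f (0%R, y) = 0) -> c = 0.
Proof.
 intros Hd [M [r [Hr H]]] Hz. apply Cmod_eq_0. apply Rle_antisym; [|apply Cmod_ge_0]. apply le_epsilon. intros e He.
 set (K := (Rabs M + 1)%R). have HK : 0 < K by (unfold K; pose proof (Rabs_pos M); lra).
 set (y := Rmin (Rmin (d / 2) (r / 2)) (e / K)).
 have B : (0 < y /\ y < d /\ y < r /\ y <= e / K)%R.
 { unfold y. pose proof (Rmin_l (Rmin (d / 2) (r / 2)) (e / K)). pose proof (Rmin_r (Rmin (d / 2) (r / 2)) (e / K)).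
  pose proof (Rmin_l (d / 2) (r / 2)). pose proof (Rmin_r (d / 2) (r / 2)).
  assert (0 < Rmin (Rmin (d / 2) (r / 2)) (e / K))%R by pos. lra. }
 have E : Cmod (0%R, y) = y.
 { replace (0%R, y) with ((0%R, y) - (0%R, 0%R)) by (unfold Cminus, Cplus, Copp; simpl; f_equal; ring). rewrite Cmod_vert.
  rewrite Rminus_0_r. apply Rabs_pos_eq. lra. }
 specialize (H (0%R, y)). rewrite E, Hz in H by lra. replace (0 - c) with (- c) in H by ring. rewrite Cmod_opp in H.
 have Q : M * y <= K * (e / K).
 { apply Rle_trans with (K * y)%R; [apply Rmult_le_compat_r; [lra|]; unfold K; pose proof (Rle_abs M); lra|apply Rmult_le_compat_l; lra]. }
 replace (K * (e / K))%R with e in Q by (field; lra). specialize (H arith). lra.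
Qed.

Section Factor2.
Variables t D : R.
Hypothesis Ht : 0 < t.
Hypothesis HD : 0 < D < 1.
Variable n : nat.
Variable f : C -> C.
Hypothesis Hf : in_Pn t D n f.
Hypothesis Hmon : monic_at0 n f.
Variable ls : list R.
Hypothesis Hls : forall s, In s ls -> 0 <= s < 1.
Hypothesis Hlen : length ls = n.
Hypothesis Hord : forall s, In s ls -> exists k, (count_occ Req_EM_T ls s <= k)%nat /\ zero_order f (gam t s) k.

Let b := bpt t D n ls.
Let mul (p : C) : C := th t p ^ n * th t (p - RtoC D) * ce (RtoC (INR (mup n)) * p).

Lemma thps_nz_off x y : - t / 2 < y < t -> y <> (t / 2)%R -> thp t (sgam t ls) (x, y) <> 0.
Proof.
 intros Hy Hn. apply thp_nz. intros z Hz K. apply in_sgam in Hz. destruct Hz as [s [_ ->]]. apply isZ_Im in K.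
 rewrite Im_minus, Im_gam in K. apply Hn. change (Im (x, y)) with y in K. lra.
Qed.

(** On gamma the quotient [Fq] takes arbitrary values at the listed zeros. The identity is therefore
    freed of its denominator and carried to gamma by continuity from above. *)
Lemma factor_mul : exists c : C,
 (forall x y, okline t y -> f (x, y) * mul (x, y) = c * th t ((x, y) - b) * thp t (sgam t ls) (x, y)) /\
 (forall s, f (gam t s) * mul (gam t s) = c * th t (gam t s - b) * thp t (sgam t ls) (gam t s)).
Proof.
 destruct (factor_lines t D Ht HD n f Hf ls Hls Hlen Hord) as [c Hc].
 have A : forall x y, okline t y -> f (x, y) * mul (x, y) = c * th t ((x, y) - b) * thp t (sgam t ls) (x, y).
 { intros x y O. unfold b. rewrite <- (Hc x y O). unfold Fq, mul. field. destruct O as [O1 [_ O2]].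
  apply thps_nz_off; lra. }
 exists c. split; auto. intros s. rewrite gam_eq. apply Ceq_minus.
 apply (ccont_vert_zero (fun p => f p * mul p - c * th t (p - b) * thp t (sgam t ls) p) s (t / 2) (t / 4)); [lra| |].
 - rewrite <- gam_eq. apply chol_cont, chol_minus; [apply chol_mult; [apply gam_chol with D n; auto|]|apply chol_mult; [apply chol_mult; [apply chol_const|]|]].
  + apply num_chol; auto. rewrite Im_gam. apply Rabs_def1; lra.
  + apply th_bpt_chol; auto. rewrite Im_gam. lra.
  + apply thps_chol; auto. rewrite Im_gam. lra.
 - intros y Hy. rewrite A; [ring|]. unfold okline. lra.
Qed.

(** Limit of the factorisation as p tends to 0 along the imaginary axis: p^n f tends to 1 and
    theta(p) / p to [B1]. This is how the condition at 0 fixes c. *)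
Lemma factor_norm (c : C) : (forall x y, okline t y -> f (x, y) * mul (x, y) = c * th t ((x, y) - b) * thp t (sgam t ls) (x, y)) ->
 B1 (cth t) ^ n * th t (- RtoC D) = c * th t (- b) * thp t (sgam t ls) 0.
Proof.
 intros A. apply Ceq_minus.
 have I0 : Im (RtoC 0) = 0%R by reflexivity.
 set (g := fun p => th t (p - RtoC D) * ce (RtoC (INR (mup n)) * p)).
 set (h := fun p => (- c) * (th t (p - b) * thp t (sgam t ls) p)).
 have L : lip0 (fun p => (p ^ n * f p) * (th t p / p) ^ n * g p + h p) (1 * B1 (cth t) ^ n * g 0 + h 0).
 { apply lip0_plus; [apply lip0_mult; [apply lip0_mult|]|].
  - pos.
  - apply lip0_pow, (Bf_lip0 (cth t) _ t Ht (cth_bd t Ht)).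
  - apply lip0_chol, chol_mult; [apply th_sh_chol; auto; rewrite I0, Rabs_R0; auto|].
   apply (chol_ce (fun p => RtoC (INR (mup n)) * p)). apply chol_mult; [apply chol_const|apply chol_id].
  - apply lip0_chol, chol_mult; [apply chol_const|apply chol_mult]; [apply th_bpt_chol|apply thps_chol]; auto; rewrite I0; lra. }
 have d0 : 0 < t / 4 by lra.
 have Z := lip0_vert_zero _ _ _ d0 L. etransitivity; [|apply Z].
 - unfold g, h. replace (0 - RtoC D) with (- RtoC D) by ring. replace (0 - b) with (- b) by ring.
  replace (RtoC (INR (mup n)) * 0) with (RtoC 0) by ring. rewrite ce_0. ring.
 - intros y Hy. set (p := (0%R, y) : C). have N : p <> 0 by (intro K; injection K; lra).
  replace (p ^ n * f p * (th t p / p) ^ n * g p) with (f p * mul p).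
  2: { unfold Cdiv. rewrite Cpow_mult_l. transitivity (f p * th t p ^ n * g p * (p ^ n * (/ p) ^ n)); [|ring].
     rewrite <- Cinv_pow, Cinv_r by (apply Cpow_nz; auto). unfold mul, g. ring. }
  have Ap := A 0%R y ltac:(unfold okline; lra). fold p in Ap. rewrite Ap. unfold h. ring.
Qed.

Lemma norm_nz (c : C) : B1 (cth t) ^ n * th t (- RtoC D) = c * th t (- b) * thp t (sgam t ls) 0 -> c <> 0 /\ th t (- b) <> 0.
Proof.
 intros E. have N : B1 (cth t) ^ n * th t (- RtoC D) <> 0.
 { apply Cmult_neq_0; [apply Cpow_nz, B1_neq0|apply (th_D_nz t D HD)]. }
 rewrite E in N. split; intro K; apply N; rewrite K; ring.
Qed.

(** If the order were larger than the zeros of the theta factors allow, solving the factorisation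
    for c would leave a positive power of p - z times a bounded function, so c = 0. *)
Lemma order_bound (c : C) s k : c <> 0 -> 0 <= s < 1 ->
 (forall x y, okline t y -> f (x, y) * mul (x, y) = c * th t ((x, y) - b) * thp t (sgam t ls) (x, y)) ->
 zero_order f (gam t s) k -> (k <= count_occ Req_EM_T ls s + 1)%nat /\ (~ isZ (gam t s - b) -> (k <= count_occ Req_EM_T ls s)%nat).
Proof.
 intros Hc Hs A Hk. set (k' := count_occ Req_EM_T ls s). set (z := gam t s).
 have Iz : Im z = (t / 2)%R by apply Im_gam.
 have Ib : Rabs (Im (z - b)) < t.
 { rewrite Im_minus, Iz. unfold b. destruct (Im_bpt t D n ls) as [-> | ->]; apply Rabs_def1; lra. }
 have P : exists e, (e <= 1)%nat /\ (~ isZ (z - b) -> e = 0%nat) /\ pbounded (fun p => (p - z) ^ e / th t (p - b)) z.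
 { destruct (classic (isZ (z - b))) as [[m Em]|N].
  - exists 1%nat. split; [lia|]. split; [intros N; exfalso; apply N; exists m; auto|].
   have B := pbounded_inv_th t z z Ht (or_introl eq_refl). destruct (Ceq_dec z z) as [_|]; [|tauto].
   apply (pbounded_ext_fun _ _ _ B). exists 1%R. split; [lra|]. intros p _. f_equal.
   replace (p - b) with (p - z + RtoC (IZR m)) by (rewrite <- Em; ring). symmetry. unfold th. rewrite Bf_Z. reflexivity.
  - exists 0%nat. split; [lia|]. split; auto.
   have B := pbounded_inv_th t z b Ht (or_intror (conj N Ib)). destruct (Ceq_dec z b) as [E|_]; auto.
   exfalso. apply N. exists 0%Z. rewrite E. ring. }
 destruct P as [e [He1 [He2 Pe]]].
 have B := pbounded_inv_thp t ls s Ht Hs Hls. destruct Hk as [r [g [Hr [Hg [Hgh Hfg]]]]]. fold z in Hg, Hgh, Hfg.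
 have Key : (k <= k' + e)%nat.
 2: { split; [lia|]. intros N. specialize (He2 N). lia. }
 apply Nat.nlt_ge. intro K. apply Hc.
 have Pb : pbounded (fun p => (p - z) ^ k' / thp t (sgam t ls) p * ((p - z) ^ e / th t (p - b)) * (mul p * g p)) z.
 { apply pbounded_mult; [apply pbounded_mult; auto|]. apply pbounded_chol, chol_mult.
  - apply num_chol; auto. rewrite Iz. apply Rabs_def1; lra.
  - apply holo_at_chol, Hgh. replace (z - z) with (RtoC 0) by ring. rewrite Cmod_0. auto. }
 destruct Pb as [M [r2 [Hr2 HM]]].
 (* The excess order is S m: k' zeros belong to the listed factors and e to the factor centred at
    [b]. *)
 set (m := (k - k' - e - 1)%nat).
  set (d := Rmin (Rmin r r2) (Rmin (t / 4) 1)) in *.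
 have Bd : (d <= r /\ d <= r2 /\ d <= t / 4 /\ d <= 1)%R.
 { unfold d. pose proof (Rmin_l (Rmin r r2) (Rmin (t / 4) 1)). pose proof (Rmin_r (Rmin r r2) (Rmin (t / 4) 1)).
  pose proof (Rmin_l r r2). pose proof (Rmin_r r r2). pose proof (Rmin_l (t / 4) 1). pose proof (Rmin_r (t / 4) 1). lra. }
 apply Cmod_eq_0. apply Rle_antisym; [|pos]. apply le_epsilon. intros eps Heps.
 have HK : 0 < Rabs M + 1 by (pose proof (Rabs_pos M); lra).
 set (y := Rmin (d / 2) (eps / (Rabs M + 1))).
 have By : (0 < y /\ y < d /\ y <= eps / (Rabs M + 1))%R.
 { unfold y. pose proof (Rmin_l (d / 2) (eps / (Rabs M + 1))). pose proof (Rmin_r (d / 2) (eps / (Rabs M + 1))).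
  assert (0 < Rmin (d / 2) (eps / (Rabs M + 1)))%R by pos. lra. }
 set (p := (s, (t / 2 + y)%R) : C).
 have Mp : Cmod (p - z) = y.
 { unfold p, z. rewrite gam_eq, Cmod_vert. replace (t / 2 + y - t / 2)%R with y by ring. apply Rabs_pos_eq. lra. }
 have Hp := HM p ltac:(rewrite Mp; lra).
 have Ap := A s (t / 2 + y)%R ltac:(unfold okline; lra). fold p in Ap. rewrite Hfg in Ap by (rewrite Mp; lra).
 have N1 : thp t (sgam t ls) p <> 0 by (apply thps_nz_off; lra).
 have N2 : th t (p - b) <> 0.
 { apply th_nz. intro Q. apply isZ_Im in Q. rewrite Im_minus in Q. change (Im p) with (t / 2 + y)%R in Q. unfold b in Q.
  destruct (Im_bpt t D n ls) as [E | E]; rewrite E in Q; lra. }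
 have E : c = (p - z) ^ (S m) * ((p - z) ^ k' / thp t (sgam t ls) p * ((p - z) ^ e / th t (p - b)) * (mul p * g p)).
 { transitivity (c * th t (p - b) * thp t (sgam t ls) p / (th t (p - b) * thp t (sgam t ls) p)); [field; auto|].
  rewrite <- Ap. replace k with (S m + (k' + e))%nat at 1 by (unfold m; lia). rewrite !Cpow_add_r. field. auto. }
 rewrite E, Cmod_mult, Cmod_pow, Mp.
 have Y : y ^ S m <= y.
 { simpl. rewrite <- (Rmult_1_r y) at 3. apply Rmult_le_compat_l; [lra|]. rewrite <- (pow1 m). apply pow_incr. lra. }
 apply Rle_trans with (y * (Rabs M + 1))%R.
 - apply Rmult_le_compat; auto; [pos|pos|]. pose proof (Rle_abs M). lra.
 - rewrite Rplus_0_l. apply Rmult_le_reg_r with (/ (Rabs M + 1))%R; [pos|].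
  rewrite Rmult_assoc, Rinv_r, Rmult_1_r by lra. apply By.
Qed.
End Factor2.

(* All zeros beyond the first [n] come from the single remaining theta factor. *)
Lemma zeros_le t D n f zs : 0 < t -> 0 < D < 1 -> in_Pn t D n f -> monic_at0 n f -> zeros_on_gamma t f zs ->
 (n <= length zs)%nat -> (length zs <= S n)%nat.
Proof.
 intros Ht HD Hf Hm [Hz1 Hz2] Hl. set (ls := firstn n zs). set (rs := skipn n zs).
 have Ez : zs = ls ++ rs by (symmetry; apply firstn_skipn).
 have Hls : forall s, In s ls -> 0 <= s < 1 by (intros; apply Hz1; rewrite Ez; apply in_or_app; auto).
 have Hlen : length ls = n by (apply firstn_length_le; auto).
 have Hord : forall s, In s ls -> exists k, (count_occ Req_EM_T ls s <= k)%nat /\ zero_order f (gam t s) k.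
 { intros s Hs. exists (count_occ Req_EM_T zs s). split; [rewrite Ez, count_occ_app; lia|]. apply Hz2; auto. }
 destruct (factor_mul t D Ht HD n f Hf ls Hls Hlen Hord) as [c [A _]].
 destruct (norm_nz t D HD n ls c (factor_norm t D Ht n f Hm ls c A)) as [Hc _].
 have O : forall s, 0 <= s < 1 -> (count_occ Req_EM_T rs s <= 1)%nat /\
   (~ isZ (gam t s - bpt t D n ls) -> count_occ Req_EM_T rs s = 0%nat).
 { intros s Hs. have Q := order_bound t D Ht HD n f ls Hls Hlen c s _ Hc Hs A (Hz2 s Hs).
  rewrite Ez, count_occ_app in Q. destruct Q as [Q1 Q2]. split; [lia|]. intros N. specialize (Q2 N). lia. }
 have Hr : (length rs <= 1)%nat.
 { destruct rs as [|s [|s' rs']] eqn:Er; simpl; try lia. exfalso.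
  have S1 : 0 <= s < 1 by (apply Hz1; rewrite Ez; apply in_or_app; right; left; auto).
  have S2 : 0 <= s' < 1 by (apply Hz1; rewrite Ez; apply in_or_app; right; right; left; auto).
  destruct (O s S1) as [O1 O2]. destruct (O s' S2) as [_ O4]. simpl in O1, O2, O4.
  destruct (Req_EM_T s s) as [_|]; [|tauto]. destruct (Req_EM_T s' s') as [_|]; [|tauto].
  destruct (Req_EM_T s' s) as [E|N]; [lia|]. destruct (Req_EM_T s s') as [E|_]; [pos|].
  have K1 : isZ (gam t s - bpt t D n ls) by (apply NNPP; intro K; specialize (O2 K); discriminate).
  have K2 : isZ (gam t s' - bpt t D n ls) by (apply NNPP; intro K; specialize (O4 K); discriminate).
  apply N, unit_Z; auto. destruct K1 as [m1 E1], K2 as [m2 E2]. exists (m2 - m1)%Z.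
  rewrite <- (gam_minus t), minus_IZR, RtoC_minus. change (RtoC (IZR m1)) with (IZR m1 : C) in E1. rewrite <- E1, <- E2. ring. }
 rewrite Ez, length_app. lia.
Qed.

(** * A lower bound for monic sections on gamma *)

Definition lsum (F : R -> R) (l : list R) : R := fold_right (fun s acc => F s + acc)%R 0%R l.
Definition mth (t x : R) : R := Cmod (th t (RtoC x)).
Definition mthp (t : R) (l : list R) (s : R) : R := fold_right (fun x acc => mth t (s - x) * acc)%R 1%R l.
(** Its exponential compares the capacity with the derivative of theta at 0, see [B1_Ecap]. It
    returns in [chi_LR] as minus the mean of [LR] against the equilibrium density. *)
Definition kap0 (t : R) : R := Series (fun k => 2 * cph t k - 2 * cth t k)%R.

Lemma geo_ex a A r : geo_bd a A r -> 0 <= r < 1 -> ex_series (fun k => 2 * a k)%R.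
Proof.
 intros [_ H] Hr. apply (ex_series_le (fun k => 2 * a k)%R (fun k => 2 * A * r ^ k)%R).
 - intros k. rewrite Rabs_mult, Rabs_pos_eq, Rmult_assoc by lra. apply Rmult_le_compat_l; [lra|pos].
 - apply ex_series_mul_l, ex_series_geom. apply Rabs_def1; lra.
Qed.

Lemma Cmod_B1 c A r : geo_bd c A r -> 0 <= r < 1 -> Cmod (B1 c) = (2 * PI * exp (Series (fun k => 2 * c k)))%R.
Proof.
 intros H Hr. unfold B1. rewrite (Bex_R c 0 A r H) by lra. rewrite !Cmod_mult, !Cmod_R, Cmod_Ci.
 have P := PI_RGT_0. rewrite (Rabs_pos_eq (exp _)) by pos.
 rewrite Rabs_left by lra. rewrite (Series_ext (fun k => 2 * c k * cos (om k * 0))%R (fun k => 2 * c k)%R); [ring|].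
 intros k. rewrite Rmult_0_r, cos_0. ring.
Qed.

Lemma B1_Ecap t : 0 < t -> (Cmod (B1 (cth t)) * exp (- (PI * t / 2)) = Ecap t * exp (- kap0 t))%R.
Proof.
 intros Ht. have Q := nome_bd t Ht.
 unfold Ecap. rewrite (Cmod_B1 _ _ _ (cth_bd t Ht)) by lra. change (RtoC 0) with (RtoC 0%R). rewrite (Bex_R (cph t) 0 _ _ (cph_bd t Ht)) by lra.
 rewrite Cmod_R, (Rabs_pos_eq (exp _)) by pos.
 rewrite (Series_ext (fun k => 2 * cph t k * cos (om k * 0))%R (fun k => 2 * cph t k)%R).
 2: { intros k. rewrite Rmult_0_r, cos_0. ring. }
 unfold kap0. rewrite Series_minus by (eapply geo_ex; [apply cph_bd || apply cth_bd|]; auto; lra).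
 replace (exp (Series (fun k => 2 * cth t k))%R) with (exp (Series (fun k => 2 * cph t k)%R) * exp (- (Series (fun k => 2 * cph t k)%R - Series (fun k => 2 * cth t k)%R)))%R.
 - ring.
 - rewrite <- exp_plus. f_equal. ring.
Qed.

Lemma th_gam_mod t s : 0 < t -> Cmod (th t (gam t s)) = exp (LR t s).
Proof. intros Ht. rewrite th_gam, Cmod_R by auto. apply Rabs_pos_eq. left; apply exp_pos. Qed.

Lemma th_ogam_mod t s : 0 < t -> Cmod (th t (- gam t s)) = exp (PI * t + LR t s).
Proof.
 intros Ht. unfold th. rewrite Bf_opp, Cmod_mult, Cmod_opp, Cmod_ce, Im_opp, Im_gam. fold (th t). rewrite th_gam_mod by auto.
 rewrite <- exp_plus. f_equal. field.
Qed.

Lemma cth_abs_ex t : 0 < t -> ex_series (fun k => 2 * Rabs (cth t k))%R.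
Proof.
 intros Ht. destruct (cth_bd t Ht) as [G1 G2]. apply (geo_ex _ (/ (1 - nome t)) (nome t)); [|pose proof (nome_bd t Ht); lra].
 split; auto. intros k. rewrite Rabs_Rabsolu. apply G2.
Qed.

Lemma LT_abs t x : 0 < t -> ex_series (fun k => 2 * cth t k * cos (om k * x))%R /\
 exp (LT t x) <= exp (Series (fun k => 2 * Rabs (cth t k))).
Proof.
 intros Ht. destruct (Rabs_Series_le (fun k => 2 * cth t k * cos (om k * x))%R (fun k => 2 * Rabs (cth t k))%R) as [E B].
 - intros k. rewrite !Rabs_mult, (Rabs_pos_eq 2) by lra. rewrite <- (Rmult_1_r (2 * Rabs (cth t k))) at 2.
  apply Rmult_le_compat_l; [pos|]. apply Rabs_le, COS_bound.
 - apply cth_abs_ex; auto.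
 - split; auto. apply exp_le_mono. eapply Rle_trans; [apply Rle_abs|pos].
Qed.

Lemma mth_le t x : 0 < t -> mth t x <= 2 * exp (Series (fun k => 2 * Rabs (cth t k))).
Proof.
 intros Ht. unfold mth. rewrite th_R, Cmod_mult, Cmod_R by auto. rewrite (Rabs_pos_eq (exp _)) by pos.
 apply Rmult_le_compat; [pos|pos| |].
 - apply Cmod_tri. rewrite Cmod_opp, Cmod_1, Cmod_ce.
  replace (- (2 * PI * Im (RtoC x)))%R with 0%R by (unfold RtoC, Im; simpl; ring). rewrite exp_0. lra.
 - apply LT_abs; auto.
Qed.

Lemma thp_gam_mod t ls s : Cmod (thp t (sgam t ls) (gam t s)) = mthp t ls s.
Proof.
 induction ls as [|x l IH]; cbn [sgam map thp mthp fold_right]; [apply Cmod_1|].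
 rewrite Cmod_mult, gam_minus. f_equal. exact IH.
Qed.

Lemma thp_0_mod t ls : 0 < t -> Cmod (thp t (sgam t ls) 0)%C = exp (INR (length ls) * (PI * t) + lsum (LR t) ls).
Proof.
 intros Ht. induction ls as [|x l IH].
 - cbn [sgam map thp]. rewrite Cmod_1. simpl. rewrite Rmult_0_l, Rplus_0_l, exp_0. auto.
 - cbn [sgam map thp]. rewrite Cmod_mult. fold (sgam t l). rewrite IH. replace (0 - gam t x) with (- gam t x) by ring. rewrite th_ogam_mod by auto.
  rewrite <- exp_plus. f_equal. cbn [length lsum fold_right]. fold (lsum (LR t) l). rewrite S_INR. ring.
Qed.

Lemma mthp_nonneg t l s : 0 <= mthp t l s.
Proof. induction l; simpl; [lra|]. apply Rmult_le_pos; auto. apply Cmod_ge_0. Qed.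

(* The theta function at [b] contributes only a bounded factor at [0]; on [gamma] it is either bounded below, or one more factor of the product. *)
Lemma last_factor t D n ls : 0 < t -> exists L, (L = ls \/ exists x, L = x :: ls) /\
 Cmod (th t (- bpt t D n ls)) <= 2 * exp (PI * t + Series (rk t) + Series (fun k => 2 * Rabs (cth t k))) /\
 forall s, exp (- Series (rk t)) * mthp t L s <= Cmod (th t (gam t s - bpt t D n ls)) * mthp t ls s.
Proof.
 intros Ht. set (S0 := Series (rk t)). set (S1 := Series (fun k => 2 * Rabs (cth t k))%R).
 have P0 : 0 < PI * t by pos.
 have B0 : forall x, - S0 <= LR t x <= S0.
 { intros x. have B := LR_bound t x Ht. fold S0 in B. apply Rabs_le_between in B. lra. }
 have S0p : 0 <= S0 by (specialize (B0 0%R); lra).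
 have S1p : 0 <= S1.
 { apply Series_nonneg; [|apply cth_abs_ex; auto]. intros k. pose proof (Rabs_pos (cth t k)). lra. }
 set (x := (D - Rsum ls)%R). unfold bpt. fold x. destruct (Nat.even n).
 - exists ls. split; [auto|]. split.
  + replace (- (RtoC x + 0)) with (RtoC (- x)) by (rewrite RtoC_opp; ring). eapply Rle_trans; [apply mth_le; auto|].
   fold S1. apply Rmult_le_compat_l; [lra|]. apply exp_le_mono. lra.
  + intros s. apply Rmult_le_compat_r; [apply mthp_nonneg|].
   replace (gam t s - (RtoC x + 0)) with (gam t (s - x)) by (unfold gam; rewrite RtoC_minus; ring).
   rewrite th_gam_mod by auto. apply exp_le_mono, B0.
 - exists (x :: ls). split; [right; exists x; auto|]. split.
  + replace (- (RtoC x + RtoC (/ 2) * tauC t)) with (- gam t x).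
   2: { unfold gam, tauC, RtoC, Copp, Cplus, Cmult; simpl. f_equal; field. }
   rewrite th_ogam_mod by auto. have X := exp_pos (PI * t + S0 + S1).
   assert (exp (PI * t + LR t x) <= exp (PI * t + S0 + S1))%R by (apply exp_le_mono; specialize (B0 x); lra). lra.
  + intros s. cbn [mthp fold_right]. fold (mthp t ls s).
   replace (gam t s - (RtoC x + RtoC (/ 2) * tauC t)) with (RtoC (s - x)).
   2: { unfold gam, tauC, RtoC, Cminus, Copp, Cplus, Cmult; simpl. f_equal; field. }
   fold (mth t (s - x)). rewrite <- (Rmult_1_l (mth t (s - x) * mthp t ls s)) at 2. apply Rmult_le_compat_r.
   * apply Rmult_le_pos; [pos|apply mthp_nonneg].
   * rewrite <- exp_0. apply exp_le_mono. lra.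
Qed.

(** The factorisation on gamma with its constant eliminated through the value at 0. What does not
    grow with n is collected in c0, so the exponent is exact in its terms of order n. *)
Lemma section_lower t D : 0 < t -> 0 < D < 1 -> exists c0, 0 < c0 /\ forall n f ls,
 in_Pn t D n f -> monic_at0 n f -> (forall s, In s ls -> 0 <= s < 1) -> length ls = n ->
 (forall s, In s ls -> exists k, (count_occ Req_EM_T ls s <= k)%nat /\ zero_order f (gam t s) k) ->
 exists L, (L = ls \/ exists x, L = x :: ls) /\ forall s,
  c0 * (exp (- lsum (LR t) ls - INR n * LR t s - INR n * kap0 t) * mthp t L s) * Ecap t ^ n <= Cmod (f (gam t s)).
Proof.
 intros Ht HD. set (S0 := Series (rk t)). set (S1 := Series (fun k => 2 * Rabs (cth t k))%R).
 set (mD := Cmod (th t (- RtoC D))). set (C1 := (2 * exp (PI * t + S0 + S1))%R).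
 have HmD : 0 < mD by (apply Cmod_gt_0, (th_D_nz t D HD)).
  (* [mD] is |theta(-D)| and C1 bounds |theta(-b)|, both from the condition at 0; one factor exp(-
     S0) bounds 1 / theta(p - D) on gamma, the other comes from [last_factor]. *)
  exists (mD / C1 * exp (- S0) * exp (- S0))%R. split.
 { pos. }
 intros n f ls Hf Hm Hls Hlen Hord.
 destruct (factor_mul t D Ht HD n f Hf ls Hls Hlen Hord) as [c [A1 A2]].
 have Nm := factor_norm t D Ht n f Hm ls c A1. destruct (norm_nz t D HD n ls c Nm) as [_ Nb].
 destruct (last_factor t D n ls Ht) as [L [HL [HL1 HL2]]]. exists L. split; auto. intros s.
 fold S0 S1 in HL1, HL2. specialize (HL2 s).
 have A := f_equal Cmod (A2 s). rewrite !Cmod_mult, Cmod_pow, th_gam_mod, thp_gam_mod, Cmod_ce in A by auto.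
 have Nn := f_equal Cmod Nm. rewrite !Cmod_mult, Cmod_pow, thp_0_mod in Nn by auto. fold mD in Nn. rewrite Hlen in Nn.
 set (b := bpt t D n ls) in *.
 replace (gam t s - RtoC D) with (gam t (s - D)) in A by (unfold gam; rewrite RtoC_minus; ring).
 rewrite th_gam_mod in A by auto.
 have Im0 : Im (RtoC (INR (mup n)) * gam t s) = (INR (mup n) * (t / 2))%R.
 { unfold gam, tauC, RtoC, Im, Cmult, Cplus; simpl. ring. }
 rewrite Im0 in A. rewrite <- exp_pow in A.
 set (F := Cmod (f (gam t s))) in *. set (tb := Cmod (th t (- b))) in *. set (T := Cmod (th t (gam t s - b))) in *.
 have Ltb : 0 < tb by (apply Cmod_gt_0; auto).
 set (W := lsum (LR t) ls) in *.
 have Ec : Cmod (B1 (cth t)) ^ n * exp (- (INR n * (PI * t) + W)) * mD / C1 <= Cmod c.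
 { replace (Cmod c) with (Cmod (B1 (cth t)) ^ n * exp (- (INR n * (PI * t) + W)) * mD / tb)%R.
  - apply Rmult_le_compat_l; [|apply Rinv_le_contravar; auto].
   apply Rmult_le_pos; [pos|lra].
  - transitivity (Cmod (B1 (cth t)) ^ n * mD * exp (- (INR n * (PI * t) + W)) / tb)%R; [pos|].
   rewrite Nn. pose proof (exp_pos (INR n * (PI * t) + W)) as X. rewrite exp_Ropp. field. split; apply Rgt_not_eq; auto. }
 have Fe : (F = Cmod c * (T * mthp t ls s) * (exp (- (INR n * LR t s)) * exp (- LR t (s - D)) * exp (2 * PI * (INR (mup n) * (t / 2)))))%R.
 { replace (Cmod c * (T * mthp t ls s))%R with (Cmod c * T * mthp t ls s)%R by ring. rewrite <- A.
  transitivity (F * (exp (INR n * LR t s) * exp (- (INR n * LR t s))) * (exp (LR t (s - D)) * exp (- LR t (s - D))) * (exp (- (2 * PI * (INR (mup n) * (t / 2)))) * exp (2 * PI * (INR (mup n) * (t / 2)))))%R; [|ring].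
  rewrite <- !exp_plus. replace (INR n * LR t s + - (INR n * LR t s))%R with 0%R by ring. replace (LR t (s - D) + - LR t (s - D))%R with 0%R by ring.
  replace (- (2 * PI * (INR (mup n) * (t / 2))) + 2 * PI * (INR (mup n) * (t / 2)))%R with 0%R by ring. rewrite exp_0. ring. }
 have B0 : LR t (s - D) <= S0.
 { have B := LR_bound t (s - D) Ht. fold S0 in B. apply Rabs_le_between in B. lra. }
 (* The modulus of e(mup p) on gamma is exp(- PI t mup); rounding n / 2 up helps the lower bound. *)
 have Mu : INR n / 2 <= INR (mup n).
 { unfold mup. apply Rmult_le_reg_l with 2%R; [lra|]. replace (2 * (INR n / 2))%R with (INR n) by field.
  change 2%R with (INR 2). rewrite <- mult_INR. apply le_INR. destruct (Nat.Even_or_Odd (S n)) as [[j E]|[j E]]; rewrite E.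
  - rewrite Nat.div2_double. lia.
  - replace (2 * j + 1)%nat with (S (2 * j)) by lia. rewrite Nat.div2_succ_double. lia. }
 have P0 : 0 < PI * t by pos.
 have En : (Cmod (B1 (cth t)) ^ n * exp (- (INR n * (PI * t / 2))) = Ecap t ^ n * exp (- (INR n * kap0 t)))%R.
 { replace (- (INR n * (PI * t / 2)))%R with (INR n * (- (PI * t / 2)))%R by ring. replace (- (INR n * kap0 t))%R with (INR n * (- kap0 t))%R by ring.
  rewrite !exp_pow, <- !Rpow_mult_distr. f_equal. apply B1_Ecap; auto. }
 rewrite Fe.
 apply Rle_trans with ((Cmod (B1 (cth t)) ^ n * exp (- (INR n * (PI * t) + W)) * mD / C1) * (exp (- S0) * mthp t L s) *
   (exp (- (INR n * LR t s)) * exp (- S0) * exp (INR n * (PI * t / 2))))%R.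
 - right.
  transitivity (mD / C1 * exp (- S0) * exp (- S0) * mthp t L s * (Ecap t ^ n * exp (- (INR n * kap0 t))) * (exp (- W) * exp (- (INR n * LR t s))))%R.
  { rewrite <- exp_plus. replace (- W - INR n * LR t s - INR n * kap0 t)%R with (- (INR n * kap0 t) + (- W + - (INR n * LR t s)))%R by ring. rewrite (exp_plus (- (INR n * kap0 t))). ring. }
  rewrite <- En. replace (exp (- (INR n * (PI * t) + W)) )%R with (exp (- (INR n * (PI * t / 2))) * exp (- (INR n * (PI * t / 2))) * exp (- W))%R.
  2: { rewrite <- !exp_plus. f_equal. field. }
  have X : (exp (- (INR n * (PI * t / 2))) * exp (INR n * (PI * t / 2)) = 1)%R.
  { rewrite <- exp_plus. replace (- (INR n * (PI * t / 2)) + INR n * (PI * t / 2))%R with 0%R by ring. apply exp_0. }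
  transitivity (mD / C1 * exp (- S0) * exp (- S0) * mthp t L s * (Cmod (B1 (cth t)) ^ n * exp (- (INR n * (PI * t / 2)))) *
   (exp (- W) * exp (- (INR n * LR t s))) * (exp (- (INR n * (PI * t / 2))) * exp (INR n * (PI * t / 2))))%R; [rewrite X|pos]; ring.
 - have M0 := mthp_nonneg t L s.
  apply Rmult_le_compat.
  + apply Rmult_le_pos; [|pos]. apply Rmult_le_pos; [|pos].
   apply Rmult_le_pos; [pos|lra].
  + pos.
  + apply Rmult_le_compat; auto; [|pos].
   apply Rmult_le_pos; [|pos].
   apply Rmult_le_pos; [pos|lra].
  + apply Rmult_le_compat; [pos|pos| |].
   * apply Rmult_le_compat_l; [pos|]. apply exp_le_mono. lra.
   * apply exp_le_mono. apply Rle_trans with (INR (mup n) * (PI * t))%R; [|pos].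
    apply Rle_trans with (INR n / 2 * (PI * t))%R; [pos|apply Rmult_le_compat_r; lra].
Qed.

Close Scope C_scope.

(** * Moments of the zeros *)

Lemma contR_eps (f : R -> R) x : (forall e, 0 < e -> exists d, 0 < d /\ forall y, Rabs (y - x) < d -> Rabs (f y - f x) < e) <-> continuous f x.
Proof.
 split.
 - intros H. apply filterlim_locally. intros e. destruct (H e (cond_pos e)) as [d [Hd K]].
  exists (mkposreal d Hd). intros y Hy. apply K, Hy.
 - intros H e He. destruct (proj1 (filterlim_locally f (f x)) H (mkposreal e He)) as [d K].
  exists d. split; [apply cond_pos|]. intros y Hy. exact (K y Hy).
Qed.

(** N depends on the majorant only, which gives uniformity for series of functions. *)
Lemma Series_tail (b : nat -> R) e : ex_series b -> 0 < e -> exists N, forall u : nat -> R,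
 (forall k, Rabs (u k) <= b k) -> Rabs (Series u - sum_f_R0 u N) < e.
Proof.
 intros Hb He. destruct Hb as [lb Hb].
 have Q := proj1 (is_lim_seq_Reals _ _) Hb. destruct (Q e He) as [N HN]. exists N. intros u Hu.
 have Eb : ex_series b by (exists lb; auto). have Eu := proj1 (Rabs_Series_le u b Hu Eb).
 rewrite (Series_incr_n u (S N)) by (auto; lia). simpl pred.
 replace (sum_f_R0 u N + Series (fun k => u (S N + k)%nat) - sum_f_R0 u N) with (Series (fun k => u (S N + k)%nat)) by ring.
 have Es : ex_series (fun k => b (S N + k)%nat) by (apply (ex_series_incr_n b (S N)), Eb).
 eapply Rle_lt_trans; [apply (Rabs_Series_le (fun k => u (S N + k)%nat) (fun k => b (S N + k)%nat)); auto|].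
 specialize (HN N (le_n _)). unfold Rdist in HN. rewrite sum_n_Reals in HN.
 have Elb : lb = Series b by (symmetry; apply is_series_unique; auto).
 rewrite Elb, (Series_incr_n b (S N)) in HN by (auto; lia). simpl pred in HN.
 have P : 0 <= Series (fun k => b (S N + k)%nat).
 { apply Series_nonneg; auto. intros k. eapply Rle_trans; [pos|pos]. }
 rewrite Rabs_left1 in HN by lra. lra.
Qed.

Section Termwise.
Variable u : nat -> R -> R.
Variable b : nat -> R.
Variable R0 : R.
Hypothesis HR0 : 1 < R0.
Hypothesis Hc : forall k x, continuous (u k) x.
Hypothesis Hu : forall k x, Rabs x < R0 -> Rabs (u k x) <= b k.
Hypothesis Hb : ex_series b.

Lemma cont_psum N x : continuous (fun x => sum_f_R0 (fun k => u k x) N) x.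
Proof. induction N; simpl; [pos|apply contR_plus; auto]. Qed.

(** Domination is assumed for |x| < R0 only: the majorants used for the sech series grow with the
    interval. *)
Lemma cont_Series_loc x : Rabs x < R0 -> continuous (fun x => Series (fun k => u k x)) x.
Proof.
 intros Hx. apply contR_eps. intros e He. destruct (Series_tail b (e / 3) Hb arith) as [N HN].
 destruct (proj2 (contR_eps _ x) (cont_psum N x) (e / 3) arith) as [d [Hd K]].
 exists (Rmin d (R0 - Rabs x)). split; [pos|]. intros y Hy.
 specialize (K y (proj1 (Rlt_min Hy))). have Hy2 := Rlt_le_trans _ _ _ Hy (Rmin_r _ _).
 have Ry : Rabs y < R0.
 { replace y with (x + (y - x)) by ring. eapply Rle_lt_trans; [apply Rabs_triang|]. lra. }
 have A := HN (fun k => u k x) (fun k => Hu k x Hx). have B := HN (fun k => u k y) (fun k => Hu k y Ry).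
 apply Rabs_def2 in A, B, K. apply Rabs_def1; lra.
Qed.

Lemma RInt_psum N : RInt (fun x => sum_f_R0 (fun k => u k x) N) 0 1 = sum_f_R0 (fun k => RInt (u k) 0 1) N.
Proof.
 induction N; simpl; [pos|]. rewrite RInt_plusR; [pos| |apply ex_RInt_contR; auto].
 apply ex_RInt_contR. intros; apply cont_psum.
Qed.

Lemma unit_in x : 0 <= x <= 1 -> Rabs x < R0.
Proof. intros H. rewrite Rabs_pos_eq; lra. Qed.

Lemma RInt_Series_loc : ex_series (fun k => RInt (u k) 0 1) /\ RInt (fun x => Series (fun k => u k x)) 0 1 = Series (fun k => RInt (u k) 0 1).
Proof.
 have HI : forall k, Rabs (RInt (u k) 0 1) <= b k.
 { intros k. replace (b k) with ((1 - 0) * b k) by ring. apply (abs_RInt_le_const (u k) 0 1 (b k)); [lra|apply ex_RInt_contR; auto|].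
  intros x Hx. apply Hu, unit_in, Hx. }
 have EI := Rabs_Series_le _ _ HI Hb. split; [apply EI|].
 have ES : ex_RInt (fun x => Series (fun k => u k x)) 0 1.
 { apply (ex_RInt_continuous (V := VR)). intros x Hx. apply cont_Series_loc, unit_in.
  rewrite Rmin_left, Rmax_right in Hx by lra. exact Hx. }
 apply Rminus_diag_uniq. have Z : Rabs (RInt (fun x => Series (fun k => u k x)) 0 1 - Series (fun k => RInt (u k) 0 1)) <= 0.
 2: { apply Rabs_le_between in Z. lra. }
 apply le_epsilon. intros e He. rewrite Rplus_0_l.
 destruct (Series_tail b (e / 2) Hb arith) as [N HN].
 have A := HN _ HI.
 have EP : ex_RInt (fun x => sum_f_R0 (fun k => u k x) N) 0 1 by (apply ex_RInt_contR; intros; apply cont_psum).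
 have B : Rabs (RInt (fun x => Series (fun k => u k x) - sum_f_R0 (fun k => u k x) N) 0 1) <= e / 2.
 { replace (e / 2) with ((1 - 0) * (e / 2)) by ring. apply (abs_RInt_le_const (fun x => Series (fun k => u k x) - sum_f_R0 (fun k => u k x) N) 0 1 (e / 2)); [lra| |].
  - apply (ex_RInt_minus (V := R_NormedModule) (fun x => Series (fun k => u k x))); auto.
  - intros x Hx. left. apply HN. intros; apply Hu, unit_in, Hx. }
 rewrite (RInt_minusR (fun x => Series (fun k => u k x))) in B by auto.
 rewrite RInt_psum in B. apply Rabs_def2 in A. apply Rabs_le_between in B. apply Rabs_le. lra.
Qed.
End Termwise.

Lemma cont_Series (u : nat -> R -> R) (b : nat -> R) x : (forall k x, continuous (u k) x) -> (forall k x, Rabs (u k x) <= b k) -> ex_series b ->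
 continuous (fun x => Series (fun k => u k x)) x.
Proof.
 intros Hc Hu Hb. apply (cont_Series_loc u b (Rabs x + 2)); auto. lra.
Qed.

Lemma RInt_Series (u : nat -> R -> R) (b : nat -> R) : (forall k x, continuous (u k) x) -> (forall k x, Rabs (u k x) <= b k) -> ex_series b ->
 ex_series (fun k => RInt (u k) 0 1) /\ RInt (fun x => Series (fun k => u k x)) 0 1 = Series (fun k => RInt (u k) 0 1).
Proof. intros Hc Hu Hb. apply (RInt_Series_loc u b 2); auto; lra. Qed.

Definition cosk (k : nat) (x : R) : R := cos (om k * x).

Lemma cont_cos_affine a b x : continuous (fun s => cos (a * s + b)) x.
Proof.
 apply contR_derive with (- (a * sin (a * x + b))). auto_derive; auto. ring.
Qed.

Lemma RInt_cos_freq (j : nat) b : (1 <= j)%nat -> RInt (fun s => cos (om j * s + b)) 0 1 = 0.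
Proof.
 intros Hj. have P := PI_RGT_0. have J : INR j <> 0 by (apply not_0_INR; lia).
 apply is_RInt_unique.
 replace 0 with (minus (sin (om j * 1 + b) / (om j)) (sin (om j * 0 + b) / (om j))) at 2.
 - apply (is_RInt_derive (fun s => sin (om j * s + b) / (om j))).
  + intros x _. auto_derive; auto. field. split; auto. lra.
  + intros x _. apply cont_cos_affine.
 - unfold minus, plus, opp; simpl. replace (om j * 1 + b) with (b + 2 * INR j * PI) by ring.
  rewrite sin_period. replace (om j * 0 + b) with b by ring. ring.
Qed.

Lemma cos_prod a b : cos a * cos b = / 2 * (cos (a - b) + cos (a + b)).
Proof. rewrite cos_minus, cos_plus. field. Qed.

Lemma RInt_cosk_cos k m x theta : (1 <= m)%nat ->
 RInt (fun s => cosk k (s - x) * cos (om m * s - theta)) 0 1 = (if Nat.eqb k m then / 2 * cos (om m * x - theta) else 0).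
Proof.
 intros Hm.
 have E : RInt (fun s => cosk k (s - x) * cos (om m * s - theta)) 0 1 =
   / 2 * (RInt (fun s => cos (2 * PI * (INR k - INR m) * s + (theta - om k * x))) 0 1 +
      RInt (fun s => cos (2 * PI * INR (k + m) * s + (- theta - om k * x))) 0 1).
 { rewrite <- RInt_plusR by (apply ex_RInt_contR; intros; apply cont_cos_affine).
  rewrite <- RInt_mulR. 2: { apply ex_RInt_contR. intros; apply contR_plus; apply cont_cos_affine. }
  apply RInt_ext. intros s _. unfold cosk. rewrite cos_prod, plus_INR. req.
  match goal with |- _ * (cos ?a + cos ?b) = _ * (cos ?c + cos ?d) => replace a with c by ring; replace b with d by ring end. reflexivity. }
 rewrite E, RInt_cos_freq, Rplus_0_r by lia. destruct (Nat.eqb_spec k m) as [->|N].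
 - f_equal. rewrite (RInt_ext _ (fun _ => cos (om m * x - theta))).
  + rewrite RInt_const. unfold scal; simpl; unfold mult; simpl. ring.
  + intros s _. rewrite <- cos_neg. f_equal. ring.
 - destruct (Nat.lt_ge_cases k m).
  + rewrite (RInt_ext _ (fun s => cos (2 * PI * INR (m - k) * s + - (theta - om k * x)))).
   * rewrite RInt_cos_freq by lia. apply Rmult_0_r.
   * intros s _. rewrite <- cos_neg. f_equal. rewrite minus_INR by lia. ring.
  + rewrite (RInt_ext _ (fun s => cos (2 * PI * INR (k - m) * s + (theta - om k * x)))).
   * rewrite RInt_cos_freq by lia. apply Rmult_0_r.
   * intros s _. rewrite minus_INR by lia. reflexivity.
Qed.

Lemma Series_single (m : nat) (a : nat -> R) : ex_series (fun k => if Nat.eqb k m then a k else 0) /\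
 Series (fun k => if Nat.eqb k m then a k else 0) = a m.
Proof.
 have Z : ex_series (fun k => if Nat.eqb k m then a k else 0).
 { apply (ex_series_incr_n _ (S m)). apply ex_series_ext with (fun k => 0 * (/ 2) ^ k).
  - intros k. destruct (Nat.eqb_spec (S m + k) m); [lia|]. apply Rmult_0_l.
  - apply ex_series_mul_l, ex_series_geom. apply Rabs_def1; lra. }
 split; auto. rewrite (Series_incr_n _ (S m)) by (auto; lia). simpl pred.
 rewrite (Series_ext (fun k => if Nat.eqb (S m + k) m then a (S m + k)%nat else 0) (fun k => 0 * 0)).
 2: { intros k. destruct (Nat.eqb_spec (S m + k) m); [lia|ring]. }
 rewrite Series_scal_l, Rmult_0_l, Rplus_0_r.
 have Y : forall j, (j < m)%nat -> sum_f_R0 (fun k => if Nat.eqb k m then a k else 0) j = 0.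
 { induction j as [|j IHj]; intros Hj.
  - destruct m; [lia|pos].
  - rewrite tech5, IHj by lia. destruct (Nat.eqb_spec (S j) m); [lia|ring]. }
 destruct m; [pos|]. rewrite tech5, Y, Nat.eqb_refl by lia. ring.
Qed.

(** This is 1 / cosh (PI k t), the k-th cosine moment of the equilibrium density. *)
Definition ch (t : R) (k : nat) : R := 2 * (hnome t ^ k / (1 + nome t ^ k)).

Lemma ch_bd t k : 0 < t -> 0 <= ch t k <= 2 * hnome t ^ k.
Proof.
 intros Ht. unfold ch. have H := pow_lt _ k (proj1 (hnome_bd t Ht)). have Q := pow_lt _ k (proj1 (nome_bd t Ht)).
 split; [pos|].
 apply Rmult_le_compat_l; [lra|]. rewrite <- (Rmult_1_r (hnome t ^ k)) at 2. apply Rmult_le_compat_l; [lra|].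
 rewrite <- Rinv_1. apply Rinv_le_contravar; lra.
Qed.

Lemma ch_ex t : 0 < t -> ex_series (ch t).
Proof.
 intros Ht. apply (Rabs_Series_le (ch t) (fun k => 2 * hnome t ^ k)).
 - intros k. destruct (ch_bd t k Ht). rewrite Rabs_pos_eq; auto.
 - apply ex_series_mul_l, ex_series_geom. destruct (hnome_bd t Ht). apply Rabs_def1; lra.
Qed.

(* Fourier coefficients of [- ln |1 - rho e(x)| - LT x] *)
Definition lamk (t rho : R) (k : nat) : R := invk k * rho ^ k - 2 * cth t k.

(** The equilibrium relation. At rho = 1 it says that the average of ln |theta(s - x)| against the
    density is [LR] at x, coefficient by coefficient; the last term is the error of the
    smoothing. *)
Lemma lamk_ch t rho k : 0 < t -> lamk t rho k * ch t k = rk t k - invk k * (1 - rho ^ k) * ch t k.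
Proof.
 intros Ht. unfold lamk, ch, rk, cth. destruct k as [|k]; [simpl; ring|].
 have B := pow_lt1 _ (S k) (nome_bd t Ht) ltac:(lia). have B1 := nome_bd t Ht.
 set (Q := nome t ^ S k) in *. field. split; lra.
Qed.

(** By this formula the constant of [B1_Ecap] is minus the average of [LR] against the density, and
    the capacity drops out of the energy estimate. *)
Lemma kap0_rk t : 0 < t -> kap0 t = Series (fun k => rk t k * ch t k).
Proof.
 intros Ht. apply Series_ext. intros k. unfold cph, cth, rk, ch. destruct k as [|k]; [simpl; ring|].
 have B := pow_lt1 _ (S k) (nome_bd t Ht) ltac:(lia). have B1 := nome_bd t Ht.
 rewrite (nome_hnome t (S k)) in *. set (H := hnome t ^ S k) in *. field. split; lra.
Qed.

Lemma cth_neg t k : 0 < t -> cth t k <= 0.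
Proof.
 intros Ht. unfold cth. destruct k as [|k]; [simpl; lra|].
 have B := pow_lt1 _ (S k) (nome_bd t Ht) ltac:(lia). have B1 := nome_bd t Ht. have I := invk_le1 (S k).
 assert (0 <= invk (S k) * (nome t ^ S k / (1 - nome t ^ S k))); [|lra].
 apply Rmult_le_pos; [lra|]. left; apply Rdiv_lt_0_compat; lra.
Qed.

Lemma lamk_pos t rho k : 0 < t -> 0 <= rho -> 0 <= lamk t rho k.
Proof.
 intros Ht Hr. unfold lamk. have C := cth_neg t k Ht. have I := invk_le1 k. assert (0 <= rho ^ k) by (apply pow_le; auto).
 assert (0 <= invk k * rho ^ k) by pos. lra.
Qed.

Lemma lamk_ex t rho : 0 < t -> 0 <= rho < 1 -> ex_series (lamk t rho).
Proof.
 intros Ht Hr. apply (ex_series_minus (K := R_AbsRing) (V := R_NormedModule) (fun k => invk k * rho ^ k) (fun k => 2 * cth t k)).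
 - apply (Rabs_Series_le _ (fun k => rho ^ k)).
  + intros k. have I := invk_le1 k. assert (0 <= rho ^ k) by pos.
   rewrite Rabs_pos_eq by (apply Rmult_le_pos; lra). rewrite <- (Rmult_1_l (rho ^ k)) at 2. apply Rmult_le_compat_r; lra.
  + apply ex_series_geom. apply Rabs_def1; lra.
 - eapply geo_ex; [apply cth_bd; auto|]. pose proof (nome_bd t Ht). lra.
Qed.

(** Bernoulli's inequality; the factor 1 / k makes the smoothing error uniform in k. *)
Lemma bern_le rho k : 0 <= rho <= 1 -> 0 <= invk k * (1 - rho ^ k) <= 1 - rho.
Proof.
 intros Hr. destruct k as [|k]; [pos|]. have R1 : 0 <= rho ^ S k <= 1 by (split; [pos|rewrite <- (pow1 (S k)); apply pow_incr; lra]).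
 have P : 0 < INR (S k) by (apply lt_0_INR; lia).
 have Q : 1 - rho ^ S k <= INR (S k) * (1 - rho).
 { clear - Hr. induction k as [|k IH]; [simpl; lra|]. rewrite S_INR. change (rho ^ S (S k)) with (rho * rho ^ S k).
  assert (0 <= rho ^ S k <= 1) by (split; [pos|rewrite <- (pow1 (S k)); apply pow_incr; lra]).
  assert (0 <= (1 - rho) * (1 - rho ^ S k)) by pos. lra. }
 split; [pos|].
 apply Rmult_le_reg_l with (INR (S k)); auto. rewrite <- Rmult_assoc, Rinv_r, Rmult_1_l by lra. auto.
Qed.

(** ln |theta(x)| with 1 - e(x) replaced by 1 - rho e(x): continuous for rho < 1, so that no
    improper integral occurs. *)
Definition Lam (t rho x : R) : R := Series (fun k => - lamk t rho k * cosk k x).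
Definition Mr (t rho x : R) : R := exp (Lam t rho x).

Lemma Re_ce_k a k x y : Re (Cmult (RtoC a) (ce (Cmult (RtoC (INR k)) (x, y))%C))%C = a * (exp (INR k * - (2 * PI * y)) * cos (om k * x)).
Proof.
 unfold ce, cexp, Cmult, RtoC, Ci, Re, Im; simpl.
 match goal with |- _ * (exp ?A * cos ?B) - _ = _ * (exp ?C * cos ?E) => replace A with C by ring; replace B with E by ring; ring end.
Qed.

Lemma Mr_eq t y x : 0 < t -> 0 < y -> Mr t (exp (- (2 * PI * y))) x = Cmod (Cminus 1 (ce (x, y)))%C * exp (LT t x).
Proof.
 intros Ht Hy. rewrite <- (cexp_log_series (x, y)) by exact Hy. rewrite Cmod_cexp, <- exp_plus. unfold Mr. f_equal.
 have E : Re (Copp (ES invk (x, y)))%C = Series (fun k => - (invk k * exp (- (2 * PI * y)) ^ k * cosk k x)).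
 { transitivity (- Series (fun k => Re (Cmult (RtoC (invk k)) (ce (Cmult (RtoC (INR k)) (x, y))%C))%C)); [pos|].
  rewrite <- Series_opp. apply Series_ext. intros k.
  rewrite <- exp_pow, Re_ce_k. unfold cosk. ring. }
 rewrite E. unfold LT. rewrite <- Series_plus.
 - apply Series_ext. intros k. unfold lamk, cosk. ring.
 - have Hr : 0 <= exp (- (2 * PI * y)) < 1.
  { split; [pos|]. rewrite <- exp_0. apply exp_increasing. assert (0 < 2 * PI * y); [|lra].
   apply Rmult_lt_0_compat; auto. pose proof PI_RGT_0. lra. }
  apply (Rabs_Series_le _ (fun k => exp (- (2 * PI * y)) ^ k)).
  + intros k. have I := invk_le1 k. assert (0 <= exp (- (2 * PI * y)) ^ k) by pos.
   rewrite Rabs_Ropp, !Rabs_mult, (Rabs_pos_eq (invk k)), (Rabs_pos_eq (_ ^ k)) by lra.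
   rewrite <- (Rmult_1_l (_ ^ k)) at 2. rewrite <- (Rmult_1_r (1 * _)). apply Rmult_le_compat; [pos|pos|apply Rmult_le_compat_r; lra|].
   apply Rabs_le, COS_bound.
  + apply ex_series_geom. apply Rabs_def1; lra.
 - apply LT_abs; auto.
Qed.

Lemma rho_of_y rho : 0 < rho < 1 -> exists y, 0 < y /\ rho = exp (- (2 * PI * y)).
Proof.
 intros Hr. have P := PI_RGT_0. exists (- ln rho / (2 * PI)). assert (ln rho < 0) by (rewrite <- ln_1; apply ln_increasing; lra).
 split; [pos|]. replace (- (2 * PI * (- ln rho / (2 * PI)))) with (ln rho) by (field; lra).
 rewrite exp_ln; lra.
Qed.

(** The smoothed modulus is compared before taking logarithms: |1 - rho e(x)| and |1 - e(x)| differ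
    by at most 1 - rho, also at the zero. *)
Lemma Mr_close t : 0 < t -> exists B, 0 < B /\ forall rho x, 0 < rho < 1 ->
 0 <= Mr t rho x <= B /\ 0 <= mth t x <= B /\ Rabs (Mr t rho x - mth t x) <= B * (1 - rho).
Proof.
 intros Ht. set (E := exp (Series (fun k => 2 * Rabs (cth t k)))). have HE : 0 < E by apply exp_pos.
 exists (2 * E). split; [lra|]. intros rho x Hr. destruct (rho_of_y rho Hr) as [y [Hy Ey]].
 have LE : exp (LT t x) <= E by (apply LT_abs; auto). have L0 := exp_pos (LT t x).
 have mE : mth t x = Cmod (Cminus 1 (ce (RtoC x)))%C * exp (LT t x).
 { unfold mth. rewrite th_R, Cmod_mult, Cmod_R by auto. rewrite (Rabs_pos_eq (exp _)); lra. }
 have c1 : Cmod (ce (x, y)) = rho by (rewrite Cmod_ce, Ey; reflexivity).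
 have c2 : Cmod (ce (RtoC x)) = 1 by (rewrite Cmod_ce; unfold RtoC, Im; simpl; rewrite Rmult_0_r, Ropp_0; apply exp_0).
 have c3 : ce (x, y) = Cmult rho (ce (RtoC x)).
 { replace ((x, y) : C) with (Cplus (0, y) (RtoC x)) by (unfold Cplus, RtoC; simpl; f_equal; ring).
  rewrite ce_plus. f_equal. rewrite Ey. unfold ce, cexp, Cmult, RtoC, Ci, Re, Im; simpl.
  match goal with |- (exp ?A * cos ?B, exp ?A * sin ?B) = (exp ?E, _) => replace A with E by ring; replace B with 0 by ring end.
  rewrite cos_0, sin_0. f_equal; ring. }
 have F : forall z r, Cmod z = r -> r <= 1 -> 0 <= Cmod (Cminus 1 z) <= 2.
 { intros z r E1 E2. split; [pos|]. apply Cmod_tri. rewrite Cmod_opp, Cmod_1. lra. }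
 have F1 := F _ _ c1 arith. have F2 := F _ _ c2 arith.
 rewrite mE, Ey, Mr_eq, <- Ey by auto.
 split; [|split].
 - split; [pos|]. apply Rmult_le_compat; lra.
 - split; [pos|]. apply Rmult_le_compat; lra.
 - rewrite <- Rmult_minus_distr_r, Rabs_mult, (Rabs_pos_eq (exp _)) by lra.
  apply Rle_trans with ((1 - rho) * E).
  + apply Rmult_le_compat; try lra; [pos|].
   have K : Cmod (Cminus (Cminus 1 (ce (x, y))) (Cminus 1 (ce (RtoC x))))%C = 1 - rho.
   { replace (Cminus (Cminus 1 (ce (x, y))) (Cminus 1 (ce (RtoC x)))) with (Cmult (RtoC (1 - rho)%R) (ce (RtoC x))) by (rewrite c3, RtoC_minus; ring).
    rewrite Cmod_mult, c2, Cmod_R, Rabs_pos_eq by lra. lra. }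
   have T1 := Cmod_rev_triangle (Cminus 1 (ce (x, y))) (Cminus 1 (ce (RtoC x))).
   have T2 := Cmod_rev_triangle (Cminus 1 (ce (RtoC x))) (Cminus 1 (ce (x, y))).
   rewrite (Cmod_minus_sym (Cminus 1 (ce (RtoC x)))) in T2. rewrite K in T1, T2. apply Rabs_le. lra.
  + assert (0 <= (1 - rho) * E) by pos. lra.
Qed.

(** The constant depends on [L], which is harmless since rho tends to 1 while [L] is fixed. *)
Lemma mthp_close t L : 0 < t -> exists B, 0 < B /\ forall rho s, 0 < rho < 1 ->
 0 <= exp (lsum (fun x => Lam t rho (s - x)) L) <= B /\ 0 <= mthp t L s <= B /\
 Rabs (exp (lsum (fun x => Lam t rho (s - x)) L) - mthp t L s) <= B * (1 - rho).
Proof.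
 intros Ht. destruct (Mr_close t Ht) as [B1 [HB1 H1]]. induction L as [|x L [B2 [HB2 H2]]].
 - exists 1. split; [lra|]. intros rho s Hr. simpl. rewrite exp_0, Rminus_diag, Rabs_R0. lra.
 - exists (B1 * B2 + B1 * B2). have P : 0 < B1 * B2 by pos. split; [lra|].
  intros rho s Hr. cbn [lsum mthp fold_right]. fold (lsum (fun x => Lam t rho (s - x)) L) (mthp t L s).
  rewrite exp_plus. fold (Mr t rho (s - x)). destruct (H1 rho (s - x) Hr) as [A1 [A2 A3]]. destruct (H2 rho s Hr) as [C1 [C2 C3]].
  set (a := Mr t rho (s - x)) in *. set (a' := mth t (s - x)) in *. set (c := exp (lsum _ L)) in *. set (c' := mthp t L s) in *.
  assert (a * c <= B1 * B2) by (apply Rmult_le_compat; lra). assert (a' * c' <= B1 * B2) by (apply Rmult_le_compat; lra).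
  split; [|split].
  + split; [pos|lra].
  + split; [pos|lra].
  + replace (a * c - a' * c') with ((a - a') * c + a' * (c - c')) by ring. apply Rabs_tri.
   rewrite !Rabs_mult, (Rabs_pos_eq c), (Rabs_pos_eq a') by lra.
   assert (Rabs (a - a') * c <= B1 * (1 - rho) * B2) by (apply Rmult_le_compat; try lra; apply Rabs_pos).
   assert (a' * Rabs (c - c') <= B1 * (B2 * (1 - rho))) by (apply Rmult_le_compat; try lra; apply Rabs_pos). lra.
Qed.

Lemma cosk_cont k x s : continuous (fun s => cosk k (s - x)) s.
Proof.
 apply (continuous_ext (fun s => cos (om k * s + - (om k * x)))); [|apply cont_cos_affine].
 intros u. unfold cosk. f_equal. ring.
Qed.

Lemma cosk_abs k x : Rabs (cosk k x) <= 1.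
Proof. apply Rabs_le, COS_bound. Qed.

Lemma RInt_lin3 (a b c : R) (f g h : R -> R) : (forall s, continuous f s) -> (forall s, continuous g s) -> (forall s, continuous h s) ->
 RInt (fun s => a * f s + b * g s + c * h s) 0 1 = a * RInt f 0 1 + b * RInt g 0 1 + c * RInt h 0 1.
Proof.
 intros Hf Hg Hh.
 have E : forall c (f : R -> R), (forall s, continuous f s) -> ex_RInt (fun s => c * f s) 0 1 by (intros; apply ex_RInt_mulR, ex_RInt_contR; auto).
 rewrite (RInt_plusR (fun s => a * f s + b * g s) (fun s => c * h s) 0 1 (ex_RInt_plusR _ _ _ _ (E a f Hf) (E b g Hg)) (E c h Hh)).
 rewrite (RInt_plusR (fun s => a * f s) (fun s => b * g s) 0 1 (E a f Hf) (E b g Hg)).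
 rewrite (RInt_mulR a f), (RInt_mulR b g), (RInt_mulR c h) by (apply ex_RInt_contR; auto). reflexivity.
Qed.

Section Moments.
Variable t : R.
Hypothesis Ht : 0 < t.
Variable d : R -> R.
Hypothesis d_cont : forall x, continuous d x.
Variables dmin dmax : R.
Hypothesis dmin_pos : 0 < dmin.
Hypothesis d_bd : forall x, dmin <= d x <= dmax.
Hypothesis d_cos : forall k, RInt (fun s => d s * cos (om k * s)) 0 1 = ch t k.
Hypothesis d_sin : forall k, RInt (fun s => d s * sin (om k * s)) 0 1 = 0.
Variable m : nat.
Hypothesis Hm : (1 <= m)%nat.
Variable theta : R.

(** The amplitude is the lower bound of d, hence the weight is nonnegative; its mass stays 1 because
    m >= 1. The phase theta treats cosine and sine moments together. *)
Definition chi (s : R) : R := d s + dmin * cos (om m * s - theta).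

Lemma chi_cont s : continuous chi s.
Proof. apply contR_plus; [pos|apply contR_mult; [cts|apply (cont_cos_affine _ (- theta))]]. Qed.

Lemma chi_bd s : 0 <= chi s <= dmax + dmin.
Proof. unfold chi. destruct (COS_bound (om m * s - theta)). specialize (d_bd s). split; nra. Qed.

Lemma chi_cosk k x : RInt (fun s => cosk k (s - x) * chi s) 0 1 =
 ch t k * cosk k x + dmin * (if Nat.eqb k m then / 2 * cos (om m * x - theta) else 0).
Proof.
 have C1 : forall s, continuous (fun s : R => d s * cos (om k * s)) s by (intros; apply contR_mult; [auto|cts]).
 have C2 : forall s, continuous (fun s : R => d s * sin (om k * s)) s by (intros; apply contR_mult; [auto|apply contR_sin]).
 have C3 : forall s, continuous (fun s : R => cosk k (s - x) * cos (om m * s - theta)) s.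
 { intros; apply contR_mult; [apply cosk_cont|apply (cont_cos_affine _ (- theta))]. }
 rewrite <- RInt_cosk_cos by auto. rewrite <- (d_cos k).
 transitivity (RInt (fun s => (cosk k x * (d s * cos (om k * s)) + sin (om k * x) * (d s * sin (om k * s))) +
  dmin * (cosk k (s - x) * cos (om m * s - theta))) 0 1).
 - apply RInt_ext. intros s _. req. unfold chi, cosk at 1 2.
  replace (cosk k (s - x)) with (cos (om k * s) * cos (om k * x) + sin (om k * s) * sin (om k * x)).
  + rewrite <- cos_minus. replace (om k * s - om k * x) with (om k * (s - x)) by ring.
   replace (cos (om k * (s - x)) * (d s + dmin * cos (om m * s - theta))) with
    (d s * cos (om k * (s - x)) + dmin * (cos (om k * (s - x)) * cos (om m * s - theta))) by ring.
   f_equal. replace (om k * (s - x)) with (om k * s - om k * x) by ring. rewrite cos_minus. ring.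
  + rewrite <- cos_minus. unfold cosk. f_equal. ring.
 - etransitivity; [exact (RInt_lin3 _ _ _ _ _ _ C1 C2 C3)|].
  have Z := d_sin k. rewrite Z. req. ring.
Qed.

Lemma chi_mass : RInt chi 0 1 = 1.
Proof.
 have E := chi_cosk 0 0. have N : Nat.eqb 0 m = false by (apply Nat.eqb_neq; lia). rewrite N, Rmult_0_r, Rplus_0_r in E.
 transitivity (RInt (fun s => cosk 0 (s - 0) * chi s) 0 1).
 - apply RInt_ext. intros s _. req. unfold cosk. rewrite Rmult_0_r, Rmult_0_l, cos_0. ring.
 - rewrite E. unfold ch, cosk. simpl. rewrite Rmult_0_r, cos_0. field.
Qed.

Lemma ex_cos_series (a c : nat -> R) : ex_series a -> (forall k, 0 <= a k) -> (forall k, Rabs (c k) <= 1) -> ex_series (fun k => a k * c k).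
Proof.
 intros Ha Hp H. apply (Rabs_Series_le _ a); auto. intros k. rewrite Rabs_mult, (Rabs_pos_eq (a k)) by auto.
 rewrite <- (Rmult_1_r (a k)) at 2. apply Rmult_le_compat_l; auto.
Qed.

(** Integration against d multiplies the k-th coefficient by [ch t k]; the perturbation sees the
    frequency m only. *)
Lemma chi_series a x : ex_series a -> (forall k, 0 <= a k) ->
 (forall s, continuous (fun s => Series (fun k => - a k * cosk k (s - x))) s) /\
 RInt (fun s => Series (fun k => - a k * cosk k (s - x)) * chi s) 0 1 =
  - Series (fun k => a k * ch t k * cosk k x) - dmin / 2 * a m * cos (om m * x - theta).
Proof.
 intros Ha Hp. split.
 { intros s. apply (cont_Series (fun k s => - a k * cosk k (s - x)) a); auto.
  - intros k y. apply contR_mult; [cts|apply cosk_cont].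
  - intros k y. rewrite Rabs_mult, Rabs_Ropp, (Rabs_pos_eq (a k)) by auto. rewrite <- (Rmult_1_r (a k)) at 2.
   apply Rmult_le_compat_l; auto. apply cosk_abs. }
 set (K := dmax + dmin).
 have cu : forall k s, continuous (fun s => - a k * (cosk k (s - x) * chi s)) s.
 { intros k s. apply contR_mult; [cts|apply contR_mult; [apply cosk_cont|apply chi_cont]]. }
 have bu : forall k s, Rabs (- a k * (cosk k (s - x) * chi s)) <= K * a k.
 { intros k s. have B := chi_bd s. rewrite !Rabs_mult, Rabs_Ropp, (Rabs_pos_eq (a k)), (Rabs_pos_eq (chi s)) by pos.
  rewrite (Rmult_comm K). apply Rmult_le_compat_l; auto. rewrite <- (Rmult_1_l K). apply Rmult_le_compat; try apply B; [pos|apply cosk_abs]. }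
 destruct (RInt_Series (fun k s => - a k * (cosk k (s - x) * chi s)) (fun k => K * a k) cu bu (ex_series_mul_l _ _ Ha)) as [_ E].
 transitivity (RInt (fun s => Series (fun k => - a k * (cosk k (s - x) * chi s))) 0 1).
 { apply RInt_ext. intros s _. req. rewrite <- Series_scal_r. apply Series_ext. intros k. ring. }
 etransitivity; [exact E|].
 destruct (Series_single m (fun k => dmin * a k * (/ 2 * cos (om m * x - theta)))) as [S1 S2].
 transitivity (Series (fun k => - (a k * ch t k * cosk k x) - (if Nat.eqb k m then dmin * a k * (/ 2 * cos (om m * x - theta)) else 0))).
 - apply Series_ext. intros k.
  etransitivity; [apply (RInt_mulR (- a k) (fun s => cosk k (s - x) * chi s)); apply ex_RInt_contR; intros; apply contR_mult; [apply cosk_cont|apply chi_cont]|].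
  have Z := chi_cosk k x. rewrite Z. req. destruct (Nat.eqb k m); ring.
 - rewrite Series_minus; auto.
  + rewrite Series_opp, S2. req. field.
  + apply (ex_series_ext (fun k => -1 * (a k * (ch t k * cosk k x)))); [pos|]. apply ex_series_mul_l.
   apply (Rabs_Series_le _ (fun k => 2 * a k)); [|apply ex_series_mul_l; auto].
   intros k. destruct (ch_bd t k Ht) as [C1 C2]. have h1 : hnome t ^ k <= 1.
   { rewrite <- (pow1 k). apply pow_incr. pose proof (hnome_bd t Ht). lra. }
   rewrite !Rabs_mult, (Rabs_pos_eq (a k)), (Rabs_pos_eq (ch t k)), (Rmult_comm 2) by auto. apply Rmult_le_compat_l; auto.
   have A := cosk_abs k x. nra.
Qed.

(** By [lamk_ch] the part from d is [LR] at x up to O(1 - rho). The cosine at x is the contribution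
    of one zero to the m-th moment. *)
Lemma chi_Lam rho x : 0 < rho < 1 -> (forall s, continuous (fun s => Lam t rho (s - x)) s) /\
 LR t x - dmin / 2 * lamk t 1 m * cos (om m * x - theta) - (1 - rho) * (Series (ch t) + dmin)
 <= RInt (fun s => Lam t rho (s - x) * chi s) 0 1.
Proof.
 intros Hr. destruct (chi_series (lamk t rho) x) as [C E]; [apply lamk_ex; lra|intros; apply lamk_pos; lra|].
 split; [pos|]. unfold Lam. rewrite E.
 have X1 : ex_series (fun k => rk t k * cosk k x).
 { apply ex_cos_series; [apply rk_ex; auto|intros; apply rk_bd; auto|intros; apply cosk_abs]. }
 have B : forall k, Rabs (invk k * (1 - rho ^ k) * ch t k * cosk k x) <= (1 - rho) * ch t k.
 { intros k. have B := bern_le rho k arith. destruct (ch_bd t k Ht) as [C1 _]. rewrite !(Rabs_mult _ (cosk k x)), Rabs_pos_eq by pos.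
  rewrite <- (Rmult_1_r ((1 - rho) * ch t k)). apply Rmult_le_compat; [pos|pos|apply Rmult_le_compat_r; lra|apply cosk_abs]. }
 destruct (Rabs_Series_le _ _ B (ex_series_mul_l _ _ (ch_ex t Ht))) as [X2 B2]. rewrite Series_scal_l in B2.
 have EQ : Series (fun k => lamk t rho k * ch t k * cosk k x) = - LR t x - Series (fun k => invk k * (1 - rho ^ k) * ch t k * cosk k x).
 { transitivity (Series (fun k => rk t k * cosk k x - invk k * (1 - rho ^ k) * ch t k * cosk k x)).
  - apply Series_ext. intros k. rewrite lamk_ch by auto. ring.
  - rewrite Series_minus by auto. f_equal. unfold LR. rewrite <- Series_opp. apply Series_ext. intros k. unfold rk, cosk. ring. }
 rewrite EQ. apply Rabs_le_between in B2.
 have L1 : lamk t rho m = lamk t 1 m - invk m * (1 - rho ^ m) by (unfold lamk; rewrite pow1; ring).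
 rewrite L1. have B3 := bern_le rho m arith. have B4 := COS_bound (om m * x - theta).
 set (g := cos (om m * x - theta)) in *. set (v := invk m * (1 - rho ^ m)) in *.
 assert (- (1 - rho) <= v * g) by nra. nra.
Qed.

Lemma chi_LR : (forall s, continuous (LR t) s) /\ RInt (fun s => LR t s * chi s) 0 1 = - kap0 t - dmin / 2 * rk t m * cos theta.
Proof.
 destruct (chi_series (rk t) 0) as [C E]; [apply rk_ex; auto|intros; apply rk_bd; auto|].
 have Q : forall s, LR t s = Series (fun k => - rk t k * cosk k (s - 0)).
 { intros s. apply Series_ext. intros k. rewrite Rminus_0_r. reflexivity. }
 split.
 - intros s. apply (continuous_ext (fun s => Series (fun k => - rk t k * cosk k (s - 0)))); [pos|pos].
 - etransitivity; [|etransitivity; [exact E|]].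
  + apply RInt_ext. intros s _. rewrite Q. reflexivity.
  + rewrite kap0_rk by auto. rewrite Rmult_0_r. replace (0 - theta) with (- theta) by ring. rewrite cos_neg. f_equal. f_equal.
   apply Series_ext. intros k. unfold cosk. rewrite Rmult_0_r, cos_0. ring.
Qed.

Lemma lsum_cont (F : R -> R -> R) L : (forall x s, continuous (F x) s) -> forall s, continuous (fun s => lsum (fun x => F x s) L) s.
Proof. intros H. induction L; intros s; simpl; [cts|]. apply contR_plus; auto. Qed.

Lemma lsum_RInt (F : R -> R -> R) L : (forall x s, continuous (F x) s) ->
 RInt (fun s => lsum (fun x => F x s) L * chi s) 0 1 = lsum (fun x => RInt (fun s => F x s * chi s) 0 1) L.
Proof.
 intros H. have cF : forall x s, continuous (fun s => F x s * chi s) s by (intros; apply contR_mult; [apply H|apply chi_cont]).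
 induction L as [|x L IH]; simpl.
 - rewrite (RInt_ext _ (fun _ => 0)); [|pos]. rewrite RInt_const. unfold scal; simpl; unfold mult; simpl. ring.
 - rewrite <- IH. rewrite <- (RInt_plusR (fun s => F x s * chi s) (fun s => lsum (fun x => F x s) L * chi s)).
  + apply RInt_ext. intros s _. req. ring.
  + apply ex_RInt_contR. auto.
  + apply ex_RInt_contR. intros s. apply contR_mult; [apply lsum_cont; auto|apply chi_cont].
Qed.

Lemma lsum_le (F G : R -> R) L : (forall x, F x <= G x) -> lsum F L <= lsum G L.
Proof. intros H. induction L; simpl; [lra|]. specialize (H a). lra. Qed.

Lemma lsum_lin (F G : R -> R) a c L : lsum (fun x => F x + a * G x + c) L = lsum F L + a * lsum G L + INR (length L) * c.
Proof. induction L as [|x L IH]; [simpl; ring|]. cbn [length]. rewrite S_INR. simpl in *. rewrite IH. ring. Qed.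

(** The exponent of [section_lower]. *)
Definition Gb (n : nat) (ls : list R) (s : R) : R := - lsum (LR t) ls - INR n * LR t s - INR n * kap0 t.

(** For the upper bound of the mean logarithm the pointwise inequality y <= exp (2 y) is enough. In
    the exact value of the mean the terms n kap0 cancel by [chi_LR], and for L = ls the sums of [LR]
    over the zeros cancel too. *)
Lemma energy_bound K n ls L : RInt (fun s => (exp (Gb n ls s) * mthp t L s) ^ 2) 0 1 <= K -> (forall s, continuous (mthp t L) s) ->
 lsum (fun x => LR t x + - (dmin / 2 * lamk t 1 m) * cos (om m * x - theta)) L - lsum (LR t) ls + INR n * (dmin / 2 * rk t m * cos theta)
 <= (dmax + dmin) * K.
Proof.
 intros HK HL. set (X := lsum (fun x => LR t x + - (dmin / 2 * lamk t 1 m) * cos (om m * x - theta)) L).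
 destruct chi_LR as [cLR iLR]. have cG : forall s, continuous (Gb n ls) s.
 { intros s. apply contR_minus; [apply contR_minus; [apply contR_const|apply contR_mult; [cts|pos]]|cts]. }
 have cE : forall (f : R -> R), (forall s, continuous f s) -> forall s, continuous (fun s => exp (f s)) s.
 { intros f Hf s. apply (continuous_comp f exp); [pos|]. apply contR_derive with (exp (f s)). apply is_derive_exp. }
 have Dp : 0 < dmax + dmin by (specialize (d_bd 0); lra).
 destruct (mthp_close t L Ht) as [B [HB HBc]].
 destruct (periodic_bounded (fun s => exp (Gb n ls s)) 0 1 arith) as [Q [HQ HGQ]]; [pos|].
 apply le_epsilon. intros e He.
 set (W := INR (length L) * (Series (ch t) + dmin)).
 set (V := 2 * (Q * Q * B * B) * (dmax + dmin)).
 have HV : 0 < V by pos.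
 have HW : 0 <= W.
 { assert (0 <= Series (ch t)) by (apply Series_nonneg; [intros; apply ch_bd|apply ch_ex]; auto). pos. }
 (* [W] collects the errors of [chi_Lam] over the points of [L], [V] that of replacing the smoothed
    product by the true one; together they cost at most e. *)
 set (rho := 1 - Rmin (/ 2) (e / (V + W))).
 have Hr : 0 < rho < 1 /\ (1 - rho) * (V + W) <= e.
 { assert (0 < Rmin (/ 2) (e / (V + W))) by pos.
  have M1 := Rmin_l (/ 2) (e / (V + W)). have M2 := Rmin_r (/ 2) (e / (V + W)). apply Rle_div_r in M2; unfold rho; lra. }
 destruct Hr as [Hr Hre].
 have cL : forall x s, continuous (fun s => Lam t rho (s - x)) s by (intros x; apply (chi_Lam rho x Hr)).
 set (T := fun s => lsum (fun x => Lam t rho (s - x)) L).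
 have cT : forall s, continuous T s by (apply (lsum_cont (fun x s => Lam t rho (s - x))); auto).
 set (F := fun s => Gb n ls s + T s).
 have cF : forall s, continuous F s by (intros; apply contR_plus; auto).
 have E2 : forall (f : R -> R) (s : R), continuous f s -> continuous (fun s => f s ^ 2) s.
 { intros f s Hf. apply (continuous_ext (fun s => f s * f s)); [pos|apply contR_mult; auto]. }
 have L1 : X - lsum (LR t) ls + INR n * (dmin / 2 * rk t m * cos theta) - (1 - rho) * W <= RInt (fun s => F s * chi s) 0 1.
 { have EF : RInt (fun s => F s * chi s) 0 1 = (- lsum (LR t) ls - INR n * kap0 t) * RInt chi 0 1 + (- INR n) * RInt (fun s => LR t s * chi s) 0 1 + 1 * RInt (fun s => T s * chi s) 0 1.
  { rewrite <- RInt_lin3.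
   - apply RInt_ext. intros s _. req. unfold F, Gb. ring.
   - apply chi_cont.
   - intros; apply contR_mult; [pos|apply chi_cont].
   - intros; apply contR_mult; [pos|apply chi_cont]. }
  rewrite EF, chi_mass, iLR. unfold T. rewrite (lsum_RInt (fun x s => Lam t rho (s - x)) L cL).
  have LL : lsum (fun x => (LR t x + - (dmin / 2 * lamk t 1 m) * cos (om m * x - theta)) + 0 * 0 + - ((1 - rho) * (Series (ch t) + dmin))) L <= lsum (fun x => RInt (fun s => Lam t rho (s - x) * chi s) 0 1) L.
  { apply lsum_le. intros x. destruct (chi_Lam rho x Hr) as [_ Z]. lra. }
  rewrite (lsum_lin _ (fun _ => 0)) in LL. fold X in LL. unfold W. lra. }
 (* upper bound: [y <= exp (2 y)] and the comparison of the regularised product *)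
 have U1 : RInt (fun s => F s * chi s) 0 1 <= RInt (fun s => (dmax + dmin) * (exp (Gb n ls s) * mthp t L s) ^ 2 + (1 - rho) * V) 0 1.
 { apply RInt_le; [lra|apply ex_RInt_contR; intros; apply contR_mult; auto; apply chi_cont| |].
  - apply ex_RInt_contR. intros s. apply contR_plus; [|cts]. apply contR_mult; [cts|]. apply E2, contR_mult; auto.
  - intros s Hs. destruct (chi_bd s) as [c0 c1]. destruct (HBc rho s Hr) as [[a0 a1] [[b0 b1] ab]]. fold (T s) in *.
   have g0 := exp_pos (Gb n ls s). have g1 := Rle_trans _ _ _ (Rle_abs _) (HGQ s arith). set (g := exp (Gb n ls s)) in *.
   have E := exp_ineq1_le (2 * F s). have EE : exp (2 * F s) = (g * exp (T s)) ^ 2.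
   { unfold F, g. rewrite <- exp_plus. simpl. rewrite Rmult_1_r, <- exp_plus. f_equal. ring. }
   rewrite EE in E. set (a := exp (T s)) in *. set (c := mthp t L s) in *.
   have H1 : F s <= (g * a) ^ 2 by (pose proof (pow2_ge_0 (g * a)); lra).
   have H2 : (g * a) ^ 2 <= (g * c) ^ 2 + (1 - rho) * (2 * (Q * Q * B * B)).
   { replace ((g * a) ^ 2) with ((g * c) ^ 2 + (g * g) * ((a - c) * (a + c))) by ring. apply Rplus_le_compat_l.
    have Y : (a - c) * (a + c) <= (B * (1 - rho)) * (2 * B).
    { apply Rle_trans with (Rabs (a - c) * (a + c)); [apply Rmult_le_compat_r; [lra|apply Rle_abs]|].
     apply Rmult_le_compat; [pos|lra|lra|lra]. }
    have Z : 0 <= (B * (1 - rho)) * (2 * B) by pos.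
    have GG : g * g <= Q * Q by (apply Rmult_le_compat; lra).
    apply Rle_trans with (g * g * (B * (1 - rho) * (2 * B))); [apply Rmult_le_compat_l; [pos|auto]|].
    apply Rle_trans with (Q * Q * (B * (1 - rho) * (2 * B))); [apply Rmult_le_compat_r; auto|]. right; ring. }
   apply Rle_trans with ((g * a) ^ 2 * chi s); [apply Rmult_le_compat_r; auto|].
   apply Rle_trans with ((g * a) ^ 2 * (dmax + dmin)); [apply Rmult_le_compat_l; auto; apply pow2_ge_0|].
   apply Rle_trans with (((g * c) ^ 2 + (1 - rho) * (2 * (Q * Q * B * B))) * (dmax + dmin)); [apply Rmult_le_compat_r; lra|].
   unfold V. right; ring. }
 have cS : forall s, continuous (fun s : R => (exp (Gb n ls s) * mthp t L s) ^ 2) s by (intros; apply E2, contR_mult; auto).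
 have U2 : RInt (fun s => (dmax + dmin) * (exp (Gb n ls s) * mthp t L s) ^ 2 + (1 - rho) * V) 0 1 <= (dmax + dmin) * K + (1 - rho) * V.
 { have Z := RInt_lin3 (dmax + dmin) ((1 - rho) * V) 0 _ (fun _ => 1) (fun _ => 1) cS (fun s => contR_const 1 s) (fun s => contR_const 1 s).
  have I1 : RInt (fun _ => 1) 0 1 = 1 by (rewrite RInt_const; unfold scal; simpl; unfold mult; simpl; ring). rewrite I1 in Z.
  have HK2 := Rmult_le_compat_l (dmax + dmin) _ _ arith HK.
  refine (Rle_trans _ _ _ (Req_le _ _ (eq_trans (RInt_ext _ _ _ _ _) Z)) _); [pos|lra]. }
 lra.
Qed.

(** Since rk m = A ch m, the energy estimate divided by dmin / 2 * A is a one-sided bound for the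
    defect of the m-th moment, uniform in n. *)
Lemma moment_bound K : exists C0, forall n ls L, length ls = n -> (L = ls \/ exists x, L = x :: ls) -> (forall s, continuous (mthp t L) s) ->
 RInt (fun s => (exp (Gb n ls s) * mthp t L s) ^ 2) 0 1 <= K ->
 INR n * (ch t m * cos theta) - lsum (fun x => cos (om m * x - theta)) ls <= C0.
Proof.
 set (A := lamk t 1 m). have PA : 0 < A.
 { unfold A, lamk. rewrite pow1. have Z := cth_neg t m Ht. destruct m as [|m']; [lia|]. unfold invk at 1.
  assert (0 < / INR (S m')) by (apply Rinv_0_lt_compat, lt_0_INR; lia). lra. }
 have RA : rk t m = A * ch t m by (unfold A; rewrite lamk_ch, pow1 by auto; ring).
 (* The last two summands of the numerator pay for the possible extra point of [L]. *)
 exists (((dmax + dmin) * K + Series (rk t) + dmin / 2 * A) / (dmin / 2 * A)).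
 intros n ls L Hlen HL cL HK. have E := energy_bound K n ls L HK cL. fold A in E. rewrite RA in E.
 have G : forall l, lsum (fun x => LR t x + - (dmin / 2 * A) * cos (om m * x - theta)) l =
   lsum (LR t) l - (dmin / 2 * A) * lsum (fun x => cos (om m * x - theta)) l.
 { intros l. induction l as [|x l IH]; simpl in *; [ring|pos]. }
 have S0 : 0 <= Series (rk t) by (apply Series_nonneg; [intros; apply rk_bd; auto|apply rk_ex; auto]).
 have PD : 0 < dmin / 2 * A by pos.
 apply Rmult_le_reg_l with (dmin / 2 * A); auto.
 replace (dmin / 2 * A * (((dmax + dmin) * K + Series (rk t) + dmin / 2 * A) / (dmin / 2 * A))) with ((dmax + dmin) * K + Series (rk t) + dmin / 2 * A) by (field; lra).
 destruct HL as [-> | [x ->]].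
 - rewrite G in E. lra.
 - cbn [lsum fold_right] in E. fold (lsum (fun x => LR t x + - (dmin / 2 * A) * cos (om m * x - theta)) ls) in E. rewrite G in E.
  have B := LR_bound t x Ht. apply Rabs_le_between in B. have CB := COS_bound (om m * x - theta).
  assert (dmin / 2 * A * cos (om m * x - theta) <= dmin / 2 * A * 1) by (apply Rmult_le_compat_l; lra). lra.
Qed.
End Moments.

Open Scope C_scope.

(** * The equilibrium density *)

Definition sch (x : R) : R := (2 / (exp x + exp (- x)))%R.

Lemma pbounded_quot N h l : chol N 0 -> N 0 = 0 -> cder h 0 l -> (l : C) <> 0 -> h 0 = 0 -> pbounded (fun p => N p / h p) 0.
Proof.
 intros [a Na] N0 Hh Hl h0. have Pl := proj1 (Cmod_gt_0 l) Hl.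
 destruct (Na 1%R Rlt_0_1) as [d1 [Hd1 K1]]. destruct (Hh (Cmod l / 2)%R arith) as [d2 [Hd2 K2]].
 exists ((1 + Cmod a) / (Cmod l / 2))%R, (Rmin d1 d2). split; [pos|].
 intros p. replace (p - 0) with p by ring. intros [Hp1 Hp2].
 have Q1 := K1 p (proj1 (Rlt_min Hp2)). have Q2 := K2 p (proj2 (Rlt_min Hp2)).
 rewrite Cplus_0_l, N0 in Q1. rewrite Cplus_0_l, h0 in Q2.
 have A1 : Cmod (N p) <= (1 + Cmod a) * Cmod p.
 { replace (N p) with ((N p - 0 - a * p) + a * p) by ring. apply Cmod_tri. rewrite Cmod_mult. lra. }
 have A2 : Cmod l / 2 * Cmod p <= Cmod (h p).
 { have T : Cmod (l * p) <= Cmod (h p) + Cmod (h p - 0 - l * p).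
  { have E : l * p = h p + - (h p - 0 - l * p) by ring. rewrite E at 1. apply Cmod_tri. rewrite Cmod_opp. apply Rle_refl. }
  rewrite Cmod_mult in T. lra. }
 have P2 : 0 < Cmod l / 2 * Cmod p by pos.
 have hn : h p <> 0 by (apply Cmod_gt_0; lra).
 rewrite Cmod_div by auto. apply Rle_trans with ((1 + Cmod a) * Cmod p / (Cmod l / 2 * Cmod p))%R.
 - apply Rmult_le_compat; [pos|pos|auto|apply Rinv_le_contravar; auto].
 - right. field. lra.
Qed.

Section Contour.
Variable t : R.
Hypothesis Ht : 0 < t.
Variable k : nat.

Let al : R := (PI / t)%R.
Let qq (p : C) : C := RtoC (- / t) * Ci * p.
Let den (p : C) : C := ce (qq p) - 1.
(** The integrand num / den is (e(-kp) - 1) / sinh(PI p / t). On Im p = t / 2 and - t / 2 the sinh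
    becomes i or - i times cosh. Subtracting 1 removes the pole at 0, at the price of the integral
    of sech, which [sch_mass] computes. *)
Let num (p : C) : C := (ce (- (RtoC (INR k) * p)) - 1) * (2 * ce (RtoC (/ 2) * qq p)).
Let f (p : C) : C := num p / den p.

Lemma ce_qq r x y : ce (RtoC r * qq (x, y))%C = (exp (2 * r * (al * x)) * cos (2 * r * (al * y)), exp (2 * r * (al * x)) * sin (2 * r * (al * y)))%R.
Proof.
 unfold ce, qq, cexp, al, RtoC, Ci, Cmult, Re, Im; simpl.
 match goal with |- (exp ?A * cos ?B, _)%R = (exp ?C * cos ?D, _)%R => replace A with C by pos; replace B with D by pos end.
 reflexivity.
Qed.

Lemma den_xy x y : den (x, y) = (exp (2 * (al * x)) * cos (2 * (al * y)) - 1, exp (2 * (al * x)) * sin (2 * (al * y)))%R.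
Proof.
 unfold den. replace (qq (x, y)) with (RtoC 1 * qq (x, y)) by ring. rewrite ce_qq, !Rmult_1_r. unfold Cminus, Cplus, Copp, RtoC; simpl. f_equal; ring.
Qed.

Lemma den_nz x y : - (t / 2) <= y <= t / 2 -> (x, y) <> (0%R, 0%R) -> den (x, y) <> 0.
Proof.
 intros Hy N K. apply N. have E : ce (qq (x, y))%C = 1 by (apply Ceq_minus in K; auto).
 apply ce_eq1 in E. destruct E as [n E]. injection E as E1 E2.
 have Y : (y = IZR n * t)%R.
 { apply Rmult_eq_reg_r with (/ t)%R; [|apply Rinv_neq_0_compat; lra]. rewrite Rmult_assoc, Rinv_r, Rmult_1_r by lra. rewrite <- E1. ring. }
 have X : (x = 0)%R.
 { have H : (x * / t = 0)%R by lra. apply Rmult_integral in H. destruct H as [H|H]; auto. exfalso. apply (Rinv_neq_0_compat t); lra. }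
 assert (n = 0)%Z.
 { assert (-1 < n < 1)%Z by (split; apply lt_IZR; apply Rmult_lt_reg_r with t; auto; lra). lia. }
 subst n. rewrite X, Y. f_equal. ring.
Qed.

Lemma qq_chol p : chol qq p.
Proof. apply chol_mult; [apply chol_const|apply chol_id]. Qed.

Lemma num_ch p : chol num p.
Proof.
 apply chol_mult; [apply chol_minus|apply chol_mult]; try apply chol_const.
 - apply (chol_ce (fun p => - (RtoC (INR k) * p))). apply chol_opp, chol_mult; [apply chol_const|apply chol_id].
 - apply (chol_ce (fun p => RtoC (/ 2) * qq p)). apply chol_mult; [apply chol_const|apply qq_chol].
Qed.

Lemma den_ch p : chol den p.
Proof. apply chol_minus; [apply (chol_ce qq), qq_chol|apply chol_const]. Qed.

Lemma f_chol (z : C) : - (t / 2) <= snd z <= t / 2 -> z <> 0 -> chol f z.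
Proof. intros Hz N. destruct z as [x y]. apply chol_div; [apply num_ch|apply den_ch|]. apply den_nz; auto. Qed.

Lemma f_pb : pbounded f 0.
Proof.
 have Q0 : qq 0 = 0 by (unfold qq; ring).
 have Hd : den 0 = 0 by (unfold den; rewrite Q0, ce_0; ring).
 set (c := RtoC (2 * PI) * Ci * (RtoC (- / t) * Ci)).
 have Hl : cder den 0 (cexp (c * 0) * (c * 1) + 0).
 { apply (cder_ext (fun p => cexp (c * p) + - (1))); [intros p; unfold den, ce, qq, c; unfold Cminus; f_equal; f_equal; ring|].
  apply cder_plus; [|apply cder_const]. apply (cder_comp (fun p => c * p)); [apply cder_scal, cder_id|apply cder_cexp]. }
 apply (pbounded_quot num den (cexp (c * 0) * (c * 1) + 0)); auto.
 - apply num_ch.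
 - unfold num. replace (- (RtoC (INR k) * 0)) with (RtoC 0) by ring. rewrite ce_0. ring.
 - intro K. have K2 : c = 0.
  { rewrite <- K. replace (c * 0) with (RtoC 0) by ring. rewrite cexp_0. ring. }
  have K3 := f_equal Re K2. unfold c, RtoC, Ci, Re, Cmult in K3; simpl in K3. have P := PI_RGT_0.
  assert (PI * / t = 0)%R as K4 by lra. apply Rmult_integral in K4. destruct K4 as [K4|K4]; [lra|]. apply (Rinv_neq_0_compat t); lra.
Qed.

Lemma f_line x y : den (x, y) <> 0 -> f (x, y) =
 (ce (- (RtoC (INR k) * (x, y))) - 1) * (2 * (exp (al * x) * cos (al * y), exp (al * x) * sin (al * y))%R) / den (x, y).
Proof.
 intros N. unfold f, num. rewrite ce_qq. replace (2 * / 2)%R with 1%R by field. rewrite !Rmult_1_l. reflexivity.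
Qed.

Lemma ce_k x y : ce (- (RtoC (INR k) * (x, y))) = RtoC (exp (om k * y)) * (cos (om k * x), (- sin (om k * x))%R).
Proof.
 unfold ce, cexp, RtoC, Ci, Cmult, Copp, Re, Im; simpl.
 match goal with |- (exp ?A * cos ?B, _)%R = _ => replace A with (om k * y)%R by ring; replace B with (- (om k * x))%R by ring end.
 rewrite cos_neg, sin_neg. f_equal; ring.
Qed.

Lemma f_bdry (e : R) x : (e = 1 \/ e = -1)%R ->
 f (x, (e * (t / 2))%R) = - RtoC e * Ci * RtoC (sch (al * x)) *
  (RtoC (exp (e * (PI * INR k * t))) * (cos (om k * x), (- sin (om k * x))%R) - 1).
Proof.
 intros He. have N : den (x, (e * (t / 2))%R) <> 0.
 { apply den_nz; [destruct He; subst e; lra|]. intro K; injection K; destruct He; subst e; lra. }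
 rewrite f_line by auto. rewrite ce_k. replace (om k * (e * (t / 2)))%R with (e * (PI * INR k * t))%R by field.
 set (w := RtoC (exp (e * (PI * INR k * t))) * (cos (om k * x), (- sin (om k * x))%R) - 1).
 have A1 : (al * (e * (t / 2)) = e * (PI / 2))%R by (unfold al; field; lra).
 have A2 : (2 * (al * (e * (t / 2))) = e * PI)%R by (unfold al; field; lra).
 rewrite den_xy in *. rewrite A2 in *. rewrite A1.
 have C1 : cos (e * (PI / 2)) = 0%R by (destruct He; subst e; [rewrite Rmult_1_l|replace (-1 * (PI / 2))%R with (- (PI / 2))%R by ring; rewrite cos_neg]; apply cos_PI2).
 have S1 : sin (e * (PI / 2)) = e by (destruct He; subst e; [rewrite Rmult_1_l|replace (-1 * (PI / 2))%R with (- (PI / 2))%R by ring; rewrite sin_neg]; rewrite sin_PI2; auto; ring).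
 have C2 : cos (e * PI) = (-1)%R by (destruct He; subst e; [rewrite Rmult_1_l|replace (-1 * PI)%R with (- PI)%R by ring; rewrite cos_neg]; apply cos_PI).
 have S2 : sin (e * PI) = 0%R by (destruct He; subst e; [rewrite Rmult_1_l|replace (-1 * PI)%R with (- PI)%R by ring; rewrite sin_neg]; rewrite sin_PI; auto; ring).
 rewrite C1, S1, C2, S2 in *.
 set (E := exp (al * x)). have HE : 0 < E by apply exp_pos.
 have EE : exp (2 * (al * x)) = (E * E)%R by (unfold E; rewrite <- exp_plus; f_equal; ring). rewrite EE in *.
 have SE : sch (al * x) = (2 * E / (E * E + 1))%R.
 { unfold sch. rewrite exp_Ropp. fold E. field. split; nra. }
 have D1 : ((E * E * -1 - 1)%R, (E * E * 0)%R) = RtoC (- (E * E + 1)) by (unfold RtoC; f_equal; ring).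
 have D2 : ((E * 0)%R, (E * e)%R) = RtoC (E * e) * Ci by (unfold RtoC, Ci, Cmult; simpl; f_equal; ring).
 rewrite D1, D2, SE. rewrite RtoC_div by nra. rewrite RtoC_opp, !RtoC_mult.
 have M : RtoC (E * E + 1) <> 0 by (apply RtoC_neq0; nra). field. exact M.
Qed.

(** [al * L >= 1] gives exp (2 al L) >= 2, which keeps the denominator away from 0 on both vertical
    sides. *)
Lemma f_side (e L y : R) : (e = 1 \/ e = -1)%R -> 1 <= al * L -> - (t / 2) <= y <= t / 2 ->
 Cmod (f ((e * L)%R, y))%C <= (exp (PI * INR k * t) + 1) * (4 * exp (- (al * L))).
Proof.
 intros He HL Hy. have P := PI_RGT_0. have L0 : 0 < L by (apply Rmult_lt_reg_l with al; [pos|lra]).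
 have N : den ((e * L)%R, y) <> 0.
 { apply den_nz; auto. intro K; injection K; destruct He; subst e; lra. }
 rewrite f_line by auto. rewrite Cmod_div, Cmod_mult, Cmod_mult by auto.
 set (X := (al * (e * L))%R).
 have M1 : Cmod ((exp X * cos (al * y))%R, (exp X * sin (al * y))%R)%C = exp X.
 { unfold Cmod; simpl. transitivity (sqrt (Rsqr (exp X))); [|apply sqrt_Rsqr; left; apply exp_pos]. f_equal. unfold Rsqr.
  have S := sin2_cos2 (al * y). unfold Rsqr in S. set (a := cos (al * y)) in *. set (b := sin (al * y)) in *. set (E := exp X) in *.
  transitivity (E * E * (b * b + a * a))%R; [ring|]. rewrite S. ring. }
 rewrite M1. have M2 : Cmod (RtoC 2) = 2%R by (rewrite Cmod_R; apply Rabs_pos_eq; lra). rewrite M2.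
 have B1 : Cmod (ce (- (RtoC (INR k) * ((e * L)%R, y))) - 1) <= exp (PI * INR k * t) + 1.
 { apply Cmod_tri. rewrite Cmod_opp, Cmod_1. apply Rplus_le_compat_r.
  rewrite Cmod_ce. apply exp_le_mono. unfold Im, Copp, Cmult, RtoC; simpl.
  replace (- (2 * PI * - (INR k * y + 0 * (e * L))))%R with (PI * INR k * (2 * y))%R by ring.
  apply Rmult_le_compat_l; [pos|lra]. }
 have H2 : 2 <= exp (2 * (al * L)).
 { have Q := exp_ineq1_le (2 * (al * L)). lra. }
 set (W := exp (al * L)). have W0 : 0 < W by apply exp_pos.
 have WW : exp (2 * (al * L)) = (W * W)%R by (unfold W; rewrite <- exp_plus; f_equal; ring).
 have B2 : exp X * (W / 4) * 2 <= Cmod (den ((e * L)%R, y))%C.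
 { have T := Cmod_rev_triangle (ce (qq ((e * L)%R, y))%C) 1. have T' := Cmod_rev_triangle 1 (ce (qq ((e * L)%R, y))%C).
  rewrite (Cmod_minus_sym 1) in T'. fold (den ((e * L)%R, y)) in T, T'. rewrite Cmod_1 in T, T'.
  replace (Cmod (ce (qq ((e * L)%R, y))%C)%C) with (exp X * exp X)%R in *.
  2: { rewrite Cmod_ce, <- exp_plus. f_equal. unfold X, qq, al, Im, Cmult, RtoC, Ci; simpl. field. lra. }
  rewrite WW in H2. destruct He as [-> | ->].
  - replace (exp X) with W in * by (unfold W, X; f_equal; ring). nra.
  - have EX : (exp X * W = 1)%R by (unfold W, X; rewrite <- exp_plus; replace (al * (-1 * L) + al * L)%R with 0%R by ring; apply exp_0).
   have X0 := exp_pos X. set (Y := exp X) in *. assert (Y * Y * (W * W) = 1)%R by (replace (Y * Y * (W * W))%R with ((Y * W) * (Y * W))%R by ring; rewrite EX; ring).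
   assert (2 * (Y * Y) <= 1)%R by (assert (0 < Y * Y)%R by nra; nra). replace (Y * (W / 4) * 2)%R with (Y * W / 2)%R by field. rewrite EX. lra. }
 rewrite exp_Ropp. fold W. have X0 := exp_pos X.
 apply Rle_trans with ((exp (PI * INR k * t) + 1) * (2 * exp X) / (exp X * (W / 4) * 2))%R.
 - apply Rmult_le_compat; [|left; apply Rinv_0_lt_compat, Cmod_gt_0; auto| |].
  + apply Rmult_le_pos; [pos|lra].
  + apply Rmult_le_compat_r; [lra|auto].
  + apply Rinv_le_contravar; auto. repeat apply Rmult_lt_0_compat; lra.
 - right. field. split; lra.
Qed.

Definition kC : R := (4 * (t * ((exp (PI * INR k * t) + 1) * 4)))%R.

Lemma contour L : 1 <= al * L ->
 Cmod (CI (fun s => RtoC (sch (al * s)) * (RtoC (exp (PI * INR k * t) + exp (- (PI * INR k * t))) *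
   (cos (om k * s), (- sin (om k * s))%R) - 2)) (- L) L)%C <= kC * exp (- (al * L)).
Proof.
 intros HL. have L0 : 0 < L by (apply Rmult_lt_reg_l with al; [pos|lra]).
 have Hf : forall z : C, - L <= fst z <= L -> - (t / 2) <= snd z <= t / 2 -> ~ In z (RtoC 0 :: nil) -> chol f z.
 { intros z _ H2 H3. apply f_chol; auto. intro K. apply H3. left; auto. }
 have Ho : forall z, In z (RtoC 0 :: nil) -> off_bdry (- L) L (- (t / 2)) (t / 2) z.
 { intros z [<-|[]]. unfold off_bdry, RtoC; simpl. lra. }
 have J0 := goursat_exc (RtoC 0 :: nil) f (- L) L (- (t / 2)) (t / 2) arith arith Hf Ho
   (fun z Hz => match Hz with or_introl E => eq_ind (RtoC 0) (pbounded f) f_pb z E | or_intror F => match F with end end).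
  have cont_all : forall z : C, - (t / 2) <= snd z <= t / 2 -> z <> 0 -> ccont f z by (intros; apply chol_cont, f_chol; auto).
 have I1 : cint (fun x => f (x, (- (t / 2))%R)) (- L) L.
 { apply cint_h; [lra|]. intros x _. apply cont_all; simpl; [lra|]. intro K; injection K; lra. }
 have I2 : cint (fun x => f (x, (t / 2)%R)) (- L) L.
 { apply cint_h; [lra|]. intros x _. apply cont_all; simpl; [lra|]. intro K; injection K; lra. }
 have I3 : forall e, (e = 1 \/ e = -1)%R -> cint (fun y => f ((e * L)%R, y)) (- (t / 2)) (t / 2).
 { intros e He. apply (cint_v f (e * L)); [lra|]. intros y Hy. apply cont_all; simpl; [lra|]. intro K; injection K; destruct He; subst e; lra. }
 have B : forall e, (e = 1 \/ e = -1)%R -> Cmod (CI (fun y => f ((e * L)%R, y)) (- (t / 2)) (t / 2))%C <= kC / 2 * exp (- (al * L)).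
 { intros e He. eapply Rle_trans; [apply (CI_bound _ _ _ ((exp (PI * INR k * t) + 1) * (4 * exp (- (al * L)))))|].
  - lra.
  - auto.
  - intros y Hy. apply f_side; auto.
  - right. unfold kC. field. }
 have B1 := B 1%R (or_introl eq_refl). have B2 := B (-1)%R (or_intror eq_refl).
 unfold J in J0. rewrite Rmult_1_l in B1. replace (-1 * L)%R with (- L)%R in B2 by ring.
 set (V1 := CI (fun y => f (L, y)) (- (t / 2)) (t / 2)) in *. set (V2 := CI (fun y => f ((- L)%R, y)) (- (t / 2)) (t / 2)) in *.
 set (g := fun s => RtoC (sch (al * s)) * (RtoC (exp (PI * INR k * t) + exp (- (PI * INR k * t))) * (cos (om k * s), (- sin (om k * s))%R) - 2)).
 have E : CI (fun x => f (x, (- (t / 2))%R)) (- L) L + (-1) * CI (fun x => f (x, (t / 2)%R)) (- L) L = Ci * CI g (- L) L.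
 { rewrite <- CI_scal by auto. rewrite <- CI_plus by (auto; apply cint_scal; auto).
  have G : forall s, g s = - Ci * (f (s, (- (t / 2))%R) + (-1) * f (s, (t / 2)%R)).
  { intros s. replace (- (t / 2))%R with (-1 * (t / 2))%R by ring. rewrite f_bdry by auto.
   replace (f (s, (t / 2)%R)) with (f (s, (1 * (t / 2))%R)) by (do 2 f_equal; ring). rewrite f_bdry by auto.
   unfold g. replace (-1 * (PI * INR k * t))%R with (- (PI * INR k * t))%R by ring. rewrite Rmult_1_l, RtoC_plus.
   have m1 : RtoC (-1)%R = - RtoC 1%R by (unfold RtoC, Copp; simpl; f_equal; ring). rewrite m1.
   set (v := (cos (om k * s), (- sin (om k * s))%R) : C).
   set (E1 := RtoC (exp (PI * INR k * t))). set (E2 := RtoC (exp (- (PI * INR k * t)))). set (S := RtoC (sch (al * s))).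
   have I2' : Ci * Ci = -1 by (unfold Ci, Cmult, RtoC, Copp; simpl; f_equal; ring).
   transitivity (- (Ci * Ci) * (S * ((E1 + E2) * v - 2))); [rewrite I2'; ring|ring]. }
  rewrite (CI_ext g (fun s => - Ci * (f (s, (- (t / 2))%R) + (-1) * f (s, (t / 2)%R)))) by pos.
  rewrite CI_scal by (apply cint_plus; [auto|apply cint_scal; auto]).
  set (Z := CI _ (- L) L). have I2' : Ci * Ci = -1 by (unfold Ci, Cmult, RtoC, Copp; simpl; f_equal; ring).
  transitivity (- (Ci * Ci) * Z); [rewrite I2'; ring|ring]. }
 have E2 : CI g (- L) L = V2 - V1.
 { assert (Ci * (CI g (- L) L - (V2 - V1)) = 0).
  { rewrite <- J0. transitivity (Ci * CI g (- L) L - Ci * (V2 - V1)); [ring|]. rewrite <- E. ring. }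
  destruct (Ceq_dec (CI g (- L) L) (V2 - V1)) as [|N]; auto. exfalso.
  assert (M : Ci * (CI g (- L) L - (V2 - V1)) <> 0); [|auto]. apply Cmult_neq_0; [intro K; injection K; lra|].
  intro K. apply N. apply Ceq_minus; auto. }
 rewrite E2. apply Cmod_tri. rewrite Cmod_opp. lra.
Qed.
End Contour.

Close Scope C_scope.

Lemma geo_to_0 C r e : 0 <= r < 1 -> 0 < e -> exists N0, forall N, (N0 <= N)%nat -> Rabs (C * r ^ N) < e.
Proof.
 intros Hr He. have L : is_lim_seq (fun N => C * r ^ N) (C * 0).
 { apply (is_lim_seq_scal_l (fun N => r ^ N) C 0). apply is_lim_seq_geom. apply Rabs_def1; lra. }
 rewrite Rmult_0_r in L. destruct (proj1 (is_lim_seq_Reals _ _) L e He) as [N0 H]. exists N0. intros N HN.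
 specialize (H N HN). unfold Rdist in H. rewrite Rminus_0_r in H. exact H.
Qed.

Lemma atan_le y : 0 <= y -> 0 <= atan y <= y.
Proof.
 intros Hy. destruct (MVT_gen atan 0 y (fun x => / (1 + Rsqr x))) as [c [Hc E]].
 - intros; apply is_derive_atan.
 - intros x _. apply continuity_pt_filterlim. apply (contR_derive atan x _ (is_derive_atan x)).
 - rewrite atan_0, !Rminus_0_r in E. rewrite E. have Q := Rle_0_sqr c. have B : 0 < / (1 + Rsqr c) <= 1.
  { split; [pos|]. rewrite <- Rinv_1. apply Rinv_le_contravar; lra. }
  split; [pos|]. rewrite <- (Rmult_1_l y) at 2. apply Rmult_le_compat_r; lra.
Qed.

Lemma sch_den x : 0 < exp x + exp (- x).
Proof. pose proof (exp_pos x). pose proof (exp_pos (- x)). lra. Qed.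

Lemma sch_bd x : 0 < sch x <= 2 * exp (- Rabs x).
Proof.
 have D := sch_den x. split; [pos|]. apply Rmult_le_compat_l; [lra|].
 have E : exp (- Rabs x) = / exp (Rabs x) by apply exp_Ropp. rewrite E. apply Rinv_le_contravar; [pos|].
 pose proof (exp_pos x). pose proof (exp_pos (- x)). unfold Rabs. destruct Rcase_abs; lra.
Qed.

Lemma sch_low x : exp (- Rabs x) <= sch x.
Proof.
 have D := sch_den x. rewrite exp_Ropp. replace (/ exp (Rabs x)) with (2 / (2 * exp (Rabs x))).
 - apply Rmult_le_compat_l; [lra|]. apply Rinv_le_contravar; auto.
  assert (exp x <= exp (Rabs x)) by (apply exp_le_mono, Rle_abs).
  assert (exp (- x) <= exp (Rabs x)) by (apply exp_le_mono; rewrite <- Rabs_Ropp; apply Rle_abs). lra.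
 - field. pose proof (exp_pos (Rabs x)). lra.
Qed.

Lemma sch_der a c s : is_derive (fun s => sch (a * (s + c))) s (a * (- 2 * (exp (a * (s + c)) - exp (- (a * (s + c)))) / (exp (a * (s + c)) + exp (- (a * (s + c)))) ^ 2)).
Proof. unfold sch. have D := sch_den (a * (s + c)). auto_derive; [lra|]. field. lra. Qed.

Lemma sch_cont a c s : continuous (fun s => sch (a * (s + c))) s.
Proof. eapply contR_derive, sch_der. Qed.

Section Density.
Variable t : R.
Hypothesis Ht : 0 < t.
Let al := PI / t.

(** The translates by n and by - n - 1 together, so that n runs through all integer translates
    once. *)
Definition dterm (n : nat) (s : R) : R := sch (PI / t * (s + INR n)) + sch (PI / t * (s + (- INR n - 1))).
Definition dens (s : R) : R := / t * Series (fun n => dterm n s).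
Let rr := exp (- al).

Lemma alp : 0 < al.
Proof. apply Rdiv_lt_0_compat; auto. apply PI_RGT_0. Qed.

Lemma rr_bd : 0 <= rr < 1.
Proof. pose proof alp. split; [pos|]. rewrite <- exp_0. apply exp_increasing. lra. Qed.

Lemma dterm_cont n s : continuous (dterm n) s.
Proof. apply contR_plus; apply sch_cont. Qed.

Lemma dterm_pos n s : 0 < dterm n s.
Proof. unfold dterm. pose proof (sch_bd (PI / t * (s + INR n))). pose proof (sch_bd (PI / t * (s + (- INR n - 1)))). lra. Qed.

Lemma dterm_bd R0 n s : Rabs s < R0 -> Rabs (dterm n s) <= 4 * exp (al * R0) * rr ^ n.
Proof.
 intros Hs. have A := alp. rewrite Rabs_pos_eq by (left; apply dterm_pos).
 have K : forall c, INR n - R0 <= Rabs (s + c) -> sch (PI / t * (s + c)) <= 2 * (exp (al * R0) * rr ^ n).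
 { intros c Hc. fold al. etr sch_bd. apply Rmult_le_compat_l; [lra|]. unfold rr. rewrite <- exp_pow, <- exp_plus.
  apply exp_le_mono. rewrite Rabs_mult, (Rabs_pos_eq al) by lra.
  assert (al * (INR n - R0) <= al * Rabs (s + c)) by (apply Rmult_le_compat_l; lra). lra. }
 apply Rabs_def2 in Hs. unfold dterm.
 have K1 := K (INR n). have K2 := K (- INR n - 1).
 assert (INR n - R0 <= Rabs (s + INR n)) by (pose proof (Rle_abs (s + INR n)); lra).
 assert (INR n - R0 <= Rabs (s + (- INR n - 1))) by (rewrite <- Rabs_Ropp; pose proof (Rle_abs (- (s + (- INR n - 1)))); lra).
 specialize (K1 H). specialize (K2 H0). lra.
Qed.

Lemma dbd_ex R0 : ex_series (fun n => 4 * exp (al * R0) * rr ^ n).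
Proof. apply ex_series_mul_l, ex_series_geom. destruct rr_bd. apply Rabs_def1; lra. Qed.

Lemma dens_cont s : continuous dens s.
Proof.
 apply contR_mult; [cts|]. apply (cont_Series_loc dterm (fun n => 4 * exp (al * (Rabs s + 2)) * rr ^ n) (Rabs s + 2)).
 - apply dterm_cont.
 - intros k x Hx. apply dterm_bd, Hx.
 - apply dbd_ex.
 - lra.
Qed.

Lemma dens_ex s : ex_series (fun n => dterm n s).
Proof. apply (Rabs_Series_le _ (fun n => 4 * exp (al * (Rabs s + 1)) * rr ^ n)); [intros; apply dterm_bd; lra|apply dbd_ex]. Qed.

Lemma dens_bounds : exists dmin dmax, 0 < dmin /\ forall s, 0 <= s <= 1 -> dmin <= dens s <= dmax.
Proof.
 exists (/ t * exp (- al)), (/ t * Series (fun n => 4 * exp (al * 2) * rr ^ n)). have T : 0 < / t by pos.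
 split; [pos|]. intros s Hs. have A := alp. split; apply Rmult_le_compat_l; try lra.
 - rewrite (Series_incr_1 _ (dens_ex s)). have P : 0 <= Series (fun k => dterm (S k) s).
  { apply Series_nonneg; [intros; left; apply dterm_pos|]. apply (ex_series_incr_1 (fun n => dterm n s)), dens_ex. }
  unfold dterm at 1. simpl INR. have B1 := sch_bd (al * (s + (- 0 - 1))). have B2 := sch_low (al * (s + 0)). change (PI / t) with al.
  assert (exp (- al) <= exp (- Rabs (al * (s + 0)))); [|lra]. apply exp_le_mono. rewrite Rplus_0_r, Rabs_mult, !Rabs_pos_eq by lra.
  rewrite <- (Rmult_1_r al) at 1. apply Ropp_le_contravar, Rmult_le_compat_l; lra.
 - etr Rle_abs. apply Rabs_Series_le; [intros; apply dterm_bd|apply dbd_ex]. rewrite Rabs_pos_eq; lra.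
Qed.

Variable g : R -> R.
Hypothesis g_cont : forall s, continuous g s.
Hypothesis g_per : forall s, g (s + 1) = g s.
Hypothesis g_bd : forall s, Rabs (g s) <= 1.

Let G (s : R) : R := sch (al * s) * g s.

Lemma G_cont s : continuous G s.
Proof.
 apply contR_mult; auto. apply (continuous_ext (fun s => sch (al * (s + 0)))); [intros; rewrite Rplus_0_r; auto|apply sch_cont].
Qed.

Lemma RInt_shift_int (z : Z) : RInt (fun s => sch (al * (s + IZR z)) * g s) 0 1 = RInt G (IZR z) (IZR z + 1).
Proof.
 have E := RInt_comp_lin (V := VR) G 1 (IZR z) 0 1.
 replace (1 * 0 + IZR z) with (IZR z) in E by ring. replace (1 * 1 + IZR z) with (IZR z + 1) in E by ring. rewrite <- E.
 - apply RInt_ext. intros s _. req. unfold G. rewrite !Rmult_1_l. rewrite (periodic_Z g g_per z s). reflexivity.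
 - apply ex_RInt_contR. apply G_cont.
Qed.

Lemma psum_dens N : sum_f_R0 (fun n => RInt (fun s => dterm n s * g s) 0 1) N = RInt G (- (INR N + 1)) (INR N + 1).
Proof.
 have CH : forall a b c, RInt G a b + RInt G b c = RInt G a c.
 { intros a b c. apply (RInt_Chasles (V := VR)); apply ex_RInt_contR, G_cont. }
 have ST : forall n, RInt (fun s => dterm n s * g s) 0 1 = RInt G (INR n) (INR n + 1) + RInt G (- (INR n + 1)) (- INR n).
 { intros n.
  have E1 := RInt_shift_int (Z.of_nat n). have E2 := RInt_shift_int (- Z.of_nat n - 1).
  rewrite minus_IZR, opp_IZR in E2. rewrite <- INR_IZR_INZ in E1, E2.
  replace (- INR n - 1 + 1) with (- INR n) in E2 by ring. replace (- (INR n + 1)) with (- INR n - 1) by ring. rewrite <- E1, <- E2.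
  have c : forall y s, continuous (fun s => sch (al * (s + y)) * g s) s by (intros; apply contR_mult; [apply sch_cont|auto]).
  rewrite <- (RInt_plusR (fun s => sch (al * (s + INR n)) * g s) (fun s => sch (al * (s + (- INR n - 1))) * g s)) by (apply ex_RInt_contR; auto).
  apply RInt_ext. intros s _. req. unfold dterm. fold al. ring. }
 induction N as [|N IH].
 - simpl sum_f_R0. rewrite ST. simpl INR. rewrite Rplus_comm, Ropp_0, CH. reflexivity.
 - rewrite tech5, IH, ST. rewrite S_INR.
  rewrite <- (CH (- (INR N + 1 + 1)) (- (INR N + 1)) (INR N + 1 + 1)), <- (CH (- (INR N + 1)) (INR N + 1) (INR N + 1 + 1)). ring.
Qed.

(** Unfolding: because g is periodic, the partial sums up to N integrate over one period to the
    integral of sech g over [- (N + 1), N + 1]. *)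
Lemma dens_integral l C0 : (forall L, 1 <= al * L -> Rabs (RInt G (- L) L - l) <= C0 * exp (- (al * L))) ->
 RInt (fun s => dens s * g s) 0 1 = / t * l.
Proof.
 intros H. have A := alp.
 have cu : forall n s, continuous (fun s => dterm n s * g s) s by (intros; apply contR_mult; [apply dterm_cont|auto]).
 destruct (RInt_Series_loc (fun n s => dterm n s * g s) (fun n => 4 * exp (al * 2) * rr ^ n) 2 arith cu) as [EX E].
 - intros k x Hx. rewrite Rabs_mult. rewrite <- (Rmult_1_r (4 * exp (al * 2) * rr ^ k)). apply Rmult_le_compat; try apply Rabs_pos; auto. apply dterm_bd; auto.
 - apply dbd_ex.
 - transitivity (/ t * RInt (fun s => Series (fun n => dterm n s * g s)) 0 1).
  + rewrite <- RInt_mulR.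
   * apply RInt_ext. intros s _. req. unfold dens. rewrite Rmult_assoc, <- Series_scal_r. reflexivity.
   * apply (ex_RInt_ext (fun s => (t * dens s) * g s)).
    -- intros s _. unfold dens. rewrite <- Rmult_assoc, Rinv_r, Rmult_1_l by lra. rewrite <- Series_scal_r. reflexivity.
    -- apply ex_RInt_contR. intros s. apply contR_mult; auto. apply contR_mult; [cts|apply dens_cont].
  + f_equal. etransitivity; [pos|].
   destruct (EX) as [l' El']. have Lim := is_series_unique _ _ El'.
   assert (Ul : l' = l); [|pos].
   change (is_lim_seq (sum_n (fun k => RInt (fun s => dterm k s * g s) 0 1)) l') in El'.
   apply (is_lim_seq_ext (sum_n _) (fun N => RInt G (- (INR N + 1)) (INR N + 1))) in El'.
   2: { intros N. rewrite sum_n_Reals. apply psum_dens. }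
   have L2 : is_lim_seq (fun N => RInt G (- (INR N + 1)) (INR N + 1)) l.
   { apply is_lim_seq_Reals. intros e He. destruct (geo_to_0 (C0 * rr) rr e rr_bd He) as [N0 HN0].
    destruct (nfloor_ex (Rmax 0 (/ al)) (Rmax_l _ _)) as [N1 [_ HN1]].
    exists (N0 + N1)%nat. intros N HN. eapply Rle_lt_trans; [apply H|].
    - have Q : / al <= INR N + 1.
     { apply Rle_trans with (Rmax 0 (/ al)); [apply Rmax_r|]. assert (INR N1 <= INR N) by (apply le_INR; lia). lra. }
     apply Rmult_le_reg_l with (/ al); [pos|]. rewrite <- Rmult_assoc, Rinv_l, Rmult_1_l, Rmult_1_r by lra. exact Q.
    - replace (C0 * exp (- (al * (INR N + 1)))) with (C0 * rr * rr ^ N).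
     + eapply Rle_lt_trans; [apply Rle_abs|apply HN0; lia].
     + unfold rr. rewrite <- exp_pow, Rmult_assoc, <- exp_plus. f_equal. f_equal. ring. }
   have U := is_lim_seq_unique _ _ El'. rewrite (is_lim_seq_unique _ _ L2) in U. injection U; auto.
Qed.
End Density.

(** The primitive of sech is 2 atan (exp), and atan (1 / y) = PI / 2 - atan y. *)
Lemma sch_mass t L : 0 < t -> 0 <= PI / t * L -> Rabs (RInt (fun s => sch (PI / t * s)) (- L) L - t) <= 4 * t / PI * exp (- (PI / t * L)).
Proof.
 intros Ht HL. have P := PI_RGT_0. set (a := PI / t) in *. have A : 0 < a by pos.
 have E : RInt (fun s => sch (a * s)) (- L) L = 2 / a * atan (exp (a * L)) - 2 / a * atan (exp (a * - L)).
 { apply is_RInt_unique. apply (is_RInt_derive (fun s => 2 / a * atan (exp (a * s)))).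
  - intros s _. unfold sch. auto_derive; auto. rewrite exp_Ropp. have X := exp_pos (a * s). field. split; [nra|]. split; [nra|]. lra.
  - intros s _. apply (continuous_ext (fun s => sch (a * (s + 0)))); [intros; rewrite Rplus_0_r; auto|apply sch_cont]. }
 rewrite E. replace (a * - L) with (- (a * L)) by ring. set (y := exp (- (a * L))). have Y := exp_pos (- (a * L)). fold y in Y.
 replace (exp (a * L)) with (/ y) by (unfold y; rewrite exp_Ropp; apply Rinv_inv).
 rewrite atan_inv by auto. replace (2 / a * (PI / 2 - atan y) - 2 / a * atan y - t) with (- (4 / a * atan y)) by (unfold a; field; lra).
 have B := atan_le y arith. rewrite Rabs_Ropp, Rabs_pos_eq.
 - replace (4 * t / PI) with (4 / a) by (unfold a; field; lra). apply Rmult_le_compat_l; [pos|pos].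
 - pos.
Qed.

(** With H = 2 cosh (PI k t), the contour estimate says that H times the integral of sech e(-ks)
    tends to twice the integral of sech, that is to 2 t. *)
Lemma sech_fourier t k : 0 < t -> exists C0, forall L, 1 <= PI / t * L ->
 Rabs (RInt (fun s => sch (PI / t * s) * cos (om k * s)) (- L) L - t * ch t k) <= C0 * exp (- (PI / t * L)) /\
 Rabs (RInt (fun s => sch (PI / t * s) * sin (om k * s)) (- L) L - 0) <= C0 * exp (- (PI / t * L)).
Proof.
 intros Ht. set (H := exp (PI * INR k * t) + exp (- (PI * INR k * t))).
 have HP : 0 < H by apply sch_den. have PP := PI_RGT_0.
 have Hc : ch t k = 2 / H.
 { unfold ch, H. rewrite (nome_hnome t k). unfold hnome. rewrite <- exp_pow. replace (INR k * - (PI * t)) with (- (PI * INR k * t)) by ring.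
  rewrite exp_Ropp. have X := exp_pos (PI * INR k * t). field. split; nra. }
 exists ((kC t k + 2 * (4 * t / PI)) / H). intros L HL.
 have c0 : forall s, continuous (fun s : R => sch (PI / t * s)) s.
 { intros s. apply (continuous_ext (fun s => sch (PI / t * (s + 0)))); [intros; rewrite Rplus_0_r; auto|apply sch_cont]. }
 have c1 : forall s, continuous (fun s : R => sch (PI / t * s) * cos (om k * s)) s by (intros; apply contR_mult; [auto|cts]).
 have c2 : forall s, continuous (fun s : R => sch (PI / t * s) * sin (om k * s)) s by (intros; apply contR_mult; [auto|apply contR_sin]).
 have K := contour t Ht k L HL. fold H in K.
 have KR := Rle_trans _ _ _ (Re_le_Cmod _) K. have KI := Rle_trans _ _ _ (Im_le_Cmod _) K.
 rewrite Re_CI in KR. rewrite Im_CI in KI.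
 have M := sch_mass t L Ht arith.
 set (I0 := RInt (fun s => sch (PI / t * s)) (- L) L) in *.
 set (I1 := RInt (fun s => sch (PI / t * s) * cos (om k * s)) (- L) L).
 set (I2 := RInt (fun s => sch (PI / t * s) * sin (om k * s)) (- L) L).
 set (X := exp (- (PI / t * L))) in *. have E1 : RInt (fun x => Re (Cmult (RtoC (sch (PI / t * x))) (Cminus (Cmult (RtoC H) ((cos (om k * x))%R, (- sin (om k * x))%R)) 2))%C) (- L) L = H * I1 - 2 * I0.
 { unfold I1, I0. rewrite <- RInt_mulR by (apply ex_RInt_contR; auto). rewrite <- (RInt_mulR 2) by (apply ex_RInt_contR; auto).
  rewrite <- (RInt_minusR (fun x => H * (sch (PI / t * x) * cos (om k * x))) (fun x => 2 * sch (PI / t * x))) by (apply ex_RInt_mulR, ex_RInt_contR; auto).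
  apply RInt_ext. intros s _. req. unfold Cmult, Cminus, Cplus, Copp, RtoC, Re; simpl. ring. }
 have E2 : RInt (fun x => Im (Cmult (RtoC (sch (PI / t * x))) (Cminus (Cmult (RtoC H) ((cos (om k * x))%R, (- sin (om k * x))%R)) 2))%C) (- L) L = (- H) * I2.
 { unfold I2. rewrite <- RInt_mulR by (apply ex_RInt_contR; auto).
  apply RInt_ext. intros s _. req. unfold Cmult, Cminus, Cplus, Copp, RtoC, Im; simpl. ring. }
 rewrite E1 in KR. rewrite E2 in KI. rewrite Rabs_mult, Rabs_Ropp, (Rabs_pos_eq H) in KI by lra.
 have Fin : forall z, H * Rabs z <= (kC t k + 2 * (4 * t / PI)) * X -> Rabs z <= (kC t k + 2 * (4 * t / PI)) / H * X.
 { intros z Hz. apply Rmult_le_reg_l with H; auto. eapply Rle_trans; [exact Hz|]. right. field. split; lra. }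
 have Q4 : 0 <= 4 * t / PI * X by pos.
 split; apply Fin.
 - rewrite <- (Rabs_pos_eq H) at 1 by lra. rewrite <- Rabs_mult. rewrite Hc. replace (H * (I1 - t * (2 / H))) with ((H * I1 - 2 * I0) + 2 * (I0 - t)) by (field; lra).
  apply Rabs_tri. rewrite (Rabs_mult 2), (Rabs_pos_eq 2) by lra. lra.
 - rewrite Rminus_0_r. lra.
Qed.

Lemma dens_cos t k : 0 < t -> RInt (fun s => dens t s * cos (om k * s)) 0 1 = ch t k.
Proof.
 intros Ht. destruct (sech_fourier t k Ht) as [C0 H].
 rewrite (dens_integral t Ht (fun s => cos (om k * s)) (contR_cos (INR k)) (cos_per_nat k) (fun s => Rabs_le _ _ (COS_bound _)) (t * ch t k) C0).
 - req. field. lra.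
 - intros L HL. apply H, HL.
Qed.

Lemma dens_sin t k : 0 < t -> RInt (fun s => dens t s * sin (om k * s)) 0 1 = 0.
Proof.
 intros Ht. destruct (sech_fourier t k Ht) as [C0 H].
 rewrite (dens_integral t Ht (fun s => sin (om k * s)) (contR_sin (INR k)) (sin_per_nat k) (fun s => Rabs_le _ _ (SIN_bound _)) 0 C0).
 - pos.
 - intros L HL. apply H, HL.
Qed.

(** * The square of the sech series *)

Definition csch (x : R) : R := 2 / (exp x - exp (- x)).
Definition tnh (x : R) : R := (exp x - exp (- x)) / (exp x + exp (- x)).
Definition coth (x : R) : R := (exp x + exp (- x)) / (exp x - exp (- x)).

Lemma csch_den x : x <> 0 -> exp x - exp (- x) <> 0.
Proof. intros Hx K. apply Hx. have E : x = - x by (apply exp_inv; lra). lra. Qed.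

(** The addition formula of sinh divided by cosh u cosh v. With [csch_csch], it gives the cross
    terms of both squared series the same form (T i - T j) g (i - j), with the same g on equally
    spaced points. *)
Lemma sch_sch u v : u <> v -> sch u * sch v = (tnh u - tnh v) * csch (u - v).
Proof.
 intros H. unfold sch, tnh, csch. have D := csch_den (u - v) arith.
 replace (exp (u - v)) with (exp u * exp (- v)) in * by (rewrite <- exp_plus; f_equal; ring).
 replace (exp (- (u - v))) with (exp v * exp (- u)) in * by (rewrite <- exp_plus; f_equal; ring).
 have E := sch_den u. have E' := sch_den v.
   set (a := exp u) in *. set (b := exp (- u)) in *. set (c := exp v) in *. set (e := exp (- v)) in *.
 field. repeat split; lra.
Qed.

Lemma csch_csch u v : u <> v -> u <> 0 -> v <> 0 -> csch u * csch v = (- coth u - - coth v) * csch (u - v).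
Proof.
 intros H Hu Hv. unfold coth, csch. have D := csch_den (u - v) arith.
 replace (exp (u - v)) with (exp u * exp (- v)) in * by (rewrite <- exp_plus; f_equal; ring).
 replace (exp (- (u - v))) with (exp v * exp (- u)) in * by (rewrite <- exp_plus; f_equal; ring).
 have E := csch_den u Hu. have E' := csch_den v Hv.
 set (a := exp u) in *. set (b := exp (- u)) in *. set (c := exp v) in *. set (e := exp (- v)) in *.
 field. repeat split; lra.
Qed.

Lemma csch_opp x : csch (- x) = - csch x.
Proof.
 unfold csch. rewrite Ropp_involutive. destruct (Req_dec x 0) as [-> | N].
 - rewrite Ropp_0, Rminus_diag. unfold Rdiv. rewrite Rinv_0. ring.
 - have D := csch_den x N. field. lra.
Qed.

Section Windows.
Variable g : nat -> R.

Fixpoint psum (F : nat -> R) (i : nat) : R := match i with O => 0 | S i => psum F i + F i end.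

Definition cross (T : nat -> R) (M : nat) : R := psum (fun i => psum (fun j => (T i - T j) * g (i - j)) i) M.

Lemma psum_ext F G n : (forall i, (i < n)%nat -> F i = G i) -> psum F n = psum G n.
Proof. induction n; intros H; simpl; auto. rewrite IHn, H by pos. auto. Qed.

Lemma psum_plus F G n : psum (fun i => F i + G i) n = psum F n + psum G n.
Proof. induction n; simpl; [ring|pos]. Qed.

Lemma psum_scal c F n : psum (fun i => c * F i) n = c * psum F n.
Proof. induction n; simpl; [ring|pos]. Qed.

Lemma psum_abs F n B : (forall i, (i < n)%nat -> Rabs (F i) <= B) -> Rabs (psum F n) <= INR n * B.
Proof.
 induction n; intros H; [simpl; rewrite Rabs_R0; lra|]. rewrite S_INR. cbn [psum]. apply Rabs_tri.
 have A := IHn ltac:(intros; apply H; lia). have C := H n ltac:(lia). lra.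
Qed.

Lemma psum_S F n : psum F (S n) = F 0%nat + psum (fun i => F (S i)) n.
Proof. induction n; [simpl; ring|]. change (psum F (S (S n))) with (psum F (S n) + F (S n)). rewrite IHn. simpl. ring. Qed.

Lemma psum_square (x T : nat -> R) M : (forall i j, (j < i)%nat -> x i * x j = (T i - T j) * g (i - j)) ->
 psum x M * psum x M = psum (fun i => x i * x i) M + 2 * cross T M.
Proof.
 intros H. unfold cross. induction M as [|M IH]; [simpl; ring|]. cbn [psum].
 replace (psum (fun j => (T M - T j) * g (M - j)%nat) M) with (x M * psum x M).
 - pos.
 - rewrite <- psum_scal. apply psum_ext. intros; apply H; auto.
Qed.

Definition PG (m : nat) : R := psum (fun d => g (S d)) m.

Lemma psum_rev_PG M : psum (fun j => g (M - j)) M = PG M.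
Proof.
 unfold PG. induction M as [|M IH]; [pos|]. rewrite psum_S. simpl (psum (fun d => g (S d)) (S M)). rewrite <- IH.
 rewrite Nat.sub_0_r. rewrite Rplus_comm. f_equal.
Qed.

(* Abel summation: in the cross sum, [g d] and [g (- d)] cancel except near the ends of the window. *)
Lemma cross_abel T M : cross T (S M) = psum (fun i => T i * (PG i - PG (M - i))) (S M).
Proof.
 induction M as [|M IH].
 - unfold cross, PG. simpl. ring.
 - change (cross T (S (S M))) with (cross T (S M) + psum (fun j => (T (S M) - T j) * g (S M - j)) (S M)). rewrite IH.
  cbn [psum]. replace (PG (S M - S M)) with 0 by (rewrite Nat.sub_diag; reflexivity).
  have A : psum (fun j => (T (S M) - T j) * g (S M - j)) (S M) = T (S M) * PG (S M) - psum (fun j => T j * g (S M - j)) (S M).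
  { rewrite <- psum_rev_PG, <- psum_scal. have B := psum_plus (fun j => (T (S M) - T j) * g (S M - j)) (fun j => T j * g (S M - j)) (S M).
   rewrite (psum_ext _ (fun j => T (S M) * g (S M - j))) in B by pos. lra. }
  change (psum (fun j => (T (S M) - T j) * g (S M - j)) M + (T (S M) - T M) * g (S M - M)) with (psum (fun j => (T (S M) - T j) * g (S M - j)) (S M)).
  rewrite A.
  change (psum (fun i => T i * (PG i - PG (S M - i))) M + T M * (PG M - PG (S M - M))) with (psum (fun i => T i * (PG i - PG (S M - i))) (S M)).
  change (psum (fun i => T i * (PG i - PG (M - i))) M + T M * (PG M - PG (M - M))) with (psum (fun i => T i * (PG i - PG (M - i))) (S M)).
  rewrite (psum_ext (fun i => T i * (PG i - PG (S M - i))) (fun i => T i * (PG i - PG (M - i)) + - 1 * (T i * g (S M - i)%nat))).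
  + rewrite psum_plus, psum_scal. ring.
  + intros i Hi. replace (S M - i)%nat with (S (M - i)) by lia. unfold PG at 2. cbn [psum]. fold (PG (M - i)). ring.
Qed.

Lemma psum_window (F : R -> R) N : psum (fun i => F (INR i - INR N)) (N + N) = psum (fun n => F (INR n) + F (- INR n - 1)) N.
Proof.
 induction N as [|N IH]; [pos|]. replace (S N + S N)%nat with (S (S (N + N))) by lia.
 rewrite psum_S. cbn [psum]. rewrite <- IH.
 rewrite (psum_ext (fun i => F (INR (S i) - INR (S N))) (fun i => F (INR i - INR N))).
 - replace (INR (S (N + N)) - INR (S N)) with (INR N) by (rewrite !S_INR, plus_INR; ring).
  replace (INR 0 - INR (S N)) with (- INR N - 1) by (rewrite S_INR; simpl; ring). ring.
 - intros i _. f_equal. rewrite !S_INR. ring.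
Qed.

Variables c r : R.
Hypothesis Hr : 0 < r < 1.
Hypothesis Hc : 0 < c.
Hypothesis Hg : forall d, 0 <= g (S d) <= c * r ^ (S d).

Lemma PG_inc m k : 0 <= PG (m + k) - PG m <= c / (1 - r) * (r ^ m - r ^ (m + k)).
Proof.
 induction k as [|k IH]; [rewrite Nat.add_0_r; lra|]. rewrite Nat.add_succ_r.
 change (PG (S (m + k))) with (PG (m + k) + g (S (m + k))). specialize (Hg (m + k)%nat).
 have E : c / (1 - r) * (r ^ m - r ^ S (m + k)) = c / (1 - r) * (r ^ m - r ^ (m + k)) + c * r ^ (m + k).
 { simpl. field. lra. }
 rewrite E. assert (0 < r ^ (m + k)) by pos. assert (r ^ S (m + k) <= r ^ (m + k)) by (simpl; nra).
 assert (c * r ^ S (m + k) <= c * r ^ (m + k)) by (apply Rmult_le_compat_l; lra). lra.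
Qed.

Lemma PG_diff m k : Rabs (PG m - PG (m + k)) <= c / (1 - r) * r ^ m.
Proof.
 rewrite Rabs_minus_sym. have A := PG_inc m k. rewrite Rabs_pos_eq by lra.
 assert (0 < r ^ (m + k)) by pos. assert (0 < c / (1 - r)) by pos. nra.
Qed.

(** In the sum given by [cross_abel], T decays away from the centre of the window and the difference
    of the [PG] away from its ends, so every product is O(r^N). *)
Lemma cross_small (T : R -> R) B N : 0 <= B -> (forall n, Rabs (T (INR n)) <= B * r ^ n /\ Rabs (T (- INR n - 1)) <= B * r ^ n) ->
 Rabs (cross (fun i => T (INR i - INR (S N))) (S N + S N)) <= INR (S N + S N) * (B * (c / (1 - r)) * r ^ N).
Proof.
 intros HB HT. replace (S N + S N)%nat with (S (S (N + N))) by lia. rewrite cross_abel. apply psum_abs. intros i Hi.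
  have Fin : forall n y z, (n <= N)%nat -> Rabs y <= B * r ^ n -> Rabs z <= c / (1 - r) * r ^ (N - n) -> Rabs (y * z) <= B * (c / (1 - r)) * r ^ N.
 { intros n y z Hn Hy Hz. rewrite Rabs_mult. eapply Rle_trans; [apply Rmult_le_compat; [pos|pos|exact Hy|exact Hz]|].
  right. replace N with (n + (N - n))%nat at 2 by lia. rewrite pow_add. ring. }
 destruct (Nat.le_gt_cases i N) as [Hle|Hgt].
 - apply (Fin (N - i)%nat); [lia| |].
  + replace (INR i - INR (S N)) with (- INR (N - i) - 1) by (rewrite minus_INR, S_INR by lia; ring). apply HT.
  + replace (N - (N - i))%nat with i by lia. replace (S (N + N) - i)%nat with (i + (S (N + N) - i - i))%nat by lia. apply PG_diff.
 - apply (Fin (i - S N)%nat); [lia| |].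
  + replace (INR i - INR (S N)) with (INR (i - S N)) by (rewrite minus_INR by lia; ring). apply HT.
  + replace (N - (i - S N))%nat with (S (N + N) - i)%nat by lia. rewrite Rabs_minus_sym.
   replace (PG i) with (PG ((S (N + N) - i) + (i - (S (N + N) - i)))) by (f_equal; lia). apply PG_diff.
Qed.
End Windows.

Lemma psum_sum F n : psum F (S n) = sum_f_R0 F n.
Proof. induction n; [simpl; ring|]. rewrite tech5, <- IHn. reflexivity. Qed.

Lemma tnh_1 x : 0 <= x -> Rabs (tnh x - 1) <= 2 * exp (- (2 * x)).
Proof.
 intros Hx. unfold tnh. have P := exp_pos x. have Q := exp_pos (- x).
 replace ((exp x - exp (- x)) / (exp x + exp (- x)) - 1) with (- (2 * exp (- x) / (exp x + exp (- x)))) by (field; lra).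
 rewrite Rabs_Ropp, Rabs_pos_eq by pos.
 replace (exp (- (2 * x))) with (exp (- x) / exp x) by (unfold Rdiv; rewrite <- exp_Ropp, <- exp_plus; f_equal; ring).
 unfold Rdiv. rewrite Rmult_assoc. apply Rmult_le_compat_l; [lra|]. apply Rmult_le_compat_l; [lra|]. apply Rinv_le_contravar; lra.
Qed.

Lemma coth_1 a x : 0 < a <= x -> Rabs (coth x - 1) <= 2 / (1 - exp (- (2 * a))) * exp (- (2 * x)).
Proof.
 intros Hx. unfold coth. have D := csch_den x arith. have L : exp (- (2 * x)) <= exp (- (2 * a)) by (apply exp_le_mono; lra).
 have L1 : exp (- (2 * a)) < 1 by (rewrite <- exp_0; apply exp_increasing; lra).
 have E : exp (- x) = exp x * exp (- (2 * x)) by (rewrite <- exp_plus; f_equal; ring).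
 set (w := exp (- (2 * x))) in *. have W : 0 < w by apply exp_pos. rewrite E in *.
 replace ((exp x + exp x * w) / (exp x - exp x * w) - 1) with (2 / (1 - w) * w) by (field; split; lra).
 rewrite Rabs_pos_eq by pos.
 apply Rmult_le_compat_r; [lra|]. apply Rmult_le_compat_l; [lra|]. apply Rinv_le_contravar; lra.
Qed.

Lemma tnh_opp x : tnh (- x) = - tnh x.
Proof. unfold tnh. rewrite Ropp_involutive. pose proof (sch_den x). field. lra. Qed.

Lemma coth_opp x : x <> 0 -> coth (- x) = - coth x.
Proof. intros H. unfold coth. rewrite Ropp_involutive. pose proof (csch_den x H). field. lra. Qed.

Section SquareIdentity.
Variable a : R.
Hypothesis Ha : 0 < a.
Variable s : R.
Hypothesis Hs : 0 <= s <= 1.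

Let g (d : nat) : R := csch (a * INR d).
Let r := exp (- a).

Lemma g_bd d : 0 <= g (S d) <= 2 / (1 - r) * r ^ S d.
Proof.
 have R1 : r < 1 by (unfold r; rewrite <- exp_0; apply exp_increasing; lra). have R0 : 0 < r by apply exp_pos.
 unfold g, csch. have E : exp (a * INR (S d)) = / r ^ S d.
 { unfold r. rewrite <- exp_pow, <- exp_Ropp. f_equal. ring. }
 rewrite exp_Ropp, E, Rinv_inv. have B := pow_lt1 r (S d) (conj R0 R1) ltac:(lia). set (w := r ^ S d) in *.
 have W2 : w * w <= r by nra.
 replace (2 / (/ w - w)) with (2 / (1 - w * w) * w) by (field; repeat split; nra).
 split; [pos|].
 apply Rmult_le_compat_r; [lra|]. apply Rmult_le_compat_l; [lra|]. apply Rinv_le_contravar; lra.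
Qed.

Let xs (y : R) : R := sch (a * (s + y)).
Let xc (y : R) : R := csch (a * (/ 2 + y)).
(** Neither tanh nor coth tends to 0, but their limits at each end agree, so the difference decays
    exponentially. This is why the csch series at the half-integers is squared along with the sech
    series. *)
Let TT (y : R) : R := tnh (a * (s + y)) + - coth (a * (/ 2 + y)).

Lemma half_nz (z : Z) : a * (/ 2 + IZR z) <> 0.
Proof.
 intro K. apply Rmult_integral in K. destruct K as [K|K]; [lra|].
 have E : IZR (2 * z) = IZR (-1) by (rewrite mult_IZR; lra). apply eq_IZR in E. lia.
Qed.

Lemma TT_bd : exists B, 0 <= B /\ forall n, Rabs (TT (INR n)) <= B * r ^ n /\ Rabs (TT (- INR n - 1)) <= B * r ^ n.
Proof.
 have E1 : exp (- (2 * (a * / 2))) < 1 by (rewrite <- exp_0; apply exp_increasing; lra).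
 set (q := 2 / (1 - exp (- (2 * (a * / 2))))). have Q : 0 < q by pos.
 exists (2 + q). split; [lra|]. intros n. have RN : r ^ n = exp (- (a * INR n)) by (unfold r; rewrite <- exp_pow; f_equal; ring).
 have Key : forall u v, a * INR n <= u -> a * (/ 2) + a * INR n <= v -> Rabs (tnh u - 1) + Rabs (coth v - 1) <= (2 + q) * r ^ n.
 { intros u v Hu Hv. have an : 0 <= a * INR n by pos.
  have A := tnh_1 u arith. have B := coth_1 (a * / 2) v arith. fold q in B. rewrite RN.
  assert (exp (- (2 * u)) <= exp (- (a * INR n))) by (apply exp_le_mono; lra).
  assert (exp (- (2 * v)) <= exp (- (a * INR n))) by (apply exp_le_mono; lra).
  assert (q * exp (- (2 * v)) <= q * exp (- (a * INR n))) by (apply Rmult_le_compat_l; lra). lra. }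
 split.
 - eapply Rle_trans; [|apply (Key (a * (s + INR n)) (a * (/ 2 + INR n)))]; [|nra|nra].
  unfold TT. replace (tnh (a * (s + INR n)) + - coth (a * (/ 2 + INR n))) with ((tnh (a * (s + INR n)) - 1) + - (coth (a * (/ 2 + INR n)) - 1)) by ring.
  apply Rabs_tri. rewrite Rabs_Ropp. apply Rle_refl.
 - eapply Rle_trans; [|apply (Key (- (a * (s + (- INR n - 1)))) (- (a * (/ 2 + (- INR n - 1)))))]; [|nra|nra].
  have Z := half_nz (- Z.of_nat n - 1). rewrite minus_IZR, opp_IZR, <- INR_IZR_INZ in Z.
  rewrite tnh_opp, coth_opp by exact Z. unfold TT. set (A := tnh _). set (B := coth _).
  replace (A + - B) with (- (- A - 1) + (- B - 1)) by ring. apply Rabs_tri. rewrite Rabs_Ropp. apply Rle_refl.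
Qed.

(** On a symmetric window the csch sum is 0 because its terms are odd about the centre. Adding its
    squared identity to that of sech therefore changes only the right side. *)
Lemma square_window N : let M := (S N + S N)%nat in
 psum (fun n => xs (INR n) + xs (- INR n - 1)) (S N) * psum (fun n => xs (INR n) + xs (- INR n - 1)) (S N) =
 psum (fun n => (xs (INR n) ^ 2 + xs (- INR n - 1) ^ 2) + 2 * xc (INR n) ^ 2) (S N) + 2 * cross g (fun i => TT (INR i - INR (S N))) M.
Proof.
 intros M.
 have dif : forall w i j, (j < i)%nat -> a * (w + (INR i - INR (S N))) - a * (w + (INR j - INR (S N))) = a * INR (i - j).
 { intros w i j H. rewrite (minus_INR i j) by lia. ring. }
 have pos : forall i j, (j < i)%nat -> a * INR (i - j) <> 0.
 { intros i j H. apply Rgt_not_eq, Rmult_lt_0_compat; auto. apply lt_0_INR. lia. }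
 have S1 := psum_square g (fun i => xs (INR i - INR (S N))) (fun i => tnh (a * (s + (INR i - INR (S N))))) M.
 have S2 := psum_square g (fun i => xc (INR i - INR (S N))) (fun i => - coth (a * (/ 2 + (INR i - INR (S N))))) M.
 have H1 := S1 ltac:(intros i j Hij; unfold xs, g; rewrite <- (dif s i j Hij); apply sch_sch; intro K; apply (pos i j Hij); rewrite <- (dif s i j Hij), K; ring).
 have nz : forall i, a * (/ 2 + (INR i - INR (S N))) <> 0.
 { intros i. have Z := half_nz (Z.of_nat i - Z.of_nat (S N)). rewrite minus_IZR, <- !INR_IZR_INZ in Z. exact Z. }
 have H2 := S2 ltac:(intros i j Hij; unfold xc, g; rewrite <- (dif (/ 2) i j Hij); apply csch_csch; auto; intro K; apply (pos i j Hij); rewrite <- (dif (/ 2) i j Hij), K; ring).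
 clear S1 S2.
 have HC : cross g (fun i => TT (INR i - INR (S N))) M = cross g (fun i => tnh (a * (s + (INR i - INR (S N))))) M + cross g (fun i => - coth (a * (/ 2 + (INR i - INR (S N))))) M.
 { unfold cross. rewrite <- psum_plus. apply psum_ext. intros i _. rewrite <- psum_plus. apply psum_ext. intros j _. unfold TT. ring. }
 rewrite HC. rewrite (psum_window xs), (psum_window (fun y => xs y * xs y)) in H1.
 rewrite (psum_window xc), (psum_window (fun y => xc y * xc y)) in H2.
 have xo : forall n, xc (- INR n - 1) = - xc (INR n).
 { intros n. unfold xc. rewrite <- csch_opp. f_equal. field. }
 rewrite (psum_ext (fun n => xc (INR n) + xc (- INR n - 1)) (fun _ => 0 * 0)), psum_scal in H2 by (intros; rewrite xo; ring).
 rewrite (psum_ext (fun n => xc (INR n) * xc (INR n) + xc (- INR n - 1) * xc (- INR n - 1)) (fun n => 2 * xc (INR n) ^ 2)) in H2 by (intros; rewrite xo; ring).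
 rewrite (psum_plus (fun n => xs (INR n) ^ 2 + xs (- INR n - 1) ^ 2) (fun n => 2 * xc (INR n) ^ 2)). rewrite H1.
 rewrite (psum_ext (fun n => xs (INR n) * xs (INR n) + xs (- INR n - 1) * xs (- INR n - 1)) (fun n => xs (INR n) ^ 2 + xs (- INR n - 1) ^ 2)) by (intros; ring).
 lra.
Qed.

(** The limit of [square_window]: the cross terms are at most a multiple of N^2 r^N. The squares of
    csch appear twice because n and - n - 1 give the same square. *)
Lemma square_identity : ex_series (fun n => xs (INR n) + xs (- INR n - 1)) ->
 ex_series (fun n => (xs (INR n) ^ 2 + xs (- INR n - 1) ^ 2) + 2 * xc (INR n) ^ 2) /\
 Series (fun n => xs (INR n) + xs (- INR n - 1)) * Series (fun n => xs (INR n) + xs (- INR n - 1)) =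
 Series (fun n => (xs (INR n) ^ 2 + xs (- INR n - 1) ^ 2) + 2 * xc (INR n) ^ 2).
Proof.
 intros [l Hl]. have R1 : r < 1 by (unfold r; rewrite <- exp_0; apply exp_increasing; lra). have R0 : 0 < r by apply exp_pos.
 destruct TT_bd as [B [HB HT]].
 rewrite (is_series_unique _ _ Hl).
 change (is_lim_seq (sum_n (fun n => xs (INR n) + xs (- INR n - 1))) l) in Hl.
 have Lsq : is_lim_seq (fun N => sum_n (fun n => xs (INR n) + xs (- INR n - 1)) N * sum_n (fun n => xs (INR n) + xs (- INR n - 1)) N) (l * l).
 { apply (is_lim_seq_mult' _ _ l l); auto. }
 set (K := B * (2 / (1 - r) / (1 - r))).
 have Lc : is_lim_seq (fun N => cross g (fun i => TT (INR i - INR (S N))) (S N + S N)) 0.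
 { apply is_lim_seq_abs_0. apply (is_lim_seq_le_le_loc (fun _ => 0) _ (fun N => (4 * K) * (INR N * INR N * r ^ N))).
  - exists 1%nat. intros N HN. split; [pos|]. etr (cross_small g (2 / (1 - r)) r).
   + pos.
   + pos.
   + apply g_bd.
   + exact HB.
   + pos.
   +         have N1 : 1 <= INR N by (apply (le_INR 1); auto). rewrite plus_INR, S_INR.
    assert (0 <= K * r ^ N) by pos.
    replace (4 * K * (INR N * INR N * r ^ N)) with (4 * (INR N * INR N) * (K * r ^ N)) by ring. apply Rmult_le_compat_r; [auto|nra].
  - apply is_lim_seq_const.
  - replace (Finite 0) with (Rbar_mult (4 * K) 0) by (simpl; f_equal; ring). apply is_lim_seq_scal_l. apply ex_series_lim_0, ex_series_k2. lra. }
 have L3 : is_series (fun n => (xs (INR n) ^ 2 + xs (- INR n - 1) ^ 2) + 2 * xc (INR n) ^ 2) (l * l).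
 { assert (L4 : is_lim_seq (sum_n (fun n => (xs (INR n) ^ 2 + xs (- INR n - 1) ^ 2) + 2 * xc (INR n) ^ 2)) (l * l)); [|pos].
  apply (is_lim_seq_ext (fun N => sum_n (fun n => xs (INR n) + xs (- INR n - 1)) N * sum_n (fun n => xs (INR n) + xs (- INR n - 1)) N - 2 * cross g (fun i => TT (INR i - INR (S N))) (S N + S N))).
  - intros N. rewrite !sum_n_Reals, <- !psum_sum. have Z := square_window N. lra.
  - replace (Finite (l * l)) with (Finite (l * l - 2 * 0)) by (f_equal; ring).
   apply is_lim_seq_minus'; auto. apply (is_lim_seq_scal_l _ 2 0). exact Lc. }
 split; [exists (l * l); exact L3|]. symmetry. apply is_series_unique. exact L3.
Qed.
End SquareIdentity.

(* Real part of [1 / (x + i w)^2]. *)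
Definition RR (x w : R) : R := (x * x - w * w) / ((x * x + w * w) * (x * x + w * w)).
(** A telescoping majorant, of the size of 1 / k^2 and defined at k = 0. *)
Definition inv2 (k : nat) : R := / ((INR k + 1) * (INR k + 2)).

Lemma inv2_ex : ex_series inv2.
Proof.
 exists 1. assert (L : is_lim_seq (sum_n inv2) 1); [|pos].
 apply (is_lim_seq_ext (fun N => 1 - / (INR N + 2))).
 - intros N. rewrite sum_n_Reals. induction N as [|N IH]; [unfold inv2; simpl; field|]. rewrite tech5, <- IH. unfold inv2. rewrite S_INR.
  pose proof (pos_INR N). field. repeat split; lra.
 - replace (Finite 1) with (Finite (1 - 0)) by (f_equal; ring). apply is_lim_seq_minus'; [apply is_lim_seq_const|].
  apply (is_lim_seq_ext (fun N => / (INR (N + 2)))); [intros n; rewrite plus_INR; reflexivity|].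
  apply (is_lim_seq_incr_n (fun N => / INR N) 2). replace (Finite 0) with (Rbar_inv p_infty) by reflexivity.
  apply is_lim_seq_inv; [apply is_lim_seq_INR|discriminate].
Qed.

Lemma RR_bd x w c k : 0 < c -> c <= x * x + w * w -> c * (INR k * INR k) <= w * w -> Rabs (RR x w) <= 8 / c * inv2 k.
Proof.
 intros Hc H1 H2. have N := pos_INR k. have Q : 0 <= w * w by apply Rle_0_sqr. have X : 0 <= x * x by apply Rle_0_sqr.
 apply Rle_trans with (/ (x * x + w * w)).
 - unfold RR, Rdiv. rewrite Rabs_mult. rewrite (Rabs_pos_eq (/ _)) by pos.
  apply Rle_trans with ((x * x + w * w) * / ((x * x + w * w) * (x * x + w * w))); [|right; field; lra].
  apply Rmult_le_compat_r; [pos|]. apply Rabs_le. lra.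
 - unfold inv2. have D : c * ((INR k + 1) * (INR k + 2)) <= 8 * (x * x + w * w) by nra.
    apply Rmult_le_reg_l with (x * x + w * w); [lra|]. rewrite Rinv_r by lra.
  apply Rmult_le_reg_l with (c * ((INR k + 1) * (INR k + 2))); [pos|].
  rewrite Rmult_1_r. eapply Rle_trans; [exact D|]. right. field. split; lra.
Qed.

(** * Partial fractions of csch^2 and sech^2 *)

Section PartialFractions.
Variable x : R.
Hypothesis Hx : 0 < x.

(** Minus the derivative in x of cosh (x (1 - 2 y)) / sinh x. Its cosine coefficients are the values
    [RR x (PI k)], and at y = 0 it equals csch^2 x. *)
Definition ckern (y : R) : R :=
 ((exp (x * (1 - 2 * y)) + exp (- (x * (1 - 2 * y)))) * (exp x + exp (- x)) -
  (1 - 2 * y) * (exp (x * (1 - 2 * y)) - exp (- (x * (1 - 2 * y)))) * (exp x - exp (- x))) / ((exp x - exp (- x)) * (exp x - exp (- x))).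

Lemma sh_pos : 0 < exp x - exp (- x).
Proof. assert (exp (- x) < exp x) by (apply exp_increasing; lra). lra. Qed.

Lemma ckern_cont y : continuous ckern y.
Proof.
 eapply contR_derive. unfold ckern. auto_derive; [|pos]. repeat split; nra.
Qed.

Lemma ckern_sym y : ckern (1 - y) = ckern y.
Proof.
 have S := sh_pos. unfold ckern. replace (1 - 2 * (1 - y)) with (- (1 - 2 * y)) by ring. set (c := 1 - 2 * y).
 replace (- (x * - c)) with (x * c) by ring. replace (x * - c) with (- (x * c)) by ring. field. lra.
Qed.

(* [- d/dx] of the antiderivative of [cosh (x (1 - 2 y)) / sinh x * cos (w y)] *)
Definition ckern_prim (w y : R) : R :=
 let Q := 4 * x * x + w * w in let c := 1 - 2 * y in
 let S := exp (x * c) - exp (- (x * c)) in let Ch := exp (x * c) + exp (- (x * c)) in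
 let s0 := exp x - exp (- x) in let c0 := exp x + exp (- x) in
 let A := - 2 * x / Q in let B := w / Q in let A' := - 2 / Q + 16 * x * x / (Q * Q) in let B' := - 8 * x * w / (Q * Q) in
 - ((A' * S * cos (w * y) + A * c * Ch * cos (w * y) + B' * Ch * sin (w * y) + B * c * S * sin (w * y)) / s0
   - c0 * (A * S * cos (w * y) + B * Ch * sin (w * y)) / (s0 * s0)).

Lemma ckern_prim_der w y : is_derive (ckern_prim w) y (ckern y * cos (w * y)).
Proof.
 have S := sh_pos. have Q : 4 * x * x + w * w <> 0 by nra. unfold ckern_prim, ckern. auto_derive; auto. replace (1 + - (2 * y)) with (1 - 2 * y) by ring.
 set (E1 := exp (x * (1 - 2 * y))). set (E2 := exp (- (x * (1 - 2 * y)))). set (s0 := exp x - exp (- x)) in *. set (c0 := exp x + exp (- x)).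
 field. split; lra.
Qed.

Lemma ckern_cos k : RInt (fun y => ckern y * cos (om k * y)) 0 1 = RR x (PI * INR k).
Proof.
 have S := sh_pos. apply is_RInt_unique. replace (RR x (PI * INR k)) with (minus (ckern_prim (om k) 1) (ckern_prim (om k) 0)).
 - apply (is_RInt_derive (ckern_prim (om k))).
  + intros y _. apply ckern_prim_der.
  + intros y _. apply contR_mult; [apply ckern_cont|cts].
 - unfold minus, plus, opp; simpl. set (w := om k).
  have cw : cos (w * 1) = 1 by (replace (w * 1) with (0 + 2 * INR k * PI) by (unfold w; ring); rewrite cos_period; apply cos_0).
  have sw : sin (w * 1) = 0 by (replace (w * 1) with (0 + 2 * INR k * PI) by (unfold w; ring); rewrite sin_period; apply sin_0).
  unfold ckern_prim. rewrite cw, sw. replace (w * 0) with 0 by ring. rewrite cos_0, sin_0.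
  replace (x * (1 - 2 * 1)) with (- x) by ring. replace (x * (1 - 2 * 0)) with x by ring. rewrite Ropp_involutive.
  unfold RR. replace (PI * INR k) with (w / 2) by (unfold w; field).
  set (e := exp x) in *. set (e' := exp (- x)) in *. field. repeat split; nra.
Qed.

Lemma ckern_sin k : RInt (fun y => ckern y * sin (om k * y)) 0 1 = 0.
Proof.
 set (h := fun y => ckern y * sin (om k * y)).
 have ch : forall y, continuous h y by (intros; apply contR_mult; [apply ckern_cont|apply contR_sin]).
 have hs : forall y, h (1 - y) = - h y.
 { intros y. unfold h. rewrite ckern_sym. replace (om k * (1 - y)) with (- (om k * y) + 2 * INR k * PI) by ring.
  rewrite sin_period, sin_neg. ring. }
 have E := RInt_comp_lin (V := VR) h (-1) 1 0 1. replace (-1 * 0 + 1) with 1 in E by ring. replace (-1 * 1 + 1) with 0 in E by ring.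
 specialize (E (ex_RInt_contR h 1 0 ch)).
 have S : RInt h 1 0 = - RInt h 0 1 by (symmetry; apply (opp_RInt_swap (V := VR) h 0 1), ex_RInt_contR, ch).
 rewrite S in E. rewrite (RInt_ext _ h) in E.
 - lra.
 - intros y _. unfold scal; simpl; unfold mult; simpl. replace (-1 * y + 1) with (1 - y) by ring. rewrite hs. req. ring.
Qed.

(** The periodic extension, continuous at the integers because [ckern] is symmetric about 1/2. *)
Definition cper (y : R) : R := ckern (y - IZR (Int_part y)).

Lemma cper_unit y : 0 <= y < 1 -> cper y = ckern y.
Proof. intros H. unfold cper. rewrite (Int_part_unique y 0) by pos. f_equal. ring. Qed.

Lemma cper_1 y : cper (y + 1) = cper y.
Proof.
 unfold cper. destruct (base_Int_part y) as [A B]. rewrite (Int_part_unique (y + 1) (Int_part y + 1)) by (rewrite plus_IZR; lra).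
 f_equal. rewrite plus_IZR. ring.
Qed.

Lemma cper_cont y : continuous cper y.
Proof.
 apply contR_eps. intros e He. destruct (base_Int_part y) as [A B]. set (n := Int_part y) in *.
 have K := fun z => proj2 (contR_eps ckern z) (ckern_cont z) e He.
 destruct (K (y - IZR n)) as [d1 [Hd1 K1]]. destruct (K 1) as [d2 [Hd2 K2]].
 destruct (Req_dec y (IZR n)) as [E|N].
 - exists (Rmin (Rmin d1 d2) 1). split; [pos|]. intros u Hu.
  have M1 := Rmin_l (Rmin d1 d2) 1. have M2 := Rmin_r (Rmin d1 d2) 1. have M3 := Rmin_l d1 d2. have M4 := Rmin_r d1 d2.
  apply Rabs_def2 in Hu. unfold cper at 2. fold n. destruct (Rle_lt_dec y u).
  + unfold cper. rewrite (Int_part_unique u n) by lra. apply K1. apply Rabs_def1; lra.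
  + unfold cper. rewrite (Int_part_unique u (n - 1)) by (rewrite minus_IZR; lra).
   replace (y - IZR n) with (1 - 1) by lra. rewrite (ckern_sym 1). apply K2. rewrite minus_IZR. apply Rabs_def1; lra.
 - exists (Rmin d1 (Rmin (y - IZR n) (IZR n + 1 - y))). split; [pos|]. intros u Hu.
  have M1 := Rmin_l d1 (Rmin (y - IZR n) (IZR n + 1 - y)). have M2 := Rmin_r d1 (Rmin (y - IZR n) (IZR n + 1 - y)).
  have M3 := Rmin_l (y - IZR n) (IZR n + 1 - y). have M4 := Rmin_r (y - IZR n) (IZR n + 1 - y).
  apply Rabs_def2 in Hu. unfold cper. rewrite (Int_part_unique u n) by lra. apply K1. apply Rabs_def1; lra.
Qed.

Lemma RR_pi_bd k : Rabs (2 * RR x (PI * INR k)) <= 2 * (8 / Rmin (x * x) 1 * inv2 k).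
Proof.
 rewrite Rabs_mult, (Rabs_pos_eq 2) by lra. apply Rmult_le_compat_l; [lra|]. have P := PI2_1. have M1 := Rmin_l (x * x) 1. have M2 := Rmin_r (x * x) 1. have M0 : 0 < Rmin (x * x) 1 by pos.
 have W : 0 <= PI * INR k * (PI * INR k) by apply Rle_0_sqr.
 apply RR_bd; auto; [lra|]. have K : 0 <= INR k * INR k by apply Rle_0_sqr.
 apply Rle_trans with (1 * (INR k * INR k)); [apply Rmult_le_compat_r; auto|].
 replace (PI * INR k * (PI * INR k)) with (PI * PI * (INR k * INR k)) by ring. apply Rmult_le_compat_r; auto. nra.
Qed.

Definition cser (y : R) : R := Series (fun k => 2 * RR x (PI * INR k) * cosk k y).

Lemma cser_term_bd k y : Rabs (2 * RR x (PI * INR k) * cosk k y) <= 2 * (8 / Rmin (x * x) 1 * inv2 k).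
Proof.
 rewrite Rabs_mult. eapply Rle_trans; [apply Rmult_le_compat_l; [pos|apply cosk_abs]|]. rewrite Rmult_1_r. apply RR_pi_bd.
Qed.

Lemma cser_bd_ex : ex_series (fun k => 2 * (8 / Rmin (x * x) 1 * inv2 k)).
Proof. apply ex_series_mul_l, ex_series_mul_l, inv2_ex. Qed.

Lemma cser_cont y : continuous cser y.
Proof.
 apply (cont_Series (fun k y => 2 * RR x (PI * INR k) * cosk k y) (fun k => 2 * (8 / Rmin (x * x) 1 * inv2 k))).
 - intros k z. apply contR_mult; [apply contR_const|cts].
 - apply cser_term_bd.
 - apply cser_bd_ex.
Qed.

Lemma cser_1 y : cser (y + 1) = cser y.
Proof. apply Series_ext. intros k. unfold cosk. rewrite cos_per_nat. reflexivity. Qed.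

Lemma cser_fourier m theta : RInt (fun y => cser y * cos (om m * y - theta)) 0 1 =
 (if Nat.eqb m 0 then 2 else 1) * (RR x (PI * INR m) * cos theta).
Proof.
 have cc : forall k s, continuous (fun y : R => 2 * RR x (PI * INR k) * (cosk k y * cos (om m * y - theta))) s.
 { intros k s. apply contR_mult; [cts|apply contR_mult; [cts|apply (cont_cos_affine _ (- theta))]]. }
 destruct (RInt_Series (fun k y => 2 * RR x (PI * INR k) * (cosk k y * cos (om m * y - theta))) (fun k => 2 * (8 / Rmin (x * x) 1 * inv2 k))) as [_ E].
 - pos.
 - intros k y. rewrite (Rabs_mult (2 * RR x (PI * INR k))). eapply Rle_trans; [apply Rmult_le_compat_l; [pos|]|rewrite Rmult_1_r; apply RR_pi_bd].
  rewrite Rabs_mult, <- (Rmult_1_r 1). apply Rmult_le_compat; try apply Rabs_pos; [apply cosk_abs|apply Rabs_le, COS_bound].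
 - apply cser_bd_ex.
 - transitivity (RInt (fun y => Series (fun k => 2 * RR x (PI * INR k) * (cosk k y * cos (om m * y - theta)))) 0 1).
  { apply RInt_ext. intros y _. req. unfold cser. rewrite <- Series_scal_r. apply Series_ext. intros k. ring. }
  etransitivity; [exact E|].
  transitivity (Series (fun k => if Nat.eqb k m then (if Nat.eqb m 0 then 2 else 1) * (RR x (PI * INR k) * cos theta) else 0)); [|apply Series_single].
  apply Series_ext. intros k.
  etransitivity; [apply (RInt_mulR (2 * RR x (PI * INR k)) (fun y => cosk k y * cos (om m * y - theta))); apply ex_RInt_contR; intros; apply contR_mult; [cts|apply (cont_cos_affine _ (- theta))]|].
  req. destruct (Nat.eqb_spec m 0) as [-> | Nm].
  + rewrite (RInt_ext _ (fun y => cos theta * cosk k y)).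
   2: { intros y _. req. simpl INR. replace (2 * PI * 0 * y - theta) with (- theta) by ring. rewrite cos_neg. ring. }
   rewrite RInt_mulR by cts.
   destruct (Nat.eqb_spec k 0) as [-> | Nk].
   * rewrite (RInt_ext _ (fun _ => 1)); [|intros y _; req; unfold cosk; simpl INR; rewrite Rmult_0_r, Rmult_0_l; apply cos_0].
    rewrite RInt_const. unfold scal; simpl; unfold mult; simpl. ring.
   * rewrite (RInt_ext _ (fun y => cos (om k * y + 0))); [|intros y _; req; unfold cosk; f_equal; ring].
    rewrite RInt_cos_freq by lia. ring.
  + have F := RInt_cosk_cos k m 0 theta ltac:(lia).
   rewrite (RInt_ext _ (fun y => cosk k y * cos (om m * y - theta))) in F by (intros; rewrite Rminus_0_r; reflexivity).
   rewrite F. destruct (Nat.eqb_spec k m) as [-> | _]; [|ring].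
   replace (om m * 0 - theta) with (- theta) by ring. rewrite cos_neg. field.
Qed.

(** The sum of 1 / (x + i PI k)^2 over all integers k, in real form. The cosine series and the
    periodic kernel have the same Fourier coefficients, hence agree at y = 0; the series counts the
    term k = 0 twice. *)
Lemma csch_partial : csch x * csch x = Series (fun k => 2 * RR x (PI * INR k)) - RR x 0.
Proof.
 have S := sh_pos. set (phi := fun y => cser y - RR x 0 - cper y).
 have cphi : forall y, continuous phi y.
 { intros y. apply contR_minus; [apply contR_minus; [apply cser_cont|cts]|apply cper_cont]. }
 have Fc : forall m theta v, RInt (fun y => ckern y * cos (om m * y - theta)) 0 1 = v ->
   RInt (fun y => phi y * cos (om m * y - theta)) 0 1 = (if Nat.eqb m 0 then 2 else 1) * (RR x (PI * INR m) * cos theta) - (if Nat.eqb m 0 then RR x 0 * cos theta else 0) - v.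
 { intros m theta v Hv. have cT : forall y : R, continuous (fun y : R => cos (om m * y - theta)) y by (intros; apply (cont_cos_affine _ (- theta))).
  rewrite <- (cser_fourier m theta), <- Hv.
  have I0 : RInt (fun y => cos (om m * y - theta)) 0 1 = if Nat.eqb m 0 then cos theta else 0.
  { destruct (Nat.eqb_spec m 0) as [-> | Nm].
   - rewrite (RInt_ext _ (fun _ => cos theta)).
    + rewrite RInt_const. unfold scal; simpl; unfold mult; simpl. ring.
    + intros y _. simpl INR. replace (2 * PI * 0 * y - theta) with (- theta) by ring. apply cos_neg.
   - apply (RInt_cos_freq m (- theta)). lia. }
  have c1 : forall y, continuous (fun y : R => cser y * cos (om m * y - theta)) y by (intros; apply contR_mult; [apply cser_cont|auto]).
  have c2 : forall y, continuous (fun y : R => ckern y * cos (om m * y - theta)) y by (intros; apply contR_mult; [apply ckern_cont|auto]).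
  have L := RInt_lin3 1 (- RR x 0) (-1) _ _ _ c1 cT c2. rewrite I0 in L.
  transitivity (RInt (fun y => 1 * (cser y * cos (om m * y - theta)) + - RR x 0 * cos (om m * y - theta) + -1 * (ckern y * cos (om m * y - theta))) 0 1).
  - apply RInt_ext. intros y Hy. req. rewrite Rmin_left, Rmax_right in Hy by lra. unfold phi. rewrite cper_unit by lra. ring.
  - rewrite L. destruct (Nat.eqb m 0); req; ring. }
 have Z : phi 0 = 0.
 { apply (fourier_unique phi cphi).
  - intros y. unfold phi. rewrite cser_1, cper_1. reflexivity.
  - intros k. unfold fcos. transitivity (RInt (fun y => phi y * cos (om k * y - 0)) 0 1).
   { apply RInt_ext. intros; rewrite Rminus_0_r; reflexivity. }
   rewrite (Fc k 0 (RR x (PI * INR k))).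
   + rewrite cos_0. destruct (Nat.eqb_spec k 0) as [-> | N]; simpl INR; rewrite ?Rmult_0_r; ring.
   + rewrite <- ckern_cos. apply RInt_ext. intros; rewrite Rminus_0_r; reflexivity.
  - pos. have sc : forall z, sin z = cos (z - PI / 2) by (intros z; rewrite cos_minus, cos_PI2, sin_PI2; ring).
   transitivity (RInt (fun y => phi y * cos (om k * y - PI / 2)) 0 1).
   { apply RInt_ext. intros; rewrite sc; reflexivity. }
   rewrite (Fc k (PI / 2) 0).
   + rewrite cos_PI2. destruct (Nat.eqb k 0); ring.
   + etransitivity; [|exact (ckern_sin k)]. apply RInt_ext. intros; rewrite sc; reflexivity. }
 unfold phi in Z. rewrite cper_unit in Z by lra.
 have C0 : ckern 0 = csch x * csch x.
 { unfold ckern, csch. replace (x * (1 - 2 * 0)) with x by ring. have U : exp x * exp (- x) = 1 by (rewrite <- exp_plus, Rplus_opp_r; apply exp_0).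
  set (a := exp x) in *. set (b := exp (- x)) in *. transitivity (4 * (a * b) / ((a - b) * (a - b))); [pos|]. rewrite U. field. lra. }
 rewrite C0 in Z. unfold cser in Z.
 rewrite (Series_ext (fun k => 2 * RR x (PI * INR k) * cosk k 0) (fun k => 2 * RR x (PI * INR k))) in Z.
 - lra.
 - intros k. unfold cosk. rewrite Rmult_0_r, cos_0. ring.
Qed.
End PartialFractions.

Lemma Series_pairs (c : nat -> R) : ex_series c -> is_series (fun n => c (2 * n)%nat + c (2 * n + 1)%nat) (Series c).
Proof.
 intros H. assert (L : is_lim_seq (sum_n (fun n => c (2 * n)%nat + c (2 * n + 1)%nat)) (Series c)); [|exact L].
 have SC : is_lim_seq (sum_n c) (Series c) by (apply (Series_correct c H)).
 apply (is_lim_seq_ext (fun N => sum_n c (2 * N + 1))).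
 - intros N. rewrite !sum_n_Reals. induction N as [|N IH]; [simpl; ring|]. rewrite (tech5 _ N), <- IH.
  replace (2 * S N + 1)%nat with (S (S (2 * N + 1))) by lia. rewrite !tech5. replace (S (2 * N + 1)) with (2 * S N)%nat by lia.
  replace (S (2 * S N)) with (2 * S N + 1)%nat by lia. ring.
 - apply (is_lim_seq_subseq (sum_n c) (Series c) (fun N => (2 * N + 1)%nat)); auto. intros P [N0 HN]. exists N0. intros n Hn. apply HN. lia.
Qed.

Lemma RR_even x w : RR (- x) w = RR x w.
Proof. unfold RR. replace (- x * - x) with (x * x) by ring. reflexivity. Qed.

Lemma RR_even_w x w : RR x (- w) = RR x w.
Proof. unfold RR. replace (- w * - w) with (w * w) by ring. reflexivity. Qed.

Lemma RR_scale a x w : 0 < a -> RR x w = a * a * RR (a * x) (a * w).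
Proof.
 intros Ha. unfold RR. replace (a * x * (a * x)) with (a * a * (x * x)) by ring. replace (a * w * (a * w)) with (a * a * (w * w)) by ring.
 destruct (Req_dec (x * x + w * w) 0) as [E|N].
 - assert (0 <= x * x) by apply Rle_0_sqr. assert (0 <= w * w) by apply Rle_0_sqr. replace (x * x) with 0 by lra. replace (w * w) with 0 by lra.
  unfold Rdiv. ring.
 - field. repeat split; auto; try lra.
  intro K. replace (a * a * (x * x) + a * a * (w * w)) with (a * a * (x * x + w * w)) in K by ring. apply Rmult_integral in K. destruct K; [nra|auto].
Qed.

Lemma RR_pi_ex x : 0 < x -> ex_series (fun k => 2 * RR x (PI * INR k)).
Proof. intros Hx. apply (Rabs_Series_le _ (fun k => 2 * (8 / Rmin (x * x) 1 * inv2 k))); [apply RR_pi_bd; auto|apply cser_bd_ex]. Qed.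

(** The half-integers are all the multiples of 1/2 less the integers, and 4 csch^2 (2 x) - csch^2 x
    = - sech^2 x. *)
Lemma sch_partial x : 0 < x -> ex_series (fun n => 2 * RR x (PI * (INR n + / 2))) /\ Series (fun n => 2 * RR x (PI * (INR n + / 2))) = - (sch x * sch x).
Proof.
 intros Hx. have E2 := RR_pi_ex (2 * x) arith. have E1 := RR_pi_ex x Hx.
 set (c := fun k => 2 * RR x (PI * (INR k / 2))).
 have cE : forall k, c k = 4 * (2 * RR (2 * x) (PI * INR k)).
 { intros k. unfold c. rewrite (RR_scale 2 x) by lra. replace (2 * (PI * (INR k / 2))) with (PI * INR k) by field. ring. }
 have Ec : ex_series c by (apply (ex_series_ext (fun k => 4 * (2 * RR (2 * x) (PI * INR k)))); [intros; rewrite cE; reflexivity|apply ex_series_mul_l; auto]).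
 have Sc : Series c = 4 * (csch (2 * x) * csch (2 * x) + RR (2 * x) 0).
 { rewrite (Series_ext c _ cE), Series_scal_l. rewrite (csch_partial (2 * x)) by lra. ring. }
 have P := Series_pairs c Ec.
 have ec : forall n, c (2 * n)%nat = 2 * RR x (PI * INR n).
 { intros n. unfold c. rewrite mult_INR. do 3 f_equal. simpl (INR 2). field. }
 have oc : forall n, c (2 * n + 1)%nat = 2 * RR x (PI * (INR n + / 2)).
 { intros n. unfold c. rewrite plus_INR, mult_INR. do 3 f_equal. simpl (INR 2). simpl (INR 1). field. }
 have Q : is_series (fun n => 2 * RR x (PI * (INR n + / 2))) (Series c - Series (fun k => 2 * RR x (PI * INR k))).
 { apply (is_series_ext (fun n => (c (2 * n)%nat + c (2 * n + 1)%nat) - 2 * RR x (PI * INR n))).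
  - intros n. rewrite ec, oc. req. ring.
  - apply (is_series_minus (K := R_AbsRing) (V := R_NormedModule) _ _ (Series c) _ P), (Series_correct _ E1). }
 split; [exists (Series c - Series (fun k => 2 * RR x (PI * INR k))); exact Q|].
 rewrite (is_series_unique _ _ Q), Sc. have Z := csch_partial x Hx.
 replace (Series (fun k => 2 * RR x (PI * INR k))) with (csch x * csch x + RR x 0) by lra.
 rewrite (RR_scale 2 x 0) by lra. replace (2 * 0) with 0 by ring.
 have D := sh_pos x Hx. have D2 := sch_den x. unfold csch, sch.
 replace (exp (2 * x)) with (exp x * exp x) by (rewrite <- exp_plus; f_equal; ring).
 replace (exp (- (2 * x))) with (exp (- x) * exp (- x)) by (rewrite <- exp_plus; f_equal; ring).
 have U : exp x * exp (- x) = 1 by (rewrite <- exp_plus, Rplus_opp_r; apply exp_0).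
 set (a := exp x) in *. set (b := exp (- x)) in *.
 replace (a * a - b * b) with ((a - b) * (a + b)) by ring.
 transitivity ((16 - 4 * (a + b) * (a + b)) / ((a - b) * (a - b) * ((a + b) * (a + b)))); [field; lra|].
 replace 16 with (16 * (a * b)) by (rewrite U; ring). field. lra.
Qed.

(** * Summing the Weierstrass function along the columns of the lattice *)

Section Columns.
Variable t : R.
Hypothesis Ht : 0 < t.
Let al := PI / t.

(** The real part of the sum of (X + i y + b tau)^(-2) over all integers b. The inner sums of [wp]
    are differences of such columns. *)
Definition Qcol (X y : R) : R := Series (fun k => RR X (y + INR k * t)) + Series (fun k => RR X (y + (- INR k - 1) * t)).

Lemma al_p : 0 < al.
Proof. apply Rdiv_lt_0_compat; auto. apply PI_RGT_0. Qed.

Lemma RR_al X j : RR X (j * t) = al * al / 2 * (2 * RR (al * X) (PI * j)).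
Proof. rewrite (RR_scale al) by apply al_p. replace (al * (j * t)) with (PI * j) by (unfold al; field; lra). field. Qed.

Definition colsum (X y v : R) : Prop :=
 (ex_series (fun k => RR X (y + INR k * t)) /\ ex_series (fun k => RR X (y + (- INR k - 1) * t))) /\ Qcol X y = v.

Lemma colsum_sign y v : (forall X, 0 < X -> colsum X y (v X)) -> (forall X, v (- X) = v X) -> forall X, X <> 0 -> colsum X y (v X).
Proof.
 intros Pos Hv X HX. destruct (Rlt_le_dec 0 X); [auto|]. destruct (Pos (- X) arith) as [[P1 P2] P3].
 rewrite Hv in P3. split; [split|].
 - apply (ex_series_ext _ _ (fun k => RR_even X (y + INR k * t))), P1.
 - apply (ex_series_ext _ _ (fun k => RR_even X (y + (- INR k - 1) * t))), P2.
 - rewrite <- P3. unfold Qcol. f_equal; apply Series_ext; intros; symmetry; apply RR_even.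
Qed.

Lemma Qcol_0 X : X <> 0 -> colsum X 0 (al * al * (csch (al * X) * csch (al * X))).
Proof.
 have A := al_p. revert X. apply (colsum_sign 0 (fun X => al * al * (csch (al * X) * csch (al * X)))); intros X.
 2: { replace (al * - X) with (- (al * X)) by ring. rewrite csch_opp. ring. }
 intros HX. have aX : 0 < al * X by (apply Rmult_lt_0_compat; auto).
 have E : forall k, RR X (0 + INR k * t) = al * al / 2 * (2 * RR (al * X) (PI * INR k)) by (intros k; rewrite Rplus_0_l; apply RR_al).
 have E' : forall k, RR X (0 + (- INR k - 1) * t) = RR X (0 + INR (S k) * t).
 { intros k. rewrite <- RR_even_w. f_equal. rewrite S_INR. ring. }
 have X1 : ex_series (fun k => RR X (0 + INR k * t)).
 { apply (ex_series_ext (fun k => al * al / 2 * (2 * RR (al * X) (PI * INR k)))); [intros; rewrite E; reflexivity|apply ex_series_mul_l, RR_pi_ex; auto]. }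
 have X2 : ex_series (fun k => RR X (0 + (- INR k - 1) * t)).
 { apply (ex_series_ext (fun k => RR X (0 + INR (S k) * t))); [intros; rewrite E'; reflexivity|]. apply (ex_series_incr_1 (fun k => RR X (0 + INR k * t))), X1. }
 split; [split; auto|]. unfold Qcol. rewrite (Series_ext _ _ E'). have I := Series_incr_1 _ X1. rewrite (Series_ext _ _ E), Series_scal_l in I.
 rewrite (Series_ext _ _ E), Series_scal_l. rewrite (csch_partial (al * X) aX) .
 have R0 : RR X (0 + INR 0 * t) = al * al * RR (al * X) 0.
 { simpl INR. replace (0 + 0 * t) with 0 by ring. rewrite (RR_scale al) by auto. f_equal. f_equal. ring. }
 rewrite R0 in I. lra.
Qed.

Lemma sch_opp x : sch (- x) = sch x.
Proof. unfold sch. rewrite Ropp_involutive, Rplus_comm. reflexivity. Qed.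

Lemma Qcol_half X : X <> 0 -> colsum X (t / 2) (- (al * al * (sch (al * X) * sch (al * X)))).
Proof.
 have A := al_p. revert X. apply (colsum_sign (t / 2) (fun X => - (al * al * (sch (al * X) * sch (al * X))))); intros X.
 2: { replace (al * - X) with (- (al * X)) by ring. rewrite sch_opp. ring. }
 intros HX. have aX : 0 < al * X by (apply Rmult_lt_0_compat; auto). destruct (sch_partial _ aX) as [S1 S2].
 have E : forall k, RR X (t / 2 + INR k * t) = al * al / 2 * (2 * RR (al * X) (PI * (INR k + / 2))).
 { intros k. rewrite <- RR_al. f_equal. field. }
 have E' : forall k, RR X (t / 2 + (- INR k - 1) * t) = al * al / 2 * (2 * RR (al * X) (PI * (INR k + / 2))).
 { intros k. rewrite <- RR_al, <- RR_even_w. f_equal. field. }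
 have EX : ex_series (fun k => al * al / 2 * (2 * RR (al * X) (PI * (INR k + / 2)))) by (apply ex_series_mul_l; auto).
 split; [split|].
 - apply (ex_series_ext (fun k => al * al / 2 * (2 * RR (al * X) (PI * (INR k + / 2))))); [intros; rewrite E; reflexivity|auto].
 - apply (ex_series_ext (fun k => al * al / 2 * (2 * RR (al * X) (PI * (INR k + / 2))))); [intros; rewrite E'; reflexivity|auto].
 - unfold Qcol. rewrite (Series_ext _ _ E), (Series_ext _ _ E'), Series_scal_l, S2. field.
Qed.

(** The column through the origin needs convergence only; its value cancels between the two values
    of [wp] in [density_eq]. *)
Lemma Qcol_00 : ex_series (fun k => RR 0 (0 + INR k * t)) /\ ex_series (fun k => RR 0 (0 + (- INR k - 1) * t)).
Proof.
 have TT : 0 < t * t by (apply Rmult_lt_0_compat; auto).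
 have X1 : ex_series (fun k => RR 0 (0 + INR k * t)).
 { apply (Rabs_Series_le _ (fun k => 8 / (t * t) * inv2 k)); [|apply ex_series_mul_l, inv2_ex]. intros k. destruct k as [|k].
  - simpl INR. unfold RR, Rdiv. replace (0 * 0 - (0 + 0 * t) * (0 + 0 * t)) with 0 by ring. rewrite Rmult_0_l, Rabs_R0.
   unfold inv2. simpl INR. assert (0 < / ((0 + 1) * (0 + 2))) by (apply Rinv_0_lt_compat; lra). assert (0 < / (t * t)) by (apply Rinv_0_lt_compat; auto). nra.
  - have N : 1 <= INR (S k) by (rewrite S_INR; pose proof (pos_INR k); lra). apply RR_bd; auto.
   + replace (0 * 0 + (0 + INR (S k) * t) * (0 + INR (S k) * t)) with (t * t * (INR (S k) * INR (S k))) by ring.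
    rewrite <- (Rmult_1_r (t * t)) at 1. apply Rmult_le_compat_l; nra.
   + right. ring. }
 split; auto. apply (ex_series_ext (fun k => RR 0 (0 + INR (S k) * t))).
 - intros k. rewrite <- RR_even_w. f_equal. rewrite S_INR. ring.
 - apply (ex_series_incr_1 (fun k => RR 0 (0 + INR k * t))), X1.
Qed.

Lemma latpt_eq a b : latpt t a b = (IZR a, IZR b * t).
Proof. unfold latpt, tauC, RtoC, Cplus, Cmult; simpl. f_equal; ring. Qed.

Lemma Re_inv_sqr u v : Re (Cinv (Cmult (u, v) (u, v)))%C = RR u v.
Proof. unfold RR, Cinv, Cmult, Re; simpl. f_equal. ring. Qed.

Lemma Re_wp_term px py a b : ~ (a = 0 /\ b = 0)%Z -> Re (wp_term t (px, py) a b)%C = RR (px + IZR a) (py + IZR b * t) - RR (IZR a) (0 + IZR b * t).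
Proof.
 intros N. unfold wp_term. destruct (Z.eqb_spec a 0); destruct (Z.eqb_spec b 0); simpl andb; cbv iota; try tauto;
 rewrite latpt_eq, Rplus_0_l, <- !Re_inv_sqr; reflexivity.
Qed.

Lemma zcol k : IZR (- Z.of_nat k - 1) = - INR k - 1.
Proof. rewrite minus_IZR, opp_IZR, <- INR_IZR_INZ. reflexivity. Qed.

Variables px py : R.
Hypothesis Hpx : forall a : Z, px + IZR a <> 0.
Hypothesis Hcol : forall a : Z, ex_series (fun k => RR (px + IZR a) (py + INR k * t)) /\ ex_series (fun k => RR (px + IZR a) (py + (- INR k - 1) * t)).

Definition Ecol (a : Z) : R := Qcol (px + IZR a) py - Qcol (IZR a) 0.

Lemma Q0_ex (a : Z) : ex_series (fun k => RR (IZR a) (0 + INR k * t)) /\ ex_series (fun k => RR (IZR a) (0 + (- INR k - 1) * t)).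
Proof.
 destruct (Z.eq_dec a 0) as [-> | N]; [apply Qcol_00|]. apply Qcol_0. apply not_0_IZR, N.
Qed.

(** For a = 0 the term of the lattice point 0 is missing; the summand p^(-2) of [wp] supplies it in
    [Re_wp]. *)
Lemma inner_sum (a : Z) : Re (csum_Z (fun b => wp_term t (px, py) a b))%C = Ecol a - (if Z.eqb a 0 then RR px py else 0).
Proof.
 change (Series (fun k => Re (wp_term t (px, py) a (Z.of_nat k))%C) + Series (fun k => Re (wp_term t (px, py) a (- Z.of_nat k - 1))%C) = Ecol a - (if Z.eqb a 0 then RR px py else 0)).
 destruct (Hcol a) as [H1 H2]. destruct (Q0_ex a) as [G1 G2].
 rewrite (Series_ext (fun k => Re (wp_term t (px, py) a (- Z.of_nat k - 1))%C) (fun k => RR (px + IZR a) (py + (- INR k - 1) * t) - RR (IZR a) (0 + (- INR k - 1) * t))).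
 2: { intros k. rewrite Re_wp_term by lia. rewrite zcol. reflexivity. }
 rewrite Series_minus by auto. unfold Ecol, Qcol.
 destruct (Z.eqb_spec a 0) as [-> | N].
 - have EX : ex_series (fun k => Re (wp_term t (px, py) 0 (Z.of_nat k))%C).
  { apply (ex_series_incr_1 (fun k => Re (wp_term t (px, py) 0 (Z.of_nat k))%C)).
   apply (ex_series_ext (fun k => RR (px + 0) (py + INR (S k) * t) - RR 0 (0 + INR (S k) * t))).
   - intros k. rewrite Re_wp_term by lia. rewrite <- INR_IZR_INZ. reflexivity.
   - apply (ex_series_minus (K := R_AbsRing) (V := R_NormedModule) (fun k => RR (px + 0) (py + INR (S k) * t))).
    + apply (ex_series_incr_1 (fun k => RR (px + 0) (py + INR k * t))), H1.
    + apply (ex_series_incr_1 (fun k => RR 0 (0 + INR k * t))), G1. }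
  rewrite (Series_incr_1 _ EX). rewrite (Series_incr_1 _ H1), (Series_incr_1 _ G1).
  rewrite (Series_ext (fun k => Re (wp_term t (px, py) 0 (Z.of_nat (S k)))%C) (fun k => RR (px + 0) (py + INR (S k) * t) - RR 0 (0 + INR (S k) * t))).
  2: { intros k. rewrite Re_wp_term by lia. rewrite <- INR_IZR_INZ. reflexivity. }
  rewrite Series_minus.
  2: { apply (ex_series_incr_1 (fun k => RR (px + 0) (py + INR k * t))), H1. }
  2: { apply (ex_series_incr_1 (fun k => RR 0 (0 + INR k * t))), G1. }
  have T0 : Re (wp_term t (px, py) 0 (Z.of_nat 0))%C = 0 by reflexivity. rewrite T0.
  (* The numerator of [RR 0 0] is 0, so the full column may include the origin at no cost. *)
  have R00 : RR 0 (0 + INR 0 * t) = 0 by (simpl INR; unfold RR, Rdiv; ring). rewrite R00.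
  have Rp : RR (px + 0) (py + INR 0 * t) = RR px py by (simpl INR; f_equal; ring). rewrite Rp. ring.
 - rewrite (Series_ext (fun k => Re (wp_term t (px, py) a (Z.of_nat k))%C) (fun k => RR (px + IZR a) (py + INR k * t) - RR (IZR a) (0 + INR k * t))).
  2: { intros k. rewrite Re_wp_term by tauto. rewrite <- INR_IZR_INZ. reflexivity. }
  rewrite Series_minus by auto. ring.
Qed.

Lemma Re_wp : ex_series (fun k => Ecol (Z.of_nat k)) ->
 Re (wp t (px, py))%C = Series (fun k => Ecol (Z.of_nat k)) + Series (fun k => Ecol (- Z.of_nat k - 1)).
Proof.
 intros EX.
 have W : Re (wp t (px, py))%C = RR px py + (Series (fun k => Re (csum_Z (fun b => wp_term t (px, py) (Z.of_nat k) b))%C) + Series (fun k => Re (csum_Z (fun b => wp_term t (px, py) (- Z.of_nat k - 1) b))%C)).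
 { rewrite <- Re_inv_sqr. reflexivity. }
 rewrite W.
 rewrite (Series_ext (fun k => Re (csum_Z (fun b => wp_term t (px, py) (- Z.of_nat k - 1) b))%C) (fun k => Ecol (- Z.of_nat k - 1))).
 2: { intros k. rewrite inner_sum. destruct (Z.eqb_spec (- Z.of_nat k - 1) 0); [lia|ring]. }
 have IS : forall k, Re (csum_Z (fun b => wp_term t (px, py) (Z.of_nat (S k)) b))%C = Ecol (Z.of_nat (S k)).
 { intros k. rewrite inner_sum. destruct (Z.eqb_spec (Z.of_nat (S k)) 0); [lia|ring]. }
 have E2 := proj1 (ex_series_incr_1 _) EX.
 have EX2 : ex_series (fun k => Re (csum_Z (fun b => wp_term t (px, py) (Z.of_nat k) b))%C).
 { apply (ex_series_incr_1 (fun k => Re (csum_Z (fun b => wp_term t (px, py) (Z.of_nat k) b))%C)).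
  apply (ex_series_ext (fun k => Ecol (Z.of_nat (S k)))); [intros; symmetry; apply IS|exact E2]. }
 rewrite (Series_incr_1 _ EX2), (Series_incr_1 _ EX), (Series_ext _ _ IS), inner_sum. simpl Z.of_nat. simpl Z.eqb. cbv iota. ring.
Qed.
End Columns.

(** At 1/2 the columns are csch^2 at the half-integers, on gamma they are - sech^2; their difference
    is the right side of [square_identity]. For s = 0 a column would pass through the point itself,
    where the formulas fail. *)
Lemma density_eq t s : 0 < t -> 0 < s < 1 ->
 Re (wp t (RtoC (1 / 2)))%C - Re (wp t (gam t s)) = (PI * dens t s) * (PI * dens t s).
Proof.
 intros Ht Hs. set (a := PI / t). have Ha : 0 < a by (apply (al_p t Ht)).
 have sn : forall z : Z, s + IZR z <> 0.
 { intros z K. assert (-1 < z < 0)%Z by (split; apply lt_IZR; lra). lia. }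
 have hn : forall z : Z, / 2 + IZR z <> 0.
 { intros z K. have E : IZR (2 * z) = IZR (-1) by (rewrite mult_IZR; lra). apply eq_IZR in E. lia. }
 destruct (square_identity a Ha s arith (dens_ex t Ht s)) as [SX SI].
 set (xs := fun y => sch (a * (s + y))) in *. set (xc := fun y => csch (a * (/ 2 + y))) in *.
 set (S2 := fun n => xs (INR n) ^ 2 + xs (- INR n - 1) ^ 2 + 2 * xc (INR n) ^ 2) in *. set (S1 := Series (fun n => xs (INR n) + xs (- INR n - 1))).
 change (S1 * S1 = Series S2) in SI.
 have sub : forall u, (forall n, 0 <= u n <= S2 n) -> ex_series (fun n => a * a * u n).
 { intros u Hu. apply ex_series_mul_l, (Rabs_Series_le u S2); auto. intros n. rewrite Rabs_pos_eq; apply Hu. }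
 have sq := fun n => conj (pow2_ge_0 (xs (INR n))) (conj (pow2_ge_0 (xs (- INR n - 1))) (pow2_ge_0 (xc (INR n)))).
 assert (ex_series (fun n => a * a * xs (INR n) ^ 2) /\ ex_series (fun n => a * a * xs (- INR n - 1) ^ 2) /\ ex_series (fun n => a * a * xc (INR n) ^ 2))
  as [u1 [u2 u3]] by (repeat split; apply sub; intros n; specialize (sq n); unfold S2; lra).
 have q0 : forall k, Qcol t (IZR (Z.of_nat (S k))) 0 = a * a * csch (a * INR (S k)) ^ 2.
 { intros k. rewrite <- INR_IZR_INZ. destruct (Qcol_0 t Ht (INR (S k))) as [_ Q]; [apply not_0_INR; lia|]. rewrite Q. fold a. ring. }
 have q1 : forall k, Qcol t (IZR (- Z.of_nat k - 1)) 0 = a * a * csch (a * INR (S k)) ^ 2.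
 { intros k. rewrite zcol. replace (- INR k - 1) with (- INR (S k)) by (rewrite S_INR; ring).
  destruct (Qcol_0 t Ht (- INR (S k))) as [_ Q]; [apply Ropp_neq_0_compat, not_0_INR; lia|]. rewrite Q. fold a.
  replace (a * - INR (S k)) with (- (a * INR (S k))) by ring. rewrite csch_opp. ring. }
 have r1 : 0 < exp (- a) < 1 by (split; [apply exp_pos|rewrite <- exp_0; apply exp_increasing; lra]).
 have u4 : ex_series (fun k => a * a * csch (a * INR (S k)) ^ 2).
 { apply ex_series_mul_l. apply (Rabs_Series_le _ (fun k => (2 / (1 - exp (- a))) ^ 2 * exp (- a) ^ k)); [|apply ex_series_mul_l, ex_series_geom, Rabs_def1; lra].
  intros k. rewrite Rabs_pos_eq by apply pow2_ge_0. have B := g_bd a Ha k. set (c0 := 2 / (1 - exp (- a))) in *. set (r := exp (- a)) in *.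
  have rk0 : 0 < r ^ k by (apply pow_lt; lra). have rk1 := pow_lt1 r (S k) r1 ltac:(lia). have rk2 : r ^ k <= 1 by (rewrite <- (pow1 k); apply pow_incr; lra).
  have c0p : 0 < c0 by (apply Rdiv_lt_0_compat; lra).
  apply Rle_trans with ((c0 * r ^ S k) ^ 2); [apply pow_incr; lra|]. replace ((c0 * r ^ S k) ^ 2) with (c0 ^ 2 * (r * r * (r ^ k * r ^ k))) by (simpl; ring).
  apply Rmult_le_compat_l; [apply pow2_ge_0|]. assert (r * r <= 1) by nra. assert (r ^ k * r ^ k <= r ^ k) by nra. nra. }
 have xo : forall n, xc (- INR n - 1) ^ 2 = xc (INR n) ^ 2.
 { intros n. unfold xc. replace (a * (/ 2 + (- INR n - 1))) with (- (a * (/ 2 + INR n))) by field. rewrite csch_opp. ring. }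
 (* The column of lattice points through 0, left unevaluated. *)
 set (K0 := Qcol t (IZR (Z.of_nat 0)) 0).
 have Gen : forall px py (v : Z -> R), (forall z : Z, px + IZR z <> 0) ->
  (forall z : Z, (ex_series (fun k => RR (px + IZR z) (py + INR k * t)) /\ ex_series (fun k => RR (px + IZR z) (py + (- INR k - 1) * t))) /\ Qcol t (px + IZR z) py = v z) ->
  ex_series (fun k => v (Z.of_nat k)) -> ex_series (fun k => v (- Z.of_nat k - 1)%Z) ->
  Re (wp t (px, py))%C = Series (fun k => v (Z.of_nat k)) + Series (fun k => v (- Z.of_nat k - 1)%Z) - (K0 + 2 * Series (fun k => a * a * csch (a * INR (S k)) ^ 2)).
 { intros px py v Hp Hv V1 V2.
  have Q0X : ex_series (fun k => Qcol t (IZR (Z.of_nat k)) 0).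
  { apply (ex_series_incr_1 (fun k => Qcol t (IZR (Z.of_nat k)) 0)). apply (ex_series_ext (fun k => a * a * csch (a * INR (S k)) ^ 2)); [intros; symmetry; apply q0|auto]. }
  have EE : forall z, Ecol t px py z = v z - Qcol t (IZR z) 0 by (intros z; unfold Ecol; rewrite (proj2 (Hv z)); reflexivity).
  rewrite (Re_wp t Ht px py (fun z => proj1 (Hv z))).
  - rewrite (Series_ext _ _ (fun k => EE (Z.of_nat k))), (Series_ext _ _ (fun k => EE (- Z.of_nat k - 1)%Z)).
   rewrite (Series_ext (fun k => v (- Z.of_nat k - 1)%Z - Qcol t (IZR (- Z.of_nat k - 1)) 0) (fun k => v (- Z.of_nat k - 1)%Z - a * a * csch (a * INR (S k)) ^ 2)) by (intros; rewrite q1; reflexivity).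
   rewrite !Series_minus by auto. rewrite (Series_incr_1 _ Q0X), (Series_ext _ _ q0). fold K0. ring.
  - apply (ex_series_ext (fun k => v (Z.of_nat k) - Qcol t (IZR (Z.of_nat k)) 0)); [intros; symmetry; apply EE|].
   apply (ex_series_minus (K := R_AbsRing) (V := R_NormedModule) (fun k => v (Z.of_nat k))); auto. }
 have W1 := Gen (/ 2) 0 (fun z => a * a * xc (IZR z) ^ 2) hn.
 have W2 := Gen s (t / 2) (fun z => - (a * a * xs (IZR z) ^ 2)) sn.
 replace (RtoC (1 / 2)) with ((/ 2, 0) : C) by (unfold RtoC; f_equal; field). rewrite gam_eq.
 assert (Zi : forall (F : R -> R), (forall k, F (INR k) = F (IZR (Z.of_nat k))) /\ forall k, F (- INR k - 1) = F (IZR (- Z.of_nat k - 1)))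
  by (split; intros; rewrite ?zcol, <- ?INR_IZR_INZ; reflexivity).
 have Si := fun F => Series_ext _ _ (proj1 (Zi F)). have Sj := fun F => Series_ext _ _ (proj2 (Zi F)).
 have Xi := fun F => ex_series_ext _ _ (proj1 (Zi F)). have Xj := fun F => ex_series_ext _ _ (proj2 (Zi F)).
 have nege := fun u => ex_series_opp (K := R_AbsRing) (V := R_NormedModule) u.
 rewrite W1, W2; clear W1 W2.
 - rewrite <- (Si (fun y => a * a * xc y ^ 2)), <- (Sj (fun y => a * a * xc y ^ 2)), <- (Si (fun y => - (a * a * xs y ^ 2))), <- (Sj (fun y => - (a * a * xs y ^ 2))).
  rewrite !Series_opp. rewrite (Series_ext (fun k => a * a * xc (- INR k - 1) ^ 2) (fun k => a * a * xc (INR k) ^ 2)) by (intros; rewrite xo; reflexivity).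
  unfold dens. change (Series (fun n => dterm t n s)) with S1. transitivity (a * a * Series S2); [|rewrite <- SI; unfold a; field; lra].
  rewrite <- (Series_scal_l (a * a)), (Series_ext (fun n => a * a * S2 n) (fun n => (a * a * xs (INR n) ^ 2 + a * a * xs (- INR n - 1) ^ 2) + 2 * (a * a * xc (INR n) ^ 2))) by (intros; unfold S2; ring).
  rewrite Series_plus, Series_plus, (Series_scal_l 2) by (auto; try (apply ex_series_mul_l; auto); apply (ex_series_plus (K := R_AbsRing) (V := R_NormedModule) (fun n => a * a * xs (INR n) ^ 2)); auto).
  ring.
 - intros z. destruct (Qcol_half t Ht (s + IZR z) (sn z)) as [Q1 Q2]. split; auto. rewrite Q2. fold a. unfold xs. ring.
 - apply (Xi (fun y => - (a * a * xs y ^ 2))), nege, u1.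
 - apply (Xj (fun y => - (a * a * xs y ^ 2))), nege, u2.
 - intros z. destruct (Qcol_0 t Ht (/ 2 + IZR z) (hn z)) as [Q1 Q2]. split; auto. rewrite Q2. fold a. unfold xc. ring.
 - apply (Xi (fun y => a * a * xc y ^ 2)), u3.
 - apply (Xj (fun y => a * a * xc y ^ 2)). apply (ex_series_ext (fun k => a * a * xc (INR k) ^ 2)); [intros; rewrite xo; reflexivity|auto].
Qed.

(** * Weak convergence *)

Lemma mth_cont t x s : 0 < t -> continuous (fun s => mth t (s - x)) s.
Proof.
 intros Ht. apply contR_eps. intros e He.
 have C0 : ccont (th t) (RtoC (s - x)).
 { apply chol_cont, th_chol; auto. unfold Im, RtoC; simpl. rewrite Rabs_R0. auto. }
 destruct (C0 e He) as [d [Hd H]]. exists d. split; auto. intros y Hy. unfold mth.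
 have E : Cmod (Cminus (RtoC (y - x)) (RtoC (s - x)))%C < d.
 { rewrite <- RtoC_minus, Cmod_R. replace (y - x - (s - x)) with (y - s) by ring. exact Hy. }
 specialize (H _ E). have T1 := Cmod_rev_triangle (th t (RtoC (y - x))) (th t (RtoC (s - x))).
 have T2 := Cmod_rev_triangle (th t (RtoC (s - x))) (th t (RtoC (y - x))). rewrite (Cmod_minus_sym (th t (RtoC (s - x)))) in T2.
 apply Rabs_def1; lra.
Qed.

Lemma mthp_cont t L s : 0 < t -> continuous (mthp t L) s.
Proof.
 intros Ht. induction L as [|x L IH]; [cts|]. apply (contR_mult (fun s => mth t (s - x)) (mthp t L)); [apply mth_cont; auto|pos].
Qed.

(** The moment estimate asks for bounds of the density on the whole line, while [dens_bounds] gives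
    them on [0, 1]. Composition with [clamp] extends the bounds and keeps all integrals over
    [0, 1]. *)
Definition clamp (s : R) : R := Rmax 0 (Rmin 1 s).

Lemma clamp_bd s : 0 <= clamp s <= 1.
Proof. split; [apply Rmax_l|]. apply Rmax_lub; [lra|apply Rmin_l]. Qed.

Lemma clamp_id s : 0 <= s <= 1 -> clamp s = s.
Proof. intros H. unfold clamp. rewrite Rmin_right, Rmax_right by lra. reflexivity. Qed.

Lemma clamp_lip x y : Rabs (clamp y - clamp x) <= Rabs (y - x).
Proof.
 unfold clamp, Rmax, Rmin. repeat destruct Rle_dec; unfold Rabs; repeat destruct Rcase_abs; lra.
Qed.

Lemma clamp_cont s : continuous clamp s.
Proof. apply contR_eps. intros e He. exists e. split; auto. intros y Hy. eapply Rle_lt_trans; [apply clamp_lip|auto]. Qed.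

Lemma lsum_bound (F : R -> R) e l : (forall x, Rabs (F x) <= e) -> Rabs (lsum F l) <= INR (length l) * e.
Proof.
 intros H. induction l as [|x l IH]; [simpl; rewrite Rabs_R0; lra|]. cbn [length]. rewrite S_INR. change (lsum F (x :: l)) with (F x + lsum F l).
 apply Rabs_tri. specialize (H x). lra.
Qed.

Lemma lsum_app F l1 l2 : lsum F (l1 ++ l2) = lsum F l1 + lsum F l2.
Proof. induction l1 as [|x l IH]; simpl in *; [ring|pos]. Qed.

Lemma lsum_ext (F G : R -> R) l : (forall x, F x = G x) -> lsum F l = lsum G l.
Proof. intros H. induction l as [|x l IH]; simpl in *; [auto|rewrite H, IH; auto]. Qed.

Section Distribution.
Variables t D : R.
Hypothesis Ht : 0 < t.
Hypothesis HD : 0 < D < 1.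
Variable w : C -> C.
Hypothesis Hw_hol : exists delta, 0 < delta /\ forall p, Rabs (Im p - t / 2) < delta -> holo_at w p.
Hypothesis Hw_real : forall s, Im (w (gam t s)) = 0.
Variable pi_ : nat -> C -> C.
Hypothesis Hpi : forall n, (1 <= n)%nat -> monic_orth_section t D w n (pi_ n).
Variable zs : nat -> list R.
Hypothesis Hzs : forall n, (1 <= n)%nat -> zeros_on_gamma t (pi_ n) (zs n).

Lemma zeros_ge_n n : (1 <= n)%nat -> (n <= length (zs n))%nat.
Proof. intros Hn. apply (zeros_ge t D Ht HD w Hw_hol Hw_real n (pi_ n)); auto. Qed.

Lemma zeros_le_n n : (1 <= n)%nat -> (length (zs n) <= S n)%nat.
Proof.
 intros Hn. destruct (Hpi n Hn) as [H1 [H2 _]]. apply (zeros_le t D n (pi_ n)); auto. apply zeros_ge_n, Hn.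
Qed.

(** The upper bound of the norm and the lower bound [section_lower] carry the same power of the
    capacity, which divides out. *)
Lemma energy_hyp : exists K, forall n, (1 <= n)%nat -> exists L,
 (L = firstn n (zs n) \/ exists x, L = x :: firstn n (zs n)) /\
 RInt (fun s => (exp (Gb t n (firstn n (zs n)) s) * mthp t L s) ^ 2) 0 1 <= K.
Proof.
 destruct (section_norm t D w Ht HD Hw_hol Hw_real) as [K [HK HN]].
 destruct (section_lower t D Ht HD) as [c0 [Hc0 HL]].
 exists (K / (c0 * c0)). intros n Hn. have Hf := Hpi n Hn. destruct Hf as [Hf1 [Hf2 Hf3]]. destruct (Hzs n Hn) as [Hz1 Hz2].
 have Hlen : length (firstn n (zs n)) = n by (apply firstn_length_le, zeros_ge_n, Hn).
 have Inc : forall s, In s (firstn n (zs n)) -> In s (zs n).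
 { intros s Hs. rewrite <- (firstn_skipn n (zs n)). apply in_or_app; auto. }
 destruct (HL n (pi_ n) (firstn n (zs n)) Hf1 Hf2) as [L [HL1 HL2]]; auto.
 { intros s Hs. exists (count_occ Req_EM_T (zs n) s). split; [|pos].
  rewrite <- (firstn_skipn n (zs n)) at 2. rewrite count_occ_app. lia. }
 exists L. split; auto.
 set (E := Ecap t ^ n). have HE : 0 < E by (apply pow_lt, Ecap_pos).
 have HI := HN n (pi_ n) Hn (Hpi n Hn). have cf : forall s : R, continuous (fun s : R => Re (pi_ n (gam t s))) s.
 { intros s. apply ccontR_Re, gam_ccontR. apply (gam_chol t D n (pi_ n)); auto. }
 have cG : forall s : R, continuous (fun s : R => (exp (Gb t n (firstn n (zs n)) s) * mthp t L s) ^ 2) s.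
 { have cLR : forall s, continuous (LR t) s.
  { intros s. unfold LR. apply (cont_Series (fun k s => - (2 * invk k * (hnome t ^ k / (1 - nome t ^ k))) * cos (om k * s)) (rk t)).
   - intros k x. apply contR_mult; [apply contR_const|apply contR_cos].
   - intros k x. fold (rk t k). rewrite Rabs_mult, Rabs_Ropp, (Rabs_pos_eq (rk t k)) by (apply rk_bd; auto).
    rewrite <- (Rmult_1_r (rk t k)) at 2. apply Rmult_le_compat_l; [apply rk_bd; auto|apply Rabs_le, COS_bound].
   - apply rk_ex; auto. }
  intros s. have c1 : continuous (fun s : R => exp (Gb t n (firstn n (zs n)) s) * mthp t L s) s.
  { apply contR_mult; [|apply mthp_cont; auto]. apply (continuous_comp (Gb t n (firstn n (zs n))) exp).
   - apply contR_minus; [apply contR_minus; [cts|apply contR_mult; [cts|pos]]|cts].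
   - eapply contR_derive, is_derive_exp. }
  apply (continuous_ext (fun s => (exp (Gb t n (firstn n (zs n)) s) * mthp t L s) * (exp (Gb t n (firstn n (zs n)) s) * mthp t L s))); [pos|apply contR_mult; auto]. }
 apply Rle_trans with (RInt (fun s => / (c0 * c0 * (E * E)) * (Re (pi_ n (gam t s)) * Re (pi_ n (gam t s)))) 0 1).
 - apply RInt_le; [lra|apply ex_RInt_contR; auto| |].
  + apply ex_RInt_mulR, ex_RInt_contR. intros; apply contR_mult; auto.
  + intros s _. have B := HL2 s. rewrite (section_real t D Ht w Hw_hol Hw_real n (pi_ n) Hn (Hpi n Hn) s), Cmod_R in B. set (G := exp (Gb t n (firstn n (zs n)) s) * mthp t L s) in *. have G0 : 0 <= G by (apply Rmult_le_pos; [pos|apply mthp_nonneg]).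
   set (f := Re (pi_ n (gam t s))) in *.
   have SQ : (c0 * G * E) * (c0 * G * E) <= f * f.
   { have FF : f * f = Rabs f * Rabs f by (rewrite <- Rabs_mult; symmetry; apply Rabs_pos_eq, Rle_0_sqr). rewrite FF.
    assert (0 <= c0 * G * E) by pos. apply Rmult_le_compat; auto. }
   have P : 0 < c0 * c0 * (E * E) by pos.
   apply Rmult_le_reg_l with (c0 * c0 * (E * E)); auto. replace (c0 * c0 * (E * E) * (/ (c0 * c0 * (E * E)) * (f * f))) with (f * f) by (field; split; lra).
   eapply Rle_trans; [|exact SQ]. right. ring.
 - rewrite RInt_mulR by (apply ex_RInt_contR; intros; apply contR_mult; auto).
  apply Rle_trans with (/ (c0 * c0 * (E * E)) * (K * E ^ 2)).
  + apply Rmult_le_compat_l; [pos|pos].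
  + right. field. split; lra.
Qed.

Let dcl (s : R) : R := dens t (clamp s).

Lemma dcl_cont s : continuous dcl s.
Proof. apply (continuous_comp clamp (dens t)); [apply clamp_cont|apply dens_cont; auto]. Qed.

Lemma dcl_int (g : R -> R) : RInt (fun s => dcl s * g s) 0 1 = RInt (fun s => dens t s * g s) 0 1.
Proof. apply RInt_ext. intros s Hs. rewrite Rmin_left, Rmax_right in Hs by lra. unfold dcl. rewrite clamp_id by lra. reflexivity. Qed.

Lemma moments m theta : (1 <= m)%nat -> exists C0, forall n, (1 <= n)%nat ->
 Rabs (lsum (fun s => cos (om m * s - theta)) (firstn n (zs n)) - INR n * (ch t m * cos theta)) <= C0.
Proof.
 intros Hm. destruct energy_hyp as [K HK]. destruct (dens_bounds t Ht) as [dmin [dmax [Hd1 Hd2]]].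
 have bd : forall s, dmin <= dcl s <= dmax by (intros; apply Hd2, clamp_bd).
 have dc : forall k, RInt (fun s => dcl s * cos (om k * s)) 0 1 = ch t k by (intros k; rewrite dcl_int; apply dens_cos; auto).
 have ds : forall k, RInt (fun s => dcl s * sin (om k * s)) 0 1 = 0 by (intros k; etransitivity; [apply dcl_int|apply dens_sin; auto]).
 destruct (moment_bound t Ht dcl dcl_cont dmin dmax Hd1 bd dc ds m Hm theta K) as [C1 H1].
 (* Shifting the phase by PI changes the sign of both cosines and so gives the opposite
    inequality. *)
 destruct (moment_bound t Ht dcl dcl_cont dmin dmax Hd1 bd dc ds m Hm (theta + PI) K) as [C2 H2].
 exists (Rmax C1 C2). intros n Hn. destruct (HK n Hn) as [L [HL1 HL2]].
 have Hlen : length (firstn n (zs n)) = n by (apply firstn_length_le, zeros_ge_n, Hn).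
 have B1 := H1 n _ L Hlen HL1 (fun s => mthp_cont t L s Ht) HL2. have B2 := H2 n _ L Hlen HL1 (fun s => mthp_cont t L s Ht) HL2.
 rewrite neg_cos in B2.
 have E : lsum (fun x => cos (om m * x - (theta + PI))) (firstn n (zs n)) = - lsum (fun s => cos (om m * s - theta)) (firstn n (zs n)).
 { generalize (firstn n (zs n)). intros l. induction l as [|x l IH]; simpl in *; [ring|]. rewrite IH.
  replace (om m * x - (theta + PI)) with (- ((theta - om m * x) + PI)) by ring. rewrite cos_neg, neg_cos.
  replace (theta - om m * x) with (- (om m * x - theta)) by ring. rewrite cos_neg. ring. }
 rewrite E in B2. have M1 := Rmax_l C1 C2. have M2 := Rmax_r C1 C2. apply Rabs_le. lra.
Qed.

Definition avg_lim (g : R -> R) : Prop := is_lim_seq (fun n => / INR n * lsum g (zs n)) (RInt (fun s => dens t s * g s) 0 1).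

(** A bounded defect for the first n zeros is enough: at most one zero remains, and both disappear
    after division by n. *)
Lemma avg_lim_bound (g : R -> R) v C0 : (forall x, Rabs (g x) <= 1) -> RInt (fun s => dens t s * g s) 0 1 = v ->
 (forall n, (1 <= n)%nat -> Rabs (lsum g (firstn n (zs n)) - INR n * v) <= C0) -> avg_lim g.
Proof.
 intros Hg Hv H. unfold avg_lim. rewrite Hv. clear Hv.
 have B : forall n, (1 <= n)%nat -> Rabs (/ INR n * lsum g (zs n) - v) <= (C0 + 1) * / INR n.
 { intros n Hn. have N : 0 < INR n by (apply lt_0_INR; lia). rewrite <- (firstn_skipn n (zs n)), lsum_app.
  have R1 : (length (skipn n (zs n)) <= 1)%nat by (rewrite length_skipn; pose proof (zeros_le_n n Hn); lia).
  have R2 : Rabs (lsum g (skipn n (zs n))) <= 1.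
  { eapply Rle_trans; [apply (lsum_bound g 1); auto|]. rewrite Rmult_1_r. apply (le_INR _ 1), R1. }
  replace (/ INR n * (lsum g (firstn n (zs n)) + lsum g (skipn n (zs n))) - v) with
   (/ INR n * ((lsum g (firstn n (zs n)) - INR n * v) + lsum g (skipn n (zs n)))) by (field; lra).
  rewrite Rabs_mult, (Rabs_pos_eq (/ _)), Rmult_comm by pos.
  apply Rmult_le_compat_r; [pos|]. apply Rabs_tri. specialize (H n Hn). lra. }
 have L : is_lim_seq (fun n => / INR n * lsum g (zs n) - v) 0.
 { apply is_lim_seq_abs_0. apply (is_lim_seq_le_le_loc (fun _ => 0) _ (fun n => (C0 + 1) * / INR n)).
  - exists 1%nat. intros n Hn. split; [pos|pos].
  - apply is_lim_seq_const.
  - replace (Finite 0) with (Rbar_mult (C0 + 1) 0) by (simpl; f_equal; ring). apply is_lim_seq_scal_l.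
   replace (Finite 0) with (Rbar_inv p_infty) by reflexivity. apply is_lim_seq_inv; [apply is_lim_seq_INR|discriminate]. }
 apply (is_lim_seq_ext (fun n => (/ INR n * lsum g (zs n) - v) + v)); [pos|].
 replace (Finite v) with (Finite (0 + v)) by (f_equal; ring). apply is_lim_seq_plus'; [pos|apply is_lim_seq_const].
Qed.

Lemma avg_cos k : avg_lim (fun s => cos (om k * s)).
Proof.
 destruct k as [|k].
 - apply (avg_lim_bound _ (ch t 0) 0); [intros; apply Rabs_le, COS_bound|apply dens_cos; auto|].
  intros n Hn. rewrite (lsum_ext _ (fun x => 0 + 0 * 0 + 1)) by (intros; simpl INR; rewrite Rmult_0_r, Rmult_0_l, cos_0; ring).
  rewrite (lsum_lin (fun _ => 0) (fun _ => 0)). rewrite firstn_length_le by (apply zeros_ge_n; auto).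
  have Z : lsum (fun _ => 0) (firstn n (zs n)) = 0 by (generalize (firstn n (zs n)); intros l; induction l; simpl in *; lra). rewrite Z.
  unfold ch. simpl. replace (0 + 0 * 0 + INR n * 1 - INR n * (2 * (1 / (1 + 1)))) with 0 by field. rewrite Rabs_R0. lra.
 - destruct (moments (S k) 0 ltac:(lia)) as [C0 H]. apply (avg_lim_bound _ (ch t (S k)) C0); [intros; apply Rabs_le, COS_bound|apply dens_cos; auto|].
  intros n Hn. specialize (H n Hn). rewrite cos_0, Rmult_1_r in H.
  rewrite (lsum_ext _ (fun s => cos (om (S k) * s))) in H by (intros; rewrite Rminus_0_r; reflexivity). exact H.
Qed.

Lemma avg_sin k : avg_lim (fun s => sin (om k * s)).
Proof.
 have sc : forall z, sin z = cos (z - PI / 2) by (intros z; rewrite cos_minus, cos_PI2, sin_PI2; ring).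
 destruct k as [|k].
 - apply (avg_lim_bound _ 0 0); [intros; apply Rabs_le, SIN_bound|apply dens_sin; auto|].
  intros n Hn. rewrite (lsum_ext _ (fun _ => 0)) by (intros; simpl INR; rewrite Rmult_0_r, Rmult_0_l; apply sin_0).
  have Z : lsum (fun _ => 0) (firstn n (zs n)) = 0 by (generalize (firstn n (zs n)); intros l; induction l; simpl in *; lra). rewrite Z.
  rewrite Rmult_0_r, Rminus_0_r, Rabs_R0. lra.
 - destruct (moments (S k) (PI / 2) ltac:(lia)) as [C0 H]. apply (avg_lim_bound _ 0 C0); [intros; apply Rabs_le, SIN_bound|apply dens_sin; auto|].
  intros n Hn. specialize (H n Hn). rewrite cos_PI2, Rmult_0_r in H.
  rewrite (lsum_ext _ (fun s => sin (om (S k) * s))) in H by pos. exact H.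
Qed.

Lemma avg_lin (f g : R -> R) a b : (forall s, continuous f s) -> (forall s, continuous g s) -> avg_lim f -> avg_lim g -> avg_lim (fun s => a * f s + b * g s).
Proof.
 intros cf cg Hf Hg. have L : forall l, lsum (fun s => a * f s + b * g s) l = a * lsum f l + b * lsum g l by (intros l; induction l as [|x l IH]; simpl in *; [ring|pos]).
 apply (is_lim_seq_ext (fun n => a * (/ INR n * lsum f (zs n)) + b * (/ INR n * lsum g (zs n)))); [intros n; rewrite L; ring|].
 have c1 : forall s : R, continuous (fun s : R => dens t s * f s) s by (intros; apply contR_mult; [apply dens_cont; auto|auto]).
 have c2 : forall s : R, continuous (fun s : R => dens t s * g s) s by (intros; apply contR_mult; [apply dens_cont; auto|auto]).
 have E := RInt_lin3 a b 0 _ _ _ c1 c2 c2. replace (RInt (fun s => dens t s * (a * f s + b * g s)) 0 1) with (a * RInt (fun s => dens t s * f s) 0 1 + b * RInt (fun s => dens t s * g s) 0 1).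
 - apply is_lim_seq_plus'; apply (is_lim_seq_scal_l _ _ (Finite _)); assumption.
 - transitivity (RInt (fun s => a * (dens t s * f s) + b * (dens t s * g s) + 0 * (dens t s * g s)) 0 1); [pos|].
  apply RInt_ext. intros; req; ring.
Qed.

Lemma fsum_cont phi l s : continuous (fsum phi l) s.
Proof.
 induction l as [|[c k] l IH]; simpl; [cts|]. apply contR_plus; auto. apply contR_mult; [cts|].
 apply contR_plus; apply contR_mult; try apply contR_const; [cts|apply contR_sin].
Qed.

Lemma avg_ext f g : (forall s, f s = g s) -> avg_lim f -> avg_lim g.
Proof.
 intros E H. unfold avg_lim in *. rewrite (RInt_ext (fun s => dens t s * g s) (fun s => dens t s * f s)) by (intros; rewrite E; reflexivity).
 apply (is_lim_seq_ext (fun n => / INR n * lsum f (zs n))); [intros n; rewrite (lsum_ext f g) by auto; reflexivity|pos].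
Qed.

Lemma avg_fsum phi l : avg_lim (fsum phi l).
Proof.
 induction l as [|[c k] l IH].
 - apply (avg_ext (fun s => 0 * cos (om 0 * s) + 0 * cos (om 0 * s))); [intros; simpl; ring|].
  apply avg_lin; try (intros; apply contR_cos); apply avg_cos.
 - apply (avg_ext (fun s => 1 * (c * fcos phi k * cos (om k * s) + c * fsin phi k * sin (om k * s)) + 1 * fsum phi l s)); [intros; simpl; ring|].
  apply (avg_lin (fun s => c * fcos phi k * cos (om k * s) + c * fsin phi k * sin (om k * s)) (fsum phi l)); auto.
  + intros s. apply contR_plus; apply contR_mult; try apply contR_const; [cts|apply contR_sin].
  + intros; apply fsum_cont.
  + apply avg_lin; [intros; apply contR_cos|intros; apply contR_sin|apply avg_cos|apply avg_sin].
Qed.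

Lemma avg_all phi : (forall s, continuous phi s) -> (forall s, phi (s + 1) = phi s) -> avg_lim phi.
Proof.
 intros Hc Hp. apply is_lim_seq_Reals. intros e He.
 (* There are at most n + 1 <= 2 n zeros, so the approximation costs 2 e / 6 in the average and e /
    6 in the integral; the trigonometric polynomial has the remaining e / 2. *)
 destruct (trig_dense phi (e / 6) Hc Hp arith) as [l Hl].
 have A := proj1 (is_lim_seq_Reals _ _) (avg_fsum phi l) (e / 2) arith. destruct A as [N0 HN].
 exists (S N0). intros n Hn. specialize (HN n ltac:(lia)). unfold Rdist in *.
 have N1 : 1 <= INR n by (apply (le_INR 1); lia).
 have S1 : Rabs (/ INR n * lsum phi (zs n) - / INR n * lsum (fsum phi l) (zs n)) <= 2 * (e / 6).
 { have L : forall m, lsum phi m - lsum (fsum phi l) m = lsum (fun s => phi s - fsum phi l s) m by (intros m; induction m as [|x m IH]; simpl in *; [ring|rewrite <- IH; ring]).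
  rewrite <- Rmult_minus_distr_l, L, Rabs_mult, (Rabs_pos_eq (/ _)) by (left; apply Rinv_0_lt_compat; lra).
  have B := lsum_bound _ (e / 6) (zs n) Hl. have Z : INR (length (zs n)) <= 2 * INR n.
  { have Q := le_INR _ _ (zeros_le_n n ltac:(lia)). rewrite S_INR in Q. lra. }
  apply Rmult_le_reg_l with (INR n); [lra|]. rewrite <- Rmult_assoc, Rinv_r, Rmult_1_l by lra.
  eapply Rle_trans; [exact B|]. apply Rle_trans with (2 * INR n * (e / 6)); [apply Rmult_le_compat_r; lra|right; ring]. }
 have S2 : Rabs (RInt (fun s => dens t s * fsum phi l s) 0 1 - RInt (fun s => dens t s * phi s) 0 1) <= e / 6.
 { have c1 : forall s : R, continuous (fun s : R => dens t s * fsum phi l s) s by (intros; apply contR_mult; [apply dens_cont; auto|apply fsum_cont]).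
  have c2 : forall s : R, continuous (fun s : R => dens t s * phi s) s by (intros; apply contR_mult; [apply dens_cont; auto|auto]).
  have c3 : forall s : R, continuous (dens t) s by (intros; apply dens_cont; auto).
  rewrite <- (RInt_minusR (fun s => dens t s * fsum phi l s) (fun s => dens t s * phi s)) by (apply ex_RInt_contR; auto).
  have M : RInt (dens t) 0 1 = 1.
  { transitivity (RInt (fun s => dens t s * cos (om 0 * s)) 0 1).
   - apply RInt_ext. intros. rewrite Rmult_0_r, Rmult_0_l, cos_0. req. ring.
   - rewrite dens_cos by auto. unfold ch. simpl. field. }
  have cd : forall s : R, continuous (fun s : R => dens t s * fsum phi l s - dens t s * phi s) s by (intros; apply contR_minus; auto).
  replace (e / 6) with (RInt (fun s => e / 6 * dens t s) 0 1) by (rewrite RInt_mulR by (apply ex_RInt_contR; auto); rewrite M; req; ring).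
  eapply Rle_trans; [apply (abs_RInt_le (fun s => dens t s * fsum phi l s - dens t s * phi s) 0 1); [lra|apply ex_RInt_contR; auto]|].
  apply RInt_le; [lra| |apply ex_RInt_mulR, ex_RInt_contR; auto|].
  - apply ex_RInt_contR. intros s. apply (continuous_comp (fun s => dens t s * fsum phi l s - dens t s * phi s) Rabs); [pos|].
   apply continuity_pt_filterlim, Rcontinuity_abs.
  - intros s Hs. destruct (dens_bounds t Ht) as [dmin [dmax [D1 D2]]]. specialize (D2 s arith).
   replace (dens t s * fsum phi l s - dens t s * phi s) with (dens t s * - (phi s - fsum phi l s)) by ring.
   rewrite Rabs_mult, Rabs_Ropp, (Rabs_pos_eq (dens t s)), Rmult_comm by lra. apply Rmult_le_compat_r; [lra|pos]. }
 replace (/ INR n * lsum phi (zs n) - RInt (fun s => dens t s * phi s) 0 1) with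
  ((/ INR n * lsum phi (zs n) - / INR n * lsum (fsum phi l) (zs n)) + (/ INR n * lsum (fsum phi l) (zs n) - RInt (fun s => dens t s * fsum phi l s) 0 1)
   + (RInt (fun s => dens t s * fsum phi l s) 0 1 - RInt (fun s => dens t s * phi s) 0 1)) by ring.
 eapply Rle_lt_trans; [apply Rabs_triang|]. eapply Rle_lt_trans; [apply Rplus_le_compat_r, Rabs_triang|]. lra.
Qed.
End Distribution.

Lemma csum_list_parts phi l : csum_list phi l = (lsum (fun s => Re (phi s)) l, lsum (fun s => Im (phi s)) l).
Proof. induction l as [|x l IH]; [pos|]. simpl. rewrite IH. reflexivity. Qed.

Lemma mu0_parts t (phi : R -> C) : 0 < t -> (forall s, continuous (fun s => Re (phi s)) s) -> (forall s, continuous (fun s => Im (phi s)) s) ->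
 mu0_integral t phi = (RInt (fun s => dens t s * Re (phi s)) 0 1, RInt (fun s => dens t s * Im (phi s)) 0 1).
Proof.
 intros Ht Hr Hi. transitivity (RInt (V := C_R_CompleteNormedModule) (fun s => Cmult (phi s) (RtoC (dens t s))) 0 1).
 (* The integrands need to agree only in the open interval, which is where [density_eq] applies; the
    square root is PI dens because dens is positive. *)
 - refine (RInt_ext (V := C_R_CompleteNormedModule) _ _ 0 1 _). intros s Hs. rewrite Rmin_left, Rmax_right in Hs by lra. f_equal. f_equal.
  rewrite density_eq by auto. destruct (dens_bounds t Ht) as [dmin [dmax [D1 D2]]]. specialize (D2 s arith).
  have P := PI_RGT_0. rewrite sqrt_square by pos. field. lra.
 - have cR : forall s : R, continuous (fun s : R => dens t s * Re (phi s)) s by (intros; apply contR_mult; [apply dens_cont; auto|auto]).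
  have cI : forall s : R, continuous (fun s : R => dens t s * Im (phi s)) s by (intros; apply contR_mult; [apply dens_cont; auto|auto]).
  have ER : forall s, Re (Cmult (phi s) (RtoC (dens t s))) = dens t s * Re (phi s) by (intros; unfold Cmult, RtoC, Re; simpl; ring).
  have EI : forall s, Im (Cmult (phi s) (RtoC (dens t s))) = dens t s * Im (phi s) by (intros; unfold Cmult, RtoC, Im; simpl; ring).
  rewrite RInt_C.
  + apply Ceq_ReIm.
   * rewrite Re_CI. apply RInt_ext. intros; apply ER.
   * rewrite Im_CI. apply RInt_ext. intros; apply EI.
  + split.
   * apply (ex_RInt_ext (fun s => dens t s * Re (phi s))); [pos|apply ex_RInt_contR; auto].
   * apply (ex_RInt_ext (fun s => dens t s * Im (phi s))); [pos|apply ex_RInt_contR; auto].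
Qed.

Theorem theorem3p17
  (t : R) (Ht : 0 < t)
  (D : R) (HD : 0 < D < 1)
  (w : C -> C)
  (Hw_hol : exists delta, 0 < delta /\
      forall p, Rabs (Im p - t / 2) < delta -> holo_at w p)
  (Hw_per : forall p, w (Cplus p (RtoC 1)) = w p)
  (Hw_real : forall s, Im (w (gam t s)) = 0)
  (pi_ : nat -> C -> C)
  (Hpi : forall n, (1 <= n)%nat -> monic_orth_section t D w n (pi_ n))
  (zs : nat -> list R)
  (Hzs : forall n, (1 <= n)%nat -> zeros_on_gamma t (pi_ n) (zs n))
  (phi : R -> C)
  (Hphi_cont : forall s, continuous phi s)
  (Hphi_per : forall s, phi (s + 1) = phi s) :
  filterlim (fun n : nat => Cmult (RtoC (/ INR n)) (csum_list phi (zs n)))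
    eventually (locally (mu0_integral t phi)).
Proof.
 have cR : forall s, continuous (fun s => Re (phi s)) s by (intros s; apply (continuous_comp phi fst); [pos|apply continuous_fst]).
 have cI : forall s, continuous (fun s => Im (phi s)) s by (intros s; apply (continuous_comp phi snd); [pos|apply continuous_snd]).
 rewrite mu0_parts by auto.
 have LR := avg_all t D Ht HD w Hw_hol Hw_real pi_ Hpi zs Hzs (fun s => Re (phi s)) cR (fun s => f_equal Re (Hphi_per s)).
 have LI := avg_all t D Ht HD w Hw_hol Hw_real pi_ Hpi zs Hzs (fun s => Im (phi s)) cI (fun s => f_equal Im (Hphi_per s)).
 apply filterlim_locally. intros e.
 have BR := proj1 (filterlim_locally _ _) LR e. have BI := proj1 (filterlim_locally _ _) LI e.
 generalize (filter_and _ _ BR BI). apply filter_imp. intros n [H1 H2].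
 have E : Cmult (RtoC (/ INR n)) (csum_list phi (zs n)) = (/ INR n * lsum (fun s => Re (phi s)) (zs n), / INR n * lsum (fun s => Im (phi s)) (zs n)).
 { rewrite csum_list_parts. unfold Cmult, RtoC; simpl. f_equal; ring. }
 rewrite E. split; [exact H1|pos].
Qed.
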